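(* Let $s>1/2$, let $r\in\{1,2\}$, and let $\varphi\in \Im_{s,r}=H^s(\mathbb{R})\cap L^2_r(\mathbb{R})$ be real-valued. Then there exists a unique $u\in C([0,\infty);\Im_{s,r})$ that solves the initial value problem $$\partial_t u+\partial_x u+\mathcal H\partial_x\partial_t u+u\,\partial_x u=0,\qquad u(x,0)=\varphi(x),\qquad x\in\mathbb{R},\ t\ge 0,$$ and satisfies $\partial_t u\in C([0,\infty);L^2(\mathbb{R}))$.
   Context: All functions are real-valued. $\mathcal H$ is the Hilbert transform on $\mathbb{R}$, i.e. the Fourier multiplier $\widehat{\mathcal H f}(\xi)=-i\,\mathrm{sgn}(\xi)\widehat f(\xi)$; thus $\mathcal H\partial_x$ has symbol $|\xi|$. $H^s(\mathbb{R})$ is the $L^2$-based Sobolev space with norm $\|\cdot\|_s$. $L^2_r(\mathbb{R})=\{f\in L^2(\mathbb{R}) : |x|^r f\in L^2(\mathbb{R})\}$, with $\|f\|_{L^2_r}=\||x|^r f\|_{L^2}$. $\Im_{s,r}=H^s(\mathbb{R})\cap L^2_r(\mathbb{R})$ is a Banach space with norm $\|f\|_{s,r}^2=\|f\|_s^2+\|f\|_{L^2_r}^2$. The initial value problem is understood through the equivalent integral equation $$u(t)=e^{tA}\varphi-\frac12\int_0^t e^{(t-\tau)A}\,\partial_x(1+\mathcal H\partial_x)^{-1}\big(u(\tau)^2\big)\,d\tau,\qquad A=-\partial_x(1+\mathcal H\partial_x)^{-1},$$ where $A$ is the Fourier multiplier with symbol $-i\xi/(1+|\xi|)$. *)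

(* Defs.v *)
From HB Require Import structures.
From mathcomp Require Import all_boot all_order all_algebra.
From mathcomp Require Import all_classical all_reals all_analysis.
From mathcomp Require Import complex.

Set Implicit Arguments.
Unset Strict Implicit.
Unset Printing Implicit Defensive.

Import Order.TTheory GRing.Theory Num.Theory.
Import numFieldNormedType.Exports.

Local Open Scope classical_set_scope.
Local Open Scope complex_scope.
Local Open Scope ring_scope.

Notation leb R := (@lebesgue_measure R).

Definition L1 {R : realType} : set (R -> R) := [set f | f \in Lfun (leb R) 1%E].

Definition L2 {R : realType} : set (R -> R) :=
  [set f | f \in Lfun (leb R) 2%:E].

Definition L2norm {R : realType} (f : R -> R) : \bar R :=
  ('N[leb R]_2%:E[EFin \o f])%E.

Definition L2C {R : realType} : set (R -> R[i]) :=
  [set g | L2 (fun x => complex.Re (g x)) /\ L2 (fun x => complex.Im (g x))].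

Definition L2normC {R : realType} (g : R -> R[i]) : \bar R :=
  L2norm (fun x => Normc.normc (g x)).

Definition integralC {R : realType} (g : R -> R[i]) : R[i] :=
  (\int[leb R]_x complex.Re (g x)) +i* (\int[leb R]_x complex.Im (g x)).

Definition expi {R : realType} (a : R) : R[i] := cos a +i* sin a.

Definition fourier1 {R : realType} (f : R -> R) (xi : R) : R[i] :=
  integralC (fun x => (f x)%:C * expi (- (x * xi))).

(* Extension of [fourier1] from L1 `&` L2 to L2 by continuity: the graph is
   closed in the product of L2 and of its complex version. *)
Definition is_fourier {R : realType} (f : R -> R) (g : R -> R[i]) : Prop :=
  [/\ L2 f, L2C g &
    exists f_ : nat -> R -> R,
      [/\ forall n, (L1 `&` L2) (f_ n),
          L2norm (f_ n \- f) @[n --> \oo] --> 0%E &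
          L2normC (fourier1 (f_ n) \- g) @[n --> \oo] --> 0%E]].

(* By Plancherel's theorem this is defined, up to a.e. equality, for every
   [f] in L2. There is no factor (2 pi)^(-1/2): it would leave the multipliers
   unchanged and replace the Sobolev norms by proportional ones. *)
Definition fourier {R : realType} (f : R -> R) : R -> R[i] :=
  xget (fun=> 0) [set g | is_fourier f g].

(* If [m] is bounded and measurable and [m (- xi)] is the conjugate of [m xi],
   as for the symbols below, this operator is defined on the whole of L2 and
   preserves real-valuedness. *)
Definition multiplier {R : realType} (m : R -> R[i]) (f : R -> R) : R -> R :=
  xget (fun=> 0)
    [set g | L2 g /\ fourier g = (fun xi => m xi * fourier f xi) %[ae leb R]].

(* The operator d_x (1 + H d_x)^-1, with H the Hilbert transform: d_x has
   symbol i xi and H d_x has symbol |xi|. *)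
Definition reg_dx {R : realType} : (R -> R) -> (R -> R) :=
  multiplier (fun xi => 0 +i* (xi / (1 + `|xi|))).

(* The group exp (t A) generated by A = - reg_dx. *)
Definition exp_tA {R : realType} (t : R) : (R -> R) -> (R -> R) :=
  multiplier (fun xi => expi (- (t * (xi / (1 + `|xi|))))).

Definition Hs_norm {R : realType} (s : R) (f : R -> R) : \bar R :=
  L2normC (fun xi => ((1 + xi ^+ 2) `^ (s / 2))%:C * fourier f xi).

Definition weight {R : realType} (r : nat) (f : R -> R) : R -> R :=
  fun x => `|x| ^+ r * f x.

Definition wsobolev {R : realType} (s : R) (r : nat) : set (R -> R) :=
  [set f | [/\ L2 f, (Hs_norm s f < +oo)%E & L2 (weight r f)]].

Definition wsobolev_norm {R : realType} (s : R) (r : nat) (f : R -> R) : \bar R :=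
  ((Hs_norm s f `^ 2 + L2norm (weight r f) `^ 2) `^ 2^-1)%E.

(* Continuity of [u] from [0, +oo[ to the normed space (X, N). The values of
   [u] at negative times are irrelevant, here and below. *)
Definition continuous_curve {R : realType} (X : set (R -> R))
    (N : (R -> R) -> \bar R) (u : R -> R -> R) : Prop :=
  forall t, 0 <= t ->
    X (u t) /\
    N (u t' \- u t) @[t' --> within [set t' | 0 <= t'] (nbhs t)] --> 0%E.

(* Strong derivative in L2, one-sided at t = 0. *)
Definition time_derivative {R : realType} (u v : R -> R -> R) : Prop :=
  forall t, 0 <= t ->
    L2norm (fun x => (u t' x - u t x) / (t' - t) - v t x)
      @[t' --> within [set t' | 0 <= t'] t^'] --> 0%E.

Definition riemann_sum {R : realType} (F : R -> R -> R) (a : R) (p : seq R)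
    (c : nat -> R) : R -> R :=
  fun x => \sum_(k < size p)
    (nth a (a :: p) k.+1 - nth a (a :: p) k) * F (c k) x.

(* Riemann integral of an L2-valued function. For a curve that is continuous
   in [wsobolev s r], it agrees with the integral in that smaller space, which
   embeds continuously in L2. *)
Definition is_L2_integral {R : realType} (F : R -> R -> R) (a b : R)
    (I : R -> R) : Prop :=
  L2 I /\
  forall e : R, 0 < e -> exists2 d : R, 0 < d &
    forall (p : seq R) (c : nat -> R), itv_partition a b p ->
      (forall k, (k < size p)%N ->
        nth a (a :: p) k <= c k <= nth a (a :: p) k.+1 /\
        nth a (a :: p) k.+1 - nth a (a :: p) k < d) ->
      (L2norm (riemann_sum F a p c \- I)%R < e%:E)%E.

(* The problem u_t + u_x + H u_xt + u u_x = 0, u(0) = phi, in its integral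
   form (Duhamel's formula after inverting 1 + H d_x). *)
Definition solves_ivp {R : realType} (phi : R -> R) (u : R -> R -> R) : Prop :=
  forall t, 0 <= t -> exists2 I : R -> R,
    is_L2_integral
      (fun tau => exp_tA (t - tau) (reg_dx (fun x => u tau x ^+ 2))) 0 t I &
    u t = (fun x => exp_tA t phi x - 2^-1 * I x) %[ae leb R].

(* Main.v *)
(* The equation is treated as the ODE u' = - K (u + u^2 / 2) in H^s with weight
   |x|^r, where K = d_x (1 + H d_x)^-1 is bounded there: for H^s because its
   symbol b is bounded, for the weight because multiplication by sin (d x)
   becomes a difference quotient on the Fourier side and b has bounded first
   and second differences. As s > 1/2, the quadratic term is locally Lipschitz.

   The radially truncated field is globally Lipschitz, so that dyadic Euler
   schemes converge to a curve u with u(t') - u(t) - (t' - t) Q (u(t)) =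
   O((t' - t)^2), a form of the equation that is easily combined with norms:
   summing such remainders over fine partitions replaces differentiation.
   The truncation is removed by bounds that do not depend on it. The energy
   int (1 + |xi|) |u^|^2 is conserved, since int f d_x (f^2) = 0. By the
   Brezis-Gallouet inequality it controls the sup norm by the logarithm of the
   H^s norm, which therefore grows at most doubly exponentially; the weighted
   norm then grows at most exponentially. The group exp (t A) turns the
   remainder estimate into Duhamel's formula, and uniqueness is Gronwall's
   argument in L^2 on Riemann sums.

   Fourier analysis is done with the Hartley transform int f(x) cas (x xi) dx,
   cas = cos + sin. It is real-valued on real functions and, normalized by
   (2 pi)^-1/2, it is a selfadjoint isometric involution of L^2. A multiplier
   a + i b with a even and b odd maps h(xi) to a(xi) h(xi) - b(xi) h(- xi). *)
From HB Require Import structures.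
Require Import Defs.
From mathcomp Require Import all_boot all_order all_algebra.
From mathcomp Require Import all_classical all_reals all_analysis.
From mathcomp Require Import measurable_realfun complex ring lra.
Set Implicit Arguments.
Unset Strict Implicit.
Unset Printing Implicit Defensive.
Import Order.TTheory GRing.Theory Num.Theory.
Import numFieldNormedType.Exports.
Local Open Scope classical_set_scope.
Local Open Scope ring_scope.

(** The obstacle is that no conserved quantity bounds the sup norm. The energy is an H^(1/2) norm,
    the critical case in which the embedding into bounded functions fails, but only by a logarithm.
    Hence the need for estimates that are linear in the H^s norm, with the L^1 norm of the transform
    as coefficient: y' <= K y (1 + ln y) still has global solutions. The truncation is designed to
    respect this. It only replaces the coefficient 1/2 of the square by a smaller number depending
    on the function, and the energy identity and the growth bounds hold for every coefficient in
    [0, 1/2]. The resulting bound is therefore the same for all radii, and choosing it as the radius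
    makes the truncation invisible. A second constraint is that functions equal almost everywhere
    are not identified, and that the operators of the statement are obtained by choice. Algebraic
    laws then hold only almost everywhere, so the arguments run on real-valued norms, which do not
    see null sets, and curves are compared up to functions of norm zero. *)

Notation itg f := ((leb _).-integrable setT (EFin \o f)).
Notation J f := (Rintegral (leb _) setT f).

(** * Lebesgue integrals and L^2 on the line *)

Section measurability.
Context {d} {T : measurableType d} {R : realType}.
Implicit Types f g : T -> R.

Lemma mfD f g : measurable_fun setT f -> measurable_fun setT g ->
  measurable_fun setT (fun x => f x + g x).
Proof. exact: measurable_funD. Qed.

Lemma mfB f g : measurable_fun setT f -> measurable_fun setT g ->
  measurable_fun setT (fun x => f x - g x).
Proof. exact: measurable_funB. Qed.

Lemma mfN f : measurable_fun setT f -> measurable_fun setT (fun x => - f x).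
Proof. exact: measurable_funN. Qed.

Lemma mfM f g : measurable_fun setT f -> measurable_fun setT g ->
  measurable_fun setT (fun x => f x * g x).
Proof. exact: measurable_funM. Qed.

Lemma mfX f n : measurable_fun setT f -> measurable_fun setT (fun x => f x ^+ n).
Proof. exact: measurable_funX. Qed.

Lemma mf_norm f : measurable_fun setT f -> measurable_fun setT (fun x => `|f x|).
Proof. by move=> mf; exact: measurableT_comp. Qed.

Lemma mf_cts f (h : R -> R) : continuous h -> measurable_fun setT f ->
  measurable_fun setT (fun x => h (f x)).
Proof.
by move=> ch mf; apply: measurableT_comp mf; exact: continuous_measurable_fun.
Qed.

Lemma mf_cos f : measurable_fun setT f -> measurable_fun setT (fun x => cos (f x)).
Proof. exact: (mf_cts (@continuous_cos R)). Qed.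

Lemma mf_sin f : measurable_fun setT f -> measurable_fun setT (fun x => sin (f x)).
Proof. exact: (mf_cts (@continuous_sin R)). Qed.

Lemma mf_exp f : measurable_fun setT f -> measurable_fun setT (fun x => expR (f x)).
Proof. by move=> mf; exact: measurableT_comp. Qed.

Lemma mf_powR f p : measurable_fun setT f ->
  measurable_fun setT (fun x => f x `^ p).
Proof. by move=> mf; exact: (measurableT_comp (measurable_powR p)). Qed.

Lemma mf_sqrt f : measurable_fun setT f ->
  measurable_fun setT (fun x => Num.sqrt (f x)).
Proof. exact: (mf_cts (@sqrt_continuous R)). Qed.

Lemma mf_inv f : measurable_fun setT f -> measurable_fun setT (fun x => (f x)^-1).
Proof.
move=> mf.
have mV : measurable_fun [set: R] (fun x : R => x^-1).
  (* Inversion is discontinuous at 0, but this product of measurable functions equals it on the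
     whole line, both being 0 at 0. *)
  pose h : R -> R := fun x => x * ((x ^+ 2) `^ (-1)).
  have -> : (fun x : R => x^-1) = h.
    apply/funext => x; rewrite /h; have [->|x0] := eqVneq x 0.
      by rewrite invr0 mul0r.
    by rewrite powR_inv1 ?sqr_ge0// expr2 invfM mulrA mulfV// mul1r.
  apply: measurable_funM => //.
  by apply: (measurableT_comp (measurable_powR (-1))); exact: measurable_funX.
exact: measurableT_comp mV mf.
Qed.

End measurability.

Ltac mf_tac :=
  repeat first
    [ assumption
    | lazymatch goal with
      | |- measurable_fun _ (fun y_ => y_) => exact: measurable_id
      | |- measurable_fun _ (fun _ => ?c) => exact: measurable_cst
      | |- measurable_fun _ (fun y_ => y_.1) => exact: measurable_fst
      | |- measurable_fun _ (fun y_ => y_.2) => exact: measurable_snd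
      | |- measurable_fun _ (fun y_ => @?f y_ - @?g y_) => apply: mfB
      | |- measurable_fun _ (fun y_ => @?f y_ + @?g y_) => apply: mfD
      | |- measurable_fun _ (fun y_ => - @?f y_) => apply: mfN
      | |- measurable_fun _ (fun y_ => @?f y_ * @?g y_) => apply: mfM
      | |- measurable_fun _ (fun y_ => @?f y_ ^+ _) => apply: mfX
      | |- measurable_fun _ (fun y_ => `|@?f y_|) => apply: mf_norm
      | |- measurable_fun _ (fun y_ => cos (@?f y_)) => apply: mf_cos
      | |- measurable_fun _ (fun y_ => sin (@?f y_)) => apply: mf_sin
      | |- measurable_fun _ (fun y_ => expR (@?f y_)) => apply: mf_exp
      | |- measurable_fun _ (fun y_ => @?f y_ `^ _) => apply: mf_powR
      | |- measurable_fun _ (fun y_ => Num.sqrt (@?f y_)) => apply: mf_sqrt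
      | |- measurable_fun _ (fun y_ => (@?f y_)^-1) => apply: mf_inv
      end ].

Section almost_everywhere.
Context {R : realType}.
Implicit Types P Q : R -> Prop.

Definition ae P := (leb R).-negligible [set x | ~ P x].

Lemma ae_mono P Q : (forall x, P x -> Q x) -> ae P -> ae Q.
Proof.
by move=> PQ; apply: negligibleS => x /= nQ p; apply: nQ; exact: PQ.
Qed.

Lemma ae_all P : (forall x, P x) -> ae P.
Proof. by move=> p; apply: negligibleS (negligible_set0 _) => x /= np; apply: np. Qed.

Lemma ae_and P Q : ae P -> ae Q -> ae (fun x => P x /\ Q x).
Proof.
move=> p q; apply: negligibleS (negligibleU p q) => x /= h.
have [px|np] := pselect (P x); last by left.
by right=> /= qx; apply: h.
Qed.

Lemma ae_mono2 P Q S : (forall x, P x -> Q x -> S x) -> ae P -> ae Q -> ae S.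
Proof. by move=> h p q; apply: ae_mono (ae_and p q) => x [? ?]; exact: h. Qed.

Lemma ae_eqP {U} (f g : R -> U) : f = g %[ae leb R] <-> ae (fun x => f x = g x).
Proof.
split=> [|h].
  by apply: negligibleS => x /= h h2; apply: h; exact: h2.
by apply: negligibleS h => x /= h h2; apply: h => _; exact: h2.
Qed.

End almost_everywhere.

Section integral.
Context {R : realType}.
Implicit Types f g : R -> R.

Lemma itg_mf f : itg f -> measurable_fun setT f.
Proof. by move=> /integrableP[/measurable_EFinP]. Qed.

Lemma itg_ext f g : f =1 g -> itg f -> itg g.
Proof. by move=> /funext ->. Qed.

Lemma itgD f g : itg f -> itg g -> itg (fun x => f x + g x).
Proof. by move=> itf ig; have := integrableD measurableT itf ig. Qed.

Lemma itgB f g : itg f -> itg g -> itg (fun x => f x - g x).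
Proof. by move=> itf ig; have := integrableB measurableT itf ig. Qed.

Lemma itgZ c f : itg f -> itg (fun x => c * f x).
Proof. by move=> itf; have := integrableZl measurableT c itf. Qed.

Lemma itg_norm f : itg f -> itg (fun x => `|f x|).
Proof. by move=> itf; have := integrable_norm itf. Qed.

Lemma itg0 : itg (fun x : R => 0 : R).
Proof. exact: integrable0. Qed.

Lemma itg_le f g : measurable_fun setT f -> (forall x, `|f x| <= g x) -> itg g -> itg f.
Proof.
move=> mf fg ig; apply: (le_integrable measurableT _ _ ig) => /=.
  exact/measurable_EFinP.
by move=> x _; rewrite lee_fin (le_trans (fg x))// ler_norm.
Qed.

Lemma JD f g : itg f -> itg g -> J (fun x => f x + g x) = J f + J g.
Proof. by move=> ? ?; rewrite RintegralD. Qed.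

Lemma JB f g : itg f -> itg g -> J (fun x => f x - g x) = J f - J g.
Proof. by move=> ? ?; rewrite RintegralB. Qed.

Lemma JZ c f : itg f -> J (fun x => c * f x) = c * J f.
Proof. by move=> ?; rewrite RintegralZl. Qed.

Lemma JN f : itg f -> J (fun x => - f x) = - J f.
Proof.
by move=> itf; rewrite -mulN1r -JZ//; congr Rintegral; apply/funext => x; rewrite mulN1r.
Qed.

Lemma J0 : J (fun x : R => 0 : R) = 0.
Proof. by rewrite /Rintegral integral0. Qed.

Lemma J_ge0 f : (forall x, 0 <= f x) -> 0 <= J f.
Proof. by move=> f0; exact: Rintegral_ge0. Qed.

Lemma J_le f g : itg f -> itg g -> (forall x, f x <= g x) -> J f <= J g.
Proof. by move=> ? ? fg; exact: le_Rintegral. Qed.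

Lemma J_norm f : itg f -> `|J f| <= J (fun x => `|f x|).
Proof. by move=> itf; exact: le_normr_Rintegral. Qed.

Lemma JE f : itg f -> (\int[leb R]_x (f x)%:E)%E = (J f)%:E.
Proof. by move=> itf; rewrite /Rintegral fineK//; exact: integrable_fin_num. Qed.

Lemma itg_ge0 f : measurable_fun setT f -> (forall x, 0 <= f x) ->
  (\int[leb R]_x (f x)%:E < +oo)%E -> itg f.
Proof.
move=> mf f0 h; apply/integrableP; split; first exact/measurable_EFinP.
by under eq_integral do rewrite /= ger0_norm//.
Qed.

Lemma itg_lty f : itg f -> (\int[leb R]_x `|f x|%:E < +oo)%E.
Proof. by move=> /integrableP[]. Qed.

Lemma J_ae f g : measurable_fun setT f -> measurable_fun setT g ->
  ae (fun x => f x = g x) -> J f = J g.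
Proof.
move=> mf mg /ae_eqP fg; congr fine; apply: ae_eq_integral => //; try exact/measurable_EFinP.
exact: (ae_eq_comp EFin fg).
Qed.

Lemma itg_ae f g : measurable_fun setT f -> measurable_fun setT g ->
  ae (fun x => f x = g x) -> itg f -> itg g.
Proof.
move=> mf mg /ae_eqP fg /integrableP[_ h]; apply/integrableP; split; first exact/measurable_EFinP.
rewrite (_ : integral _ _ _ = \int[leb R]_x `|(f x)%:E|)%E//.
apply: ae_eq_integral => //; try by apply/measurable_EFinP; apply: mf_norm.
exact: (ae_eq_sym (ae_eq_comp (fun x => `|x|%:E) fg)).
Qed.

Lemma J_eq0 f : itg f -> (forall x, 0 <= f x) -> J f = 0 -> ae (fun x => f x = 0).
Proof.
move=> itf f0 Jf.
have mf := itg_mf itf.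
have : (\int[leb R]_x `|(f x)%:E| = 0)%E.
  by under eq_integral do rewrite /= ger0_norm//; rewrite JE// Jf.
move/(ae_eq_integral_abs (leb R) measurableT (proj2 (measurable_EFinP _ _) mf)).
by apply: negligibleS => x /= h h2; apply: h; have [] := h2 I.
Qed.

(** The isometries of the line. With one predicate for translations and reflections, a single
    invariance lemma serves shifts, parity and convolutions. *)
Definition rigid (phi : R -> R) := exists a, phi = (fun x => x + a) \/ phi = (fun x => a - x).

Lemma mf_rigid phi : rigid phi -> measurable_fun setT phi.
Proof. by case=> a [] ->; mf_tac. Qed.

(** By uniqueness of Lebesgue measure it is enough to compare lengths of half-open intervals. A
    reflection exchanges the open and the closed end, which does not change the length. *)
Lemma leb_rigid phi (A : set R) : rigid phi -> measurable A ->
  pushforward (leb R) (phi : measurableTypeR R -> measurableTypeR R) A = leb R A.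
Proof.
move=> rphi mA.
have mphi : measurable_fun (setT : set (measurableTypeR R)) (phi : _ -> measurableTypeR R).
  exact: mf_rigid.
pose mm := isMeasurableFun.Build _ _ _ _ _ mphi.
pose phim : {mfun measurableTypeR R >-> measurableTypeR R} := HB.pack phi mm.
have := @lebesgue_measure_unique R (pushforward (leb R) phim).
move=> /(_ mphi _ A mA) <- //.
move=> _ [[a b]] _ <-; rewrite /pushforward /=.
case: rphi => c [] ephi; rewrite {phim mm mphi}ephi.
  transitivity (leb R `]a - c, b - c]%classic); last first.
    congr (leb R _); apply/seteqP; split => x /=; by rewrite !in_itv/= ltrBlDr lerBrDr.
  by rewrite !lebesgue_measure_itv/= !lte_fin ltrD2r; case: ifP => // _; congr EFin; ring.
transitivity (leb R `[c - b, c - a[%classic); last first.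
  congr (leb R _); apply/seteqP; split => x /=;
  by rewrite !in_itv/= ltrBrDr lerBlDr ltrBrDl lerBlDl andbC.
by rewrite !lebesgue_measure_itv/= !lte_fin ltrD2l ltrN2; case: ifP => // _; congr EFin; ring.
Qed.

Lemma int_rigid phi (f : R -> \bar R) : rigid phi -> measurable_fun setT f ->
  (forall x, 0 <= f x)%E ->
  (\int[leb R]_x f (phi x) = \int[leb R]_x f x)%E.
Proof.
move=> rphi mf f0.
have mphi : measurable_fun (setT : set (measurableTypeR R)) (phi : _ -> measurableTypeR R).
  exact: mf_rigid.
have := @ge0_integral_pushforward _ _ (measurableTypeR R) (measurableTypeR R) R phi mphi (leb R) setT f measurableT mf.
rewrite preimage_setT => <- //.
apply: eq_measure_integral => A mA _; exact: leb_rigid.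
Qed.

Lemma itg_rigid phi f : rigid phi -> itg f -> itg (fun x => f (phi x)).
Proof.
move=> rphi itf; have mf := itg_mf itf; apply/integrableP; split.
  apply/measurable_EFinP; apply: measurableT_comp mf _; exact: mf_rigid.
rewrite (int_rigid (f := fun x => `|(f x)%:E|%E) rphi)//.
  exact: (itg_lty itf).
by apply/measurable_EFinP; mf_tac.
Qed.

Lemma J_rigid phi f : rigid phi -> itg f -> J (fun x => f (phi x)) = J f.
Proof.
move=> rphi itf; have mf := itg_mf itf.
have mphi : measurable_fun (setT : set (measurableTypeR R)) (phi : _ -> measurableTypeR R).
  exact: mf_rigid.
have mEf : measurable_fun setT (EFin \o f) by exact/measurable_EFinP.
have := @integral_pushforward _ _ (measurableTypeR R) (measurableTypeR R) R phi mphi (leb R) setT (EFin \o f) mEf.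
rewrite preimage_setT => /(_ (itg_rigid rphi itf) measurableT) e.
rewrite /Rintegral -[X in fine X = _]e; congr fine.
apply: eq_measure_integral => A mA _; exact: leb_rigid.
Qed.

Lemma rigid_opp : rigid (fun x => - x).
Proof. by exists 0; right; apply/funext => x; rewrite sub0r. Qed.

Lemma rigid_add a : rigid (fun x => x + a).
Proof. by exists a; left. Qed.

Lemma rigid_addl a : rigid (fun x => a + x).
Proof. by exists a; left; apply/funext => x; rewrite addrC. Qed.

Lemma rigid_sub a : rigid (fun x => x - a).
Proof. by exists (- a); left. Qed.

Lemma rigid_subl a : rigid (fun x => a - x).
Proof. by exists a; right. Qed.

Lemma rigid_addN a : rigid (fun x => - x - a).
Proof. by exists (- a); right; apply/funext => x; rewrite addrC. Qed.

Lemma ae_rigid phi (P : R -> Prop) : rigid phi -> ae P -> ae (fun x => P (phi x)).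
Proof.
move=> rphi [N [mN N0 sN]]; exists (phi @^-1` N); split.
- by rewrite -[X in measurable X]setTI; apply: mf_rigid.
- have := leb_rigid rphi mN; rewrite /pushforward N0; exact.
- by move=> x /= h; apply: sN => /= h2.
Qed.

Lemma cvg_EFin (u : nat -> R) l : u @ \oo --> l -> (fun n => (u n)%:E) @ \oo --> l%:E.
Proof. by move=> ul; apply/fine_cvgP; split => //; apply: nearW => n. Qed.

Lemma J_fatou (f_ : nat -> R -> R) f C : (forall n, itg (f_ n)) -> (forall n x, 0 <= f_ n x) ->
  (forall n, J (f_ n) <= C) -> measurable_fun setT f ->
  ae (fun x => f_ n x @[n --> \oo] --> f x) -> (forall x, 0 <= f x) ->
  itg f /\ J f <= C.
Proof.
move=> itf f0 JC mf cv ff0.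
have mf_ n : measurable_fun setT (fun x => (f_ n x)%:E).
  by apply/measurable_EFinP; exact: itg_mf.
have H : (\int[leb R]_x (f x)%:E <= C%:E)%E.
  have -> : (\int[leb R]_x (f x)%:E = \int[leb R]_x limn_einf (fun n => (f_ n x)%:E))%E.
    apply: ae_eq_integral => //.
    - exact/measurable_EFinP.
    - rewrite (_ : (fun x => _) = (fun x => - limn_esup (fun n => - (f_ n x)%:E))%E)//.
      apply: measurableT_comp => //; apply: measurable_fun_limn_esup => n.
      rewrite (_ : (fun x => _) = EFin \o (fun x => - f_ n x))//.
      by apply/measurable_EFinP; apply: mfN; exact: itg_mf.
    - apply/ae_eqP; apply: ae_mono cv => x cx.
      by have [-> _] := cvg_limn_einf_sup (cvg_EFin cx).
  apply: le_trans (fatou _ measurableT _ _) _ => //.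
    by move=> n x _; rewrite lee_fin.
  apply: le_trans (limn_einf_sup _) _ => /=.
  rewrite limn_esup_lim; apply: lime_le; first exact: is_cvg_esups.
  apply: nearW => n; apply: ge_ereal_sup => _ [k _ <-].
  by rewrite JE// lee_fin.
have itf' : itg f by apply: itg_ge0 => //; apply: le_lt_trans H _; rewrite ltry.
by split => //; rewrite -lee_fin -JE.
Qed.

Lemma J_dct (f_ : nat -> R -> R) f g : (forall n, measurable_fun setT (f_ n)) ->
  measurable_fun setT f -> itg g ->
  ae (fun x => f_ n x @[n --> \oo] --> f x) ->
  (forall n x, `|f_ n x| <= g x) ->
  itg f /\ (J (f_ n) @[n --> \oo] --> J f).
Proof.
move=> mf_ mf ig cv dom.
have [] := @dominated_convergence _ _ R (leb R) setT measurableT (fun n x => (f_ n x)%:E)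
  (EFin \o f) (EFin \o g).
- move=> n; have := mf_ n; exact: (proj2 (measurable_EFinP _ _)).
- exact/measurable_EFinP.
- by apply: negligibleS cv => x /= h cx; apply: h => _; exact: cvg_EFin.
- exact: ig.
- by apply: aeW => x n _; rewrite /= lee_fin.
move=> itf _ c; split => //.
have itf_ n : itg (f_ n) by apply: itg_le (dom n) ig.
apply: (fine_cvg (f := fun n => \int[leb R]_x (f_ n x)%:E)%E).
by move: c; rewrite (JE itf) /Rintegral.
Qed.

End integral.

Section fubini_real.
Context {R : realType}.
Implicit Types f g : R -> R.

(** By Tonelli, domination by a product of two integrable functions gives integrability on the
    plane; the kernels met below are all bounded in this way. *)
Lemma J_fubini (F : R * R -> R) (a b : R -> R) : measurable_fun setT F ->
  itg a -> itg b -> (forall x y, `|F (x, y)| <= a x * b y) ->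
  [/\ itg (fun x => J (fun y => F (x, y))), itg (fun y => J (fun x => F (x, y))) &
      J (fun x => J (fun y => F (x, y))) = J (fun y => J (fun x => F (x, y)))].
Proof.
move=> mF ia ib dom.
have mE : measurable_fun setT (EFin \o F) by exact/measurable_EFinP.
have ix x : itg (fun y => F (x, y)).
  apply: (itg_le (g := fun y => a x * b y)) => //; last exact: itgZ.
  exact: (measurableT_comp mF).
have iy y : itg (fun x => F (x, y)).
  apply: (itg_le (g := fun x => b y * a x)) => //; last exact: itgZ.
    exact: (measurableT_comp mF).
  by move=> x; rewrite mulrC.
have a0 x : 0 <= `|a x| by [].
have iF : (leb R \x leb R)%E.-integrable setT (EFin \o F).
  apply/(@integrable12ltyP _ _ _ _ R (leb R) (leb R) (EFin \o F) mE).
  apply: (@le_lt_trans _ _ (\int[leb R]_x \int[leb R]_y (`|a x| * `|b y|)%:E)%E).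
    apply: ge0_le_integral => //.
    - by move=> x _; exact: integral_ge0.
    - apply: (@measurable_fun_fubini_tonelli_F _ _ _ _ R (leb R) (fun z : R * R => `|(F z)%:E|)%E) => //.
      by apply/measurable_EFinP; mf_tac.
    - apply: (@measurable_fun_fubini_tonelli_F _ _ _ _ R (leb R) (fun z : R * R => (`|a z.1| * `|b z.2|)%:E)%E) => //.
      + apply/measurable_EFinP; apply: mfM; apply: mf_norm.
          by apply: measurableT_comp (itg_mf ia) _; mf_tac.
        by apply: measurableT_comp (itg_mf ib) _; mf_tac.
    - move=> x _; apply: ge0_le_integral => //.
      + by apply/measurable_EFinP; apply: mf_norm; exact: itg_mf.
      + by apply/measurable_EFinP; apply: mfM; [mf_tac | apply: mf_norm; exact: itg_mf].
      + by move=> y _; rewrite lee_fin -normrM (le_trans (dom x y))// ler_norm.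
  under eq_integral => x _ do rewrite (JE (itgZ `|a x| (itg_norm ib))) (JZ _ (itg_norm ib)) mulrC.
  by rewrite (JE (itgZ _ (itg_norm ia))) ltry.
have E1 : (fun x => \int[leb R]_y (F (x, y))%:E)%E = EFin \o (fun x => J (fun y => F (x, y))).
  by apply/funext => x; rewrite JE.
have E2 : (fun y => \int[leb R]_x (F (x, y))%:E)%E = EFin \o (fun y => J (fun x => F (x, y))).
  by apply/funext => y; rewrite JE.
have i1 := integrable_fubini_F iF.
rewrite /fubini_F /= E1 in i1.
have i2 : itg (fun y => J (fun x => F (x, y))).
  apply: (itg_le _ _ (itgZ (J (fun x => `|a x|)) (itg_norm ib))).
    by have := measurable_fubini_G iF; rewrite /fubini_G /= E2 => /measurable_EFinP.
  move=> y; apply: le_trans (J_norm (iy y)) _; rewrite mulrC -JZ; last exact: itg_norm.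
  apply: J_le; [exact: itg_norm|by apply: itgZ; exact: itg_norm|move=> x].
  by rewrite mulrC -normrM (le_trans (dom x y))// ler_norm.
split=> //.
have := Fubini iF; rewrite /= E1.
rewrite [X in _ = X -> _](_ : _ = \int[leb R]_y (EFin \o (fun y => J (fun x => F (x, y)))) y)%E; last by rewrite -E2.
by rewrite /Rintegral => ->.
Qed.

End fubini_real.

(** * The L^2 norm and scalar product, with real values *)

Section L2.
Context {R : realType}.
Implicit Types f g h : R -> R.

(** Together with [nrm], a real-valued replacement for [L2] and [L2norm] (see [L2P] and [L2normE]),
    which spares extended real arithmetic. *)
Definition isL2 f := measurable_fun setT f /\ itg (fun x => f x ^+ 2).

Definition nrm f := Num.sqrt (J (fun x => f x ^+ 2)).

Definition ip f g := J (fun x => f x * g x).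

Lemma L2normE f : isL2 f -> L2norm f = (nrm f)%:E.
Proof.
move=> [mf if2]; rewrite /L2norm unlock /=.
have -> : (\int[leb R]_x `|(f x)%:E| `^ 2 = (J (fun x => f x ^+ 2))%:E)%E.
  rewrite -JE//; apply: eq_integral => x _ /=.
  by rewrite powR_mulrn// real_normK// num_real.
by rewrite poweR_EFin powR12_sqrt//; apply: J_ge0 => x; exact: sqr_ge0.
Qed.

Lemma L2P f : L2 f <-> isL2 f.
Proof.
split.
  move=> h; have := Lfun2_integrable_sqr h; move: h; rewrite /L2 /= => /andP[].
  by rewrite inE.
move=> h; have e := L2normE h; case: h => mf if2.
rewrite /L2 /=; apply/andP; split; rewrite inE//=.
by rewrite /finite_norm; move: e; rewrite /L2norm => ->; rewrite ltry.
Qed.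

Lemma isL2_mf f : isL2 f -> measurable_fun setT f. Proof. by case. Qed.
Lemma isL2_sq f : isL2 f -> itg (fun x => f x ^+ 2). Proof. by case. Qed.

Lemma isL2_le f g : measurable_fun setT f -> (forall x, `|f x| <= `|g x|) -> isL2 g -> isL2 f.
Proof.
move=> mf fg [mg ig]; split => //; apply: itg_le ig; first by mf_tac.
by move=> x; rewrite ger0_norm ?sqr_ge0// -(real_normK (num_real (f x)))
  -(real_normK (num_real (g x))) ler_pXn2r ?nnegrE.
Qed.

Lemma isL2_ae f g : measurable_fun setT g -> ae (fun x => f x = g x) -> isL2 f -> isL2 g.
Proof.
move=> mg fg [mf if2]; split => //; apply: itg_ae if2; try by mf_tac.
by apply: ae_mono fg => x ->.
Qed.

Lemma itgM f g : isL2 f -> isL2 g -> itg (fun x => f x * g x).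
Proof.
move=> [mf if2] [mg ig2]; apply: itg_le (itgD if2 ig2); first by mf_tac.
move=> x; rewrite normrM -(real_normK (num_real (f x))) -(real_normK (num_real (g x))).
have := sqr_ge0 (`|f x| - `|g x|); have := mulr_ge0 (normr_ge0 (f x)) (normr_ge0 (g x)); nra.
Qed.

Lemma isL2D f g : isL2 f -> isL2 g -> isL2 (fun x => f x + g x).
Proof.
move=> hf hg; split; first by apply: mfD; [case: hf|case: hg].
have := itgD (itgD (isL2_sq hf) (itgZ 2 (itgM hf hg))) (isL2_sq hg).
by apply: itg_ext => x; ring.
Qed.

Lemma isL2Z c f : isL2 f -> isL2 (fun x => c * f x).
Proof.
move=> [mf if2]; split; first by mf_tac.
by apply: itg_ext (itgZ (c ^+ 2) if2) => x; rewrite exprMn.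
Qed.

Lemma isL2N f : isL2 f -> isL2 (fun x => - f x).
Proof. by move=> [mf if2]; split; [mf_tac|apply: itg_ext if2 => x; rewrite sqrrN]. Qed.

Lemma isL2B f g : isL2 f -> isL2 g -> isL2 (fun x => f x - g x).
Proof. by move=> hf hg; exact: isL2D hf (isL2N hg). Qed.

Lemma isL2_0 : isL2 (fun x : R => 0 : R).
Proof. by split; [mf_tac|apply: itg_ext itg0 => x; rewrite expr0n]. Qed.

Lemma isL2_norm f : isL2 f -> isL2 (fun x => `|f x|).
Proof. by move=> hf; apply: (isL2_le _ _ hf); [apply: mf_norm; case: hf|move=> x; rewrite normr_id]. Qed.

Lemma isL2_rigid phi f : rigid phi -> isL2 f -> isL2 (fun x => f (phi x)).
Proof.
move=> rphi [mf if2]; split; first by apply: measurableT_comp mf _; exact: mf_rigid.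
exact: (itg_rigid rphi if2).
Qed.

Lemma isL2_bnd (a : R -> R) f (M : R) : measurable_fun setT a -> (forall x, `|a x| <= M) -> isL2 f ->
  isL2 (fun x => a x * f x).
Proof.
move=> ma aM hf; apply: isL2_le (isL2Z M hf); first by have ? := isL2_mf hf; mf_tac.
by move=> x; rewrite !normrM ler_wpM2r// (le_trans (aM x))// ler_norm.
Qed.

Lemma nrm_ge0 f : 0 <= nrm f. Proof. exact: sqrtr_ge0. Qed.

Lemma nrm_sqr f : nrm f ^+ 2 = J (fun x => f x ^+ 2).
Proof. by rewrite sqr_sqrtr//; apply: J_ge0 => x; exact: sqr_ge0. Qed.

Lemma nrm_ip f : nrm f ^+ 2 = ip f f.
Proof. by rewrite nrm_sqr. Qed.

Lemma nrm_le_sqr f c : 0 <= c -> J (fun x => f x ^+ 2) <= c ^+ 2 -> nrm f <= c.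
Proof. by move=> c0 h; rewrite -(ler_pXn2r (ltn0Sn 1)) ?nnegrE ?nrm_ge0// nrm_sqr. Qed.

Lemma nrm_ext f g : f =1 g -> nrm f = nrm g.
Proof. by move=> /funext ->. Qed.

Lemma nrm_ae f g : measurable_fun setT f -> measurable_fun setT g ->
  ae (fun x => f x = g x) -> nrm f = nrm g.
Proof.
move=> mf mg fg; congr Num.sqrt; apply: J_ae; try by mf_tac.
by apply: ae_mono fg => x ->.
Qed.

Lemma nrm_ae_le f g : measurable_fun setT f -> isL2 g ->
  ae (fun x => `|f x| <= `|g x|) -> isL2 f /\ nrm f <= nrm g.
Proof.
move=> mf hg fg.
(* [h] agrees with [f] off a null set and satisfies the bound at every point, so integrals can be
   compared pointwise. *)
pose h x := if `|f x| <= `|g x| then f x else 0.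
have mh : measurable_fun setT h.
  apply: measurable_fun_ifT => //.
  by apply: measurable_fun_ler; apply: mf_norm => //; case: hg.
have hh : isL2 h.
  by apply: isL2_le hg => // x; rewrite /h; case: ifP => // _; rewrite normr0.
have e : ae (fun x => h x = f x) by apply: ae_mono fg => x; rewrite /h => ->.
split; first exact: isL2_ae e hh.
rewrite -(nrm_ae mh mf e); apply: ler_wsqrtr; apply: J_le; [exact: isL2_sq|exact: isL2_sq|].
move=> x; rewrite -(real_normK (num_real (h x))) -(real_normK (num_real (g x))).
by rewrite ler_pXn2r ?nnegrE// /h; case: ifP => // _; rewrite normr0.
Qed.

Lemma nrm_le f g : measurable_fun setT f -> isL2 g ->
  (forall x, `|f x| <= `|g x|) -> nrm f <= nrm g.
Proof. by move=> mf hg fg; apply: (nrm_ae_le mf hg (ae_all fg)).2. Qed.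

Lemma nrm0 : nrm (fun x : R => 0) = 0.
Proof.
by rewrite /nrm (_ : (fun x => _) = (fun=> 0)) ?J0 ?sqrtr0//; apply/funext => x; rewrite expr0n.
Qed.

Lemma nrmZ c f : isL2 f -> nrm (fun x => c * f x) = `|c| * nrm f.
Proof.
move=> hf; rewrite /nrm -sqrtr_sqr -sqrtrM ?sqr_ge0//; congr Num.sqrt.
by rewrite -JZ; [congr Rintegral; apply/funext => x; rewrite exprMn|exact: isL2_sq].
Qed.

Lemma nrmN f : nrm (fun x => - f x) = nrm f.
Proof. by congr Num.sqrt; congr Rintegral; apply/funext => x; rewrite sqrrN. Qed.

Lemma nrm_distC f g : nrm (fun x => f x - g x) = nrm (fun x => g x - f x).
Proof. by rewrite -nrmN; apply: nrm_ext => x; rewrite opprB. Qed.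

Lemma nrm_rigid phi f : rigid phi -> isL2 f -> nrm (fun x => f (phi x)) = nrm f.
Proof. by move=> rphi [mf if2]; congr Num.sqrt; exact: (J_rigid rphi if2). Qed.

Lemma nrm_norm f : nrm (fun x => `|f x|) = nrm f.
Proof.
by congr Num.sqrt; congr Rintegral; apply/funext => x; rewrite real_normK// num_real.
Qed.

Lemma nrm_eq0 f : isL2 f -> nrm f = 0 -> ae (fun x => f x = 0).
Proof.
move=> hf n0; have := @J_eq0 _ (fun x => f x ^+ 2) (isL2_sq hf) (fun x => sqr_ge0 _).
rewrite -nrm_sqr n0 expr0n => /(_ erefl); apply: ae_mono => x /eqP.
by rewrite sqrf_eq0 => /eqP.
Qed.

Lemma nrm_eq0_eq f g : isL2 f -> isL2 g -> nrm (fun x => f x - g x) = 0 ->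
  ae (fun x => f x = g x).
Proof.
move=> hf hg /(nrm_eq0 (isL2B hf hg)); apply: ae_mono => x /eqP.
by rewrite subr_eq0 => /eqP.
Qed.

Lemma ipC f g : ip f g = ip g f.
Proof. by congr Rintegral; apply/funext => x; rewrite mulrC. Qed.

Lemma ipD f g h : isL2 f -> isL2 g -> isL2 h -> ip f (fun x => g x + h x) = ip f g + ip f h.
Proof.
move=> hf hg hh; rewrite /ip -JD; [|exact: itgM|exact: itgM].
by congr Rintegral; apply/funext => x; rewrite mulrDr.
Qed.

Lemma ipZ c f g : isL2 f -> isL2 g -> ip f (fun x => c * g x) = c * ip f g.
Proof.
move=> hf hg; rewrite /ip -JZ; last exact: itgM.
by congr Rintegral; apply/funext => x; rewrite mulrCA.
Qed.

Lemma ipN f g : isL2 f -> isL2 g -> ip f (fun x => - g x) = - ip f g.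
Proof.
move=> hf hg; rewrite -mulN1r -ipZ//.
by congr Rintegral; apply/funext => x; rewrite mulN1r.
Qed.

Lemma ipB f g h : isL2 f -> isL2 g -> isL2 h -> ip f (fun x => g x - h x) = ip f g - ip f h.
Proof. by move=> hf hg hh; rewrite (ipD hf hg (isL2N hh)) ipN. Qed.

Lemma ip_ae f g g' : measurable_fun setT f -> measurable_fun setT g -> measurable_fun setT g' ->
  ae (fun x => g x = g' x) -> ip f g = ip f g'.
Proof.
by move=> mf mg mg' gg; apply: J_ae; try mf_tac; apply: ae_mono gg => x ->.
Qed.

Lemma nrmD_sqr f g : isL2 f -> isL2 g ->
  nrm (fun x => f x + g x) ^+ 2 = nrm f ^+ 2 + 2 * ip f g + nrm g ^+ 2.
Proof.
move=> hf hg; rewrite !nrm_sqr /ip -JZ; last exact: itgM.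
rewrite -JD; [|exact: isL2_sq|exact: itgZ (itgM hf hg)].
rewrite -JD; [|exact: itgD (isL2_sq hf) (itgZ 2 (itgM hf hg))|exact: isL2_sq].
by congr Rintegral; apply/funext => x; ring.
Qed.

(** The square of the norm of [f + t * g] is a nonnegative quadratic polynomial in [t]. It is
    evaluated at its minimizer or, when [nrm g = 0] makes it affine, at a point where it would be
    -1. *)
Lemma ip_le f g : isL2 f -> isL2 g -> `|ip f g| <= nrm f * nrm g.
Proof.
move=> hf hg.
have P t : 0 <= nrm f ^+ 2 + 2 * t * ip f g + t ^+ 2 * nrm g ^+ 2.
  have := sqr_ge0 (nrm (fun x => f x + t * g x)).
  rewrite (nrmD_sqr hf (isL2Z t hg)) ipZ// nrmZ// exprMn real_normK ?num_real//.
  by rewrite mulrA.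
have nf := nrm_ge0 f; have ng := nrm_ge0 g.
have [g0|g0] := eqVneq (nrm g) 0.
  rewrite g0 mulr0 normr_le0; apply/negPn/negP => i0.
  have := P (- (nrm f ^+ 2 + 1) / (2 * ip f g)).
  rewrite g0 expr0n mulr0 addr0 [_ * ip f g](_ : _ = - (nrm f ^+ 2 + 1)); first lra.
  by field.
have gp : 0 < nrm g by rewrite lt_neqAle eq_sym g0.
have H : ip f g ^+ 2 <= (nrm f * nrm g) ^+ 2.
  have := P (- ip f g / nrm g ^+ 2).
  have -> : nrm f ^+ 2 + 2 * (- ip f g / nrm g ^+ 2) * ip f g +
     (- ip f g / nrm g ^+ 2) ^+ 2 * nrm g ^+ 2 =
     ((nrm f * nrm g) ^+ 2 - ip f g ^+ 2) / nrm g ^+ 2 by field.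
  by rewrite pmulr_lge0 ?invr_gt0 ?exprn_gt0// subr_ge0.
rewrite -(ler_pXn2r (ltn0Sn 1)) ?nnegrE ?mulr_ge0//.
by rewrite real_normK ?num_real.
Qed.

Lemma nrmD f g : isL2 f -> isL2 g -> nrm (fun x => f x + g x) <= nrm f + nrm g.
Proof.
move=> hf hg; have nf := nrm_ge0 f; have ng := nrm_ge0 g.
rewrite -(ler_pXn2r (ltn0Sn 1)) ?nnegrE ?addr_ge0 ?nrm_ge0// nrmD_sqr//.
have := le_trans (ler_norm _) (ip_le hf hg); nra.
Qed.

Lemma nrmB f g : isL2 f -> isL2 g -> nrm (fun x => f x - g x) <= nrm f + nrm g.
Proof. by move=> hf hg; rewrite -(nrmN g); exact: nrmD hf (isL2N hg). Qed.

Lemma nrm_tri f g h : isL2 f -> isL2 g -> isL2 h ->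
  nrm (fun x => f x - h x) <= nrm (fun x => f x - g x) + nrm (fun x => g x - h x).
Proof.
move=> hf hg hh; apply: le_trans (nrmD (isL2B hf hg) (isL2B hg hh)).
by rewrite le_eqVlt; apply/orP; left; apply/eqP/nrm_ext => x; ring.
Qed.

Lemma nrm_rtri f g : isL2 f -> isL2 g -> `|nrm f - nrm g| <= nrm (fun x => f x - g x).
Proof.
move=> hf hg.
have h1 : nrm f <= nrm (fun x => f x - g x) + nrm g.
  rewrite [X in X <= _](@nrm_ext _ (fun x => (f x - g x) + g x)); first exact: nrmD (isL2B hf hg) hg.
  by move=> x; ring.
have h2 : nrm g <= nrm (fun x => f x - g x) + nrm f.
  rewrite nrm_distC [X in X <= _](@nrm_ext _ (fun x => (g x - f x) + f x)); first exact: nrmD (isL2B hg hf) hf.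
  by move=> x; ring.
by rewrite ler_norml; apply/andP; split; lra.
Qed.

Lemma nrm_bnd (a : R -> R) f (M : R) : measurable_fun setT a -> (forall x, `|a x| <= M) -> isL2 f ->
  nrm (fun x => a x * f x) <= M * nrm f.
Proof.
move=> ma aM hf.
have M0 : 0 <= M by apply: le_trans (aM 0).
rewrite -[X in X * nrm f](ger0_norm M0) -nrmZ//; apply: nrm_le; last first.
- by move=> x; rewrite !normrM ler_wpM2r// (le_trans (aM x))// ler_norm.
- exact: isL2Z.
- by have ? := isL2_mf hf; mf_tac.
Qed.

(** The way in which bounds for regularized expressions pass to the limit: membership of the limit
    in L^2 is part of the conclusion, so unbounded weights can be approached by bounded ones. *)
Lemma nrm_fatou (f_ : nat -> R -> R) f C : (forall n, isL2 (f_ n)) -> 0 <= C ->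
  (forall n, nrm (f_ n) <= C) -> measurable_fun setT f ->
  ae (fun x => f_ n x @[n --> \oo] --> f x) -> isL2 f /\ nrm f <= C.
Proof.
move=> hf C0 fC mf cv.
have [] := @J_fatou _ (fun n x => f_ n x ^+ 2) (fun x => f x ^+ 2) (C ^+ 2).
- by move=> n; exact: isL2_sq.
- by move=> n x; exact: sqr_ge0.
- by move=> n; rewrite -nrm_sqr ler_pXn2r ?nnegrE ?nrm_ge0.
- by mf_tac.
- apply: ae_mono cv => x cx; under eq_fun do rewrite expr2; rewrite expr2; exact: cvgM.
- by move=> x; exact: sqr_ge0.
by move=> if2 JC; split => //; exact: nrm_le_sqr.
Qed.

Lemma nrm_dct (f_ : nat -> R -> R) f g : (forall n, measurable_fun setT (f_ n)) ->
  measurable_fun setT f -> isL2 g -> ae (fun x => f_ n x @[n --> \oo] --> f x) ->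
  (forall n x, `|f_ n x| <= g x) -> (forall x, `|f x| <= g x) ->
  nrm (fun x => f_ n x - f x) @[n --> \oo] --> 0.
Proof.
move=> mf_ mf hg cv dom domf.
have [] := @J_dct _ (fun n x => (f_ n x - f x) ^+ 2) (fun x => 0) (fun x => 4 * g x ^+ 2).
- by move=> n; have ? := mf_ n; mf_tac.
- by mf_tac.
- exact: itgZ (isL2_sq hg).
- apply: ae_mono cv => x cx.
  have c0 : f_ n x - f x @[n --> \oo] --> 0.
    rewrite -(subrr (f x)); apply: cvgB => //; exact: cvg_cst.
  by under eq_fun do rewrite expr2; rewrite -(mulr0 0); exact: cvgM.
- move=> n x; rewrite ger0_norm ?sqr_ge0//.
  have := dom n x; have := domf x; rewrite !ler_norml => /andP[? ?] /andP[? ?]; nra.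
move=> _; rewrite J0 => c.
rewrite -[X in _ --> X](sqrtr0 R); apply: (cvg_comp _ _ c); exact: sqrt_continuous.
Qed.

End L2.

(* [lra] compares atoms up to conversion, which is slow on norms and integrals. *)
Ltac nlra :=
  repeat match goal with
  | H : is_true (_ <= _) |- _ => revert H
  | H : is_true (_ < _) |- _ => revert H
  | H : @eq (Real.sort _) _ _ |- _ => revert H
  end;
  repeat match goal with
  | |- context [nrm ?f] => generalize (nrm f); intro
  | |- context [ip ?f ?g] => generalize (ip f g); intro
  | |- context [Rintegral ?m ?D ?f] => generalize (Rintegral m D f); intro
  end;
  repeat match goal with H : _ |- _ => clear H end;
  intros; lra.

(** * Completeness of L^2 *)

Section completeness.
Context {R : realType}.

Lemma half_sum (C : R) n m : C * 2^-1 ^+ n * 2 - 2 * C * 2^-1 ^+ (n + m) + C * 2^-1 ^+ (n + m) =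
  C * 2^-1 ^+ n * 2 - 2 * C * 2^-1 ^+ (n + m.+1).
Proof. by rewrite addnS exprS; field. Qed.

Lemma geom_tail (f_ : nat -> R -> R) (C : R) : (forall n, isL2 (f_ n)) ->
  (forall n, nrm (fun x => f_ n.+1 x - f_ n x) <= C * 2^-1 ^+ n) ->
  forall n m, nrm (fun x => f_ n x - f_ (n + m)%N x) <= 2 * C * 2^-1 ^+ n.
Proof.
move=> hf hC n m.
have C0 : 0 <= C by have := le_trans (nrm_ge0 _) (hC 0%N); rewrite expr0 mulr1.
(* The exact sum of the geometric bounds has to be kept for the induction to close; its negative
   part is dropped only here. *)
suff H : nrm (fun x => f_ n x - f_ (n + m)%N x) <= C * 2^-1 ^+ n * 2 - 2 * C * 2^-1 ^+ (n + m).
  apply: le_trans H _; have : 0 <= C * 2^-1 ^+ (n + m) by rewrite mulr_ge0// exprn_ge0.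
  lra.
elim: m => [|m IH].
  rewrite addn0 (@nrm_ext _ _ (fun=> 0)) ?nrm0; last by move=> x; rewrite subrr.
  by rewrite (_ : _ - _ = 0)//; ring.
apply: le_trans (nrm_tri (hf n) (hf (n + m)%N) (hf (n + m.+1)%N)) _.
rewrite -half_sum; apply: lerD => //.
by rewrite addnS nrm_distC.
Qed.

Lemma cvg_of_summable (u : nat -> R) (M : R) :
  (forall n, \sum_(k < n) `|u k.+1 - u k| <= M) -> cvgn u.
Proof.
move=> h.
have : cvgn [normed series (fun k => u k.+1 - u k)].
  apply: nondecreasing_is_cvgn.
    apply/nondecreasing_seqP => n; rewrite /series /= [leRHS]big_nat_recr//= lerDl.
    exact: normr_ge0.
  exists M => _ [n _ <-].
    by have := h n; rewrite -(big_mkord xpredT (fun k => `|u k.+1 - u k|)).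
move=> /normed_cvg.
have -> : series (fun k => u k.+1 - u k) = (fun n => u n - u 0%N).
  apply/funext => n; rewrite /series /=; elim: n => [|n IH].
    by rewrite big_geq// subrr.
  by rewrite big_nat_recr//= IH; ring.
move=> /cvg_ex[l cl]; apply/cvg_ex; exists (l + u 0%N).
apply: cvg_trans (cvgD cl (cvg_cst (u 0%N))); apply: near_eq_cvg; apply: nearW => n.
by rewrite !fctE /cst subrK.
Qed.

(** Riesz-Fischer for geometrically Cauchy sequences. The partial sums [S n] of the absolute
    increments are bounded in L^2, so by monotone convergence their limit is finite almost
    everywhere and [f_ n] converges there; Fatou then gives the rate. *)
Lemma L2_complete (f_ : nat -> R -> R) (C : R) : (forall n, isL2 (f_ n)) ->
  (forall n, nrm (fun x => f_ n.+1 x - f_ n x) <= C * 2^-1 ^+ n) ->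
  exists2 f, isL2 f & forall n, nrm (fun x => f_ n x - f x) <= 2 * C * 2^-1 ^+ n.
Proof.
move=> hf hC.
have C0 : 0 <= C by have := le_trans (nrm_ge0 _) (hC 0%N); rewrite expr0 mulr1.
pose g n x : R := `|f_ n.+1 x - f_ n x|.
have hg n : isL2 (g n) by apply: isL2_norm; exact: isL2B.
pose S n x : R := \sum_(k < n) g k x.
have hS n : isL2 (S n).
  elim: n => [|n IH].
    by rewrite (_ : S 0%N = (fun=> 0)); [exact: isL2_0|apply/funext => x; rewrite /S big_ord0].
  rewrite (_ : S n.+1 = (fun x => S n x + g n x)); first exact: isL2D.
  by apply/funext => x; rewrite /S big_ord_recr.
have nS n : nrm (S n) <= 2 * C - 2 * C * 2^-1 ^+ n.
  elim: n => [|n IH].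
    rewrite (@nrm_ext _ _ (fun=> 0)) ?nrm0; last by move=> x; rewrite /S big_ord0.
    by rewrite expr0 mulr1 subrr.
  rewrite (@nrm_ext _ _ (fun x => S n x + g n x)); last by move=> x; rewrite /S big_ord_recr.
  apply: le_trans (nrmD (hS n) (hg n)) _.
  have := hC n; rewrite -nrm_norm exprS => h; rewrite [X in _ <= X](_ : _ =
    2 * C - 2 * C * 2^-1 ^+ n + C * 2^-1 ^+ n); first exact: lerD.
  by field.
have S0 n x : 0 <= S n x by apply: sumr_ge0 => k _; exact: normr_ge0.
have Sle x : nondecreasing_seq (fun n => (S n x ^+ 2)%:E).
  apply/nondecreasing_seqP => n; rewrite lee_fin ler_pXn2r ?nnegrE//.
  by rewrite /S big_ord_recr lerDl; exact: normr_ge0.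
have mS n : measurable_fun setT (fun x => (S n x ^+ 2)%:E).
  by apply/measurable_EFinP; have ? := isL2_mf (hS n); mf_tac.
pose L x := limn (fun n => (S n x ^+ 2)%:E).
have mL : measurable_fun setT L.
  apply: (emeasurable_fun_cvg (fun n x => (S n x ^+ 2)%:E)) => // x _.
  exact: ereal_nondecreasing_is_cvgn.
have L0 x : (0 <= L x)%E.
  apply: lime_ge; first exact: ereal_nondecreasing_is_cvgn.
  by apply: nearW => n; rewrite lee_fin sqr_ge0.
have iL : (leb R).-integrable setT L.
  apply/integrableP; split => //.
  under eq_integral do rewrite gee0_abs//.
  rewrite monotone_convergence//; last by move=> n x _; rewrite lee_fin sqr_ge0.
  apply: (@le_lt_trans _ _ ((2 * C) ^+ 2)%:E); last exact: ltry.
  apply: lime_le.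
    apply: ereal_nondecreasing_is_cvgn => n m nm; apply: ge0_le_integral => //.
    + by move=> x _; rewrite lee_fin sqr_ge0.
    + exact: mS.
    + exact: mS.
    + by move=> x _; exact: Sle.
  apply: nearW => n; rewrite (JE (isL2_sq (hS n))) lee_fin -nrm_sqr.
  rewrite ler_pXn2r ?nnegrE ?nrm_ge0 ?mulr_ge0//; apply: le_trans (nS n) _.
  by rewrite gerBl mulr_ge0 ?mulr_ge0// exprn_ge0.
have cv : ae (fun x => cvgn (fun n => f_ n x)).
  have : ae (fun x => setT x -> L x \is a fin_num) by have := integrable_ae measurableT iL.
  apply: ae_mono => x /(_ I) Lx; apply: (@cvg_of_summable _ (fine (L x) + 1)) => n.
  have h : S n x ^+ 2 <= fine (L x).
    rewrite -lee_fin fineK//; apply: lime_ge; first exact: ereal_nondecreasing_is_cvgn.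
    by exists n => // m /= nm; exact: Sle.
  rewrite -/(S n x); have := S0 n x; nra.
(* A limsup is measurable as it stands, whatever happens on the null set without convergence. *)
pose f x := fine (limn_esup (fun n => (f_ n x)%:E)).
have mf : measurable_fun setT f.
  apply: measurableT_comp => //.
  by apply: measurable_fun_limn_esup => n; apply/measurable_EFinP; case: (hf n).
have cf : ae (fun x => f_ n x @[n --> \oo] --> f x).
  apply: ae_mono cv => x /cvg_ex[l cl]; rewrite /f.
  by have [_ ->] := cvg_limn_einf_sup (cvg_EFin cl).
have K n : isL2 (fun x => f_ n x - f x) /\ nrm (fun x => f_ n x - f x) <= 2 * C * 2^-1 ^+ n.
  apply: (@nrm_fatou _ (fun m x => f_ n x - f_ (n + m)%N x)).
  - by move=> m; exact: isL2B.
  - by rewrite mulr_ge0 ?mulr_ge0// exprn_ge0.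
  - by move=> m; exact: geom_tail.
  - by have ? := isL2_mf (hf n); mf_tac.
  - apply: ae_mono cf => x cx; apply: cvgB; first exact: cvg_cst.
    rewrite [X in X @ _](_ : _ = (fun m => f_ (m + n)%N x)).
      by rewrite (cvg_shiftn n (fun m => f_ m x)).
    by apply/funext => m; rewrite addnC.
exists f; last by move=> n; have [] := K n.
have := isL2B (hf 0%N) (K 0%N).1.
by rewrite (_ : (fun x => _) = f)//; apply/funext => x; ring.
Qed.

End completeness.

(** * Young's convolution inequality *)

Section young.
Context {R : realType}.

Definition conv (a b : R -> R) (x : R) := J (fun y => a y * b (x - y)).

(** Writing [a] as the square of its root in Cauchy-Schwarz gives [conv a b x ^+ 2 <= J a * G x],
    where [G] is the convolution of [a] and [b ^+ 2]; Tonelli integrates [G]. With [a] and [b] both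
    in L^2, [conv a b] is finite at every point. *)
Lemma young (a b : R -> R) : (forall x, 0 <= a x) -> (forall x, 0 <= b x) ->
  itg a -> isL2 a -> isL2 b -> isL2 (conv a b) /\ nrm (conv a b) <= J a * nrm b.
Proof.
move=> a0 b0 ia ha hb.
have ma := isL2_mf ha; have mb := isL2_mf hb.
have mbs : measurable_fun setT (fun z : R * R => b (z.1 - z.2)).
  by apply: measurableT_comp mb _; mf_tac.
have mas : measurable_fun setT (fun z : R * R => a z.2).
  by apply: measurableT_comp ma _; mf_tac.
have hbs x : isL2 (fun y => b (x - y)) := isL2_rigid (rigid_subl x) hb.
have ic x : itg (fun y => a y * b (x - y)) := itgM ha (hbs x).
have mc : measurable_fun setT (conv a b).
  apply: measurableT_comp; first exact: fine_measurable.
  apply: (@measurable_fun_fubini_tonelli_F _ _ _ _ R (leb R)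
    (fun z : R * R => (a z.2 * b (z.1 - z.2))%:E)%E).
    by apply/measurable_EFinP; mf_tac.
  by move=> z; rewrite lee_fin mulr_ge0.
pose G x := (\int[leb R]_y (a y * b (x - y) ^+ 2)%:E)%E.
have G0 x : (0 <= G x)%E by apply: integral_ge0 => y _; rewrite lee_fin mulr_ge0// sqr_ge0.
have mG : measurable_fun setT G.
  apply: (@measurable_fun_fubini_tonelli_F _ _ _ _ R (leb R)
    (fun z : R * R => (a z.2 * b (z.1 - z.2) ^+ 2)%:E)%E).
    by apply/measurable_EFinP; mf_tac.
  by move=> z; rewrite lee_fin mulr_ge0// sqr_ge0.
have Ja0 : 0 <= J a by exact: J_ge0.
have h2 : isL2 (fun y => Num.sqrt (a y)).
  split; first by mf_tac.
  by apply: itg_ext ia => y; rewrite sqr_sqrtr.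
have cG x : ((conv a b x ^+ 2)%:E <= (J a)%:E * G x)%E.
  (* If [G x] is infinite the right-hand side is infinite too, unless [J a = 0]; in that case [a]
     vanishes almost everywhere and so does the convolution. *)
  have [Gf|] := ltP (G x) +oo%E; last first.
    rewrite leye_eq => /eqP ->; have [Ja|Ja] := eqVneq (J a) 0; last first.
      by rewrite gt0_muley ?leey// lte_fin lt_neqAle eq_sym Ja.
    have a_ae := J_eq0 ia a0 Ja.
    rewrite /conv (@J_ae _ _ (fun=> 0)) ?J0 ?expr0n ?Ja ?mul0e//.
    - exact: (itg_mf (ic x)).
    - by apply: ae_mono a_ae => y ->; rewrite mul0r.
  have iG : itg (fun y => a y * b (x - y) ^+ 2).
    apply: itg_ge0 => //; last by move=> y; rewrite mulr_ge0// sqr_ge0.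
    by have ? := isL2_mf (hbs x); mf_tac.
  have h1 : isL2 (fun y => Num.sqrt (a y) * b (x - y)).
    split; first by have ? := isL2_mf (hbs x); mf_tac.
    by apply: itg_ext iG => y; rewrite exprMn sqr_sqrtr.
  rewrite /G JE// -EFinM lee_fin.
  have -> : conv a b x = ip (fun y => Num.sqrt (a y)) (fun y => Num.sqrt (a y) * b (x - y)).
    by congr Rintegral; apply/funext => y; rewrite mulrA -expr2 sqr_sqrtr.
  have e1 : nrm (fun y => Num.sqrt (a y)) ^+ 2 = J a.
    by rewrite nrm_sqr; congr Rintegral; apply/funext => y; rewrite sqr_sqrtr.
  have e2 : nrm (fun y => Num.sqrt (a y) * b (x - y)) ^+ 2 = J (fun y => a y * b (x - y) ^+ 2).
    by rewrite nrm_sqr; congr Rintegral; apply/funext => y; rewrite exprMn sqr_sqrtr.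
  rewrite -e1 -e2 -exprMn -(real_normK (num_real (ip _ _))).
  by rewrite ler_pXn2r ?nnegrE ?mulr_ge0 ?nrm_ge0//; exact: ip_le.
have H : (\int[leb R]_x (conv a b x ^+ 2)%:E <= ((J a * nrm b) ^+ 2)%:E)%E.
  apply: (@le_trans _ _ (\int[leb R]_x ((J a)%:E * G x))%E).
    apply: ge0_le_integral => //.
    - by move=> x _; rewrite lee_fin sqr_ge0.
    - by apply/measurable_EFinP; mf_tac.
    - exact: emeasurable_funM.
  rewrite ge0_integralZl//.
  rewrite /G.
  rewrite (@fubini_tonelli _ _ _ _ R (leb R) (leb R)
    (fun z : R * R => (a z.2 * b (z.1 - z.2) ^+ 2)%:E)) /=; first last.
  - by move=> z; rewrite lee_fin mulr_ge0// sqr_ge0.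
  - by apply/measurable_EFinP; mf_tac.
  have e y : (\int[leb R]_x (a y * b (x - y) ^+ 2)%:E = (nrm b ^+ 2 * a y)%:E)%E.
    have hy : isL2 (fun x => b (x - y)) := isL2_rigid (rigid_sub y) hb.
    rewrite (JE (itgZ _ (isL2_sq hy))) (JZ _ (isL2_sq hy)) -nrm_sqr.
    by rewrite (nrm_rigid (rigid_sub y) hb) mulrC.
  under eq_integral => y _ do rewrite e.
  rewrite (JE (itgZ _ ia)) (JZ _ ia) -EFinM lee_fin [leLHS](_ : _ = (J a * nrm b) ^+ 2)//.
  by ring.
have hc : isL2 (conv a b).
  split => //; apply: itg_ge0; [by mf_tac|by move=> x; exact: sqr_ge0|].
  exact: le_lt_trans H (ltry _).
split => //; apply: nrm_le_sqr; first by rewrite mulr_ge0// nrm_ge0.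
by rewrite -lee_fin -JE//; exact: isL2_sq.
Qed.

End young.

Section geom.
Context {R : realType}.

Lemma le_geom (a b C : R) : (forall n, a <= b + C * 2^-1 ^+ n) -> a <= b.
Proof.
move=> h.
have c : (fun n : nat => b + C * 2^-1 ^+ n) @ \oo --> b + C * 0.
  apply: cvgD; first exact: cvg_cst.
  by apply: cvgMr; apply: cvg_expr; rewrite ger0_norm// invf_lt1 ?ltr1n.
rewrite mulr0 addr0 in c.
rewrite -(cvg_lim (@Rhausdorff R) c); apply: limr_ge; first by apply/cvg_ex; exists b.
exact: nearW.
Qed.

End geom.

Section continuity.
Context {R : realType}.
Implicit Types f g : R -> R.

(** A constant standing for [continuous], by whose head symbol [cts_tac] recognizes its goals. *)
Definition cts f : Prop := continuous f.

Lemma ctsW f : cts f -> continuous f. Proof. by []. Qed.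

Lemma ctsD f g : cts f -> cts g -> cts (fun x => f x + g x).
Proof. by move=> cf cg x; exact: (continuousD (cf x) (cg x)). Qed.

Lemma ctsN f : cts f -> cts (fun x => - f x).
Proof. by move=> cf x; exact: (continuousN (cf x)). Qed.

Lemma ctsB f g : cts f -> cts g -> cts (fun x => f x - g x).
Proof. by move=> cf cg x; exact: (continuousB (cf x) (cg x)). Qed.

Lemma ctsM f g : cts f -> cts g -> cts (fun x => f x * g x).
Proof. by move=> cf cg x; exact: (continuousM (cf x) (cg x)). Qed.

Lemma ctsX f n : cts f -> cts (fun x => f x ^+ n).
Proof.
move=> cf; elim: n => [|n IH]; first by move=> x; exact: cvg_cst.
rewrite (_ : (fun x => _) = (fun x => f x * f x ^+ n)); first exact: ctsM.
by apply/funext => x; rewrite exprS.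
Qed.

Lemma ctsV f : (forall x, f x != 0) -> cts f -> cts (fun x => (f x)^-1).
Proof. by move=> f0 cf x; exact: (continuousV (f0 x) (cf x)). Qed.

Lemma cts_comp f g : cts f -> cts g -> cts (fun x => g (f x)).
Proof. by move=> cf cg x; apply: (@continuous_comp _ _ _ f g); [exact: cf|exact: cg]. Qed.

Lemma cts_cst (c : R) : cts (fun _ : R => c).
Proof. by move=> x; exact: cvg_cst. Qed.

Lemma cts_id : cts (fun x : R => x).
Proof. by move=> x; exact: cvg_id. Qed.

Lemma cts_norm f : cts f -> cts (fun x => `|f x|).
Proof. by move=> cf; apply: (cts_comp cf); exact: norm_continuous. Qed.

Lemma cts_cos f : cts f -> cts (fun x => cos (f x)).
Proof. by move=> cf; apply: (cts_comp cf); exact: continuous_cos. Qed.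

Lemma cts_sin f : cts f -> cts (fun x => sin (f x)).
Proof. by move=> cf; apply: (cts_comp cf); exact: continuous_sin. Qed.

Lemma cts_exp f : cts f -> cts (fun x => expR (f x)).
Proof. by move=> cf; apply: (cts_comp cf); exact: continuous_expR. Qed.

End continuity.

Ltac cts_tac :=
  repeat first
    [ assumption
    | lazymatch goal with |- cts ?h_ => lazymatch h_ with
      | (fun y_ => y_) => exact: cts_id
      | (fun _ => ?c) => exact: cts_cst
      | (fun y_ => @?f y_ - @?g y_) => apply: ctsB
      | (fun y_ => @?f y_ + @?g y_) => apply: ctsD
      | (fun y_ => - @?f y_) => apply: ctsN
      | (fun y_ => @?f y_ * @?g y_) => apply: ctsM
      | (fun y_ => @?f y_ ^+ _) => apply: ctsX
      | (fun y_ => `|@?f y_|) => apply: cts_norm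
      | (fun y_ => cos (@?f y_)) => apply: cts_cos
      | (fun y_ => sin (@?f y_)) => apply: cts_sin
      | (fun y_ => expR (@?f y_)) => apply: cts_exp
      | _ => first [ exact: norm_continuous | exact: continuous_cos
                   | exact: continuous_sin | exact: continuous_expR | exact: opp_continuous
                   | exact: (ctsM (@cts_cst _ _) (@cts_id _)) | exact: (ctsD (@cts_cst _ _) (@cts_id _)) ]
      end end ].

(** * The Hartley transform and Plancherel's theorem *)

Section abel_kernel.
Context {R : realType}.
Implicit Types f F : R -> R.

Lemma dD f F (x a b : R) : is_derive x 1 f a -> is_derive x 1 F b ->
  is_derive x 1 (fun y => f y + F y) (a + b).
Proof. by move=> ? ?; exact: is_deriveD. Qed.

Lemma dB f F (x a b : R) : is_derive x 1 f a -> is_derive x 1 F b ->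
  is_derive x 1 (fun y => f y - F y) (a - b).
Proof. by move=> ? ?; exact: is_deriveB. Qed.

Lemma dM f F (x a b : R) : is_derive x 1 f a -> is_derive x 1 F b ->
  is_derive x 1 (fun y => f y * F y) (f x * b + F x * a).
Proof. by move=> ? ?; exact: is_deriveM. Qed.

Lemma dZ c f (x a : R) : is_derive x 1 f a -> is_derive x 1 (fun y => c * f y) (c * a).
Proof. by move=> ?; exact: is_deriveZ. Qed.

Lemma dlin (c x : R) : is_derive x 1 (fun y : R => c * y) c.
Proof.
have -> : c = c * 1 :> R by rewrite mulr1.
rewrite [X in is_derive _ _ X](_ : _ = (fun y : R => c * y)); first by apply: dZ; exact: is_derive_id.
by apply/funext => y; rewrite mulr1.
Qed.

Lemma dcomp f F (x a b : R) : is_derive (F x) 1 f a -> is_derive x 1 F b ->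
  is_derive x 1 (fun y => f (F y)) (a * b).
Proof. by move=> ? ?; exact: is_derive1_comp. Qed.

Lemma dexpN (e x : R) : is_derive x 1 (fun y => expR (- (e * y))) (expR (- (e * x)) * - e).
Proof.
have d1 : is_derive x 1 (fun y => - (e * y)) (- e).
  rewrite (_ : (fun y => _) = (fun y => - e * y)); first exact: dlin.
  by apply/funext => y; rewrite mulNr.
exact: (dcomp (is_derive_expR _) d1).
Qed.

Lemma int_half_line f F (l : R) : (forall x : R, 0 <= x -> 0 <= f x) -> continuous f ->
  (forall x : R, is_derive x 1 F (f x)) -> F x @[x --> +oo] --> l ->
  (\int[leb R]_(x in `[0%R, +oo[) (f x)%:E = (l - F 0)%:E)%E.
Proof.
move=> f0 cf dF Fl.
have cF : continuous F.
  by move=> x; apply: differentiable_continuous; apply/derivable1_diffP; case: (dF x).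
rewrite (ge0_continuous_FTC2y f0 _ Fl).
- by rewrite EFinB.
- exact: continuous_subspaceT.
- by move=> x _; case: (dF x).
- by apply: cvg_at_right_filter; exact: cF.
- by move=> x _; rewrite derive1E; have := dF x => -[_].
Qed.

(** The Abel summability factor. Its cosine integral is the Poisson kernel, a positive approximate
    identity of mass [2 * pi], and Plancherel's theorem is derived from these two facts. *)
Definition expabs (e x : R) := expR (- (e * `|x|)).

Lemma expabs_ge0 e x : 0 <= expabs e x. Proof. exact: expR_ge0. Qed.

Lemma expabs_le1 e x : 0 <= e -> expabs e x <= 1.
Proof. by move=> e0; rewrite /expabs -expR0 ler_expR oppr_le0 mulr_ge0. Qed.

Lemma expabsN e x : expabs e (- x) = expabs e x. Proof. by rewrite /expabs normrN. Qed.

Lemma continuous_expabs e : continuous (expabs e).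
Proof. by rewrite /expabs; apply: ctsW; cts_tac. Qed.

(** The even integrands below involve [|x|] and are not smooth at 0. The fundamental theorem of
    calculus is applied on the half line to [g], a formula without absolute value that coincides
    with [f] there. *)
Lemma integral_even f g F (l : R) : (forall x, 0 <= f x) -> continuous f -> (forall x, f (- x) = f x) ->
  (forall x, 0 <= x -> f x = g x) -> continuous g ->
  (forall x : R, is_derive x 1 F (g x)) -> F x @[x --> +oo] --> l ->
  itg f /\ J f = 2 * (l - F 0).
Proof.
move=> f0 cf fev fg cg dF Fl.
have E : (\int[leb R]_x (f x)%:E = (2 * (l - F 0))%:E)%E.
  rewrite ge0_symfun_integralT//; last by move=> x /=; rewrite fev.
  rewrite [X in (_ * X)%E](_ : _ = (l - F 0)%:E) -?EFinM//.
  rewrite -(int_half_line _ cg dF Fl); last by move=> x x0; rewrite -fg.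
  rewrite set_itvcy; apply: eq_integral => x; rewrite inE/= => x0.
  by rewrite fg.
split; last by rewrite /Rintegral E.
apply: itg_ge0 => //; first exact: continuous_measurable_fun.
by rewrite E ltry.
Qed.

Lemma cvg_expN (e : R) : 0 < e -> expR (- (e * x)) @[x --> +oo] --> (0 : R).
Proof.
move=> e0; apply: (@cvg_comp _ _ _ (fun x => e * x) (fun y => expR (- y)) _ +oo); last exact: cvgr_expR.
by apply: gt0_cvgMry => //; exact: cvg_id.
Qed.

Lemma cvg_exp_bnd (e : R) (b : R -> R) (M : R) : 0 < e -> (forall x, `|b x| <= M) ->
  expR (- (e * x)) * b x @[x --> +oo] --> (0 : R).
Proof.
move=> e0 bM; apply/cvgr0Pnorm_le => d d0.
have M0 : 0 <= M by apply: le_trans (bM 0).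
have /cvgr0Pnorm_le /(_ (d / (M + 1))) := cvg_expN e0.
have dM : 0 < d / (M + 1) by rewrite divr_gt0// ltr_wpDl.
move=> /(_ dM); apply: filterS => x h.
rewrite normrM (le_trans (ler_pM _ _ h (bM x)))//.
by rewrite mulrAC ler_pdivrMr ?ltr_wpDl// ler_wpM2l ?lerDl// ltW.
Qed.

Lemma expabs_integral (e : R) : 0 < e -> itg (expabs e) /\ J (expabs e) = 2 / e.
Proof.
move=> e0.
have [] := @integral_even (expabs e) (fun x => expR (- (e * x))) (fun x => - e^-1 * expR (- (e * x))) 0.
- exact: expabs_ge0.
- exact: continuous_expabs.
- exact: expabsN.
- by move=> x x0; rewrite /expabs ger0_norm.
- by apply: ctsW; cts_tac.
- move=> x; rewrite [X in is_derive _ _ _ X](_ : _ = - e^-1 * (expR (- (e * x)) * - e)).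
    exact: dZ (dexpN e x).
  by field; exact: lt0r_neq0.
- by rewrite -(mulr0 (- e^-1)); apply: cvgM; [exact: cvg_cst|exact: cvg_expN].
by move=> i ->; split => //; rewrite mulr0 oppr0 expR0; ring.
Qed.

Lemma expabs_cos_itg (e z : R) : 0 < e -> itg (fun x => expabs e x * cos (z * x)).
Proof.
move=> e0; apply: itg_le (expabs_integral e0).1.
  apply: mfM; last by mf_tac.
  by apply: continuous_measurable_fun; exact: continuous_expabs.
move=> x; rewrite normrM ger0_norm ?expabs_ge0// ler_piMr ?expabs_ge0//.
exact: cos_max.
Qed.

Lemma expabs_cos (e z : R) : 0 < e -> J (fun x => expabs e x * cos (z * x)) = 2 * e / (e ^+ 2 + z ^+ 2).
Proof.
move=> e0.
have d0 : e ^+ 2 + z ^+ 2 != 0.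
  by rewrite gt_eqF// ltr_wpDr ?sqr_ge0// exprn_gt0.
pose d := e ^+ 2 + z ^+ 2.
(* The improper fundamental theorem wants a nonnegative integrand, hence [1 + cos]; the integral of
   [expabs e] is subtracted at the end. *)
pose g x := expR (- (e * x)) * (1 + cos (z * x)).
pose F x := expR (- (e * x)) * (- e^-1 + d^-1 * (z * sin (z * x) - e * cos (z * x))).
have [] := @integral_even (fun x => expabs e x * (1 + cos (z * x))) g F 0.
- by move=> x; rewrite mulr_ge0 ?expabs_ge0// -lerBlDl sub0r cos_geN1.
- by rewrite /expabs; apply: ctsW; cts_tac.
- by move=> x; rewrite expabsN mulrN cosN.
- by move=> x x0; rewrite /expabs ger0_norm.
- by rewrite /g; apply: ctsW; cts_tac.
- move=> x; rewrite [X in is_derive _ _ _ X](_ : _ =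
    expR (- (e * x)) * (0 + d^-1 * (z * (cos (z * x) * z) - e * (- sin (z * x) * z))) +
    (- e^-1 + d^-1 * (z * sin (z * x) - e * cos (z * x))) * (expR (- (e * x)) * - e)); last first.
    by rewrite /g /d; field; rewrite d0 gt_eqF.
  apply: dM.
    exact: dexpN.
  apply: dD; apply: dZ; apply: dB.
    exact: dZ (dcomp (is_derive_sin _) (dlin z x)).
  exact: dZ (dcomp (is_derive_cos _) (dlin z x)).
- apply: (@cvg_exp_bnd _ _ (e^-1 + d^-1 * (`|z| + e))) => // x.
  have dp : 0 < d by rewrite /d ltr_wpDr ?sqr_ge0// exprn_gt0.
  have d1 : 0 <= d^-1 by rewrite invr_ge0 ltW.
  have e1 : 0 <= e^-1 by rewrite invr_ge0 ltW.
  apply: le_trans (ler_normD _ _) _; rewrite normrN (ger0_norm e1).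
  rewrite lerD2l normrM (ger0_norm d1) ler_wpM2l//.
  apply: le_trans (ler_normB _ _) _; rewrite !normrM (ger0_norm (ltW e0)) lerD//.
    by rewrite ler_piMr// sin_max.
  by rewrite ler_piMr ?(ltW e0)// cos_max.
move=> i; rewrite (_ : (fun x => expabs e x * (1 + cos (z * x))) =
  (fun x => expabs e x + expabs e x * cos (z * x))); last by apply/funext => x; ring.
have [ie Je] := expabs_integral e0.
rewrite (JD ie (expabs_cos_itg z e0)) Je => h.
rewrite -[LHS](addKr (2 / e)) h /F !mulr0 oppr0 expR0 sin0 cos0 /d.
by field; rewrite d0 gt_eqF.
Qed.

Lemma J_odd f : (forall x, f (- x) = - f x) -> itg f -> J f = 0.
Proof.
move=> fo itf; have := J_rigid rigid_opp itf.
rewrite (_ : (fun x => f (- x)) = (fun x => - f x)); last by apply/funext.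
by rewrite JN// => h; lra.
Qed.

Lemma poisson_integral (e : R) : 0 < e ->
  itg (fun x : R => 2 * e / (e ^+ 2 + x ^+ 2)) /\ J (fun x : R => 2 * e / (e ^+ 2 + x ^+ 2)) = 2 * pi.
Proof.
move=> e0.
have e2 x : e ^+ 2 + x ^+ 2 != 0 :> R.
  by rewrite gt_eqF// ltr_wpDr ?sqr_ge0// exprn_gt0.
have cg : continuous (fun x : R => 2 * e / (e ^+ 2 + x ^+ 2)).
  by apply: ctsW; apply: ctsM; [cts_tac|apply: ctsV => //; cts_tac].
have [] := @integral_even (fun x => 2 * e / (e ^+ 2 + x ^+ 2)) (fun x => 2 * e / (e ^+ 2 + x ^+ 2))
  (fun x => 2 * atan (e^-1 * x)) pi => //.
- by move=> x; rewrite divr_ge0 ?mulr_ge0 ?addr_ge0 ?sqr_ge0// ltW.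
- by move=> x; rewrite sqrrN.
- move=> x; rewrite [X in is_derive _ _ _ X](_ : _ = 2 * ((1 + (e^-1 * x) ^+ 2)^-1 * e^-1)).
    exact: dZ (dcomp (is_derive1_atan _) (dlin _ _)).
  have e1 : 1 + (e^-1 * x) ^+ 2 != 0 by rewrite gt_eqF// ltr_wpDr ?sqr_ge0.
  by field; rewrite e2 gt_eqF//=; apply: contra_neq (e2 x) => h; rewrite -h; ring.
- rewrite [X in _ --> X](_ : _ = 2 * (pi / 2)); last by field.
  apply: cvgM; first exact: cvg_cst.
  apply: (@cvg_comp _ _ _ (fun x => e^-1 * x) atan _ +oo); last exact: cvgy_atan.
  by apply: gt0_cvgMry; rewrite ?invr_gt0//; exact: cvg_id.
by move=> i ->; rewrite mulr0 atan0 mulr0 subr0.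
Qed.

End abel_kernel.

(** * The Hartley transform on L^1 *)

Section hartley_L1.
Context {R : realType}.
Implicit Types f g h : R -> R.

Definition cas (t : R) := cos t + sin t.

Lemma cas_bnd t : `|cas t| <= 2.
Proof.
by rewrite -[2]/(1 + 1) /cas (le_trans (ler_normD _ _))// lerD ?cos_max ?sin_max.
Qed.

Lemma cas_mul a b : cas a * cas b = cos (a - b) + sin (a + b).
Proof. by rewrite /cas cosB sinD; ring. Qed.

Lemma mf_cas d (T : measurableType d) (f : T -> R) :
  measurable_fun setT f -> measurable_fun setT (fun x => cas (f x)).
Proof. by move=> mf; rewrite /cas; mf_tac. Qed.

Definition kap : R := (Num.sqrt (2 * pi))^-1.

Lemma kap_gt0 : 0 < kap.
Proof. by rewrite invr_gt0 sqrtr_gt0 mulr_gt0// pi_gt0. Qed.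

Lemma kap_sqr : kap ^+ 2 * (2 * pi) = 1.
Proof.
by rewrite exprVn sqr_sqrtr ?mulr_ge0 ?pi_ge0// mulVf// gt_eqF// mulr_gt0// pi_gt0.
Qed.

(** Since [|cas| <= 2], this makes the sup norm of the transform at most the L^1 norm. It amounts to
    [2 <= pi]. *)
Lemma kap_le : kap * 2 <= 1.
Proof.
have k0 := kap_gt0; have k2 := kap_sqr; have p2 := pi_ge2 R.
have : (kap * 2) ^+ 2 <= 1 ^+ 2.
  rewrite expr1n exprMn -[X in _ <= X]k2 ler_wpM2l ?sqr_ge0//.
  by rewrite expr2 ler_wpM2l.
by rewrite ler_pXn2r ?nnegrE ?mulr_ge0 ?(ltW k0).
Qed.

Definition hart1 f (xi : R) : R := kap * J (fun x => f x * cas (x * xi)).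

Lemma hart1_itg f xi : itg f -> itg (fun x => f x * cas (x * xi)).
Proof.
move=> itf; apply: itg_le (itgZ 2 (itg_norm itf)).
  by apply: mfM; [exact: itg_mf|apply: mf_cas; mf_tac].
by move=> x; rewrite normrM mulrC ler_wpM2r// cas_bnd.
Qed.

Lemma hart1_bnd f xi : itg f -> `|hart1 f xi| <= J (fun x => `|f x|).
Proof.
move=> itf; have k0 := kap_gt0.
rewrite /hart1 normrM gtr0_norm//.
apply: (@le_trans _ _ (kap * J (fun x => 2 * `|f x|))).
  rewrite ler_wpM2l ?(ltW k0)//; apply: le_trans (J_norm (hart1_itg xi itf)) _.
  apply: J_le; [by apply: itg_norm; exact: hart1_itg|by apply: itgZ; exact: itg_norm|].
  by move=> x; rewrite normrM mulrC ler_wpM2r// cas_bnd.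
rewrite JZ; last exact: itg_norm.
by rewrite mulrA ler_piMl ?kap_le// J_ge0.
Qed.

Lemma mf_hart1 f : itg f -> measurable_fun setT (hart1 f).
Proof.
move=> itf; have mf := itg_mf itf.
have mf2 : measurable_fun setT (fun z : R * R => f z.2).
  by apply: measurableT_comp mf _; mf_tac.
(* Adding [2 * |f x|] makes the integrand nonnegative, as the measurability part of Tonelli's
   theorem requires; its integral is subtracted again below. *)
pose G (xi : R) := fine (\int[leb R]_x (f x * cas (x * xi) + 2 * `|f x|)%:E)%E.
have mG : measurable_fun setT G.
  apply: measurableT_comp => //.
  apply: (@measurable_fun_fubini_tonelli_F _ _ _ _ R (leb R)
    (fun z : R * R => (f z.2 * cas (z.2 * z.1) + 2 * `|f z.2|)%:E)%E).
    apply/measurable_EFinP; apply: mfD; last by mf_tac.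
    by apply: mfM => //; apply: mf_cas; mf_tac.
  move=> z; rewrite lee_fin -lerBlDr sub0r.
  have : `|f z.2 * cas (z.2 * z.1)| <= 2 * `|f z.2|.
    by rewrite normrM mulrC ler_wpM2r// cas_bnd.
  by rewrite ler_norml => /andP[].
rewrite (_ : hart1 f = (fun xi => kap * (G xi - 2 * J (fun x => `|f x|)))); first by mf_tac.
apply/funext => xi; rewrite /hart1 /G -/(Rintegral (leb R) setT _); congr (_ * _).
rewrite (JD (hart1_itg xi itf) (itgZ 2 (itg_norm itf))) (JZ _ (itg_norm itf)); ring.
Qed.

(* The Hartley kernel is symmetric, so that the transform is selfadjoint. *)
Lemma hart1_adj f g : itg f -> itg g ->
  J (fun xi => hart1 f xi * g xi) = J (fun x => f x * hart1 g x).
Proof.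
move=> itf itg_.
have mf := itg_mf itf; have mg := itg_mf itg_.
have mf2 : measurable_fun setT (fun z : R * R => f z.2).
  by apply: measurableT_comp mf _; mf_tac.
have mg2 : measurable_fun setT (fun z : R * R => g z.1).
  by apply: measurableT_comp mg _; mf_tac.
have [] := @J_fubini R (fun z => f z.2 * cas (z.2 * z.1) * g z.1)
  (fun xi => 2 * `|g xi|) (fun x => `|f x|).
- by apply: mfM => //; apply: mfM => //; apply: mf_cas; mf_tac.
- exact: itgZ (itg_norm itg_).
- exact: itg_norm.
- move=> xi x /=; rewrite !normrM [X in _ <= X](_ : _ = `|f x| * 2 * `|g xi|); last by ring.
  by rewrite ler_wpM2r// ler_wpM2l// cas_bnd.
move=> /= i1 i2 e.
have -> : (fun xi => hart1 f xi * g xi) =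
    (fun xi => kap * J (fun x => f x * cas (x * xi) * g xi)).
  apply/funext => xi; rewrite /hart1 -mulrA; congr (_ * _).
  rewrite mulrC -JZ; last exact: hart1_itg.
  by congr Rintegral; apply/funext => x; rewrite mulrC.
have -> : (fun x => f x * hart1 g x) =
    (fun x => kap * J (fun xi => f x * cas (x * xi) * g xi)).
  apply/funext => x; rewrite /hart1 mulrCA; congr (_ * _).
  rewrite -JZ; last exact: hart1_itg.
  by congr Rintegral; apply/funext => xi; rewrite [xi * x]mulrC; ring.
by rewrite (JZ _ i1) (JZ _ i2) e.
Qed.

Lemma hart1_ae f g xi : measurable_fun setT f -> measurable_fun setT g ->
  ae (fun x => f x = g x) -> hart1 f xi = hart1 g xi.
Proof.
move=> mf mg fg; congr (_ * _); apply: J_ae.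
- by apply: mfM => //; apply: mf_cas; mf_tac.
- by apply: mfM => //; apply: mf_cas; mf_tac.
- by apply: ae_mono fg => x ->.
Qed.

Lemma hart1D f g xi : itg f -> itg g ->
  hart1 (fun x => f x + g x) xi = hart1 f xi + hart1 g xi.
Proof.
move=> hf hg; rewrite /hart1 -mulrDr -JD; [|exact: hart1_itg|exact: hart1_itg].
by congr (_ * _); congr Rintegral; apply/funext => x; rewrite mulrDl.
Qed.

Lemma hart1Z c f xi : itg f -> hart1 (fun x => c * f x) xi = c * hart1 f xi.
Proof.
move=> hf; rewrite /hart1 mulrCA -(JZ c (hart1_itg xi hf)).
by congr (_ * _); congr Rintegral; apply/funext => x; rewrite mulrA.
Qed.

Lemma hart1B f g xi : itg f -> itg g ->
  hart1 (fun x => f x - g x) xi = hart1 f xi - hart1 g xi.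
Proof.
move=> hf hg; rewrite -[- hart1 g xi]mulN1r -hart1Z// -hart1D//; last exact: itgZ.
by congr hart1; apply/funext => x; rewrite mulN1r.
Qed.

Lemma hart1_cos f d xi : itg f ->
  hart1 (fun x => cos (d * x) * f x) xi = 2^-1 * (hart1 f (xi + d) + hart1 f (xi - d)).
Proof.
move=> hf; rewrite /hart1 -mulrDr mulrCA; congr (_ * _).
rewrite -JD; [|exact: hart1_itg|exact: hart1_itg].
rewrite -JZ; last by apply: itgD; exact: hart1_itg.
congr Rintegral; apply/funext => x; rewrite -mulrDr mulrCA [cos _ * _]mulrC -mulrA; congr (_ * _).
rewrite [x * (xi + d)](_ : _ = x * xi + d * x); last by ring.
rewrite [x * (xi - d)](_ : _ = x * xi - d * x); last by ring.
by rewrite /cas cosB sinB cosD sinD; field.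
Qed.

Lemma hart1_sin f d xi : itg f ->
  hart1 (fun x => sin (d * x) * f x) xi = 2^-1 * (hart1 f (d - xi) - hart1 f (- xi - d)).
Proof.
move=> hf; rewrite /hart1 -mulrBr mulrCA; congr (_ * _).
rewrite -JB; [|exact: hart1_itg|exact: hart1_itg].
rewrite -JZ; last by apply: itgB; exact: hart1_itg.
congr Rintegral; apply/funext => x; rewrite -mulrBr mulrCA [sin _ * _]mulrC -mulrA; congr (_ * _).
rewrite [x * (d - xi)](_ : _ = - (x * xi - d * x)); last by ring.
rewrite [x * (- xi - d)](_ : _ = - (x * xi + d * x)); last by ring.
by rewrite /cas !cosN !sinN cosB sinB cosD sinD; field.
Qed.

Lemma hart1_shift f d xi : itg f ->
  hart1 (fun x => f (x + d)) xi = cos (d * xi) * hart1 f xi - sin (d * xi) * hart1 f (- xi).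
Proof.
move=> hf; rewrite /hart1 mulrCA [sin _ * _]mulrCA -mulrBr; congr (_ * _).
have i1 : itg (fun x => cos (d * xi) * (f x * cas (x * xi))) by apply: itgZ; exact: hart1_itg.
have i2 : itg (fun x => sin (d * xi) * (f x * cas (x * - xi))) by apply: itgZ; exact: hart1_itg.
rewrite -JZ; last exact: hart1_itg.
rewrite -JZ; last exact: hart1_itg.
rewrite -JB// -[RHS](J_rigid (rigid_add d)); last exact: itgB.
congr Rintegral; apply/funext => x /=.
rewrite [x * xi](_ : _ = (x + d) * xi - d * xi); last by ring.
rewrite !mulrN /cas cosN sinN cosB sinB; ring.
Qed.

End hartley_L1.

(** * Plancherel's inequality on integrable functions *)

Section plancherel.
Context {R : realType}.
Implicit Types f g h : R -> R.

Definition poisson (e x : R) : R := 2 * e / (e ^+ 2 + x ^+ 2).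

Lemma poisson_ge0 e x : 0 <= e -> 0 <= poisson e x.
Proof. by move=> e0; rewrite divr_ge0 ?mulr_ge0 ?addr_ge0 ?sqr_ge0. Qed.

Lemma poisson_le (e x : R) : 0 < e -> poisson e x <= 2 / e.
Proof.
move=> e0; rewrite /poisson ler_pdivrMr; last by rewrite ltr_wpDr ?sqr_ge0 ?exprn_gt0.
have h : 0 <= 2 / e * x ^+ 2 by rewrite mulr_ge0 ?sqr_ge0 ?divr_ge0 ?(ltW e0).
have -> : 2 / e * (e ^+ 2 + x ^+ 2) = 2 * e + 2 / e * x ^+ 2 by field; rewrite gt_eqF.
by rewrite lerDl.
Qed.

Lemma poisson_itg e : 0 < e -> itg (poisson e).
Proof. by move=> e0; have [] := poisson_integral e0. Qed.

Lemma J_poisson e : 0 < e -> J (poisson e) = 2 * pi.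
Proof. by move=> e0; have [] := poisson_integral e0. Qed.

Lemma poisson_L2 e : 0 < e -> isL2 (poisson e).
Proof.
move=> e0; have mp := itg_mf (poisson_itg e0); split => //.
apply: itg_le (itgZ (2 / e) (poisson_itg e0)); first by mf_tac.
move=> x; have p0 := poisson_ge0 x (ltW e0).
by rewrite ger0_norm ?sqr_ge0// expr2 ler_wpM2r// poisson_le.
Qed.

Lemma expabs_hart1_itg e f : 0 < e -> itg f -> itg (fun xi => expabs e xi * hart1 f xi).
Proof.
move=> e0 hf; apply: itg_le (itgZ (J (fun x => `|f x|)) (expabs_integral e0).1).
  apply: mfM; last exact: mf_hart1.
  by apply: continuous_measurable_fun; exact: continuous_expabs.
move=> x; rewrite normrM mulrC (ger0_norm (expabs_ge0 e x)).
by rewrite ler_wpM2r ?expabs_ge0 ?hart1_bnd.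
Qed.

(** By [cas_mul] the product of kernels is a cosine plus a sine. The sine is odd and drops out
    against the even factor; the cosine gives the Poisson kernel. *)
Lemma hart1_expabs e y x : 0 < e ->
  hart1 (fun xi => expabs e xi * cas (xi * y)) x = kap * poisson e (y - x).
Proof.
move=> e0; congr (_ * _); have [ie _] := expabs_integral e0.
have me : measurable_fun setT (expabs e) by exact: itg_mf.
have isin : itg (fun xi => expabs e xi * sin (xi * (y + x))).
  apply: itg_le ie; first by mf_tac.
  by move=> t; rewrite normrM ger0_norm ?expabs_ge0// ler_piMr ?expabs_ge0 ?sin_max.
rewrite (_ : (fun t => _) = (fun xi => expabs e xi * cos ((y - x) * xi) +
   expabs e xi * sin (xi * (y + x)))); last first.
  apply/funext => t; rewrite -mulrA cas_mul -mulrDr.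
  by rewrite [(y - x) * t]mulrC !mulrBr !mulrDr.
rewrite (JD (expabs_cos_itg _ e0) isin) expabs_cos// (J_odd _ isin) ?addr0//.
by move=> t; rewrite expabsN mulNr sinN mulrN.
Qed.

(** Selfadjointness, used twice, moves both transforms off [f] and onto [expabs e]. Both halves of
    Plancherel's theorem start from this identity: Young bounds its right-hand side from above, and
    the approximate identity bounds it from below. *)
Lemma hart1_energy (e : R) f : 0 < e -> itg f ->
  itg (fun y => f y * conv (poisson e) f y) /\
  J (fun xi => expabs e xi * hart1 f xi ^+ 2) =
  kap ^+ 2 * J (fun y => f y * conv (poisson e) f y).
Proof.
move=> e0 hf; have [ie _] := expabs_integral e0.
have ig := expabs_hart1_itg e0 hf.
have icas y : itg (fun xi => expabs e xi * cas (xi * y)) := hart1_itg y ie.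
rewrite [X in _ /\ Rintegral _ _ X = _](_ : _ =
    (fun xi => hart1 f xi * (expabs e xi * hart1 f xi))); last first.
  by apply/funext => t; ring.
rewrite (hart1_adj hf ig).
have E y : hart1 (fun xi => expabs e xi * hart1 f xi) y = kap ^+ 2 * conv (poisson e) f y.
  rewrite expr2 -mulrA {1}/hart1; congr (_ * _).
  rewrite (_ : (fun x => _) = (fun xi => hart1 f xi * (expabs e xi * cas (xi * y)))); last first.
    by apply/funext => t; ring.
  rewrite (hart1_adj hf (icas y)).
  rewrite [X in Rintegral _ _ X](_ : _ = (fun x => kap * (f x * poisson e (y - x)))); last first.
    by apply/funext => t; rewrite hart1_expabs//; ring.
  have ip : itg (fun x => f x * poisson e (y - x)).
    apply: itg_le (itgZ (2 / e) (itg_norm hf)).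
      apply: mfM; first exact: itg_mf.
      by apply: itg_mf; apply: (itg_rigid (rigid_subl y)); exact: poisson_itg.
    move=> x; rewrite normrM mulrC ler_wpM2r// ger0_norm ?poisson_ge0 ?(ltW e0)//.
    exact: poisson_le.
  rewrite JZ//; congr (_ * _); rewrite -(J_rigid (rigid_subl y) ip).
  by congr Rintegral; apply/funext => x; rewrite mulrC; congr (poisson _ _ * _); ring.
have ic : itg (fun y => f y * hart1 (fun xi => expabs e xi * hart1 f xi) y).
  apply: itg_le (itgZ (J (fun xi => `|expabs e xi * hart1 f xi|)) (itg_norm hf)).
    by apply: mfM; [exact: itg_mf|exact: mf_hart1].
  by move=> y; rewrite normrM mulrC ler_wpM2r// hart1_bnd.
have ic' : itg (fun y => kap ^+ 2 * (f y * conv (poisson e) f y)).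
  by apply: itg_ext ic => y; rewrite E; ring.
have ic2 : itg (fun y => f y * conv (poisson e) f y).
  apply: itg_ext (itgZ (kap ^- 2) ic') => y /=; rewrite mulKf// expf_neq0// gt_eqF//.
  exact: kap_gt0.
split; first exact: ic2.
by rewrite -(JZ _ ic2); congr Rintegral; apply/funext => y; rewrite E mulrCA.
Qed.

(* Young's inequality with the Poisson kernel, then [e --> 0] by Fatou. *)
Lemma hart1_contract f : itg f -> isL2 f -> isL2 (hart1 f) /\ nrm (hart1 f) <= nrm f.
Proof.
move=> hf hf2.
have mh := mf_hart1 hf.
have B (e : R) : 0 < e -> J (fun xi => expabs e xi * hart1 f xi ^+ 2) <= nrm f ^+ 2.
  move=> e0; have [fi ->] := hart1_energy e0 hf.
  have [hc nc] := young (fun x => poisson_ge0 x (ltW e0)) (fun x => normr_ge0 (f x))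
    (poisson_itg e0) (poisson_L2 e0) (isL2_norm hf2).
  rewrite nrm_norm J_poisson// in nc.
  have H : J (fun y => f y * conv (poisson e) f y) <= nrm f * (2 * pi * nrm f).
    have ip_ x : itg (fun y => poisson e y * f (x - y)).
      by apply: itgM; [exact: poisson_L2|exact: (isL2_rigid (rigid_subl x))].
    apply: le_trans (ler_norm _) _.
    have P : ip (fun y => `|f y|) (conv (poisson e) (fun y => `|f y|)) <= nrm f * (2 * pi * nrm f).
      apply: le_trans (ler_norm _) _; apply: le_trans (ip_le (isL2_norm hf2) hc) _.
      by rewrite nrm_norm ler_wpM2l ?nrm_ge0.
    apply: le_trans P; apply: le_trans (J_norm fi) _; apply: J_le.
    - exact: itg_norm.
    - by apply: itgM => //; exact: isL2_norm.
    - move=> y; rewrite normrM ler_wpM2l//.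
      apply: le_trans (J_norm (ip_ y)) _; apply: J_le; first exact: itg_norm.
        by apply: itgM; [exact: poisson_L2|apply: isL2_norm; exact: (isL2_rigid (rigid_subl y))].
      by move=> x; rewrite normrM (ger0_norm (poisson_ge0 x (ltW e0))).
  apply: le_trans (ler_wpM2l _ H) _; first exact: sqr_ge0.
  have -> : kap ^+ 2 * (nrm f * (2 * pi * nrm f)) = kap ^+ 2 * (2 * pi) * nrm f ^+ 2.
    by rewrite expr2; ring.
  by rewrite kap_sqr mul1r.
pose E n : R := n.+1%:R^-1.
have E0 n : 0 < E n by rewrite invr_gt0.
(* The exponent is halved because the norm squares the factor. *)
have sq n xi : (expabs (E n / 2) xi * hart1 f xi) ^+ 2 = expabs (E n) xi * hart1 f xi ^+ 2.
  by rewrite exprMn; congr (_ * _); rewrite /expabs expr2 -expRD; congr expR; field.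
have h2 n : isL2 (fun xi => expabs (E n / 2) xi * hart1 f xi).
  split.
    by apply: mfM => //; apply: continuous_measurable_fun; exact: continuous_expabs.
  apply: itg_le (itgZ (J (fun x => `|f x|) ^+ 2) (expabs_integral (E0 n)).1).
    apply: mfX; apply: mfM => //.
    by apply: continuous_measurable_fun; exact: continuous_expabs.
  move=> xi; rewrite ger0_norm ?sqr_ge0// sq mulrC ler_wpM2r ?expabs_ge0//.
  rewrite -(real_normK (num_real (hart1 f xi))) ler_pXn2r ?nnegrE ?J_ge0//.
  exact: hart1_bnd.
apply: (@nrm_fatou _ (fun n xi => expabs (E n / 2) xi * hart1 f xi)) => //.
- exact: nrm_ge0.
- move=> n; apply: nrm_le_sqr; first exact: nrm_ge0.
  by under [fun xi => _]funext => xi do rewrite sq; exact: B.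
- apply: ae_all => xi; rewrite -[X in _ --> X]mul1r; apply: cvgM; last exact: cvg_cst.
  have cE : cts (fun t => expR (- (t * (2^-1 * `|xi|)))) by cts_tac.
  have e1 : expR (- (0 * (2^-1 * `|xi|))) = 1 by rewrite mul0r oppr0 expR0.
  rewrite -[X in _ --> X]e1 /expabs.
  under eq_fun do rewrite -mulrA.
  exact: (cvg_comp _ _ (@cvg_harmonic R) (cE 0)).
Qed.

End plancherel.

(** * Density of bounded continuous integrable functions in L^2 *)

Section density.
Context {R : realType}.
Implicit Types f g h : R -> R.

Definition clip (M t : R) := Num.max (- M) (Num.min M t).

Lemma clip_bnd (M t : R) : 0 <= M -> `|clip M t| <= M.
Proof.
move=> M0; rewrite ler_norml /clip le_max lexx /= ge_max.
by rewrite ge_min lexx andbT; lra.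
Qed.

Lemma clip_lip M s t : `|s| <= M -> `|s - clip M t| <= `|s - t|.
Proof.
rewrite ler_norml => /andP[h1 h2]; rewrite /clip.
have [h|h] := leP M t; last first.
  have [h3|h3] := leP (- M) t => //.
  by rewrite ger0_norm ?subr_ge0 ?(le_trans _ h1)// ger0_norm; lra.
have M0 : - M <= M by lra.
by rewrite (max_idPr M0) ler0_norm ?subr_le0// ler0_norm; lra.
Qed.

Lemma cts_max (u v : R -> R) : cts u -> cts v -> cts (fun x => Num.max (u x) (v x)).
Proof. by move=> cu cv x; exact: (@continuous_max _ _ u v x (cu x) (cv x)). Qed.

Lemma cts_min (u v : R -> R) : cts u -> cts v -> cts (fun x => Num.min (u x) (v x)).
Proof. by move=> cu cv x; exact: (@continuous_min _ _ u v x (cu x) (cv x)). Qed.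

Definition bump (N x : R) := clip 1 (Num.max 0 (N + 1 - `|x|)).

Lemma bump_ge0 N x : 0 <= bump N x.
Proof. by rewrite /bump /clip le_max le_min ler01 le_max lexx orbT. Qed.

Lemma bump_le1 N x : bump N x <= 1.
Proof. by have := clip_bnd (Num.max 0 (N + 1 - `|x|)) ler01; rewrite ler_norml => /andP[]. Qed.

Lemma bump_in N x : `|x| <= N -> bump N x = 1.
Proof.
move=> h; rewrite /bump /clip.
have h1 : 1 <= N + 1 - `|x| by lra.
rewrite (max_idPr (le_trans ler01 h1)) (min_idPl h1).
by apply/max_idPr; lra.
Qed.

Lemma bump_out N x : N + 1 <= `|x| -> bump N x = 0.
Proof.
move=> h; rewrite /bump /clip.
have h1 : N + 1 - `|x| <= 0 by lra.
by rewrite (max_idPl h1) (min_idPr ler01); apply/max_idPr; rewrite lerN10.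
Qed.

Lemma cts_bump N : cts (bump N).
Proof.
apply: cts_max; first exact: cts_cst.
apply: cts_min; first exact: cts_cst.
by apply: cts_max; first exact: cts_cst; cts_tac.
Qed.

(* The regular functions on which Plancherel's identity is checked directly. *)
Definition nice g := [/\ cts g, exists M : R, forall x, `|g x| <= M & itg g].

Lemma itg_itv (N M : R) f : measurable_fun setT f -> (forall x, `|f x| <= M) ->
  (forall x, N < `|x| -> f x = 0) -> itg f.
Proof.
move=> mf fM f0.
have M0 : 0 <= M by apply: le_trans (fM 0).
have [N0|N0] := ltP N 0.
  apply: itg_ext itg0 => x; rewrite f0//; exact: lt_le_trans N0 _.
have i1 := @integrable_indic_itv R (- N) N true false.
apply: itg_le (itgZ M i1) => // x.
have [xN|xN] := ltP N `|x|; first by rewrite f0// normr0 mulr_ge0.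
by rewrite indicE mem_set ?mulr1//= in_itv/= -ler_norml.
Qed.

Lemma nice_L2 g : nice g -> isL2 g.
Proof.
move=> [cg [M gM] ig]; have mg : measurable_fun setT g by exact: continuous_measurable_fun.
split => //; apply: itg_le (itgZ M (itg_norm ig)); first by mf_tac.
by move=> x; rewrite ger0_norm ?sqr_ge0// -(real_normK (num_real (g x))) expr2 ler_wpM2r.
Qed.

Definition trunc (n : nat) f x : R := if (`|x| <= n%:R) && (`|f x| <= n%:R) then f x else 0.

Lemma trunc_le n f x : `|trunc n f x| <= `|f x|.
Proof. by rewrite /trunc; case: ifP => // _; rewrite normr0. Qed.

Lemma trunc_bnd n f x : `|trunc n f x| <= n%:R.
Proof. by rewrite /trunc; case: ifP => [/andP[]//|_]; rewrite normr0. Qed.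

Lemma trunc_out n f x : n%:R < `|x| -> trunc n f x = 0.
Proof. by rewrite /trunc ltNge => /negbTE ->. Qed.

Lemma mf_trunc n f : measurable_fun setT f -> measurable_fun setT (trunc n f).
Proof.
move=> mf; apply: measurable_fun_ifT => //.
apply: measurable_and; apply: measurable_fun_ler; by mf_tac.
Qed.

Lemma trunc_cvg f x : trunc n f x @[n --> \oo] --> f x.
Proof.
apply: cvg_near_cst.
have [n hn] : exists n : nat, `|x| + `|f x| <= n%:R.
  exists (Num.bound (`|x| + `|f x|)); apply/ltW/archi_boundP.
  by rewrite addr_ge0.
exists n => // m /= nm; rewrite /trunc ifT//.
have nm' : n%:R <= m%:R :> R by rewrite ler_nat.
have := normr_ge0 x; have := normr_ge0 (f x) => ? ?.
by apply/andP; split; lra.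
Qed.

Lemma trunc_itg n f : measurable_fun setT f -> itg (trunc n f).
Proof.
move=> mf; apply: (@itg_itv n%:R n%:R); first exact: mf_trunc.
  by move=> x; exact: trunc_bnd.
by move=> x; exact: trunc_out.
Qed.

Lemma trunc_L2 n f : isL2 f -> isL2 (trunc n f).
Proof. by move=> hf; apply: (isL2_le _ _ hf); [apply: mf_trunc; case: hf|exact: trunc_le]. Qed.

Lemma trunc_approx f (e : R) : isL2 f -> 0 < e -> exists n, nrm (fun x => f x - trunc n f x) <= e.
Proof.
move=> hf e0.
have := @nrm_dct _ (fun n => trunc n f) f (fun x => `|f x|).
move=> /(_ _ _ (isL2_norm hf)) H.
have {}H : nrm (fun x => trunc n f x - f x) @[n --> \oo] --> 0.
  apply: H.
  - by move=> n; apply: mf_trunc; case: hf.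
  - by case: hf.
  - by apply: ae_all => x; exact: trunc_cvg.
  - by move=> n x; exact: trunc_le.
  - by [].
have /cvgr0Pnorm_le /(_ e e0) [n _ /(_ n (leqnn n)) /=] := H.
by rewrite ger0_norm ?nrm_ge0// nrm_distC => h; exists n.
Qed.

(** Truncate [f], approximate the truncation in L^1 of an interval by a continuous function, then
    clip the values and cut off the support. As everything is bounded by [N], closeness in L^1
    becomes closeness in L^2 through [(F - g) ^+ 2 <= 2 * N * |F - g|]. *)
Lemma nice_dense f (e : R) : isL2 f -> 0 < e ->
  exists2 g, nice g & nrm (fun x => f x - g x) <= e.
Proof.
move=> hf e0; have e2 : 0 < e / 2 by rewrite divr_gt0.
have [n fn] := trunc_approx hf e2.
pose F := trunc n f; have mF : measurable_fun setT F by apply: mf_trunc; case: hf.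
have iF : itg F by apply: trunc_itg; case: hf.
have F2 : isL2 F := trunc_L2 n hf.
(* [F] lives on [|x| <= N]; the extra unit is where [bump N] descends to 0. *)
pose N : R := n%:R; pose E : set R := `[- (N + 1), N + 1]%classic.
have mE : measurable E by exact: measurable_itv.
have N0 : 0 <= N by rewrite ler0n.
have muE : (leb R E < +oo)%E by rewrite lebesgue_measure_itv/=; case: ifP => _; rewrite ?ltry// -EFinB ltry.
have iFE : (leb R).-integrable E (EFin \o F) by apply: integrableS iF.
have [g_ [cg ig H]] := approximation_continuous_integrable mE muE iFE.
have [d d0 hd] : exists2 d : R, 0 < d & 2 * N * d <= (e / 2) ^+ 2.
  exists ((e / 2) ^+ 2 / (2 * N + 1)); first by rewrite divr_gt0 ?exprn_gt0// ltr_wpDl ?mulr_ge0.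
  rewrite mulrCA ler_piMr ?sqr_ge0// ler_pdivrMr ?mul1r ?lerDl// ltr_wpDl ?mulr_ge0//.
have [k Hk] : exists k, (\int[leb R]_(z in E) `|(F z - g_ k z)%:E| <= d%:E)%E.
  have d0' : (0 < d%:E)%E by rewrite lte_fin.
  have /fine_cvgP[[k1 _ fin1] /cvgr0Pnorm_le /(_ d d0)[k2 _ h2]] := H.
  exists (maxn k1 k2); have := h2 (maxn k1 k2) (leq_maxr _ _) => /=.
  rewrite ger0_norm; last by apply: fine_ge0; exact: integral_ge0.
  by rewrite -lee_fin fineK//; apply: fin1 => /=; exact: leq_maxl.
pose g x := bump N x * clip N (g_ k x).
have cg' : cts g.
  apply: ctsM; first exact: cts_bump.
  by apply: cts_max; [exact: cts_cst|apply: cts_min; [exact: cts_cst|exact: cg]].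
have mg : measurable_fun setT g by exact: continuous_measurable_fun.
have gN x : `|g x| <= N.
  rewrite normrM ger0_norm ?bump_ge0// -[leRHS]mul1r.
  by rewrite ler_pM ?bump_ge0 ?bump_le1 ?clip_bnd.
have g0 x : N + 1 < `|x| -> g x = 0 by move=> h; rewrite /g bump_out ?mul0r// ltW.
have ig' : itg g := itg_itv mg gN g0.
have ng : nice g by split => //; exists N.
have g2 := nice_L2 ng.
exists g => //.
apply: le_trans (nrm_tri hf F2 g2) _; rewrite [e in _ <= e]splitr lerD//.
apply: nrm_le_sqr; first exact: ltW.
have P x : (F x - g x) ^+ 2 <= 2 * N * `|F x - g x|.
  rewrite -(real_normK (num_real (F x - g x))) expr2 ler_wpM2r//.
  by apply: le_trans (ler_normB _ _) _; have := gN x; have := trunc_bnd n f x; rewrite -/F -/N; lra.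
have iFg := itg_norm (itgB iF ig').
apply: le_trans (J_le (isL2_sq (isL2B F2 g2)) (itgZ (2 * N) iFg) P) _.
rewrite JZ//; apply: le_trans hd; rewrite ler_wpM2l ?mulr_ge0//.
rewrite -lee_fin -JE//; apply: le_trans Hk.
rewrite [leRHS]integral_mkcond.
apply: ge0_le_integral => //.
- by apply/measurable_EFinP; exact: itg_mf.
- apply/(measurable_restrictT _ mE); apply/measurable_EFinP/measurable_funTS.
  by apply: mf_norm; apply: mfB => //; exact: continuous_measurable_fun.
- move=> x _; rewrite /patch; case: ifPn => xE.
    rewrite lee_fin /g; have [xN|xN] := leP `|x| N.
      by rewrite bump_in// mul1r clip_lip// trunc_bnd.
    rewrite /F trunc_out// !sub0r !normrN normrM ger0_norm ?bump_ge0//.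
    have h : `|clip N (g_ k x)| <= `|g_ k x|.
      by have := @clip_lip N 0 (g_ k x); rewrite normr0 !sub0r !normrN; exact.
    by apply: le_trans h; rewrite ler_piMl ?bump_le1.
  have xN : N + 1 < `|x|.
    rewrite ltNge; apply: contra xE => h; rewrite inE /E /= in_itv/=.
    by rewrite -ler_norml.
  by rewrite g0// /F trunc_out ?subr0 ?normr0// (lt_trans _ xN)// ltrDl.
Qed.

End density.

(** * Plancherel's equality *)

Section plancherel_equality.
Context {R : realType}.
Implicit Types f g h : R -> R.

Definition autocorr f z := J (fun y => f y * f (y - z)).

Lemma autocorr_bnd f z : isL2 f -> `|autocorr f z| <= nrm f ^+ 2.
Proof.
move=> hf; have := ip_le hf (isL2_rigid (rigid_sub z) hf).
by rewrite (nrm_rigid (rigid_sub z) hf) expr2.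
Qed.

(** Continuity at 0 along a sequence that would contradict it, by dominated convergence: the
    integrand converges because [f] is continuous, and is dominated because [f] is bounded and
    integrable. *)
Lemma autocorr_cts f (e : R) : nice f -> 0 < e ->
  exists2 d : R, 0 < d & forall z, `|z| < d -> `|autocorr f z - nrm f ^+ 2| <= e.
Proof.
move=> nf e0; have hf := nice_L2 nf; have [cf [M fM] itf] := nf.
apply: contrapT => H.
have {}H (n : nat) : exists z : R, `|z| < n.+1%:R^-1 /\ ~ `|autocorr f z - nrm f ^+ 2| <= e.
  apply: contrapT => H2; apply: H; exists n.+1%:R^-1; first by rewrite invr_gt0.
  by move=> z hz; apply: contrapT => h; apply: H2; exists z.
have [z hz] := choice H.
have z0 : z n @[n --> \oo] --> 0.
  apply/cvgr0Pnorm_le => d d0.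
  have /cvgr0Pnorm_le /(_ d d0) := @cvg_harmonic R.
  apply: filterS => n; rewrite ger0_norm ?invr_ge0// => h.
  exact: le_trans (ltW (hz n).1) h.
have [] := @J_dct _ (fun n y => f y * f (y - z n)) (fun y => f y * f y) (fun y => M * `|f y|).
- move=> n; apply: mfM; first by case: hf.
  by apply: isL2_mf; exact: (isL2_rigid (rigid_sub (z n))).
- by have ? := isL2_mf hf; mf_tac.
- by apply: itgZ; exact: itg_norm.
- apply: ae_all => y; apply: cvgM; first exact: cvg_cst.
  have cy : y - z n @[n --> \oo] --> y.
    by rewrite -[X in _ --> X]subr0; apply: cvgB => //; exact: cvg_cst.
  exact: (cvg_comp _ _ cy (cf y)).
- by move=> n y; rewrite normrM mulrC ler_wpM2r.
move=> _ /cvgrPdist_le /(_ e e0) [n _ /(_ n (leqnn n)) /=].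
by rewrite -/(ip f f) -nrm_ip distrC; exact: (hz n).2.
Qed.

Lemma poisson_autocorr (e : R) f : 0 < e -> nice f ->
  itg (fun z => poisson e z * autocorr f z) /\
  J (fun y => f y * conv (poisson e) f y) = J (fun z => poisson e z * autocorr f z).
Proof.
move=> e0 nf; have hf := nice_L2 nf; have [cf [M fM] itf] := nf.
have mp := itg_mf (poisson_itg e0).
have ms (u : R * R -> R) (v : R -> R) : measurable_fun setT u -> measurable_fun setT v ->
   measurable_fun setT (fun w => v (u w)) by move=> ? ?; exact: measurableT_comp.
have mf := isL2_mf hf.
have [] := @J_fubini R (fun w => f w.1 * (poisson e w.2 * f (w.1 - w.2)))
  (fun y => M * `|f y|) (poisson e).
- apply: mfM; first by apply: ms => //; mf_tac.
  by apply: mfM; apply: ms => //; mf_tac.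
- by apply: itgZ; exact: itg_norm.
- exact: poisson_itg.
- move=> y z /=; rewrite normrM [ `|poisson e z * _|]normrM (ger0_norm (poisson_ge0 z (ltW e0))) mulrCA mulrC.
  by rewrite ler_wpM2r ?poisson_ge0 ?(ltW e0)// mulrC ler_wpM2r.
move=> /= i1 i2 e12.
have E z : J (fun x => f x * (poisson e z * f (x - z))) = poisson e z * autocorr f z.
  rewrite -JZ; last by apply: itgM => //; exact: (isL2_rigid (rigid_sub z)).
  by congr Rintegral; apply/funext => x; rewrite mulrCA.
have E2 y : J (fun z => f y * (poisson e z * f (y - z))) = f y * conv (poisson e) f y.
  rewrite JZ//; apply: itgM; first exact: poisson_L2.
  exact: (isL2_rigid (rigid_subl y)).
split; first by apply: itg_ext i2 => z; rewrite E.
have -> : (fun y => f y * conv (poisson e) f y) =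
  (fun y => J (fun z => f y * (poisson e z * f (y - z)))) by apply/funext => y; rewrite E2.
by rewrite e12; congr Rintegral; apply/funext => z; rewrite E.
Qed.

Lemma poisson_1 : itg (poisson 1 : R -> R). Proof. exact: poisson_itg. Qed.

(* Away from [|z| < d] the Poisson kernel is O(e / (1 + z^2)). *)
Lemma poisson_approx f (eta : R) : nice f -> 0 < eta -> exists2 e : R, 0 < e &
  nrm f ^+ 2 - eta <= kap ^+ 2 * J (fun z => poisson e z * autocorr f z).
Proof.
move=> nf eta0; have hf := nice_L2 nf.
have eta2 : 0 < eta / 2 by rewrite divr_gt0.
have [d d0 hd] := autocorr_cts nf eta2.
(* For [d <= |z|], the kernel is at most [e * (1 + d ^- 2)] times [poisson 1], and [autocorr f z]
   lies within [2 * nrm f ^+ 2] of [nrm f ^+ 2]. *)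
pose K : R := 2 * nrm f ^+ 2 * (1 + d ^- 2).
have d20 : 0 <= d ^- 2 by rewrite invr_ge0 sqr_ge0.
have K0 : 0 <= K by apply: mulr_ge0; [apply: mulr_ge0 => //; exact: sqr_ge0|exact: addr_ge0].
have [e e0 he] : exists2 e : R, 0 < e & e * K <= eta / 2.
  exists (eta / 2 / (K + 1)); first by rewrite divr_gt0// ltr_wpDl.
  by rewrite mulrAC ler_pdivrMr ?ltr_wpDl// ler_wpM2l ?lerDl// ltW.
exists e => //.
have [ia _] := poisson_autocorr e0 nf.
have ip := poisson_itg e0.
have k1 := @kap_sqr R; have k0 : 0 <= kap ^+ 2 :> R by exact: sqr_ge0.
have P z : poisson e z * autocorr f z >=
    (nrm f ^+ 2 - eta / 2) * poisson e z - e * K * poisson 1 z.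
  have p0 := poisson_ge0 z (ltW e0); have p1 := poisson_ge0 z (@ler01 R).
  have [hz|hz] := ltP `|z| d.
    have := hd z hz; rewrite ler_norml => /andP[h _].
    have q0 : 0 <= e * K * poisson 1 z by rewrite mulr_ge0// mulr_ge0// ltW.
    have : (nrm f ^+ 2 - eta / 2) * poisson e z <= poisson e z * autocorr f z.
      by rewrite mulrC ler_wpM2l//; lra.
    lra.
  have := autocorr_bnd z hf; rewrite ler_norml => /andP[h _].
  have h1 : - (poisson e z * nrm f ^+ 2) <= poisson e z * autocorr f z.
    by rewrite -mulrN ler_wpM2l.
  have h2 : 2 * nrm f ^+ 2 * poisson e z <= e * K * poisson 1 z.
    rewrite [X in _ <= X](_ : _ = 2 * nrm f ^+ 2 * (e * (1 + d ^- 2) * poisson 1 z)); last first.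
      by rewrite /K; ring.
    apply: ler_wpM2l; first by apply: mulr_ge0 => //; exact: sqr_ge0.
    have z2 : 0 < z ^+ 2 by rewrite -(real_normK (num_real z)) exprn_gt0// (lt_le_trans d0).
    have dz : 1 <= d ^- 2 * z ^+ 2.
      rewrite -(real_normK (num_real z)) mulrC ler_pdivlMr ?exprn_gt0// mul1r.
      by rewrite ler_pXn2r ?nnegrE ?(ltW d0).
    rewrite /poisson expr1n mulr1 ler_pdivrMr; last by rewrite ltr_wpDl ?sqr_ge0.
    rewrite [X in _ <= X](_ : _ = 2 * e * ((1 + d ^- 2) * (e ^+ 2 + z ^+ 2) / (1 + z ^+ 2))); last by ring.
    rewrite ler_peMr ?mulr_ge0 ?(ltW e0)// ler_pdivlMr ?mul1r; last by rewrite ltr_wpDr ?sqr_ge0.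
    have e20 := sqr_ge0 e; have : 0 <= d ^- 2 * e ^+ 2 by rewrite mulr_ge0.
    lra.
  have h3 : 0 <= eta / 2 * poisson e z by rewrite mulr_ge0// ltW.
  lra.
have I1 : itg (fun z => (nrm f ^+ 2 - eta / 2) * poisson e z - e * K * poisson 1 z).
  by apply: itgB; [exact: itgZ|exact: itgZ poisson_1].
apply: le_trans (ler_wpM2l k0 (J_le I1 ia P)).
rewrite (JB (itgZ _ ip) (itgZ _ poisson_1)) (JZ _ ip) (JZ _ poisson_1) J_poisson// J_poisson//.
have -> : kap ^+ 2 * ((nrm f ^+ 2 - eta / 2) * (2 * pi) - e * K * (2 * pi)) =
  (kap ^+ 2 * (2 * pi)) * (nrm f ^+ 2 - eta / 2 - e * K) by ring.
rewrite k1; nlra.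
Qed.

(** The inequality missing from [hart1_contract]: as [expabs e <= 1], the norm dominates the
    regularized energy, which is at least [nrm f ^+ 2 - eta] for a suitable [e]. *)
Lemma nice_hart1 f : nice f -> nrm (hart1 f) = nrm f.
Proof.
move=> nf; have hf := nice_L2 nf; have [cf [M fM] itf] := nf.
have [h2 hle] := hart1_contract itf hf.
apply/eqP; rewrite eq_le hle /=.
rewrite -(ler_pXn2r (ltn0Sn 1)) ?nnegrE ?nrm_ge0//.
apply/ler_addgt0Pr => eta eta0.
have [e e0 he] := poisson_approx nf eta0.
rewrite -lerBlDr; apply: le_trans he _.
have [_ <-] := poisson_autocorr e0 nf.
have [_ <-] := hart1_energy e0 itf.
have [ie _] := expabs_integral e0.
rewrite nrm_sqr; apply: J_le; last first.
- by move=> xi; apply: ler_piMl; [exact: sqr_ge0|exact: expabs_le1 (ltW e0)].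
- exact: isL2_sq.
- apply: itg_le (isL2_sq h2).
    apply: mfM; first exact: itg_mf ie.
    by apply: mfX; exact: mf_hart1.
  move=> xi; rewrite normrM (ger0_norm (expabs_ge0 e xi)) (ger0_norm (sqr_ge0 _)).
  by apply: ler_piMl; [exact: sqr_ge0|exact: expabs_le1 (ltW e0)].
Qed.

Lemma hart1_L2 f : itg f -> isL2 f -> isL2 (hart1 f).
Proof. by move=> itf hf; have [] := hart1_contract itf hf. Qed.

Lemma hart1_sub_le f g : itg f -> isL2 f -> itg g -> isL2 g ->
  nrm (fun xi => hart1 f xi - hart1 g xi) <= nrm (fun x => f x - g x).
Proof.
move=> itf hf ig hg.
rewrite (@nrm_ext _ _ (hart1 (fun x => f x - g x))).
  by have [] := hart1_contract (itgB itf ig) (isL2B hf hg).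
by move=> xi; rewrite hart1B.
Qed.

Lemma hart1_isom f : itg f -> isL2 f -> nrm (hart1 f) = nrm f.
Proof.
move=> itf hf; have [h2 hle] := hart1_contract itf hf.
apply/eqP; rewrite eq_le hle /=.
apply/ler_addgt0Pr => e e0; have e2 : 0 < e / 2 by rewrite divr_gt0.
have [g ng fg] := nice_dense hf e2; have hg := nice_L2 ng; have [_ _ ig] := ng.
have h1 := hart1_sub_le itf hf ig hg.
have h3 := nrm_rtri hf hg; have h4 := nrm_rtri h2 (hart1_L2 ig hg).
rewrite (nice_hart1 ng) in h4.
rewrite distrC in h4.
have := le_trans (ler_norm _) h3; have := le_trans (ler_norm _) h4 => ? ?; nlra.
Qed.

End plancherel_equality.

(** * Extension of the Hartley transform to L^2 *)

Section hartley_L2.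
Context {R : realType}.
Implicit Types f g h : R -> R.

(** The closure of the graph of [hart1] in the square of L^2, described with epsilons instead of
    sequences so that approximations can be added and scaled directly. *)
Definition is_hart f h := [/\ isL2 f, isL2 h & forall e : R, 0 < e ->
  exists g, [/\ itg g, isL2 g, nrm (fun x => f x - g x) <= e &
                nrm (fun x => h x - hart1 g x) <= e]].

Lemma le_eps (x y C : R) : (forall e : R, 0 < e -> x <= y + C * e) -> x <= y.
Proof.
move=> h; apply/ler_addgt0Pr => e e0.
have C1 : 0 < `|C| + 1 by rewrite ltr_wpDl.
have := h (e / (`|C| + 1)); rewrite divr_gt0// => /(_ isT) h1.
apply: le_trans h1 _; rewrite lerD2l mulrA ler_pdivrMr// mulrC ler_wpM2l ?(ltW e0)//.
by apply: le_trans (ler_norm _) _; rewrite lerDl.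
Qed.

Lemma is_hart_diff f h f' h' : is_hart f h -> is_hart f' h' ->
  nrm (fun x => h x - h' x) <= nrm (fun x => f x - f' x).
Proof.
move=> [hf hh H] [hf' hh' H']; apply: (@le_eps _ _ 4) => e e0.
have [g [ig hg fg hgg]] := H e e0; have [g' [ig' hg' fg' hgg']] := H' e e0.
have a1 := nrm_tri hh (hart1_L2 ig hg) hh'.
have a2 := nrm_tri (hart1_L2 ig hg) (hart1_L2 ig' hg') hh'.
have a3 := hart1_sub_le ig hg ig' hg'.
have a4 := nrm_tri hg hf hg'.
have a5 := nrm_tri hf hf' hg'.
rewrite nrm_distC in hgg'.
rewrite nrm_distC in fg.
nlra.
Qed.

Lemma is_hart_uniq f h h' : is_hart f h -> is_hart f h' -> ae (fun x => h x = h' x).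
Proof.
move=> H H'; have := is_hart_diff H H'.
rewrite (@nrm_ext _ (fun x => f x - f x) (fun=> 0)) ?nrm0; last by move=> x; rewrite subrr.
move=> h0; apply: nrm_eq0_eq; [by case: H|by case: H'|].
by apply/eqP; rewrite eq_le h0 nrm_ge0.
Qed.

Lemma is_hart_exists f : isL2 f -> exists h, is_hart f h.
Proof.
move=> hf.
have e2 (n : nat) : 0 < (2^-1 : R) ^+ n by rewrite exprn_gt0.
have [k hk] := choice (fun n => trunc_approx hf (e2 n)).
pose g n := trunc (k n) f.
have ig n : itg (g n) by apply: trunc_itg; case: hf.
have hg n : isL2 (g n) := trunc_L2 (k n) hf.
(* The truncation errors of levels [n] and [n.+1] add up to at most [2 * 2^-1 ^+ n]. *)
have [] := @L2_complete _ (fun n => hart1 (g n)) 2.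
- by move=> n; exact: hart1_L2.
- move=> n; apply: le_trans (hart1_sub_le _ _ _ _) _ => //.
  apply: le_trans (nrm_tri (hg _) hf (hg _)) _; rewrite nrm_distC.
  have := hk n; have := hk n.+1; rewrite -/(g n) -/(g n.+1) exprS => h1 h2.
  have := e2 n; nlra.
move=> h hh hn; exists h; split => // e e0.
have [n hen] : exists n : nat, 4 * 2^-1 ^+ n <= e.
  have e4 : 0 < e / 4 by rewrite divr_gt0.
  have /cvgr0Pnorm_le /(_ _ e4) [n _ /(_ n (leqnn n)) /=] :
      (fun n => (2^-1 : R) ^+ n) @ \oo --> 0.
    by apply: cvg_expr; rewrite ger0_norm// invf_lt1 ?ltr1n.
  by rewrite ger0_norm ?exprn_ge0// => h4; exists n; nlra.
exists (g n); split => //.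
  by apply: le_trans (hk n) _; have := e2 n; nlra.
by rewrite nrm_distC; apply: le_trans (hn n) _; nlra.
Qed.

(** A representative is chosen for each function separately, hence the algebraic laws below hold
    only almost everywhere. *)
Definition hart f : R -> R := xget (fun=> 0) [set h | is_hart f h].

Lemma hartP f : isL2 f -> is_hart f (hart f).
Proof. by move=> hf; apply: xgetPex; exact: is_hart_exists. Qed.

Lemma hart_L2 f : isL2 f -> isL2 (hart f).
Proof. by move=> hf; have [] := hartP hf. Qed.

Lemma hart_uniq f h : is_hart f h -> ae (fun x => hart f x = h x).
Proof. by move=> H; apply: (is_hart_uniq _ H); apply: hartP; case: H. Qed.

Lemma hart_hart1 f : itg f -> isL2 f -> ae (fun x => hart f x = hart1 f x).
Proof.
move=> itf hf; apply: hart_uniq; split => //; first exact: hart1_L2.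
move=> e e0; exists f; split => //; rewrite (@nrm_ext _ _ (fun=> 0)) ?nrm0 ?(ltW e0)//.
  by move=> x; rewrite subrr.
by move=> x; rewrite subrr.
Qed.

Lemma is_hartD f h f' h' : is_hart f h -> is_hart f' h' ->
  is_hart (fun x => f x + f' x) (fun x => h x + h' x).
Proof.
move=> [hf hh H] [hf' hh' H']; split; [exact: isL2D|exact: isL2D|] => e e0.
have e2 : 0 < e / 2 by rewrite divr_gt0.
have [g [ig hg fg hgg]] := H _ e2; have [g' [ig' hg' fg' hgg']] := H' _ e2.
exists (fun x => g x + g' x); split; [exact: itgD|exact: isL2D| |].
  rewrite (@nrm_ext _ _ (fun x => (f x - g x) + (f' x - g' x))); last by move=> x; ring.
  by apply: le_trans (nrmD (isL2B hf hg) (isL2B hf' hg')) _; nlra.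
rewrite (@nrm_ext _ _ (fun x => (h x - hart1 g x) + (h' x - hart1 g' x))).
  by apply: le_trans (nrmD (isL2B hh (hart1_L2 ig hg)) (isL2B hh' (hart1_L2 ig' hg'))) _; nlra.
by move=> x; rewrite hart1D//; ring.
Qed.

Lemma is_hartZ c f h : is_hart f h -> is_hart (fun x => c * f x) (fun x => c * h x).
Proof.
move=> [hf hh H]; split; [exact: isL2Z|exact: isL2Z|] => e e0.
have C1 : 0 < `|c| + 1 by rewrite ltr_wpDl.
have e2 : 0 < e / (`|c| + 1) by rewrite divr_gt0.
have P : `|c| * (e / (`|c| + 1)) <= e.
  by rewrite mulrCA ler_piMr ?(ltW e0)// ler_pdivrMr// mul1r lerDl.
have [g [ig hg fg hgg]] := H _ e2.
exists (fun x => c * g x); split; [exact: itgZ|exact: isL2Z| |].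
  rewrite (@nrm_ext _ _ (fun x => c * (f x - g x))); last by move=> x; ring.
  by rewrite nrmZ; [apply: le_trans P; rewrite ler_wpM2l|exact: isL2B].
rewrite (@nrm_ext _ _ (fun x => c * (h x - hart1 g x))); last by move=> x; rewrite hart1Z//; ring.
by rewrite nrmZ; [apply: le_trans P; rewrite ler_wpM2l|apply: isL2B => //; exact: hart1_L2].
Qed.

Lemma hartD f g : isL2 f -> isL2 g -> ae (fun x => hart (fun y => f y + g y) x = hart f x + hart g x).
Proof. by move=> hf hg; apply: hart_uniq; apply: is_hartD; exact: hartP. Qed.

Lemma hartZ c f : isL2 f -> ae (fun x => hart (fun y => c * f y) x = c * hart f x).
Proof. by move=> hf; apply: hart_uniq; apply: is_hartZ; exact: hartP. Qed.

Lemma hartB f g : isL2 f -> isL2 g -> ae (fun x => hart (fun y => f y - g y) x = hart f x - hart g x).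
Proof.
move=> hf hg; rewrite (_ : (fun y => f y - g y) = (fun y => f y + -1 * g y)); last first.
  by apply/funext => y; rewrite mulN1r.
apply: ae_mono2 (hartD hf (isL2Z (-1) hg)) (hartZ (-1) hg) => x -> ->.
by rewrite mulN1r.
Qed.

Lemma is_hart_ae f h f' h' : is_hart f h -> measurable_fun setT f' -> measurable_fun setT h' ->
  ae (fun x => f x = f' x) -> ae (fun x => h x = h' x) -> is_hart f' h'.
Proof.
move=> [hf hh H] mf' mh' ff hhh; split; [exact: isL2_ae ff hf|exact: isL2_ae hhh hh|].
move=> e e0; have [g [ig hg fg hgg]] := H e e0; exists g; split => //.
  apply: le_trans fg; rewrite le_eqVlt; apply/orP; left; apply/eqP; apply: nrm_ae.
  - by apply: mfB => //; case: hg.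
  - by apply: mfB; [case: hf|case: hg].
  - by apply: ae_mono ff => x ->.
apply: le_trans hgg; rewrite le_eqVlt; apply/orP; left; apply/eqP; apply: nrm_ae.
- by apply: mfB => //; exact: mf_hart1.
- by apply: mfB; [case: hh|exact: mf_hart1].
- by apply: ae_mono hhh => x ->.
Qed.

Lemma hart_ae f g : isL2 f -> isL2 g -> ae (fun x => f x = g x) -> ae (fun x => hart f x = hart g x).
Proof.
move=> hf hg fg; have H := hartP hf; have [_ hh _] := H.
apply: is_hart_uniq (hartP hg); apply: is_hart_ae H _ _ fg _; [by case: hg|by case: hh|].
exact: ae_all.
Qed.

Lemma hart_isom f : isL2 f -> nrm (hart f) = nrm f.
Proof.
move=> hf; have [_ hh H] := hartP hf.
suff : `|nrm (hart f) - nrm f| <= 0 by rewrite normr_le0 subr_eq0 => /eqP.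
apply: (@le_eps _ _ 2) => e e0; have [g [ig hg fg hgg]] := H e e0.
have a1 := nrm_rtri hh (hart1_L2 ig hg); have a2 := nrm_rtri hg hf.
rewrite nrm_distC in a2.
rewrite (hart1_isom ig hg) in a1.
have := ler_distD (nrm g) (nrm (hart f)) (nrm f); nlra.
Qed.

Lemma ip_diff f f' g g' : isL2 f -> isL2 f' -> isL2 g -> isL2 g' ->
  `|ip f g - ip f' g'| <= nrm (fun x => f x - f' x) * nrm g + nrm f' * nrm (fun x => g x - g' x).
Proof.
move=> hf hf' hg hg'.
have -> : ip f g - ip f' g' = ip (fun x => f x - f' x) g + ip f' (fun x => g x - g' x).
  rewrite (ipB hf' hg hg') [ip (fun x => f x - f' x) _]ipC (ipB hg hf hf') [ip g f]ipC [ip g f']ipC.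
  by rewrite addrA subrK.
by apply: le_trans (ler_normD _ _) _; rewrite lerD// ip_le//; exact: isL2B.
Qed.

Lemma hart_adj f g : isL2 f -> isL2 g -> ip (hart f) g = ip f (hart g).
Proof.
move=> hf hg; have [_ hh H] := hartP hf; have [_ hh' H'] := hartP hg.
apply/eqP; rewrite -subr_eq0 -normr_le0.
have nf := nrm_ge0 f; have ng := nrm_ge0 g.
have [B [bf bg]] : exists B, nrm f + 1 <= B /\ nrm g + 1 <= B.
  by exists (nrm f + nrm g + 1); split; nlra.
have B0 : 0 <= B by nlra.
apply: (@le_eps _ _ (4 * B)) => e0 e00.
(* Keeping [e <= 1] bounds the norms of both approximants by [B]. *)
pose e := Num.min e0 1; have e1 : e <= 1 by rewrite ge_min lexx orbT.
have ee : e <= e0 by rewrite ge_min lexx.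
have e_gt0 : 0 < e by rewrite lt_min e00 ltr01.
have [u [iu hu fu hgu]] := H e e_gt0; have [v [iv hv gv hgv]] := H' e e_gt0.
have a1 := ip_diff hh (hart1_L2 iu hu) hg hv.
have a2 := ip_diff hu hf (hart1_L2 iv hv) hh'.
have E : ip (hart1 u) v = ip u (hart1 v) by exact: hart1_adj.
have b1 : nrm u <= B.
  have := nrm_rtri hu hf; rewrite nrm_distC => /(le_trans (ler_norm _)); nlra.
have b2 : nrm v <= B.
  have := nrm_rtri hv hg; rewrite nrm_distC => /(le_trans (ler_norm _)); nlra.
rewrite (hart1_isom iu hu) in a1.
rewrite (hart1_isom iv hv) in a2.
rewrite nrm_distC in fu.
rewrite [nrm (fun x => hart1 v x - hart g x)]nrm_distC in a2.
have P x y : 0 <= x -> 0 <= y -> x <= e -> y <= B -> x * y <= B * e0.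
  by move=> x0 y0 xe yB; rewrite mulrC; apply: ler_pM => //; exact: le_trans ee.
have c1 : `|ip (hart f) g - ip (hart1 u) v| <= 2 * B * e0.
  apply: le_trans a1 _; rewrite [leRHS](_ : _ = B * e0 + B * e0); last by ring.
  by apply: lerD; [apply: P|rewrite mulrC; apply: P]; try exact: nrm_ge0; nlra.
have c2 : `|ip u (hart1 v) - ip f (hart g)| <= 2 * B * e0.
  apply: le_trans a2 _; rewrite [leRHS](_ : _ = B * e0 + B * e0); last by ring.
  by apply: lerD; [apply: P|rewrite mulrC; apply: P]; try exact: nrm_ge0; nlra.
rewrite E in c1.
have h := ler_distD (ip u (hart1 v)) (ip (hart f) g) (ip f (hart g)).
by apply: le_trans h _; rewrite add0r; apply: le_trans (lerD c1 c2) _; clear; nlra.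
Qed.

(** Isometry and selfadjointness suffice: in the expansion of the square of [nrm (H (H f) - f)], all
    of the squares and the scalar product of [H (H f)] with [f] equal [nrm f ^+ 2]. *)
Lemma hartK f : isL2 f -> ae (fun x => hart (hart f) x = f x).
Proof.
move=> hf; have h1 := hart_L2 hf; have h2 := hart_L2 h1.
apply: nrm_eq0_eq => //; apply/eqP; rewrite -sqrf_eq0.
have e : nrm (fun x => hart (hart f) x - f x) ^+ 2 = nrm (hart (hart f)) ^+ 2
     - 2 * ip (hart (hart f)) f + nrm f ^+ 2.
  have := nrmD_sqr h2 (isL2N hf); rewrite ipN// nrmN => ->; ring.
rewrite e (hart_adj h1 hf) -nrm_ip !hart_isom//; apply/eqP; ring.
Qed.

Lemma hart_ip f g : isL2 f -> isL2 g -> ip (hart f) (hart g) = ip f g.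
Proof.
move=> hf hg; rewrite hart_adj//; last exact: hart_L2.
apply: ip_ae (hartK hg); [by case: hf|by case: (hart_L2 (hart_L2 hg))|by case: hg].
Qed.

(** The involution of L^2 becomes a pointwise inversion formula once the transform is integrable.
    The sup bounds below rest on it. *)
Lemma hart_inv f : isL2 f -> itg (hart f) -> ae (fun x => f x = hart1 (hart f) x).
Proof.
move=> hf ih; apply: ae_mono2 (hartK hf) (hart_hart1 ih (hart_L2 hf)) => x <- <- //.
Qed.

End hartley_L2.

(** * Fourier multipliers *)

Section fourier_hartley.
Context {R : realType}.
Implicit Types f h : R -> R.
Local Open Scope complex_scope.

Definition half : R := kap^-1 * 2^-1.

(* [cplx] recovers the (unnormalized) Fourier transform from the Hartley
   transform, and [rl] is its inverse. *)
Definition cplx h (xi : R) : R[i] := (half * (h xi + h (- xi))) +i* (half * (h (- xi) - h xi)).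

Definition rl (g : R -> R[i]) (xi : R) : R := kap * (complex.Re (g xi) - complex.Im (g xi)).

Lemma kap_half : kap * half * 2 = 1.
Proof. by rewrite /half; field; rewrite gt_eqF// kap_gt0. Qed.

Lemma rl_cplx h xi : rl (cplx h) xi = h xi.
Proof.
rewrite /rl /cplx /= [RHS](_ : _ = (kap * half * 2) * h xi); last by rewrite kap_half mul1r.
by ring.
Qed.

Lemma cplxB h h' xi : cplx h xi - cplx h' xi = cplx (fun x => h x - h' x) xi.
Proof. by rewrite /cplx; simpc; congr (_ +i* _); ring. Qed.

(** Up to [kap], the even and odd parts of the Hartley transform are the cosine and the sine
    integral; the latter enters the Fourier transform with a minus sign. *)
Lemma fourier1E f xi : itg f -> fourier1 f xi = cplx (hart1 f) xi.
Proof.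
move=> hf; rewrite /fourier1 /integralC /cplx /hart1.
have ic : itg (fun x => f x * cos (x * xi)).
  apply: itg_le (itg_norm hf); first by have ? := itg_mf hf; mf_tac.
  by move=> x; rewrite normrM ler_piMr// cos_max.
have is_ : itg (fun x => f x * sin (x * xi)).
  apply: itg_le (itg_norm hf); first by have ? := itg_mf hf; mf_tac.
  by move=> x; rewrite normrM ler_piMr// sin_max.
have e1 : J (fun x => f x * cas (x * xi)) = J (fun x => f x * cos (x * xi)) + J (fun x => f x * sin (x * xi)).
  by rewrite -JD//; congr Rintegral; apply/funext => x; rewrite /cas mulrDr.
have e2 : J (fun x => f x * cas (x * - xi)) = J (fun x => f x * cos (x * xi)) - J (fun x => f x * sin (x * xi)).
  by rewrite -JB//; congr Rintegral; apply/funext => x; rewrite /cas mulrN cosN sinN mulrDr mulrN.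
rewrite e1 e2.
have r1 : J (fun x => complex.Re ((f x)%:C * expi (- (x * xi)))) = J (fun x => f x * cos (x * xi)).
  by congr Rintegral; apply/funext => x; rewrite /expi /= mul0r subr0 cosN.
have r2 : J (fun x => complex.Im ((f x)%:C * expi (- (x * xi)))) = - J (fun x => f x * sin (x * xi)).
  by rewrite -JN//; congr Rintegral; apply/funext => x; rewrite /expi /= mul0r addr0 sinN mulrN.
rewrite r1 r2 /half; congr (_ +i* _); field; by rewrite gt_eqF// kap_gt0.
Qed.

Lemma normcE (z : R[i]) : Normc.normc z = Num.sqrt (complex.Re z ^+ 2 + complex.Im z ^+ 2).
Proof. by case: z. Qed.

Lemma normc_re (z : R[i]) : `|complex.Re z| <= Normc.normc z.
Proof.
by rewrite normcE -sqrtr_sqr ler_wsqrtr// lerDl sqr_ge0.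
Qed.

Lemma normc_im (z : R[i]) : `|complex.Im z| <= Normc.normc z.
Proof.
by rewrite normcE -sqrtr_sqr ler_wsqrtr// lerDr sqr_ge0.
Qed.

Lemma normc_ge (z : R[i]) : 0 <= Normc.normc z.
Proof. by rewrite normcE sqrtr_ge0. Qed.

Lemma normc_dist (z w t : R[i]) :
  Normc.normc (z - w) <= Normc.normc (t - z) + Normc.normc (t - w).
Proof.
have -> : Normc.normc (t - z) = Normc.normc (z - t).
  by rewrite !normcE; case: t => a b; case: z => c d /=; congr Num.sqrt; ring.
have -> : z - w = (z - t) + (t - w) by rewrite addrA subrK.
exact: le_normcD.
Qed.

Lemma normc_cplx h xi : Normc.normc (cplx h xi) ^+ 2 = 2 * half ^+ 2 * (h xi ^+ 2 + h (- xi) ^+ 2).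
Proof. by rewrite normcE sqr_sqrtr ?addr_ge0 ?sqr_ge0//= ; ring. Qed.

Lemma normc_isL2 (g : R -> R[i]) : L2C g -> isL2 (fun x => Normc.normc (g x)).
Proof.
move=> [/L2P h1 /L2P h2].
have m1 := isL2_mf h1; have m2 := isL2_mf h2; split.
  by rewrite (funext (fun x => normcE (g x))); mf_tac.
apply: itg_ext (itgD (isL2_sq h1) (isL2_sq h2)) => x.
by rewrite normcE sqr_sqrtr// addr_ge0 ?sqr_ge0.
Qed.

Lemma L2normCE (g : R -> R[i]) : L2C g -> L2normC g = (nrm (fun x => Normc.normc (g x)))%:E.
Proof. by move=> hg; apply: L2normE; exact: normc_isL2. Qed.

Lemma cplx_L2C h : isL2 h -> L2C (cplx h).
Proof.
move=> hh; have hN := isL2_rigid rigid_opp hh.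
split; apply/L2P; apply: isL2Z; [exact: isL2D|exact: isL2B].
Qed.

Lemma L2C_B (g g' : R -> R[i]) : L2C g -> L2C g' -> L2C (g \- g').
Proof.
move=> [/L2P h1 /L2P h2] [/L2P h3 /L2P h4]; split; apply/L2P.
  rewrite (_ : (fun x => _) = (fun x => complex.Re (g x) - complex.Re (g' x))); first exact: isL2B.
  by apply/funext => x /=; case: (g x) => a b; case: (g' x) => a' b'.
rewrite (_ : (fun x => _) = (fun x => complex.Im (g x) - complex.Im (g' x))); first exact: isL2B.
by apply/funext => x /=; case: (g x) => a b; case: (g' x) => a' b'.
Qed.

Lemma rl_L2 (g : R -> R[i]) : L2C g -> isL2 (rl g).
Proof. by move=> [/L2P h1 /L2P h2]; apply: isL2Z; exact: isL2B. Qed.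

Lemma rl_le (g g' : R -> R[i]) x : `|rl g x - rl g' x| <= Normc.normc (g x - g' x).
Proof.
have k0 := @kap_gt0 R; have kl := @kap_le R.
have -> : rl g x - rl g' x = kap * (complex.Re (g x - g' x) - complex.Im (g x - g' x)).
  by rewrite /rl; case: (g x) => a b; case: (g' x) => a' b' /=; ring.
rewrite normrM (gtr0_norm k0).
have h1 := normc_re (g x - g' x); have h2 := normc_im (g x - g' x).
have h3 := ler_normB (complex.Re (g x - g' x)) (complex.Im (g x - g' x)).
have h4 := normc_ge (g x - g' x).
apply: le_trans (_ : kap * 2 * Normc.normc (g x - g' x) <= _); last by rewrite ler_piMl.
by rewrite -mulrA ler_wpM2l ?(ltW k0)//; lra.
Qed.

(** [kap^-1] is the square root of [2 * pi], the constant of Plancherel's theorem for the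
    unnormalized transform. The mixed terms of [cplx] cancel in the modulus. *)
Lemma nrm_cplx h : isL2 h -> nrm (fun x => Normc.normc (cplx h x)) = kap^-1 * nrm h.
Proof.
move=> hh; have hN := isL2_rigid rigid_opp hh.
have k0 := @kap_gt0 R.
have k1 : 0 <= kap^-1 * nrm h by rewrite mulr_ge0 ?nrm_ge0// invr_ge0 ltW.
apply/eqP; rewrite -(eqrXn2 (ltn0Sn 1) (nrm_ge0 _) k1) nrm_sqr exprMn nrm_sqr.
rewrite (_ : (fun x => Normc.normc (cplx h x) ^+ 2) =
  (fun x => 2 * half ^+ 2 * (h x ^+ 2 + h (- x) ^+ 2))); last first.
  by apply/funext => x; rewrite normc_cplx.
rewrite JZ; last by apply: itgD; exact: isL2_sq.
rewrite JD; [|exact: isL2_sq|exact: isL2_sq].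
rewrite (J_rigid rigid_opp (isL2_sq hh)) /half; apply/eqP; field.
by rewrite gt_eqF.
Qed.

Lemma cvg0_EFin (u : nat -> R) : (u @ \oo --> 0) <-> ((fun n => (u n)%:E) @ \oo --> 0%E).
Proof. by split=> [/cvg_EFin//|/fine_cvgP[]]. Qed.

Lemma cvg0_le (u : nat -> R) (e : R) : u @ \oo --> 0 -> 0 < e -> exists N, forall n, (N <= n)%N -> u n <= e.
Proof.
move=> /cvgr0Pnorm_le /[apply] -[N _ h]; exists N => n Nn.
by apply: le_trans (ler_norm _) _; apply: h.
Qed.

Lemma is_fourier_seq f g : is_fourier f g -> exists f_ : nat -> R -> R,
  [/\ forall n, itg (f_ n), forall n, isL2 (f_ n),
    nrm (fun x => f_ n x - f x) @[n --> \oo] --> 0 &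
    nrm (fun x => Normc.normc (fourier1 (f_ n) x - g x)) @[n --> \oo] --> 0].
Proof.
move=> [/L2P hf hg [f_ [h12 c1 c2]]]; exists f_.
have ig n : itg (f_ n) by have [h1 _] := h12 n; exact: (proj1 (Lfun1_integrable _ _) h1).
have h2 n : isL2 (f_ n) by have [_ /L2P] := h12 n.
split => //; apply/cvg0_EFin.
  by move: c1; rewrite (funext (fun n => L2normE (isL2B (h2 n) hf))).
have e n : L2normC (fourier1 (f_ n) \- g) = (nrm (fun x => Normc.normc (fourier1 (f_ n) x - g x)))%:E.
  rewrite L2normCE//; apply: L2C_B => //.
  by rewrite (_ : fourier1 (f_ n) = cplx (hart1 (f_ n))); [apply: cplx_L2C; exact: hart1_L2|apply/funext => x; exact: fourier1E].
by move: c2; rewrite (funext e).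
Qed.

Lemma is_fourier_hart f g : is_fourier f g -> is_hart f (rl g).
Proof.
move=> H; have [hf hg _] := H; move/L2P : hf => hf.
have [f_ [ig h2 c1 c2]] := is_fourier_seq H.
split => //; first exact: rl_L2.
move=> e e0; have [N1 h1] := cvg0_le c1 e0; have [N2 h3] := cvg0_le c2 e0.
pose n := maxn N1 N2; exists (f_ n); split => //.
  by rewrite nrm_distC; apply: h1; exact: leq_maxl.
have fE : fourier1 (f_ n) = cplx (hart1 (f_ n)) by apply/funext => x; exact: fourier1E.
have hL : L2C (fourier1 (f_ n)) by rewrite fE; apply: cplx_L2C; exact: hart1_L2.
apply: le_trans (h3 n (leq_maxr _ _)); rewrite nrm_distC.
apply: nrm_le; last first.
- move=> x; have := rl_le (fourier1 (f_ n)) g x; rewrite {1}fE rl_cplx => /le_trans; apply.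
  exact: ler_norm.
- exact: (normc_isL2 (L2C_B hL hg)).
- by apply: mfB; [exact: mf_hart1|apply: isL2_mf; exact: rl_L2].
Qed.

Lemma hart_is_fourier f h : is_hart f h -> is_fourier f (cplx h).
Proof.
move=> [hf hh H]; split; [exact/L2P|exact: cplx_L2C|].
have e0 (n : nat) : 0 < (n.+1%:R^-1 : R) by rewrite invr_gt0.
have [g hg] := choice (fun n => H _ (e0 n)); exists g.
have P (u : nat -> R) (C : R) : (forall n, 0 <= u n) -> (forall n, u n <= C * n.+1%:R^-1) ->
    (fun n => (u n)%:E) @ \oo --> 0%E.
  move=> u0 uC; apply/cvg0_EFin.
  apply: (@squeeze_cvgr _ _ _ _ (fun=> 0) (fun n => C * n.+1%:R^-1)); last 2 first.
  - exact: cvg_cst.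
  - rewrite -(mulr0 C); apply: cvgM; first exact: cvg_cst.
    exact: cvg_harmonic.
  by apply: nearW => n; rewrite u0 uC.
split.
- by move=> n; have [ig h2 _ _] := hg n; split; [exact: (proj2 (Lfun1_integrable _ _) ig)|exact/L2P].
- have h2 n : isL2 (g n) by have [] := hg n.
  rewrite (funext (fun n => L2normE (isL2B (h2 n) hf))).
  apply: (P _ 1); first by move=> n; exact: nrm_ge0.
  by move=> n; rewrite mul1r nrm_distC; have [] := hg n.
- have e n : L2normC (fourier1 (g n) \- cplx h) = (kap^-1 * nrm (fun x => hart1 (g n) x - h x))%:E.
    have [ig h2 _ _] := hg n.
    have h3 : isL2 (fun x => hart1 (g n) x - h x) by apply: isL2B => //; exact: hart1_L2.
    rewrite (_ : _ \- _ = cplx (fun x => hart1 (g n) x - h x)).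
      by rewrite L2normCE ?nrm_cplx//; exact: cplx_L2C.
    by apply/funext => x /=; rewrite fourier1E// cplxB.
  rewrite (funext e).
  have k0 := @kap_gt0 R.
  apply: (P _ kap^-1) => n; first by rewrite mulr_ge0 ?nrm_ge0// invr_ge0 ltW.
  by rewrite ler_wpM2l ?invr_ge0 ?(ltW k0)// nrm_distC; have [] := hg n.
Qed.

(** [g = cplx (rl g)] expresses the Hermitian symmetry of the transform of a real function. It holds
    for each [fourier1 (f_ n)] and survives the L^2 limit, [rl] and [cplx] being bounded. *)
Lemma is_fourier_cplx f g : is_fourier f g -> ae (fun x => g x = cplx (rl g) x).
Proof.
move=> H; have [hf hg _] := H; move/L2P : hf => hf.
have [f_ [ig h2 c1 c2]] := is_fourier_seq H.
have [_ hr Hh] := is_fourier_hart H.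
have hB : L2C (g \- cplx (rl g)) by apply: L2C_B => //; exact: cplx_L2C.
have nB := normc_isL2 hB.
suff : nrm (fun x => Normc.normc ((g \- cplx (rl g)) x)) <= 0.
  move=> h0; have /(nrm_eq0 nB) : nrm (fun x => Normc.normc ((g \- cplx (rl g)) x)) = 0.
    by apply/eqP; rewrite eq_le h0 nrm_ge0.
  apply: ae_mono => x /= /Normc.eq0_normc /eqP; rewrite subr_eq0 => /eqP //.
have k0 := @kap_gt0 R.
apply: (@le_eps _ _ _ (1 + kap^-1)) => e e0; rewrite add0r.
have [N h3] := cvg0_le c2 e0.
have fE : fourier1 (f_ N) = cplx (hart1 (f_ N)) by apply/funext => x; exact: fourier1E.
have hL : L2C (fourier1 (f_ N)) by rewrite fE; apply: cplx_L2C; exact: hart1_L2.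
have H1 := normc_isL2 (L2C_B hL hg).
have hd : isL2 (fun x => hart1 (f_ N) x - rl g x) by apply: isL2B => //; exact: hart1_L2.
have H2 := normc_isL2 (cplx_L2C hd).
have hn : nrm (fun x => hart1 (f_ N) x - rl g x) <= e.
  apply: le_trans (h3 N (leqnn _)); apply: nrm_le => //; first by case: hd.
  move=> x; have := rl_le (fourier1 (f_ N)) g x; rewrite {1}fE rl_cplx => /le_trans; apply.
  exact: ler_norm.
apply: (@le_trans _ _ (nrm (fun x => Normc.normc (fourier1 (f_ N) x - g x) +
    Normc.normc (cplx (fun x => hart1 (f_ N) x - rl g x) x)))).
  apply: nrm_le; [by case: nB|exact: isL2D|] => x.
  rewrite ger0_norm ?normc_ge// ger0_norm ?addr_ge0 ?normc_ge//.
  have -> : cplx (fun x => hart1 (f_ N) x - rl g x) x = fourier1 (f_ N) x - cplx (rl g) x.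
    by rewrite fE cplxB.
  exact: normc_dist.
apply: le_trans (nrmD H1 H2) _; rewrite (nrm_cplx hd) mulrDl mul1r; apply: lerD; first exact: h3.
by rewrite ler_wpM2l// invr_ge0 ltW.
Qed.

Lemma fourier_cplx f : isL2 f -> ae (fun x => fourier f x = cplx (hart f) x).
Proof.
move=> hf.
have H : is_fourier f (fourier f).
  by apply: xgetPex; exists (cplx (hart f)); apply: hart_is_fourier; exact: hartP.
have h1 := hart_uniq (is_fourier_hart H).
apply: ae_mono2 (is_fourier_cplx H) (ae_and h1 (ae_rigid rigid_opp h1)) => x -> [e1 e2].
by rewrite /cplx e1 e2.
Qed.

Lemma fourier_L2C f : isL2 f -> L2C (fourier f).
Proof.
move=> hf.
have [] : is_fourier f (fourier f) by apply: xgetPex; exists (cplx (hart f)); apply: hart_is_fourier; exact: hartP.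
by [].
Qed.

(* The action on Hartley transforms of the multiplier with symbol [a + i b],
   for [a] even and [b] odd. *)
Definition hm (a b h : R -> R) (xi : R) : R := a xi * h xi - b xi * h (- xi).

Lemma hm_L2 (a b : R -> R) h (M : R) : measurable_fun setT a -> measurable_fun setT b ->
  (forall x, `|a x| <= M) -> (forall x, `|b x| <= M) -> isL2 h -> isL2 (hm a b h).
Proof.
move=> ma mb aM bM hh; apply: isL2B; [exact: isL2_bnd aM hh|].
exact: isL2_bnd bM (isL2_rigid rigid_opp hh).
Qed.

Lemma multiplierP (a b : R -> R) f (M : R) : measurable_fun setT a -> measurable_fun setT b ->
  (forall x, `|a x| <= M) -> (forall x, `|b x| <= M) ->
  (forall x, a (- x) = a x) -> (forall x, b (- x) = - b x) -> isL2 f ->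
  let g := multiplier (fun xi => a xi +i* b xi) f in
  isL2 g /\ ae (fun xi => hart g xi = hm a b (hart f) xi).
Proof.
move=> ma mb aM bM ea ob hf g.
have hh := hart_L2 hf; have hk := hm_L2 ma mb aM bM hh.
have mulE h xi : (a xi +i* b xi) * cplx h xi = cplx (hm a b h) xi.
  by rewrite /cplx /hm ea ob opprK; simpc; congr (_ +i* _); ring.
pose P := [set g | L2 g /\ fourier g = (fun xi => (a xi +i* b xi) * fourier f xi) %[ae leb R]].
have [/L2P hg fg] : P g.
  (* As [hart] is an involution, this is the function with the prescribed transform
     [hm a b (hart f)]. It is real-valued by construction, which is where the parities of [a] and
     [b] count. *)
  apply: (@xgetPex _ (fun=> 0) P); exists (hart (hm a b (hart f))); split; first by apply/L2P; exact: hart_L2.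
  apply/ae_eqP; have h2 := hartK hk.
  apply: ae_mono2 (ae_and (fourier_cplx (hart_L2 hk)) (fourier_cplx hf))
    (ae_and h2 (ae_rigid rigid_opp h2)) => x [-> ->] [e1 e2].
  by rewrite mulE /cplx e1 e2.
move/ae_eqP : fg => fg; split => //.
apply: ae_mono2 (ae_and (fourier_cplx hg) (fourier_cplx hf)) fg => x [e1 e2].
rewrite e1 e2 mulE => e; have := congr1 (fun z => kap * (complex.Re z - complex.Im z)) e.
by rewrite -!/(rl _ x) !rl_cplx.
Qed.

Lemma L2norm_fin_isL2 f : measurable_fun setT f -> (L2norm f < +oo)%E -> isL2 f.
Proof. by move=> mf h; apply/L2P; rewrite /L2 /=; apply/andP; split; rewrite inE. Qed.

Lemma L2normE_ae f g : measurable_fun setT f -> measurable_fun setT g ->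
  ae (fun x => f x = g x) -> L2norm f = L2norm g.
Proof.
move=> mf mg fg; rewrite /L2norm unlock /=; congr (_ `^ _)%E.
apply: ae_eq_integral => //.
- by apply/measurable_EFinP; mf_tac.
- by apply/measurable_EFinP; mf_tac.
- by apply/ae_eqP; apply: ae_mono fg => x ->.
Qed.

Section weighted.
Variable w : R -> R.
Hypotheses (mw : measurable_fun setT w) (we : forall x, w (- x) = w x).

Let W f xi := Normc.normc ((w xi)%:C * fourier f xi).

Let Wc h xi := Normc.normc ((w xi)%:C * cplx h xi).

Let WcE h xi : Wc h xi = Normc.normc (cplx (fun x => w x * h x) xi).
Proof. by rewrite /Wc; congr Normc.normc; rewrite /cplx we; simpc; congr (_ +i* _); ring. Qed.

Let mWc h : measurable_fun setT h -> measurable_fun setT (Wc h).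
Proof.
move=> mh; have mhN : measurable_fun setT (fun x : R => h (- x)).
  by apply: measurableT_comp mh _; exact: mf_rigid rigid_opp.
have mwN : measurable_fun setT (fun x : R => w (- x)).
  by apply: measurableT_comp mw _; exact: mf_rigid rigid_opp.
rewrite (_ : Wc h = (fun x => Num.sqrt ((half * (w x * h x + w (- x) * h (- x))) ^+ 2 +
   (half * (w (- x) * h (- x) - w x * h x)) ^+ 2))); first by mf_tac.
by apply/funext => x; rewrite WcE normcE.
Qed.

Let W_ae f : isL2 f -> ae (fun x => W f x = Wc (hart f) x).
Proof. by move=> hf; apply: ae_mono (fourier_cplx hf) => x e; rewrite /W e. Qed.

Let mW f : isL2 f -> measurable_fun setT (W f).
Proof.
move=> hf; have [/L2P h1 /L2P h2] := fourier_L2C hf.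
have m1 := isL2_mf h1; have m2 := isL2_mf h2.
rewrite (_ : W f = (fun x => Num.sqrt ((w x * complex.Re (fourier f x)) ^+ 2 +
   (w x * complex.Im (fourier f x)) ^+ 2))); first by mf_tac.
by apply/funext => x; rewrite /W normcE; case: (fourier f x) => p q /=; congr Num.sqrt; ring.
Qed.

(** An even weight commutes with [cplx], so Plancherel's constant is the same with the weight. With
    [weighted_fourier_fin] this translates [Hs_norm] into a real norm of the Hartley transform. *)
Lemma weighted_fourier_norm f : isL2 f -> isL2 (fun x => w x * hart f x) ->
  L2normC (fun xi => (w xi)%:C * fourier f xi) = (kap^-1 * nrm (fun x => w x * hart f x))%:E.
Proof.
move=> hf hw; rewrite /L2normC.
rewrite (L2normE_ae (mW hf) (mWc (isL2_mf (hart_L2 hf))) (W_ae hf)).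
rewrite (funext (WcE (hart f))) -nrm_cplx// -L2normCE//; exact: cplx_L2C.
Qed.

Lemma weighted_fourier_fin f : isL2 f ->
  (L2normC (fun xi => (w xi)%:C * fourier f xi)%R < +oo)%E -> isL2 (fun x => w x * hart f x).
Proof.
move=> hf; rewrite /L2normC (L2normE_ae (mW hf) (mWc (isL2_mf (hart_L2 hf))) (W_ae hf)).
have mh := isL2_mf (hart_L2 hf).
move=> /(L2norm_fin_isL2 (mWc mh)) h1.
have k0 := @kap_gt0 R.
apply: isL2_le (isL2Z 1 h1); first by mf_tac.
move=> x; rewrite mul1r (ger0_norm (_ : 0 <= Wc _ x)); last by rewrite /Wc normc_ge.
rewrite WcE; set z := cplx _ x.
have := rl_le (cplx (fun x => w x * hart f x)) (fun=> 0) x.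
rewrite rl_cplx /rl /= subrr mulr0 !subr0; exact.
Qed.

End weighted.

End fourier_hartley.

(** * Lipschitz ordinary differential equations *)

Section euler.
Context {R : realType}.
Local Notation V := (R -> R).
(** An abstract complete space of functions with seminorm [N] and a Lipschitz field [Q]. [N] may
    vanish on nonzero functions, since functions equal almost everywhere are kept distinct. *)
Variables (D : V -> Prop) (N : V -> R) (Q : V -> V) (L : R).
Implicit Types u v : V.
Hypothesis DD : forall u v, D u -> D v -> D (fun x => u x + v x).
Hypothesis DZ : forall c u, D u -> D (fun x => c * u x).
Hypothesis N_ge0 : forall u, 0 <= N u.
Hypothesis ND : forall u v, D u -> D v -> N (fun x => u x + v x) <= N u + N v.
Hypothesis NZ : forall c u, D u -> N (fun x => c * u x) = `|c| * N u.
Hypothesis complete : forall (u_ : nat -> V) (C : R), (forall n, D (u_ n)) ->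
  (forall n, N (fun x => u_ n.+1 x - u_ n x) <= C * 2^-1 ^+ n) ->
  exists2 u, D u & exists C' : R, forall n, N (fun x => u_ n x - u x) <= C' * 2^-1 ^+ n.
Hypothesis DQ : forall u, D u -> D (Q u).
Hypothesis L_ge0 : 0 <= L.
Hypothesis QL : forall u v, D u -> D v ->
  N (fun x => Q u x - Q v x) <= L * N (fun x => u x - v x).

Lemma DB u v : D u -> D v -> D (fun x => u x - v x).
Proof.
move=> hu hv; rewrite (_ : (fun x => _) = (fun x => u x + -1 * v x)); first exact: DD hu (DZ (-1) hv).
by apply/funext => x; ring.
Qed.

Lemma NB u v : D u -> D v -> N (fun x => u x - v x) <= N u + N v.
Proof.
move=> hu hv; rewrite (_ : (fun x => _) = (fun x => u x + -1 * v x)); last by apply/funext => x; ring.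
by apply: le_trans (ND hu (DZ (-1) hv)) _; rewrite NZ// normrN1 mul1r.
Qed.

Lemma NC u v : D u -> D v -> N (fun x => u x - v x) = N (fun x => v x - u x).
Proof.
move=> hu hv; rewrite (_ : (fun x => u x - v x) = (fun x => -1 * (v x - u x))); last by apply/funext => x; ring.
by rewrite NZ ?normrN1 ?mul1r//; exact: DB.
Qed.

Lemma Ntri u v w : D u -> D v -> D w ->
  N (fun x => u x - w x) <= N (fun x => u x - v x) + N (fun x => v x - w x).
Proof.
move=> hu hv hw; rewrite (_ : (fun x => u x - w x) = (fun x => (u x - v x) + (v x - w x))).
  by apply: ND; exact: DB.
by apply/funext => x; ring.
Qed.

Lemma N_split u v : D u -> D v -> N u <= N (fun x => u x - v x) + N v.
Proof.
move=> hu hv; rewrite {1}(_ : u = (fun x => (u x - v x) + v x)); first exact: ND (DB hu hv) hv.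
by apply/funext => x; ring.
Qed.

Variable phi : V.
Hypothesis Dphi : D phi.

Fixpoint euler_step (h : R) (k : nat) : V :=
  if k is j.+1 then fun x => euler_step h j x + h * Q (euler_step h j) x else phi.

Lemma D_euler h k : D (euler_step h k).
Proof. by elim: k => [//|k IH]; apply: DD => //; apply: DZ; exact: DQ. Qed.

(** One step changes [Q] by at most [L * h] times its own norm: a discrete exponential growth of the
    speed. *)
Lemma Q_euler h k : 0 <= h -> N (Q (euler_step h k)) <= (1 + L * h) ^+ k * N (Q phi).
Proof.
move=> h0; elim: k => [|k IH]; first by rewrite expr0 mul1r.
have Da := D_euler h k; have Da1 := D_euler h k.+1.
apply: le_trans (N_split (DQ Da1) (DQ Da)) _.
apply: le_trans (_ : L * (h * N (Q (euler_step h k))) + N (Q (euler_step h k)) <= _).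
  rewrite lerD2r; apply: le_trans (QL Da1 Da) _; rewrite ler_wpM2l//.
  rewrite (_ : (fun x => _) = (fun x => h * Q (euler_step h k) x)); last by apply/funext => x /=; ring.
  by rewrite (NZ _ (DQ Da)) ger0_norm.
rewrite [X in X <= _](_ : _ = (1 + L * h) * N (Q (euler_step h k))); last by ring.
by rewrite exprS -mulrA ler_wpM2l// addr_ge0// mulr_ge0.
Qed.

Lemma growth_le (h T : R) k : 0 <= h -> k%:R * h <= T -> (1 + L * h) ^+ k <= expR (L * T).
Proof.
move=> h0 hk.
apply: (@le_trans _ _ (expR (L * h) ^+ k)).
  by apply: lerXn2r; rewrite ?nnegrE ?expR_ge0 ?expR_ge1Dx// addr_ge0// mulr_ge0.
rewrite -(expRM_natl k) ler_expR mulrCA ler_wpM2l//.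
Qed.

Definition speed (T : R) := expR (L * T) * N (Q phi).

Lemma speed_ge0 T : 0 <= speed T. Proof. by rewrite mulr_ge0 ?expR_ge0. Qed.

Lemma Q_euler_le (h T : R) k : 0 <= h -> k%:R * h <= T -> N (Q (euler_step h k)) <= speed T.
Proof.
move=> h0 hk; apply: le_trans (Q_euler k h0) _; rewrite ler_wpM2r//.
exact: growth_le.
Qed.

Lemma euler_incr (h T : R) k m : 0 <= h -> (k + m)%:R * h <= T ->
  N (fun x => euler_step h (k + m) x - euler_step h k x) <= m%:R * h * speed T.
Proof.
move=> h0; elim: m => [|m IH] hT.
  rewrite addn0 !mul0r (_ : (fun x => _) = (fun x => 0 * phi x)); last by apply/funext => x; ring.
  by rewrite NZ// normr0 mul0r.
have hT' : (k + m)%:R * h <= T.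
  by apply: le_trans hT; rewrite ler_wpM2r// ler_nat addnS.
apply: le_trans (Ntri (D_euler _ _) (D_euler h (k + m)) (D_euler _ _)) _.
rewrite addnS /= (_ : (fun x => _) = (fun x => h * Q (euler_step h (k + m)) x)); last by apply/funext => x; ring.
rewrite (NZ _ (DQ (D_euler _ _))) ger0_norm//.
have q := Q_euler_le h0 hT'; have := IH hT' => ih.
apply: le_trans (lerD (ler_wpM2l h0 q) ih) _.
by rewrite -natr1 le_eqVlt; apply/orP; left; apply/eqP; ring.
Qed.

(** Along the steps [Q] drifts from its initial value by at most [L] times the distance covered. The
    constant does not depend on the mesh, so the expansion passes to the limit in [sol_quad_le]. *)
Lemma euler_incr2 (h T : R) k m : 0 <= h -> (k + m)%:R * h <= T ->
  N (fun x => euler_step h (k + m) x - euler_step h k x - (m%:R * h) * Q (euler_step h k) x)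
   <= L * speed T * (m%:R * h) ^+ 2.
Proof.
move=> h0; elim: m => [|m IH] hT.
  rewrite addn0 !mul0r (_ : (fun x => _) = (fun x => 0 * phi x)); last by apply/funext => x; ring.
  by rewrite NZ// normr0 mul0r expr0n mulr0.
have hT' : (k + m)%:R * h <= T.
  by apply: le_trans hT; rewrite ler_wpM2r// ler_nat addnS.
have Dk := D_euler h k; have Dm := D_euler h (k + m).
have D1 : D (fun x => euler_step h (k + m) x - euler_step h k x - (m%:R * h) * Q (euler_step h k) x).
  by apply: DB; [exact: DB|apply: DZ; exact: DQ].
have D2 : D (fun x => Q (euler_step h (k + m)) x - Q (euler_step h k) x) by apply: DB; exact: DQ.
rewrite addnS /= (_ : (fun x => _) = (fun x =>
  (euler_step h (k + m) x - euler_step h k x - (m%:R * h) * Q (euler_step h k) x) +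
  h * (Q (euler_step h (k + m)) x - Q (euler_step h k) x))); last first.
  by apply/funext => x; rewrite -natr1; ring.
apply: le_trans (ND D1 (DZ h D2)) _; rewrite (NZ _ D2) ger0_norm//.
have q : N (fun x => Q (euler_step h (k + m)) x - Q (euler_step h k) x) <= L * (m%:R * h * speed T).
  by apply: le_trans (QL Dm Dk) _; rewrite ler_wpM2l//; exact: euler_incr.
apply: le_trans (lerD (IH hT') (ler_wpM2l h0 q)) _.
have c0 : 0 <= L * speed T by rewrite mulr_ge0// speed_ge0.
rewrite [X in X <= _](_ : _ = (L * speed T) * (h ^+ 2 * (m%:R ^+ 2 + m%:R))); last by ring.
rewrite ler_wpM2l// exprMn mulrC ler_wpM2r ?sqr_ge0// -natr1.
have : 0 <= m%:R :> R by rewrite ler0n.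
nra.
Qed.

(** Two half steps differ from one full step by O(h^2), and each step amplifies the error inherited
    from the previous ones by at most [1 + L * h]. With [k * h <= T] the total is O(h). *)
Lemma euler_halve (h T : R) k : 0 <= h -> k%:R * h <= T ->
  N (fun x => euler_step (h / 2) (2 * k) x - euler_step h k x) <=
  k%:R * expR (L * T) * (L * h ^+ 2 * speed T).
Proof.
move=> h0.
pose c := L * h ^+ 2 * speed T.
have c0 : 0 <= c by rewrite !mulr_ge0// ?speed_ge0 ?sqr_ge0.
have l0 : 0 <= 1 + L * h by rewrite addr_ge0// mulr_ge0.
suff H : k%:R * h <= T -> N (fun x => euler_step (h / 2) (2 * k) x - euler_step h k x) <=
    k%:R * (1 + L * h) ^+ k * c.
  move=> hT; apply: le_trans (H hT) _; rewrite ler_wpM2r// ler_wpM2l//.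
  exact: growth_le.
elim: k => [|k IH] hT.
  rewrite muln0 /= !mul0r (_ : (fun x => _) = (fun x => 0 * phi x)); last by apply/funext => x; ring.
  by rewrite NZ// normr0 mul0r.
have hT' : k%:R * h <= T by apply: le_trans hT; rewrite ler_wpM2r// ler_nat.
have h20 : 0 <= h / 2 by rewrite divr_ge0.
have hT2 : (2 * k)%:R * (h / 2) <= T.
  by rewrite (_ : _ * _ = k%:R * h)// natrM; field.
set a' := euler_step (h / 2); set a := euler_step h.
have Da i : D (a i) := D_euler _ _; have Da' i : D (a' i) := D_euler _ _.
set d := N (fun x => a' (2 * k)%N x - a k x) in IH *.
have DQk : D (fun x => Q (a' (2 * k)%N) x - Q (a k) x) by apply: DB; exact: DQ.
have DQk2 : D (fun x => Q (a' (2 * k).+1) x - Q (a k) x) by apply: DB; exact: DQ.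
have Dd : D (fun x => a' (2 * k)%N x - a k x) by exact: DB.
rewrite mulnS (_ : (fun x => _) = (fun x => (a' (2 * k)%N x - a k x) +
  (h / 2 * (Q (a' (2 * k)%N) x - Q (a k) x) + h / 2 * (Q (a' (2 * k).+1) x - Q (a k) x)))); last first.
  by apply/funext => x; rewrite /a' /a /=; field.
apply: le_trans (ND Dd (DD (DZ _ DQk) (DZ _ DQk2))) _.
have b1 : N (fun x => Q (a' (2 * k)%N) x - Q (a k) x) <= L * d by exact: QL.
have b2 : N (fun x => Q (a' (2 * k).+1) x - Q (a k) x) <= L * (d + h / 2 * speed T).
  apply: le_trans (QL (Da' _) (Da _)) _; rewrite ler_wpM2l//.
  rewrite (_ : (fun x => _) = (fun x => (a' (2 * k)%N x - a k x) + h / 2 * Q (a' (2 * k)%N) x)); last first.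
    by apply/funext => x; rewrite /a' /a /=; ring.
  apply: le_trans (ND Dd (DZ _ (DQ (Da' _)))) _; rewrite lerD2l (NZ _ (DQ (Da' _))) ger0_norm//.
  by rewrite ler_wpM2l//; exact: Q_euler_le.
have b3 := ND (DZ (h / 2) DQk) (DZ (h / 2) DQk2).
rewrite (NZ _ DQk) (NZ _ DQk2) ger0_norm// in b3.
have b4 : N (fun x => h / 2 * (Q (a' (2 * k)%N) x - Q (a k) x) +
    h / 2 * (Q (a' (2 * k).+1) x - Q (a k) x)) <= L * h * d + c.
  apply: le_trans b3 _; apply: le_trans (lerD (ler_wpM2l h20 b1) (ler_wpM2l h20 b2)) _.
  have c34 : 0 <= 3 / 4 * c by rewrite mulr_ge0.
  rewrite [X in X <= _](_ : _ = L * h * d + 1 / 4 * c); first by lra.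
  by rewrite /c; field.
apply: le_trans (lerD (lexx _) b4) _; rewrite -/d.
have ih := IH hT'.
have p1 : c <= (1 + L * h) ^+ k.+1 * c.
  by rewrite ler_peMl// exprn_ege1// lerDl mulr_ge0.
rewrite [X in X <= _](_ : _ = (1 + L * h) * d + c); last by ring.
apply: le_trans (lerD (ler_wpM2l l0 ih) p1) _.
by rewrite -natr1 exprS le_eqVlt; apply/orP; left; apply/eqP; ring.
Qed.

Definition mesh n : R := 2^-1 ^+ n.
(** The number of the last node of the dyadic grid of mesh [2^-n] that is not after [t]. Dyadic
    grids are nested, which is what [euler_halve] compares. *)
Definition index (t : R) n : nat := Num.truncn (t * 2 ^+ n).

Lemma mesh_gt0 n : 0 < mesh n. Proof. by rewrite exprn_gt0. Qed.

Lemma mesh_le1 n : mesh n <= 1.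
Proof. by rewrite exprn_ile1// invf_le1 ?ler1n. Qed.

Lemma meshK n : 2 ^+ n * mesh n = 1.
Proof. by rewrite /mesh exprVn divff// expf_neq0. Qed.

Lemma index_le t n : 0 <= t -> (index t n)%:R * mesh n <= t.
Proof.
move=> t0; have := truncn_le (t * 2 ^+ n); rewrite -/(index t n) mulr_ge0 ?exprn_ge0// => h.
have := ler_wpM2r (ltW (mesh_gt0 n)) h; rewrite -mulrA meshK mulr1; exact.
Qed.

Lemma index_gt t n : 0 <= t -> t < ((index t n)%:R + 1) * mesh n.
Proof.
move=> t0; have := truncnS_gt (t * 2 ^+ n); rewrite -/(index t n) -[(index t n).+1%:R]natr1 => h.
by rewrite -(ltr_pM2r (mesh_gt0 n)) -mulrA meshK mulr1 in h.
Qed.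

Lemma index_mono t t' n : 0 <= t -> t <= t' -> (index t n <= index t' n)%N.
Proof. by move=> t0 tt'; apply: le_truncn; rewrite ler_wpM2r// exprn_ge0. Qed.

(** Refining the grid adds at most one node between the old last node and [t]; [approx_cauchy] pays
    for that extra step with [speed t * mesh n]. *)
Lemma indexS t n : 0 <= t -> (2 * index t n <= index t n.+1 <= (2 * index t n).+1)%N.
Proof.
move=> t0.
have h1 := index_le n t0; have h2 := index_gt n t0.
have h3 := index_le n.+1 t0; have h4 := index_gt n.+1 t0.
have e : mesh n = 2 * mesh n.+1 by rewrite /mesh exprS; field.
have m0 := mesh_gt0 n.+1.
rewrite e in h1 h2.
apply/andP; split.
  rewrite -ltnS -(ltr_nat R) -natr1 natrM -(ltr_pM2r m0).
  apply: le_lt_trans h4; apply: le_trans h1; rewrite le_eqVlt; apply/orP; left; apply/eqP; ring.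
rewrite -ltnS -(ltr_nat R) -[(_.+2)%:R]natr1 -natr1 natrM -(ltr_pM2r m0).
apply: le_lt_trans h3 _; apply: lt_le_trans h2 _; rewrite le_eqVlt; apply/orP; left; apply/eqP; ring.
Qed.

Definition approx n (t : R) : V := euler_step (mesh n) (index t n).

Lemma approx_cauchy (t : R) : 0 <= t -> exists C : R, forall n,
  N (fun x => approx n.+1 t x - approx n t x) <= C * 2^-1 ^+ n.
Proof.
move=> t0; exists (t * expR (L * t) * (L * speed t) + speed t) => n.
have m0 := ltW (mesh_gt0 n).
have hk := index_le n t0.
have e : mesh n.+1 = mesh n / 2 by rewrite /mesh exprS mulrC.
have h1 := euler_halve m0 hk.
have /andP[i1 i2] := indexS n t0.
have [m em m1] : exists2 m, index t n.+1 = (2 * index t n + m)%N & (m <= 1)%N.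
  exists (index t n.+1 - 2 * index t n)%N; first by rewrite subnKC.
  by rewrite leq_subLR addn1.
have hk1 := index_le n.+1 t0.
have h2 : N (fun x => approx n.+1 t x - euler_step (mesh n.+1) (2 * index t n) x) <= speed t * mesh n.
  rewrite /approx em; rewrite em in hk1.
  apply: le_trans (euler_incr (ltW (mesh_gt0 n.+1)) hk1) _.
  rewrite [X in X <= _]mulrC ler_wpM2l ?speed_ge0// e.
  have : m%:R <= 1 :> R by rewrite -(ler_nat R) in m1.
  by move=> m1'; nra.
apply: le_trans (Ntri (D_euler _ _) (D_euler (mesh n.+1) (2 * index t n)) (D_euler _ _)) _.
rewrite mulrDl addrC; apply: lerD; last exact: h2.
rewrite e; apply: le_trans h1 _; rewrite -/(mesh n).
rewrite [X in X <= _](_ : _ = ((index t n)%:R * mesh n) * (expR (L * t) * (L * speed t) * mesh n)); last by ring.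
rewrite [X in _ <= X](_ : _ = t * (expR (L * t) * (L * speed t) * mesh n)); last by ring.
by rewrite ler_wpM2r// !mulr_ge0// ?expR_ge0 ?speed_ge0.
Qed.


Lemma sol_ex (t : R) : exists u, 0 <= t -> D u /\ exists C : R, forall n, N (fun x => approx n t x - u x) <= C * 2^-1 ^+ n.
Proof.
have [t0|t0] := boolP (0 <= t); last by exists phi => h; case/negP: t0.
have [C hC] := approx_cauchy t0.
by have [u Du hu] := complete (fun n => D_euler _ _) hC; exists u => _.
Qed.

(** Limits are determined only up to functions with [N = 0]. The value at time 0 is set by hand so
    that it is exactly [phi]. *)
Definition sol (t : R) : V := if t == 0 then phi else sval (cid (sol_ex t)).

Lemma sol0 : sol 0 = phi. Proof. by rewrite /sol eqxx. Qed.

Lemma solP t : 0 <= t ->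
  D (sol t) /\ exists C : R, forall n, N (fun x => approx n t x - sol t x) <= C * 2^-1 ^+ n.
Proof.
rewrite /sol; have [->|_] := eqVneq t 0; last by case: cid.
move=> _; split=> //; exists 0 => n.
rewrite /approx /index mul0r truncn0 /= (_ : (fun x => _) = (fun x => 0 * phi x)).
  by rewrite NZ// normr0 !mul0r.
by apply/funext => x; ring.
Qed.

Lemma D_sol t : 0 <= t -> D (sol t). Proof. by move=> /solP[]. Qed.


Lemma sol_quad_le (T t t' : R) : 0 <= t -> t <= t' -> t' <= T ->
  N (fun x => sol t' x - sol t x - (t' - t) * Q (sol t) x) <= L * speed T * (t' - t) ^+ 2.
Proof.
move=> t0 tt' t'T; have t'0 := le_trans t0 tt'.
have [D1 [C1 h1]] := solP t0; have [D2 [C2 h2]] := solP t'0.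
have lq : 0 <= L * speed T by rewrite mulr_ge0// speed_ge0.
have dt : 0 <= t' - t by rewrite subr_ge0.
(* All errors are multiples of [mesh n]: the distances [C1] and [C2] from [sol] to the Euler schemes
   at the two times, the effect of the first on [Q], and the gap between [m * h] and [t' - t], at
   most one mesh. *)
apply: (@le_geom R _ _ (C2 + C1 + (t' - t) * L * C1 + speed T + L * speed T * (2 * (t' - t) + 1))) => n.
have m0 := ltW (mesh_gt0 n); have m1 := mesh_le1 n.
have i1 := index_le n t0; have i2 := index_gt n t0.
have j1 := index_le n t'0; have j2 := index_gt n t'0.
have le := index_mono n t0 tt'.
have [m em] : exists m, index t' n = (index t n + m)%N by exists (index t' n - index t n)%N; rewrite subnKC.
have hT : (index t n + m)%:R * mesh n <= T by rewrite -em; exact: le_trans j1 t'T.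
have Da := D_euler (mesh n) (index t n); have Db := D_euler (mesh n) (index t' n).
have e1 := euler_incr2 m0 hT; rewrite -em in e1.
have q1 := Q_euler_le m0 (le_trans i1 (le_trans tt' t'T)).
set a := euler_step (mesh n) (index t n) in Da e1 q1.
set b := euler_step (mesh n) (index t' n) in Db e1.
have g1 := h1 n; have g2 := h2 n; rewrite /approx -/a -/b -/(mesh n) in g1 g2.
set h := mesh n in m0 m1 i1 i2 j1 j2 e1 g1 g2 *.
have DQa := DQ Da; have DQu := DQ D1.
have k1 : `|m%:R * h - (t' - t)| <= h.
  rewrite em natrD in j1 j2; rewrite ler_norml; apply/andP; split; nra.
have k2 : m%:R * h <= t' - t + h by move: k1; rewrite ler_norml => /andP[]; lra.
rewrite (_ : (fun x => _) = (fun x => ((sol t' x - b x) + (a x - sol t x)) +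
   (((b x - a x - (m%:R * h) * Q a x) + (m%:R * h - (t' - t)) * Q a x) + (t' - t) * (Q a x - Q (sol t) x)))); last first.
  by apply/funext => x; ring.
have E1 := DB D2 Db; have E2 := DB Da D1; have E3 := DB (DB Db Da) (DZ (m%:R * h) DQa).
have E4 := DZ (m%:R * h - (t' - t)) DQa; have E5 := DZ (t' - t) (DB DQa DQu).
apply: le_trans (ND (DD E1 E2) (DD (DD E3 E4) E5)) _.
apply: le_trans (lerD (ND E1 E2) (ND (DD E3 E4) E5)) _.
apply: le_trans (lerD (lexx _) (lerD (ND E3 E4) (lexx _))) _.
rewrite (NC D2 Db) (NZ _ DQa) (NZ _ (DB DQa DQu)) (ger0_norm dt).
have f1 : `|m%:R * h - (t' - t)| * N (Q a) <= h * speed T by exact: ler_pM.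
have f2 : (t' - t) * N (fun x => Q a x - Q (sol t) x) <= (t' - t) * (L * (C1 * h)).
  by rewrite ler_wpM2l//; apply: le_trans (QL Da D1) _; rewrite ler_wpM2l.
have f3 : L * speed T * (m%:R * h) ^+ 2 <= L * speed T * (t' - t) ^+ 2 + L * speed T * (2 * (t' - t) + 1) * h.
  rewrite -[_ * (2 * _ + 1) * h]mulrA -mulrDr ler_wpM2l//.
  have mh : 0 <= m%:R * h by rewrite mulr_ge0.
  have : (m%:R * h) ^+ 2 <= (t' - t + h) ^+ 2 by rewrite ler_pXn2r// nnegrE// (le_trans mh).
  have : h ^+ 2 <= h by rewrite expr2 ler_piMl.
  nra.
move: f1 f2 f3 e1 g1 g2 => f1 f2 f3 e1 g1 g2.
apply: le_trans (lerD (lerD g2 g1) (lerD (lerD e1 f1) f2)) _.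
apply: le_trans (lerD (lexx _) (lerD (lerD f3 (lexx _)) (lexx _))) _.
by rewrite le_eqVlt; apply/orP; left; apply/eqP; rewrite -/(mesh n) -/h; ring.
Qed.

Lemma sol_lip_le (T t t' : R) : 0 <= t -> t <= t' -> t' <= T ->
  N (fun x => sol t' x - sol t x) <= (L * speed T * T + N (Q (sol t))) * (t' - t).
Proof.
move=> t0 tt' t'T; have t'0 := le_trans t0 tt'.
have D1 := D_sol t0; have D2 := D_sol t'0.
have dt : 0 <= t' - t by rewrite subr_ge0.
have q := sol_quad_le t0 tt' t'T.
have lq : 0 <= L * speed T by rewrite mulr_ge0// speed_ge0.
have DQ1 := DZ (t' - t) (DQ D1).
have := N_split (DB D2 D1) DQ1; rewrite (NZ _ (DQ D1)) (ger0_norm dt) => n.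
apply: le_trans n _; apply: le_trans (lerD q (lexx _)) _.
rewrite [X in X <= _](_ : _ = (L * speed T * (t' - t) + N (Q (sol t))) * (t' - t)); last by ring.
rewrite ler_wpM2r// lerD2r ler_wpM2l//.
by rewrite lerBlDr (le_trans t'T)// lerDl.
Qed.

Lemma sol_bound (T : R) : 0 <= T -> exists2 M : R, 0 <= M & forall t, 0 <= t -> t <= T ->
  N (sol t) <= M /\ N (Q (sol t)) <= M.
Proof.
move=> T0; have lq : 0 <= L * speed T by rewrite mulr_ge0// speed_ge0.
pose M1 := (L * speed T * T + N (Q phi)) * T + N phi.
have M10 : 0 <= M1 by rewrite addr_ge0// mulr_ge0// addr_ge0// mulr_ge0.
have h1 t : 0 <= t -> t <= T -> N (sol t) <= M1.
  move=> t0 tT; apply: le_trans (N_split (D_sol t0) Dphi) _.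
  have := sol_lip_le (lexx 0) t0 tT; rewrite sol0 subr0 => h.
  rewrite lerD2r; apply: le_trans h _; rewrite ler_wpM2l// addr_ge0// mulr_ge0//.
exists (M1 + (L * (M1 + N phi) + N (Q phi))) => [|t t0 tT].
  by rewrite addr_ge0// addr_ge0// mulr_ge0// addr_ge0.
have hh := h1 t t0 tT.
have p : 0 <= L * (M1 + N phi) + N (Q phi) by rewrite addr_ge0// mulr_ge0// addr_ge0.
split; first by apply: le_trans hh _; rewrite lerDl.
apply: le_trans (N_split (DQ (D_sol t0)) (DQ Dphi)) _.
apply: le_trans (_ : _ <= L * (M1 + N phi) + N (Q phi)) _; last by rewrite lerDr.
rewrite lerD2r; apply: le_trans (QL (D_sol t0) Dphi) _; rewrite ler_wpM2l//.
by apply: le_trans (NB (D_sol t0) Dphi) _; rewrite lerD2r.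
Qed.

(** For [t' < t], expand at [t'] and exchange [Q (sol t')] for [Q (sol t)], at a quadratic cost.
    Both orders are wanted because the tags of a Riemann sum lie inside their intervals. *)
Lemma sol_quad (T : R) : 0 <= T -> exists2 C : R, 0 <= C & forall t t', 0 <= t <= T -> 0 <= t' <= T ->
  N (fun x => sol t' x - sol t x) <= C * `|t' - t| /\
  N (fun x => sol t' x - sol t x - (t' - t) * Q (sol t) x) <= C * (t' - t) ^+ 2.
Proof.
move=> T0; have [M M0 hM] := sol_bound T0.
have lq : 0 <= L * speed T by rewrite mulr_ge0// speed_ge0.
pose K := L * speed T * T + M.
have K0 : 0 <= K by rewrite addr_ge0// mulr_ge0.
have lip t t' : 0 <= t <= T -> 0 <= t' <= T -> N (fun x => sol t' x - sol t x) <= K * `|t' - t|.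
  move=> /andP[t0 tT] /andP[t'0 t'T]; have [tt'|/ltW tt'] := leP t t'.
    rewrite ger0_norm ?subr_ge0//; apply: le_trans (sol_lip_le t0 tt' t'T) _.
    by rewrite ler_wpM2r ?subr_ge0// lerD2l; have [] := hM t t0 tT.
  rewrite (NC (D_sol t'0) (D_sol t0)) distrC ger0_norm ?subr_ge0//; apply: le_trans (sol_lip_le t'0 tt' tT) _.
  by rewrite ler_wpM2r ?subr_ge0// lerD2l; have [] := hM t' t'0 t'T.
have C0 : 0 <= K + (L * speed T + L * K) by rewrite !addr_ge0// !mulr_ge0.
exists (K + (L * speed T + L * K)) => // t t' ht ht'.
split.
  apply: le_trans (lip _ _ ht ht') _; rewrite ler_wpM2r// lerDl addr_ge0// mulr_ge0//.
have := lip _ _ ht ht'; move: ht ht' => /andP[t0 tT] /andP[t'0 t'T] l.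
have sq : 0 <= (t' - t) ^+ 2 by rewrite sqr_ge0.
have [tt'|/ltW tt'] := leP t t'.
  apply: le_trans (sol_quad_le t0 tt' t'T) _; rewrite ler_wpM2r//.
  by rewrite addrCA lerDl addr_ge0// mulr_ge0.
have D1 := D_sol t0; have D2 := D_sol t'0; have Q1 := DQ D1; have Q2 := DQ D2.
rewrite (_ : (fun x => _) = (fun x => -1 * (sol t x - sol t' x - (t - t') * Q (sol t') x) + (t' - t) * (Q (sol t') x - Q (sol t) x))); last first.
  by apply/funext => x; ring.
apply: le_trans (ND (DZ (-1) (DB (DB D1 D2) (DZ (t - t') Q2))) (DZ (t' - t) (DB Q2 Q1))) _.
rewrite (NZ _ (DB (DB D1 D2) (DZ (t - t') Q2))) (NZ _ (DB Q2 Q1)) normrN1 mul1r.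
have q := sol_quad_le t'0 tt' tT; rewrite -[(t - t') ^+ 2]sqrrN opprB in q.
have r : `|t' - t| * N (fun x => Q (sol t') x - Q (sol t) x) <= L * K * (t' - t) ^+ 2.
  rewrite -[(t' - t) ^+ 2]real_normK ?num_real// expr2 mulrA [X in _ <= X]mulrC ler_wpM2l//.
  by apply: le_trans (QL D2 D1) _; rewrite -mulrA ler_wpM2l.
apply: le_trans (lerD q r) _; rewrite -mulrDl ler_wpM2r//.
by rewrite lerDr.
Qed.

Lemma euler_flow : exists2 u : R -> V, u 0 = phi & (forall t, 0 <= t -> D (u t)) /\
  forall T : R, 0 <= T -> exists2 C : R, 0 <= C & forall t t', 0 <= t <= T -> 0 <= t' <= T ->
  N (fun x => u t' x - u t x) <= C * `|t' - t| /\
  N (fun x => u t' x - u t x - (t' - t) * Q (u t) x) <= C * (t' - t) ^+ 2.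
Proof. by exists sol; [exact: sol0|split; [exact: D_sol|exact: sol_quad]]. Qed.

End euler.

(** * The weighted Sobolev space *)

Section space.
Context {R : realType}.
Implicit Types f g h w : R -> R.

Lemma one_sqr_ge1 (x : R) : 1 <= 1 + x ^+ 2. Proof. by rewrite lerDl sqr_ge0. Qed.

Lemma one_sqr_gt0 (x : R) : 0 < 1 + x ^+ 2.
Proof. exact: lt_le_trans (one_sqr_ge1 x). Qed.

Definition ws (s xi : R) : R := (1 + xi ^+ 2) `^ (s / 2).

Lemma ws_ge1 (s xi : R) : 0 <= s -> 1 <= ws s xi.
Proof.
by move=> s0; rewrite /ws -[X in X <= _](powRr0 (1 + xi ^+ 2)) ler_powR ?one_sqr_ge1// divr_ge0.
Qed.

Lemma ws_gt0 (s xi : R) : 0 < ws s xi. Proof. by rewrite powR_gt0// one_sqr_gt0. Qed.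

Lemma wsN (s xi : R) : ws s (- xi) = ws s xi. Proof. by rewrite /ws sqrrN. Qed.

Lemma mf_ws (s : R) : measurable_fun setT (ws s). Proof. by rewrite /ws; mf_tac. Qed.

Lemma ws_sqr (s xi : R) : ws s xi ^+ 2 = (1 + xi ^+ 2) `^ s.
Proof. by rewrite /ws -powR_mulrn ?powR_ge0// -powRrM; congr (_ `^ _); field. Qed.

(** If [a ^+ 2 <= b ^+ 2], then [1 + (a + b) ^+ 2 <= 4 * (1 + b ^+ 2)]: the larger frequency carries
    the weight. This distributes the weight over the factors of a convolution in [nS_mul]. *)
Lemma ws_split (s a b : R) : 0 <= s -> ws s (a + b) <= 4 `^ (s / 2) * (ws s a + ws s b).
Proof.
move=> s0; wlog ab : a b / a ^+ 2 <= b ^+ 2 => [H|].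
  have [/H//|/ltW/H] := leP (a ^+ 2) (b ^+ 2).
  by rewrite [b + a]addrC [ws s b + _]addrC.
have h : ws s (a + b) <= (4 * (1 + b ^+ 2)) `^ (s / 2).
  have b0 := sqr_ge0 b; have b1 := one_sqr_gt0 (a + b).
  apply: ge0_ler_powR; rewrite ?nnegrE ?divr_ge0 ?(ltW b1) ?mulr_ge0 ?addr_ge0//.
  have := sqr_ge0 (a - b); nra.
apply: le_trans h _; rewrite powRM ?(ltW (one_sqr_gt0 b))// ler_wpM2l ?powR_ge0//.
by rewrite lerDr ltW// ws_gt0.
Qed.

Lemma dpow (p x : R) :
  is_derive x 1 (fun y => expR (p * ln (1 + y ^+ 2))) (expR (p * ln (1 + x ^+ 2)) * (p * ((1 + x ^+ 2)^-1 * (2 * x)))).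
Proof.
have d1 : is_derive x 1 (fun y : R => 1 + y ^+ 2) (2 * x).
  rewrite [X in is_derive _ _ _ X](_ : _ = 0 + (x * 1 + x * 1)); last by ring.
  exact: (@dD R (fun=> 1) (fun y => y * y) x 0 _ (is_derive_cst _ _ _) (dM (is_derive_id x 1) (is_derive_id x 1))).
have d2 := @dcomp R (@ln R) (fun y => 1 + y ^+ 2) x _ _ (is_derive1_ln (one_sqr_gt0 x)) d1.
exact: (@dcomp R (@expR R) (fun y => p * ln (1 + y ^+ 2)) x _ _ (is_derive_expR _) (@dZ R p (fun y => ln (1 + y ^+ 2)) x _ d2)).
Qed.

Lemma cts_pow (p : R) : cts (fun y => expR (p * ln (1 + y ^+ 2))).
Proof.
by move=> x; apply: differentiable_continuous; apply/derivable1_diffP; have [] := dpow p x.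
Qed.

Lemma cvg_pow (p : R) : 0 < p -> expR (- p * ln (1 + x ^+ 2)) @[x --> +oo] --> (0 : R).
Proof.
move=> p0; rewrite (_ : (fun x => _) = (fun x => expR (- (p * ln (1 + x ^+ 2))))); last first.
  by apply/funext => x; rewrite mulNr.
apply: (@cvg_comp _ _ _ (fun x => p * ln (1 + x ^+ 2)) (fun y => expR (- y)) _ +oo); last exact: cvgr_expR.
apply/cvgryPge => A; near=> x.
have x1 : expR (A / p) <= x by near: x; exact: nbhs_pinfty_ge.
rewrite mulrC -ler_pdivrMr// -[A / p]expRK ler_ln ?posrE ?expR_gt0 ?one_sqr_gt0//.
apply: le_trans x1 _; have := sqr_ge0 (x - 1); have := sqr_ge0 x; nra.
Unshelve. all: by end_near. Qed.

(** The integrand is [(1 + x ^+ 2) ^ (1/2) * E x], hence at most [(1 + |x|) * E x]. Here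
    [E x <= (1 + x ^+ 2)^-1], and [x * E x] has an explicit antiderivative. The total [pi + 2 / b]
    is generously below [10 / b], and this [1 / b] is the source of the logarithm in
    [brezis_gallouet]. *)
Lemma pow_integral (b : R) : 0 < b <= 1 ->
  itg (fun x : R => expR (- ((1 + b) / 2) * ln (1 + x ^+ 2))) /\
  J (fun x : R => expR (- ((1 + b) / 2) * ln (1 + x ^+ 2))) <= 10 / b.
Proof.
move=> /andP[b0 b1].
pose E (x : R) := expR (- (b / 2 + 1) * ln (1 + x ^+ 2)).
have cE : cts E by exact: cts_pow.
have [] := @integral_even R (fun x => b * `|x| * E x) (fun x => b * x * E x)
  (fun x => - expR (- (b / 2) * ln (1 + x ^+ 2))) (- 0).
- by move=> x; rewrite !mulr_ge0 ?expR_ge0// ltW.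
- by apply: ctsW; cts_tac.
- by move=> x; rewrite normrN /E sqrrN.
- by move=> x x0; rewrite ger0_norm.
- by apply: ctsW; cts_tac.
- move=> x; rewrite [X in is_derive _ _ _ X](_ : _ = -
     (expR (- (b / 2) * ln (1 + x ^+ 2)) * (- (b / 2) * ((1 + x ^+ 2)^-1 * (2 * x))))).
    by apply: is_deriveN; exact: dpow.
  rewrite /E (_ : - (b / 2 + 1) * _ = - (b / 2) * ln (1 + x ^+ 2) - ln (1 + x ^+ 2)); last by ring.
  rewrite expRD expRN lnK ?posrE ?one_sqr_gt0//; field.
  by rewrite gt_eqF// one_sqr_gt0.
- by apply: cvgN; apply: cvg_pow; rewrite divr_gt0.
move=> i1; rewrite expr0n addr0 ln1 mulr0 expR0 opprK oppr0 add0r mulr1 => e1.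
have [i2 e2] := @poisson_integral R 1 ltr01.
pose G (x : R) := 2^-1 * (2 * 1 / (1 ^+ 2 + x ^+ 2)) + b^-1 * (b * `|x| * E x).
have iG : itg G by apply: itgD; exact: itgZ.
have JG : J G = pi + 2 / b.
  rewrite /G JD; [|exact: itgZ|exact: itgZ].
  by rewrite (JZ _ i2) (JZ _ i1) e1 e2; field; rewrite gt_eqF.
have le x : `|expR (- ((1 + b) / 2) * ln (1 + x ^+ 2))| <= G x.
  rewrite ger0_norm ?expR_ge0//.
  have y1 := one_sqr_ge1 x; have y0 := one_sqr_gt0 x.
  set y := 1 + x ^+ 2 in y1 y0 *.
  have E0 : 0 <= E x by rewrite expR_ge0.
  have Ey : E x <= y^-1.
    rewrite /E -/y -[X in _ <= X]lnK ?posrE ?invr_gt0// lnV ?posrE// ler_expR mulNr lerN2.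
    by rewrite ler_peMl ?ln_ge0// lerDr divr_ge0// ltW.
  have e : expR (- ((1 + b) / 2) * ln y) = expR (2^-1 * ln y) * E x.
    by rewrite /E -/y -expRD; congr expR; field.
  have sy : expR (2^-1 * ln y) <= 1 + `|x|.
    rewrite -(@ler_pXn2r _ 2) ?nnegrE ?expR_ge0 ?addr_ge0// -expRM_natr.
    rewrite (_ : _ * _ * _ = ln y); last by field.
    rewrite lnK ?posrE// /y -[x ^+ 2]real_normK ?num_real//.
    have := normr_ge0 x; nra.
  rewrite e /G expr1n -/y (_ : _ + _ = y^-1 + `|x| * E x); last by field; rewrite !gt_eqF.
  by apply: le_trans (ler_wpM2r E0 sy) _; rewrite mulrDl mul1r lerD2r.
have mE : measurable_fun setT (fun x : R => expR (- ((1 + b) / 2) * ln (1 + x ^+ 2))).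
  by apply: continuous_measurable_fun; exact: cts_pow.
have i3 := itg_le mE le iG; split=> //.
apply: le_trans (J_le i3 iG _) _; first by move=> x; apply: le_trans (ler_norm _) (le x).
rewrite JG; have := @pihalf_lt2 R => h.
have : 1 <= b^-1 by rewrite invf_ge1.
nra.
Qed.

(* Cauchy-Schwarz against <xi>^-(1+b)/2, with a constant uniform as b -> 0. *)
Lemma J_le_pow (b : R) h : 0 < b <= 1 -> measurable_fun setT h ->
  isL2 (fun x => expR ((1 + b) / 4 * ln (1 + x ^+ 2)) * h x) ->
  itg h /\ J (fun x => `|h x|) ^+ 2 <= 10 / b * nrm (fun x => expR ((1 + b) / 4 * ln (1 + x ^+ 2)) * h x) ^+ 2.
Proof.
move=> hb mh; set k := (fun x => expR _ * h x) => hk.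
have [i1 le1] := pow_integral hb.
pose E (x : R) := expR (- ((1 + b) / 4) * ln (1 + x ^+ 2)).
have E2 x : E x ^+ 2 = expR (- ((1 + b) / 2) * ln (1 + x ^+ 2)).
  by rewrite /E -expRM_natr; congr expR; field.
have hE : isL2 E.
  split; first by apply: continuous_measurable_fun; exact: cts_pow.
  by apply: itg_ext i1 => x; rewrite E2.
have e x : `|E x| * `|k x| = `|h x|.
  rewrite /E /k -normrM mulrA -expRD (_ : _ + _ = 0) ?expR0 ?mul1r//.
  by field.
have ik := itgM (isL2_norm hE) (isL2_norm hk).
have ih : itg h by apply: itg_le ik => // x; rewrite e.
split=> //.
have cs := ip_le (isL2_norm hE) (isL2_norm hk).
rewrite /ip !nrm_norm in cs.
rewrite [X in Rintegral _ _ X](_ : _ = (fun x => `|E x| * `|k x|)); last by apply/funext => x; rewrite e.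
set Z := Rintegral _ _ _ in cs *.
have nE : nrm E ^+ 2 <= 10 / b.
  by rewrite nrm_sqr; apply: le_trans le1; rewrite (_ : (fun x => E x ^+ 2) = (fun x => expR (- ((1 + b) / 2) * ln (1 + x ^+ 2))))//; apply/funext.
have Z2 : Z ^+ 2 <= (nrm E * nrm k) ^+ 2.
  rewrite -[Z ^+ 2]real_normK ?num_real//.
  by apply: lerXn2r; rewrite ?nnegrE ?mulr_ge0 ?nrm_ge0.
by apply: le_trans Z2 _; rewrite exprMn ler_wpM2r ?sqr_ge0.
Qed.

Lemma mul_ae w h h' : ae (fun x => h x = h' x) -> ae (fun x => w x * h x = w x * h' x).
Proof. by apply: ae_mono => x ->. Qed.

Lemma isL2_wsub w f : (forall x, 1 <= w x) -> measurable_fun setT f ->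
  isL2 (fun x => w x * f x) -> isL2 f /\ nrm f <= nrm (fun x => w x * f x).
Proof.
move=> w1 mf hf.
have le x : `|f x| <= `|w x * f x|.
  by rewrite normrM ler_peMl// (le_trans (w1 x))// ler_norm.
by split; [exact: isL2_le mf le hf|exact: nrm_le].
Qed.

(** Multiplication by [w] is a closed operator: the weighted sequence has a limit [g], and [g / w]
    is an L^2 limit of [v n] because [1 <= w], hence equals [f] almost everywhere. *)
Lemma weighted_complete w (v : nat -> R -> R) f (C C' : R) : measurable_fun setT w ->
  (forall x, 1 <= w x) -> (forall n, isL2 (fun x => w x * v n x)) -> (forall n, isL2 (v n)) ->
  (forall n, nrm (fun x => w x * v n.+1 x - w x * v n x) <= C * 2^-1 ^+ n) ->
  isL2 f -> (forall n, nrm (fun x => v n x - f x) <= C' * 2^-1 ^+ n) ->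
  isL2 (fun x => w x * f x) /\ forall n, nrm (fun x => w x * (v n x - f x)) <= 2 * C * 2^-1 ^+ n.
Proof.
move=> mw w1 hwv hv cau hf lim.
have [g hg lg] := L2_complete hwv cau.
have mg := isL2_mf hg.
pose k x := (w x)^-1 * g x.
have w0 x : 0 < w x := lt_le_trans ltr01 (w1 x).
have wk x : w x * k x = g x by rewrite /k mulrA divff ?mul1r// gt_eqF.
have mk : measurable_fun setT k by rewrite /k; mf_tac.
have hk : isL2 k by apply: (isL2_wsub w1 mk _).1; rewrite (_ : (fun x => _) = g)//; apply/funext.
have ek n : nrm (fun x => v n x - k x) <= 2 * C * 2^-1 ^+ n.
  apply: le_trans (lg n).
  rewrite [X in _ <= nrm X](_ : _ = (fun x => w x * (v n x - k x))); last first.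
    by apply/funext => x; rewrite mulrBr wk.
  apply: (isL2_wsub w1 _ _).2.
    by have := isL2_mf (hv n) => ?; mf_tac.
  rewrite (_ : (fun x => _) = (fun x => w x * v n x - g x)); first exact: isL2B.
  by apply/funext => x; rewrite mulrBr wk.
have fk : ae (fun x => f x = k x).
  apply: nrm_eq0_eq => //; apply/eqP; rewrite eq_le nrm_ge0 andbT.
  apply: (@le_geom R _ _ (C' + 2 * C)) => n; rewrite add0r mulrDl.
  apply: le_trans (nrm_tri hf (hv n) hk) _; rewrite nrm_distC.
  exact: lerD.
have mf := isL2_mf hf.
have mwf : measurable_fun setT (fun x => w x * f x) by mf_tac.
have ewf : ae (fun x => g x = w x * f x) by apply: ae_mono fk => x ->; rewrite wk.
split=> [|n]; first exact: isL2_ae mwf ewf hg.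
apply: le_trans (lg n); rewrite le_eqVlt; apply/orP; left; apply/eqP.
have mv := isL2_mf (hv n).
apply: nrm_ae; [mf_tac|mf_tac|].
by apply: ae_mono ewf => x ->; rewrite mulrBr.
Qed.

End space.

(** * Norms, products and completeness of the weighted Sobolev space *)

Section wsob.
Context {R : realType}.
Variables (s : R) (r : nat).
Hypotheses (hs : 2^-1 < s) (hr : r = 1%N \/ r = 2%N).
Implicit Types f g h : R -> R.

Let s0 : 0 < s. Proof. by apply: lt_trans hs; rewrite invr_gt0. Qed.
Let w1 (x : R) : 1 <= ws s x. Proof. by apply: ws_ge1; exact: ltW. Qed.

Definition wt (x : R) : R := `|x| ^+ r.

Lemma mf_wt : measurable_fun setT wt. Proof. by rewrite /wt; mf_tac. Qed.
Lemma wt_ge0 x : 0 <= wt x. Proof. exact: exprn_ge0. Qed.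

Lemma wt_ge x : `|x| <= 1 + wt x.
Proof.
rewrite /wt; case: hr => ->; first by rewrite expr1 lerDr.
have := normr_ge0 x; have := sqr_ge0 (`|x| - 1); nra.
Qed.

(* Membership in the space with norm [nX = nS + nW], where [nS] and [nW] are the
   Sobolev and the weighted part; [nA] dominates the sup norm. *)
Definition isX f := [/\ isL2 f, isL2 (fun x => ws s x * hart f x) & isL2 (fun x => wt x * f x)].
Definition nS f := nrm (fun x => ws s x * hart f x).
Definition nW f := nrm (fun x => wt x * f x).
Definition nX f := nS f + nW f.
Definition nA f := J (fun x => `|hart f x|).

Lemma nS_ge0 f : 0 <= nS f. Proof. exact: nrm_ge0. Qed.
Lemma nW_ge0 f : 0 <= nW f. Proof. exact: nrm_ge0. Qed.
Lemma nX_ge0 f : 0 <= nX f. Proof. by rewrite addr_ge0// nrm_ge0. Qed.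
Lemma nA_ge0 f : 0 <= nA f. Proof. exact: J_ge0. Qed.
Lemma nS_le f : nS f <= nX f. Proof. by rewrite lerDl nW_ge0. Qed.
Lemma nW_le f : nW f <= nX f. Proof. by rewrite lerDr nS_ge0. Qed.

Lemma isX_L2 f : isX f -> isL2 f. Proof. by case. Qed.
Lemma isX_hart f : isX f -> isL2 (hart f). Proof. by move=> /isX_L2; exact: hart_L2. Qed.
Lemma isX_mf f : isX f -> measurable_fun setT f. Proof. by move=> /isX_L2/isL2_mf. Qed.
Lemma mf_wshart f : isL2 f -> measurable_fun setT (fun x => ws s x * hart f x).
Proof. by move=> /hart_L2/isL2_mf h; have := mf_ws s => ?; mf_tac. Qed.
Lemma mf_wtf f : measurable_fun setT f -> measurable_fun setT (fun x => wt x * f x).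
Proof. by move=> h; have := mf_wt => ?; mf_tac. Qed.

Lemma nrm_nS f : isX f -> nrm f <= nS f.
Proof.
move=> [h1 h2 h3]; rewrite -hart_isom//.
by apply: (isL2_wsub w1 _ _).2 => //; apply: isL2_mf; exact: hart_L2.
Qed.

Lemma nS_ae f g : isL2 f -> isL2 g -> ae (fun x => f x = g x) -> nS f = nS g.
Proof.
move=> hf hg e; apply: nrm_ae; [exact: mf_wshart|exact: mf_wshart|].
by apply: mul_ae; exact: hart_ae.
Qed.

Lemma nW_ae f g : measurable_fun setT f -> measurable_fun setT g -> ae (fun x => f x = g x) -> nW f = nW g.
Proof. by move=> hf hg e; apply: nrm_ae; [exact: mf_wtf|exact: mf_wtf|exact: mul_ae]. Qed.

Lemma nX_ae f g : isL2 f -> isL2 g -> ae (fun x => f x = g x) -> nX f = nX g.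
Proof. by move=> hf hg e; rewrite /nX (nS_ae hf hg e) (nW_ae (isL2_mf hf) (isL2_mf hg) e). Qed.

Lemma isXD f g : isX f -> isX g -> isX (fun x => f x + g x).
Proof.
move=> [f1 f2 f3] [g1 g2 g3]; have h := isL2D f1 g1; split; first exact: h.
  apply: isL2_ae (mf_wshart h) _ (isL2D f2 g2).
  by apply: ae_mono (hartD f1 g1) => x ->; rewrite mulrDr.
by rewrite (_ : (fun x => _) = (fun x => wt x * f x + wt x * g x)); [exact: isL2D|apply/funext => x; ring].
Qed.

Lemma isXZ c f : isX f -> isX (fun x => c * f x).
Proof.
move=> [f1 f2 f3]; have h := isL2Z c f1; split; first exact: h.
  apply: isL2_ae (mf_wshart h) _ (isL2Z c f2).
  by apply: ae_mono (hartZ c f1) => x ->; rewrite mulrCA.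
by rewrite (_ : (fun x => _) = (fun x => c * (wt x * f x))); [exact: isL2Z|apply/funext => x; ring].
Qed.

Lemma isXB f g : isX f -> isX g -> isX (fun x => f x - g x).
Proof.
move=> hf hg; rewrite (_ : (fun x => _) = (fun x => f x + -1 * g x)); first exact: isXD hf (isXZ (-1) hg).
by apply/funext => x; ring.
Qed.

Lemma nSD f g : isX f -> isX g -> nS (fun x => f x + g x) <= nS f + nS g.
Proof.
move=> [f1 f2 f3] [g1 g2 g3]; apply: le_trans (nrmD f2 g2).
rewrite le_eqVlt; apply/orP; left; apply/eqP; apply: nrm_ae; [exact: mf_wshart (isL2D f1 g1)|exact: isL2_mf (isL2D f2 g2)|].
by apply: ae_mono (hartD f1 g1) => x ->; rewrite mulrDr.
Qed.

Lemma nSZ c f : isX f -> nS (fun x => c * f x) = `|c| * nS f.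
Proof.
move=> [f1 f2 f3]; rewrite -nrmZ//.
apply: nrm_ae; [exact: mf_wshart (isL2Z c f1)|exact: isL2_mf (isL2Z c f2)|].
by apply: ae_mono (hartZ c f1) => x ->; rewrite mulrCA.
Qed.

Lemma nWD f g : isX f -> isX g -> nW (fun x => f x + g x) <= nW f + nW g.
Proof.
move=> [f1 f2 f3] [g1 g2 g3]; apply: le_trans (nrmD f3 g3).
by rewrite /nW (@nrm_ext R _ (fun x => wt x * f x + wt x * g x))// => x; rewrite mulrDr.
Qed.

Lemma nWZ c f : isX f -> nW (fun x => c * f x) = `|c| * nW f.
Proof.
move=> [f1 f2 f3]; rewrite -nrmZ//.
by apply: nrm_ext => x; rewrite mulrCA.
Qed.

Lemma nXD f g : isX f -> isX g -> nX (fun x => f x + g x) <= nX f + nX g.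
Proof. by move=> hf hg; rewrite /nX addrACA; apply: lerD; [exact: nSD|exact: nWD]. Qed.

Lemma nXZ c f : isX f -> nX (fun x => c * f x) = `|c| * nX f.
Proof. by move=> hf; rewrite /nX nSZ// nWZ// mulrDr. Qed.

(** As [1 <= r], the function [(1 + |x|) * f] is in L^2, and so is [(1 + |x|)^-1]. Integrability
    makes the explicit transform [hart1] available on the whole space. *)
Lemma isX_itg f : isX f -> itg f.
Proof.
move=> [f1 f2 f3].
have m1 := isL2_mf f1; have mw := mf_wt.
pose a (x : R) := (1 + `|x|)^-1.
have ma : measurable_fun setT a by rewrite /a; mf_tac.
have ha : isL2 a.
  split => //; have i := @poisson_1 R.
  have ma2 : measurable_fun setT (fun x => a x ^+ 2) by mf_tac.
  apply: itg_le ma2 _ i => x.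
  have x0 := normr_ge0 x; have p0 : 0 < 1 + `|x| by rewrite ltr_wpDr.
  rewrite /a /poisson expr1n mulr1 ger0_norm ?sqr_ge0// exprVn.
  rewrite -[x ^+ 2]real_normK ?num_real//.
  have q0 : 0 < 1 + `|x| ^+ 2 by rewrite ltr_wpDr// sqr_ge0.
  rewrite ler_pdivlMr// mulrC ler_pdivrMr ?exprn_gt0//.
  have := sqr_ge0 `|x|; nra.
have hb : isL2 (fun x => `|f x| + `|wt x * f x|) by apply: isL2D; exact: isL2_norm.
have i := itgM (isL2Z 2 ha) hb.
apply: itg_le m1 _ i => x.
have p0 : 0 < 1 + `|x| by rewrite ltr_wpDr.
rewrite /a normrM (ger0_norm (wt_ge0 x)) -{2}[`|f x|]mul1r -mulrDl mulrAC mulrA.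
rewrite ler_pdivlMr// mulrC ler_wpM2r//.
have := wt_ge x; have := wt_ge0 x; lra.
Qed.

Lemma isX_hart_itg f : isX f -> itg (hart f) /\ nA f ^+ 2 <= 10 * (1 + (2 * s - 1)^-1) * nS f ^+ 2.
Proof.
move=> [f1 f2 f3].
(* The largest [b <= 1] for which the weight [(1 + b) / 4] of [J_le_pow] stays below the Sobolev
   weight [s / 2]. *)
pose b := Num.min 1 (2 * s - 1).
have s1 : 0 < 2 * s - 1 by rewrite subr_gt0 -ltr_pdivrMl// mulr1.
have b0 : 0 < b <= 1 by rewrite /b lt_min ltr01 s1 ge_min lexx.
have bs : (1 + b) / 4 <= s / 2.
  have : b <= 2 * s - 1 by rewrite ge_min lexx orbT.
  lra.
have mh := isL2_mf (hart_L2 f1).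
have le x : `|expR ((1 + b) / 4 * ln (1 + x ^+ 2)) * hart f x| <= `|ws s x * hart f x|.
  rewrite !normrM ler_wpM2r// !ger0_norm ?expR_ge0 ?powR_ge0//.
  rewrite /ws /powR gt_eqF ?one_sqr_gt0// ler_expR ler_wpM2r// ln_ge0// one_sqr_ge1//.
have mk : measurable_fun setT (fun x : R => expR ((1 + b) / 4 * ln (1 + x ^+ 2)) * hart f x).
  apply: mfM => //; apply: continuous_measurable_fun; exact: cts_pow.
have [i le1] := J_le_pow b0 mh (isL2_le mk le f2).
split=> //; apply: le_trans le1 _.
apply: ler_pM; rewrite ?sqr_ge0 ?divr_ge0//.
- by case/andP: b0 => /ltW.
- rewrite ler_wpM2l// /b; case: (leP 1 (2 * s - 1)) => _.
    by rewrite invr1 lerDl invr_ge0 ltW.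
  by rewrite lerDr.
by apply: lerXn2r; rewrite ?nnegrE ?nrm_ge0//; exact: nrm_le.
Qed.

Definition cA : R := Num.sqrt (10 * (1 + (2 * s - 1)^-1)).
Lemma cA_ge0 : 0 <= cA. Proof. exact: sqrtr_ge0. Qed.

Lemma nA_le f : isX f -> nA f <= cA * nS f.
Proof.
move=> /isX_hart_itg[_ h].
have c0 : 0 <= 10 * (1 + (2 * s - 1)^-1).
  rewrite mulr_ge0// addr_ge0// invr_ge0 subr_ge0 -ler_pdivrMl// mulr1 ltW//.
rewrite -(@ler_pXn2r _ 2) ?nnegrE ?nA_ge0// ?mulr_ge0 ?cA_ge0 ?nS_ge0//.
by rewrite exprMn sqr_sqrtr.
Qed.

Lemma nA_hart1 f : isX f -> J (fun x => `|hart1 f x|) = nA f.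
Proof.
move=> hf; have i := isX_itg hf; have h := isX_L2 hf.
apply: J_ae; [exact: mf_norm (mf_hart1 i)|exact: mf_norm (isL2_mf (hart_L2 h))|].
by apply: ae_mono (hart_hart1 i h) => x ->.
Qed.

Lemma sup_nA f : isX f -> ae (fun x => `|f x| <= nA f).
Proof.
move=> hf; have [i _] := isX_hart_itg hf.
apply: ae_mono (hart_inv (isX_L2 hf) i) => x ->.
exact: hart1_bnd.
Qed.

Lemma isL2_nA f g : isX f -> isL2 g -> isL2 (fun x => f x * g x) /\ nrm (fun x => f x * g x) <= nA f * nrm g.
Proof.
move=> hf hg; have mf := isX_mf hf; have mg := isL2_mf hg.
have A0 := nA_ge0 f.
rewrite -[X in X * _](ger0_norm A0) -nrmZ//; apply: nrm_ae_le; [mf_tac|exact: isL2Z|].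
by apply: ae_mono (sup_nA hf) => x h; rewrite !normrM (ger0_norm A0) ler_wpM2r.
Qed.

Lemma nW_mul f g : isX f -> isX g -> isL2 (fun x => wt x * (f x * g x)) /\ nW (fun x => f x * g x) <= nA f * nW g.
Proof.
move=> hf [_ _ hg]; have [a b] := isL2_nA hf hg.
rewrite /nW (_ : (fun x => wt x * (f x * g x)) = (fun x => f x * (wt x * g x)))//.
by apply/funext => x; ring.
Qed.

(* The convolution theorem, as a pointwise bound. *)
Lemma hart1_mul_le f g xi : isX f -> isX g ->
  `|hart1 (fun x => f x * g x) xi| <=
  conv (fun y => `|hart1 f y| + `|hart1 f (- y)|) (fun y => `|hart1 g y| + `|hart1 g (- y)|) xi.
Proof.
have aux (k : R) : 0 < k -> k * 2 <= 1 -> k / 2 <= 1 by lra.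
move=> hf hg.
have if1 := isX_itg hf; have lf := isX_L2 hf; have ig1 := isX_itg hg; have lg := isX_L2 hg.
have [ihf _] := isX_hart_itg hf.
have mf := isX_mf hf; have mg := isX_mf hg.
have ihf1 : itg (hart1 f).
  by apply: itg_ae (hart_hart1 if1 lf) ihf; [exact: isL2_mf (hart_L2 lf)|exact: mf_hart1].
have lhf := hart1_L2 if1 lf; have lhg := hart1_L2 ig1 lg.
(* Pairing [f * g] with [cas (x * xi)] is pairing [f] with the modulated function [p], whose
   transform consists of translates of that of [g]. *)
pose p x := cos (xi * x) * g x + sin (xi * x) * g x.
have ic : itg (fun x => cos (xi * x) * g x).
  apply: itg_le (itg_norm ig1); first by mf_tac.
  by move=> x; rewrite normrM ler_piMl// ler_norml cos_geN1 cos_le1.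
have iS : itg (fun x => sin (xi * x) * g x).
  apply: itg_le (itg_norm ig1); first by mf_tac.
  by move=> x; rewrite normrM ler_piMl// ler_norml sin_geN1 sin_le1.
have ip : itg p by exact: itgD.
have e1 : hart1 (fun x => f x * g x) xi = kap * J (fun x => f x * p x).
  by rewrite /hart1; congr (_ * Rintegral _ _ _); apply/funext => x; rewrite /p /cas [x * xi]mulrC; ring.
have e2 : J (fun x => f x * p x) = J (fun y => hart1 f y * hart1 p y).
  have mp := itg_mf ip.
  have [ml ml'] : measurable_fun setT (hart1 (hart1 f)) /\ measurable_fun setT (hart1 p) by split; exact: mf_hart1.
  rewrite -(hart1_adj ihf1 ip); apply: J_ae; [mf_tac|mf_tac|].
  have E : ae (fun x => f x = hart1 (hart1 f) x).
    apply: ae_mono (hart_inv lf ihf) => x ->; apply: hart1_ae; [exact: isL2_mf (hart_L2 lf)|exact: mf_hart1|].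
    exact: hart_hart1.
  by apply: ae_mono E => x <-.
(* The sum over both signs absorbs the reflections that come from the sine. *)
pose G y := `|hart1 g y| + `|hart1 g (- y)|.
have lG : isL2 G by apply: isL2D; [exact: isL2_norm|exact: isL2_norm (isL2_rigid rigid_opp lhg)].
have bp y : `|hart1 p y| <= 2^-1 * (G (xi + y) + G (xi - y)).
  rewrite /p hart1D// hart1_cos// hart1_sin// -mulrDr normrM ger0_norm ?invr_ge0// ler_wpM2l ?invr_ge0//.
  rewrite /G opprD opprB [- xi - y]addrC [- y - xi]addrC [xi + y]addrC.
  set a := hart1 g _; set b := hart1 g _; set c := hart1 g _; set d := hart1 g _.
  apply: le_trans (ler_normD _ _) _; apply: le_trans (lerD (ler_normD _ _) (ler_normD _ _)) _.
  by rewrite normrN; lra.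
have lG1 : isL2 (fun y => G (xi + y)) := isL2_rigid (rigid_addl xi) lG.
have lG2 : isL2 (fun y => G (xi - y)) := isL2_rigid (rigid_subl xi) lG.
have mG := isL2_mf lG.
have lnf := isL2_norm lhf.
have i1 := itgM lnf lG1; have i2 := itgM lnf lG2.
have mhp : measurable_fun setT (hart1 p) by exact: mf_hart1.
have mhf : measurable_fun setT (hart1 f) by exact: mf_hart1.
have ib : itg (fun y => 2^-1 * (`|hart1 f y| * G (xi + y) + `|hart1 f y| * G (xi - y))).
  by apply: itgZ; exact: itgD.
have symb y : `|hart1 f y * hart1 p y| <= 2^-1 * (`|hart1 f y| * G (xi + y) + `|hart1 f y| * G (xi - y)).
  by rewrite normrM -mulrDr mulrCA ler_wpM2l.
have ifp : itg (fun y => hart1 f y * hart1 p y) by apply: itg_le symb ib; mf_tac.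
rewrite e1 e2 normrM (ger0_norm (ltW (@kap_gt0 R))).
have k2 := @kap_le R; have k0 := @kap_gt0 R.
apply: le_trans (_ : kap * (2^-1 * (J (fun y => `|hart1 f y| * G (xi + y)) + J (fun y => `|hart1 f y| * G (xi - y)))) <= _).
  rewrite ler_wpM2l ?(ltW k0)//; apply: le_trans (J_norm ifp) _.
  by rewrite -JD// -JZ; [apply: J_le => //; exact: itg_norm|exact: itgD].
have e3 : J (fun y => `|hart1 f y| * G (xi + y)) = J (fun y => `|hart1 f (- y)| * G (xi - y)).
  by rewrite -(J_rigid rigid_opp i1).
have i3 : itg (fun y => `|hart1 f (- y)| * G (xi - y)) by exact: (itg_rigid rigid_opp i1).
rewrite e3 /conv -/(G _) -JD//.
rewrite (_ : (fun y => _ + _) = (fun y => (`|hart1 f y| + `|hart1 f (- y)|) * G (xi - y))); last first.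
  by apply/funext => y; ring.
rewrite -[X in _ <= X]mul1r mulrA ler_wpM2r; first by [].
  by apply: J_ge0 => y; rewrite mulr_ge0// addr_ge0.
exact: aux.
Qed.

Lemma convC (a b : R -> R) : isL2 a -> isL2 b -> conv a b =1 conv b a.
Proof.
move=> ha hb x; rewrite /conv.
have i : itg (fun y => a y * b (x - y)) by apply: itgM => //; exact: isL2_rigid (rigid_subl x) hb.
rewrite -(J_rigid (rigid_subl x) i); congr Rintegral; apply/funext => y.
by rewrite subKr mulrC.
Qed.

(** The weight is put on one factor of the convolution by [ws_split], and Young's inequality takes
    the other factor in L^1. Each term is linear in one Sobolev norm, with only [nA] of the other
    factor; the a priori bounds depend on this form. The factor 4 comes from symmetrizing both
    transforms. *)
Lemma nS_mul f g : isX f -> isX g -> isX (fun x => f x * g x) /\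
  nS (fun x => f x * g x) <= 4 `^ (s / 2) * 4 * (nS f * nA g + nA f * nS g).
Proof.
move=> hf hg.
have if1 := isX_itg hf; have lf := isX_L2 hf; have ig1 := isX_itg hg; have lg := isX_L2 hg.
have [lfg _] := isL2_nA hf lg; have ifg := itgM lf lg.
have [wfg _] := nW_mul hf hg.
have mw := mf_ws s.
pose sy h y := `|hart1 h y| + `|hart1 h (- y)|.
have syP h : isX h -> [/\ itg (sy h), isL2 (sy h), isL2 (fun y => ws s y * sy h y),
    J (sy h) <= 2 * nA h & nrm (fun y => ws s y * sy h y) <= 2 * nS h].
  move=> hh; have ih := isX_itg hh; have lh := isX_L2 hh; have [ihh _] := isX_hart_itg hh.
  have mh1 := mf_hart1 ih; have lh1 := hart1_L2 ih lh.
  have ae1 := hart_hart1 ih lh.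
  have mhh := isL2_mf (hart_L2 lh).
  have ih1 : itg (hart1 h) by exact: itg_ae ae1 ihh.
  have in1 := itg_norm ih1; have in2 := itg_rigid rigid_opp in1.
  have l1 := isL2_norm lh1; have l2 := isL2_rigid rigid_opp l1.
  have mws1 : measurable_fun setT (fun x => ws s x * hart1 h x) by mf_tac.
  have wl : isL2 (fun x => ws s x * hart1 h x).
    by apply: isL2_ae mws1 _ (let: And3 _ b _ := hh in b); exact: mul_ae.
  have wn : nrm (fun x => ws s x * hart1 h x) = nS h.
    apply: nrm_ae => //; first exact: mf_wshart.
    by apply: mul_ae; apply: ae_mono ae1 => x ->.
  have wl1 := isL2_norm wl; have wl2 := isL2_rigid rigid_opp wl1.
  have wE : (fun y => ws s y * sy h y) = (fun y => `|ws s y * hart1 h y| + `|ws s (- y) * hart1 h (- y)|).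
    by apply/funext => y; rewrite /sy wsN !normrM (gtr0_norm (ws_gt0 s y)) mulrDr.
  split.
  - exact: itgD.
  - exact: isL2D.
  - by rewrite wE; exact: isL2D.
  - by rewrite /sy JD// (J_rigid rigid_opp in1) nA_hart1// mulr2n mulrDl mul1r.
  - rewrite wE; apply: le_trans (nrmD wl1 wl2) _.
    by rewrite (nrm_rigid rigid_opp wl1) nrm_norm wn mulr2n mulrDl mul1r.
have [iF lF wF JF nF] := syP f hf; have [iG lG wG JG nG] := syP g hg.
have F0 x : 0 <= sy f x by rewrite addr_ge0.
have G0 x : 0 <= sy g x by rewrite addr_ge0.
have wF0 x : 0 <= ws s x * sy f x by rewrite mulr_ge0// ltW// ws_gt0.
have wG0 x : 0 <= ws s x * sy g x by rewrite mulr_ge0// ltW// ws_gt0.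
have [y1 y2] := young F0 wG0 iF lF wG.
have [y3 y4] := young G0 wF0 iG lG wF.
pose c : R := 4 `^ (s / 2).
have c0 : 0 <= c by rewrite powR_ge0.
pose B x := c * (conv (sy g) (fun y => ws s y * sy f y) x + conv (sy f) (fun y => ws s y * sy g y) x).
have lB : isL2 B by apply: isL2Z; exact: isL2D.
have nB : nrm B <= c * 4 * (nS f * nA g + nA f * nS g).
  rewrite nrmZ ?(ger0_norm c0)//; last exact: isL2D.
  rewrite -mulrA ler_wpM2l//; apply: le_trans (nrmD y3 y1) _.
  have := ler_pM (J_ge0 G0) (nrm_ge0 _) JG nF; have := ler_pM (J_ge0 F0) (nrm_ge0 _) JF nG.
  move: (nS f) (nA g) (nA f) (nS g) y2 y4 => a1 a2 a3 a4 y2 y4 h1 h2.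
  apply: le_trans (lerD y4 y2) _; apply: le_trans (lerD h2 h1) _.
  by rewrite le_eqVlt; apply/orP; left; apply/eqP; ring.
have mfg := isL2_mf (hart_L2 lfg).
have bnd : ae (fun x => `|ws s x * hart (fun x => f x * g x) x| <= `|B x|).
  apply: ae_mono (hart_hart1 ifg lfg) => x ->.
  rewrite normrM (gtr0_norm (ws_gt0 s x)); apply: le_trans (ler_norm _).
  apply: le_trans (ler_wpM2l (ltW (ws_gt0 s x)) (hart1_mul_le x hf hg)) _.
  rewrite -/(sy f _) -/(sy g _) /B.
  have LG' := isL2_rigid (rigid_subl x) lG; have wG' := isL2_rigid (rigid_subl x) wG.
  have j1 := itgM lF LG'; have j2 := itgM wF LG'; have j3 := itgM lF wG'.
  rewrite (convC lG wF) /conv -JZ// -JD// -JZ; last exact: itgD.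
  apply: J_le; [exact: itgZ|by apply: itgZ; exact: itgD|] => y.
  have := ws_split y (x - y) (ltW s0); rewrite addrC subrK -/c => h.
  rewrite [X in _ <= X](_ : _ = (c * (ws s y + ws s (x - y))) * (sy f y * sy g (x - y))); last by ring.
  by rewrite ler_wpM2r// mulr_ge0.
have [q1 q2] := nrm_ae_le (mf_wshart lfg) lB bnd.
by split; [split|apply: le_trans q2 nB].
Qed.

Lemma isX_complete (u_ : nat -> R -> R) (C : R) : (forall n, isX (u_ n)) ->
  (forall n, nX (fun x => u_ n.+1 x - u_ n x) <= C * 2^-1 ^+ n) ->
  exists2 u, isX u & exists C' : R, forall n, nX (fun x => u_ n x - u x) <= C' * 2^-1 ^+ n.
Proof.
move=> hu hC.
have hl n := isX_L2 (hu n).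
have hB n : isX (fun x => u_ n.+1 x - u_ n x) := isXB (hu n.+1) (hu n).
have hCS n : nS (fun x => u_ n.+1 x - u_ n x) <= C * 2^-1 ^+ n := le_trans (nS_le _) (hC n).
have hCW n : nW (fun x => u_ n.+1 x - u_ n x) <= C * 2^-1 ^+ n := le_trans (nW_le _) (hC n).
have hC2 n : nrm (fun x => u_ n.+1 x - u_ n x) <= C * 2^-1 ^+ n := le_trans (nrm_nS (hB n)) (hCS n).
have [u lu hlim] := L2_complete hl hC2.
have mw := mf_ws s; have mt := mf_wt.
have [w3 w4] : isL2 (fun x => ws s x * hart u x) /\ forall n, nrm (fun x => ws s x * (hart (u_ n) x - hart u x)) <= 2 * C * 2^-1 ^+ n.
  apply: (@weighted_complete R (ws s) (fun n => hart (u_ n)) (hart u) C (2 * C)) => //.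
  - by move=> n; case: (hu n).
  - by move=> n; exact: hart_L2.
  - move=> n; apply: le_trans (hCS n); rewrite le_eqVlt; apply/orP; left; apply/eqP.
    have ? := isL2_mf (hart_L2 (hl n)); have ? := isL2_mf (hart_L2 (hl n.+1)).
    apply: nrm_ae; [mf_tac|exact: mf_wshart (isX_L2 (hB n))|].
    by apply: ae_mono (hartB (hl n.+1) (hl n)) => x ->; rewrite mulrBr.
  - exact: hart_L2.
  - move=> n; apply: le_trans (hlim n); rewrite -(hart_isom (isL2B (hl n) lu)) le_eqVlt; apply/orP; left; apply/eqP.
    have ? := isL2_mf (hart_L2 (hl n)); have ? := isL2_mf (hart_L2 lu).
    apply: nrm_ae; [mf_tac|exact: isL2_mf (hart_L2 (isL2B (hl n) lu))|].
    by apply: ae_mono (hartB (hl n) lu) => x ->.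
(* [weighted_complete] asks for a weight at least 1, hence [1 + wt r] instead of [wt r], which
   vanishes at 0. *)
have [t3 t4] : isL2 (fun x => (1 + wt x) * u x) /\ forall n, nrm (fun x => (1 + wt x) * (u_ n x - u x)) <= 2 * (C + C) * 2^-1 ^+ n.
  apply: (@weighted_complete R (fun x => 1 + wt x) u_ u (C + C) (2 * C)) => //.
  - by mf_tac.
  - by move=> x; rewrite lerDl wt_ge0.
  - move=> n; have [a _ b] := hu n; rewrite (_ : (fun x => _) = (fun x => u_ n x + wt x * u_ n x)); first exact: isL2D.
    by apply/funext => x; ring.
  - move=> n; rewrite (_ : (fun x => _) = (fun x => (u_ n.+1 x - u_ n x) + wt x * (u_ n.+1 x - u_ n x))); last by apply/funext => x; ring.
    have [a _ b] := hB n; apply: le_trans (nrmD a b) _; rewrite mulrDl; exact: lerD (hC2 n) (hCW n).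
have mu := isL2_mf lu.
have mwu := mf_wtf mu.
have Xu : isX u.
  split=> //; apply: isL2_le t3 => // x.
  by rewrite !normrM ler_wpM2r// !ger0_norm ?addr_ge0 ?wt_ge0// lerDr.
exists u => //; exists (2 * C + 2 * (C + C)) => n; rewrite mulrDl; apply: lerD.
  apply: le_trans (w4 n); rewrite le_eqVlt; apply/orP; left; apply/eqP.
  have ? := isL2_mf (hart_L2 (hl n)); have ? := isL2_mf (hart_L2 lu).
  apply: nrm_ae; [exact: mf_wshart (isL2B (hl n) lu)|mf_tac|].
  by apply: mul_ae; exact: hartB.
have [a _ b] := isXB (hu n) Xu.
apply: le_trans (t4 n); apply: nrm_le; first exact: isL2_mf b.
  rewrite (_ : (fun x => _) = (fun x => (u_ n x - u x) + wt x * (u_ n x - u x))); first exact: isL2D.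
  by apply/funext => x; ring.
by move=> x; rewrite !normrM ler_wpM2r// !ger0_norm ?addr_ge0 ?wt_ge0// lerDr.
Qed.

End wsob.

(** * Elementary estimates for sine, cosine and the symbol *)

Section calculus.
Context {R : realType}.

Lemma lip_of_derive (f df : R -> R) (M : R) : (forall x : R, is_derive x 1 f (df x)) ->
  (forall x, `|df x| <= M) -> forall x y, `|f x - f y| <= M * `|x - y|.
Proof.
move=> hd hM.
suff H x y : x <= y -> `|f x - f y| <= M * `|x - y|.
  by move=> x y; have [/H//|/ltW/H] := leP x y; rewrite distrC [`|y - x|]distrC.
move=> xy; have cf : {within `[x, y], continuous f}.
  apply: continuous_subspaceT => z.
  by apply: differentiable_continuous; apply/derivable1_diffP; have [] := hd z.
have [c _ e] := @MVT_segment R f df x y xy (fun z _ => hd z) cf.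
by rewrite distrC e normrM distrC ler_wpM2r.
Qed.

Lemma sin_lip (x y : R) : `|sin x - sin y| <= `|x - y|.
Proof.
rewrite -[X in _ <= X]mul1r; apply: (@lip_of_derive _ cos) => z.
by rewrite ler_norml cos_geN1 cos_le1.
Qed.

Lemma cos_lip (x y : R) : `|cos x - cos y| <= `|x - y|.
Proof.
rewrite -[X in _ <= X]mul1r; apply: (@lip_of_derive _ (fun z => - sin z)) => z.
by rewrite normrN ler_norml sin_geN1 sin_le1.
Qed.

Lemma sin_le_norm (x : R) : `|sin x| <= `|x|.
Proof. by have := sin_lip x 0; rewrite sin0 !subr0. Qed.

Lemma sin_sub_id (x : R) : `|sin x - x| <= x ^+ 2.
Proof.
have h : forall z, `|z| <= `|x| -> `|cos z - 1| <= `|x|.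
  by move=> z zx; apply: le_trans zx; have := cos_lip z 0; rewrite cos0 subr0.
have hd (z : R) : is_derive z 1 (fun y : R => sin y - y) (cos z - 1).
  by apply: dB; exact: is_derive_id.
have cf (a b : R) : {within `[a, b], continuous (fun y : R => sin y - y)}.
  apply: continuous_subspaceT => z; apply: differentiable_continuous; apply/derivable1_diffP.
  by have [] := hd z.
have E : exists2 c, `|c| <= `|x| & sin x - x = (cos c - 1) * x.
  have [x0|/ltW x0] := leP 0 x.
    have [c hc e] := @MVT_segment R (fun y => sin y - y) (fun y => cos y - 1) 0 x x0 (fun z _ => hd z) (cf _ _).
    exists c; last by rewrite sin0 !subr0 in e.
    by move: hc; rewrite in_itv/= => /andP[c0 cx]; rewrite !ger0_norm.
  have [c hc e] := @MVT_segment R (fun y => sin y - y) (fun y => cos y - 1) x 0 x0 (fun z _ => hd z) (cf _ _).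
  exists c; last by move: e; rewrite sin0 subrr !sub0r; lra.
  by move: hc; rewrite in_itv/= => /andP[c0 cx]; rewrite !ler0_norm// lerN2.
have [c hc ->] := E; rewrite normrM -[x ^+ 2]real_normK ?num_real// expr2 ler_wpM2r//.
exact: h.
Qed.

Lemma cos_two (x : R) : 2 - 2 * cos x = (2 * sin (x / 2)) ^+ 2.
Proof.
have -> : cos x = cos ((x / 2) *+ 2) by congr cos; rewrite mulr2n; field.
rewrite cos_mulr2n exprMn sin2cos2 mulr2n; ring.
Qed.

Lemma cvg_harm (u : nat -> R) (l C : R) : (forall n, `|u n - l| <= C * n.+1%:R^-1) -> u @ \oo --> l.
Proof.
move=> h; apply/cvgrPdist_le => e e0.
have c : (fun n : nat => C * n.+1%:R^-1) @ \oo --> C * 0 by apply: cvgMr; exact: cvg_harmonic.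
rewrite mulr0 in c; have /cvgr0_norm_le/(_ _ e0) := c; apply: filterS => n hn.
rewrite distrC; apply: le_trans (h n) _; exact: le_trans (ler_norm _) hn.
Qed.

Lemma cvg_nsin (x : R) : (fun n : nat => n.+1%:R * sin (n.+1%:R^-1 * x)) @ \oo --> x.
Proof.
apply: (@cvg_harm _ _ (x ^+ 2)) => n.
have n0 : 0 < n.+1%:R :> R by [].
rewrite {2}(_ : x = n.+1%:R * (n.+1%:R^-1 * x)); last by rewrite mulrA divff ?mul1r// gt_eqF.
rewrite -mulrBr normrM gtr0_norm//.
apply: le_trans (ler_wpM2l (ltW n0) (sin_sub_id _)) _.
by rewrite le_eqVlt; apply/orP; left; apply/eqP; field; rewrite gt_eqF.
Qed.

Lemma cvg_ncos (x : R) : (fun n : nat => n.+1%:R ^+ 2 * (2 - 2 * cos (n.+1%:R^-1 * x))) @ \oo --> x ^+ 2.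
Proof.
rewrite (_ : (fun n => _) = (fun n => (2 * (n.+1%:R * sin (n.+1%:R^-1 * (x / 2)))) * (2 * (n.+1%:R * sin (n.+1%:R^-1 * (x / 2)))))); last first.
  by apply/funext => n; rewrite cos_two -[_ * x / 2]mulrA; ring.
rewrite (_ : x ^+ 2 = (2 * (x / 2)) * (2 * (x / 2))); last by field.
have c : (fun n : nat => 2 * (n.+1%:R * sin (n.+1%:R^-1 * (x / 2)))) @ \oo --> 2 * (x / 2).
  by apply: cvgMr; exact: cvg_nsin.
exact: cvgM.
Qed.

(** The symbol of [reg_dx] divided by the imaginary unit. *)
Definition symb (x : R) : R := x / (1 + `|x|).

Lemma symb_den (x : R) : 0 < 1 + `|x| :> R. Proof. by rewrite ltr_wpDr. Qed.

Lemma symbN x : symb (- x) = - symb x. Proof. by rewrite /symb normrN mulNr. Qed.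

Lemma symb_bnd x : `|symb x| <= 1.
Proof. by rewrite /symb normrM normfV (gtr0_norm (symb_den x)) ler_pdivrMr ?symb_den// mul1r lerDr. Qed.

Lemma mf_symb : measurable_fun setT symb. Proof. by rewrite /symb; mf_tac. Qed.

Lemma symb_pos (x y : R) : 0 <= y -> y <= x -> 0 <= symb x - symb y <= x - y.
Proof.
move=> y0 yx; have x0 := le_trans y0 yx.
rewrite /symb !ger0_norm// (_ : _ - _ = (x - y) / ((1 + x) * (1 + y))); last first.
  by field; rewrite !gt_eqF// ltr_wpDr.
have d : 0 <= x - y by rewrite subr_ge0.
have p : 1 <= (1 + x) * (1 + y) by nra.
rewrite divr_ge0 ?(le_trans ler01 p)//= ler_pdivrMr ?(lt_le_trans ltr01 p)//.
by rewrite ler_peMr.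
Qed.

Lemma symb_lip (x y : R) : `|symb x - symb y| <= `|x - y|.
Proof.
wlog yx : x y / y <= x => [H|].
  by have [/H//|/ltW/H] := leP y x; rewrite distrC [`|y - x|]distrC.
suff : 0 <= symb x - symb y <= x - y.
  by move=> /andP[a b]; rewrite !ger0_norm ?subr_ge0// -subr_ge0.
have [y0|/ltW y0] := leP 0 y; first exact: symb_pos.
have [x0|/ltW x0] := leP 0 x; last first.
  have := @symb_pos (- y) (- x); rewrite !symbN !opprK lerN2 oppr_ge0 [_ + symb x]addrC [_ + x]addrC.
  exact.
have b0 : symb 0 = 0 by rewrite /symb mul0r.
have := @symb_pos x 0 (lexx 0) x0; have := @symb_pos (- y) 0 (lexx 0).
rewrite symbN b0 !subr0 oppr_ge0 => /(_ y0).
by move=> /andP[a b] /andP[c d]; apply/andP; split; lra.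
Qed.

Lemma symb_id (x : R) : `|symb x - x| <= x ^+ 2.
Proof.
have p := symb_den x; rewrite (_ : symb x - x = - (x * `|x|) / (1 + `|x|)); last by rewrite /symb; field; rewrite gt_eqF.
rewrite normrM normrN normfV (gtr0_norm p) ler_pdivrMr// normrM normr_id -expr2 real_normK ?num_real//.
by rewrite ler_peMr ?sqr_ge0// lerDl.
Qed.

(** By oddness one may take [0 <= x] and [0 <= d]. For [d <= x] the three arguments have the same
    sign and the difference is explicit. For [x <= d], comparing each value with the identity costs
    [2 x^2 + (x + d)^2 + (x - d)^2], at most [6 * d ^+ 2]; the linear parts cancel. *)
Lemma symb_diff2 (x d : R) : `|2 * symb x - symb (x + d) - symb (x - d)| <= 6 * d ^+ 2.
Proof.
wlog d0 : d / 0 <= d => [H|].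
  have [/H//|/ltW d0] := leP 0 d; have := H (- d); rewrite oppr_ge0 opprK sqrrN => /(_ d0).
  by rewrite addrAC.
wlog x0 : x / 0 <= x => [H|].
  have [/H//|/ltW x0] := leP 0 x; have := H (- x); rewrite oppr_ge0 => /(_ x0).
  rewrite (_ : - x + d = - (x - d)); last by ring.
  rewrite (_ : - x - d = - (x + d)); last by ring.
  rewrite !symbN -normrN; apply: le_trans; rewrite le_eqVlt; apply/orP; left; apply/eqP; congr `|_|; ring.
have [dx|/ltW xd] := leP d x.
  have x1 : 0 <= x + d by rewrite addr_ge0.
  have x2 : 0 <= x - d by rewrite subr_ge0.
  rewrite /symb (ger0_norm x0) (ger0_norm x1) (ger0_norm x2).
  have q1 : 1 <= 1 + x by rewrite lerDl.
  have q2 : 1 <= 1 + (x + d) by rewrite lerDl addr_ge0.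
  have q3 : 1 <= 1 + (x - d) by rewrite lerDl subr_ge0.
  have q10 := lt_le_trans ltr01 q1; have q20 := lt_le_trans ltr01 q2; have q30 := lt_le_trans ltr01 q3.
  rewrite (_ : _ - _ - _ = 2 * d ^+ 2 / ((1 + x) * (1 + (x + d)) * (1 + (x - d)))); last first.
    by field; rewrite !gt_eqF.
  have s : 0 <= d ^+ 2 by rewrite sqr_ge0.
  have P : 1 <= (1 + x) * (1 + (x + d)) * (1 + (x - d)).
    by rewrite -[X in X <= _]mul1r ler_pM// -[X in X <= _]mul1r ler_pM.
  have P0 := lt_le_trans ltr01 P; rewrite ger0_norm; first by rewrite ler_pdivrMr//; nra.
  by apply: divr_ge0; [rewrite mulr_ge0|exact: ltW].
rewrite (_ : _ - _ - _ = 2 * (symb x - x) - (symb (x + d) - (x + d)) - (symb (x - d) - (x - d))); last by ring.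
have h1 := symb_id x; have h2 := symb_id (x + d); have h3 := symb_id (x - d).
apply: le_trans (ler_normB _ _) _; apply: le_trans (lerD (ler_normB _ _) (lexx _)) _.
rewrite normrM (ger0_norm (ler0n _ 2)).
apply: le_trans (lerD (lerD (ler_wpM2l (ler0n _ 2) h1) h2) h3) _.
nra.
Qed.

End calculus.

(** * The operator d_x (1 + H d_x)^-1 *)

Section hart_op.
Context {R : realType}.
Implicit Types f g h u v : R -> R.

(* The transformation laws of [hart1] pass to [hart] by density. *)
Lemma hart_op (T T' : (R -> R) -> R -> R) (M : R) f : 0 < M ->
  (forall u v x, T u x - T v x = T (fun y => u y - v y) x) ->
  (forall u v x, T' u x - T' v x = T' (fun y => u y - v y) x) ->
  (forall u, isL2 u -> isL2 (T u) /\ nrm (T u) <= M * nrm u) ->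
  (forall u, isL2 u -> isL2 (T' u) /\ nrm (T' u) <= M * nrm u) ->
  (forall g, itg g -> itg (T g) /\ hart1 (T g) =1 T' (hart1 g)) ->
  isL2 f -> ae (fun x => hart (T f) x = T' (hart f) x).
Proof.
move=> M0 TB TB' TL TL' TH hf; apply: hart_uniq; split.
- exact: (TL f hf).1.
- exact: (TL' _ (hart_L2 hf)).1.
move=> e e0; have [_ hh H] := hartP hf.
have [g [ig lg n1 n2]] := H (e / M) (divr_gt0 e0 M0).
have [iT eT] := TH g ig; exists (T g); split=> //; first exact: (TL g lg).1.
  rewrite (_ : (fun x => _) = T (fun y => f y - g y)); last by apply/funext => x; exact: TB.
  by apply: le_trans (TL _ (isL2B hf lg)).2 _; rewrite mulrC -ler_pdivlMr.
rewrite (_ : (fun x => _) = T' (fun y => hart f y - hart1 g y)); last by apply/funext => x; rewrite eT TB'.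
by apply: le_trans (TL' _ (isL2B hh (hart1_L2 ig lg))).2 _; rewrite mulrC -ler_pdivlMr.
Qed.

Lemma nrm_half u v : isL2 u -> isL2 v ->
  isL2 (fun x => 2^-1 * (u x + v x)) /\ nrm (fun x => 2^-1 * (u x + v x)) <= 2^-1 * (nrm u + nrm v).
Proof.
move=> hu hv; have h := isL2D hu hv; split; first exact: isL2Z.
by rewrite nrmZ// ger0_norm ?invr_ge0// ler_wpM2l ?invr_ge0//; exact: nrmD.
Qed.

Lemma hart_sin (d : R) f : isL2 f ->
  ae (fun xi => hart (fun x => sin (d * x) * f x) xi = 2^-1 * (hart f (d - xi) - hart f (- xi - d))).
Proof.
apply: (@hart_op (fun u x => sin (d * x) * u x) (fun h xi => 2^-1 * (h (d - xi) - h (- xi - d))) 1) => //.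
- by move=> u v x; rewrite mulrBr.
- by move=> u v x; ring.
- move=> u hu; have ms : measurable_fun setT (fun x : R => sin (d * x)) by mf_tac.
  have b (x : R) : `|sin (d * x)| <= 1 by rewrite ler_norml sin_geN1 sin_le1.
  by split; [exact: isL2_bnd ms b hu|exact: nrm_bnd].
- move=> u hu; have h1 := isL2_rigid (rigid_subl d) hu; have h2 := isL2_rigid (rigid_addN d) hu.
  have [a b] := nrm_half h1 (isL2N h2); split=> //; apply: le_trans b _.
  by rewrite nrmN (nrm_rigid (rigid_subl d) hu) (nrm_rigid (rigid_addN d) hu) mul1r; clear; lra.
- move=> g ig; split=> [|xi]; last exact: hart1_sin.
  have mg := itg_mf ig; apply: itg_le (itg_norm ig); first by mf_tac.
  by move=> x; rewrite normrM ler_piMl// ler_norml sin_geN1 sin_le1.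
Qed.

Lemma hart_cos (d : R) f : isL2 f ->
  ae (fun xi => hart (fun x => cos (d * x) * f x) xi = 2^-1 * (hart f (xi + d) + hart f (xi - d))).
Proof.
apply: (@hart_op (fun u x => cos (d * x) * u x) (fun h xi => 2^-1 * (h (xi + d) + h (xi - d))) 1) => //.
- by move=> u v x; rewrite mulrBr.
- by move=> u v x; ring.
- move=> u hu; have ms : measurable_fun setT (fun x : R => cos (d * x)) by mf_tac.
  have b (x : R) : `|cos (d * x)| <= 1 by rewrite ler_norml cos_geN1 cos_le1.
  by split; [exact: isL2_bnd ms b hu|exact: nrm_bnd].
- move=> u hu; have h1 := isL2_rigid (rigid_add d) hu; have h2 := isL2_rigid (rigid_sub d) hu.
  have [a b] := nrm_half h1 h2; split=> //; apply: le_trans b _.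
  by rewrite (nrm_rigid (rigid_add d) hu) (nrm_rigid (rigid_sub d) hu) mul1r; clear; lra.
- move=> g ig; split=> [|xi]; last exact: hart1_cos.
  have mg := itg_mf ig; apply: itg_le (itg_norm ig); first by mf_tac.
  by move=> x; rewrite normrM ler_piMl// ler_norml cos_geN1 cos_le1.
Qed.

Lemma hart_shift (d : R) f : isL2 f ->
  ae (fun xi => hart (fun x => f (x + d)) xi = cos (d * xi) * hart f xi - sin (d * xi) * hart f (- xi)).
Proof.
apply: (@hart_op (fun u x => u (x + d)) (fun h xi => cos (d * xi) * h xi - sin (d * xi) * h (- xi)) 2) => //.
- by move=> u v x; ring.
- move=> u hu; split; first exact: isL2_rigid (rigid_add d) hu.
  by rewrite (nrm_rigid (rigid_add d) hu) ler_peMl ?nrm_ge0// ler1n.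
- move=> u hu; have hu' := isL2_rigid rigid_opp hu.
  have ms : measurable_fun setT (fun x : R => sin (d * x)) by mf_tac.
  have b (x : R) : `|sin (d * x)| <= 1 by rewrite ler_norml sin_geN1 sin_le1.
  have mc : measurable_fun setT (fun x : R => cos (d * x)) by mf_tac.
  have c (x : R) : `|cos (d * x)| <= 1 by rewrite ler_norml cos_geN1 cos_le1.
  have l1 := isL2_bnd mc c hu; have l2 := isL2_bnd ms b hu'.
  split; first exact: isL2B.
  apply: le_trans (nrmB l1 l2) _.
  have := nrm_bnd mc c hu; have := nrm_bnd ms b hu'; rewrite (nrm_rigid rigid_opp hu).
  by clear; nlra.
- move=> g ig; split=> [|xi]; last exact: hart1_shift.
  exact: itg_rigid (rigid_add d) ig.
Qed.

End hart_op.

(** * Boundedness of the operator for the Sobolev and the weighted norms *)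

Section regdx.
Context {R : realType}.
Implicit Types f g h u v : R -> R.

Lemma reg_dxP f : isL2 f -> isL2 (reg_dx f) /\ ae (fun xi => hart (reg_dx f) xi = - symb xi * hart f (- xi)).
Proof.
move=> hf; have [] := @multiplierP R (fun=> 0) symb f 1 => //.
- exact: mf_symb.
- by move=> x; rewrite normr0.
- exact: symb_bnd.
- exact: symbN.
move=> a b; split=> //; apply: ae_mono b => x ->.
by rewrite /hm mul0r sub0r mulNr.
Qed.

Lemma reg_dx_L2 f : isL2 f -> isL2 (reg_dx f). Proof. by move=> /reg_dxP[]. Qed.

Lemma hart_inj f g : isL2 f -> isL2 g -> ae (fun x => hart f x = hart g x) -> ae (fun x => f x = g x).
Proof.
move=> hf hg e; have e2 := hart_ae (hart_L2 hf) (hart_L2 hg) e.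
by apply: ae_mono2 (ae_and (hartK hf) (hartK hg)) e2 => x [-> ->].
Qed.

Lemma reg_dx_lin (c : R) f g : isL2 f -> isL2 g ->
  ae (fun x => reg_dx (fun y => f y + c * g y) x = reg_dx f x + c * reg_dx g x).
Proof.
move=> hf hg; have hcg := isL2Z c hg; have h := isL2D hf hcg.
have [k1 e1] := reg_dxP hf; have [k2 e2] := reg_dxP hg; have [k3 e3] := reg_dxP h.
have k4 := isL2Z c k2.
apply: hart_inj => //; first exact: isL2D.
have a1 := ae_rigid rigid_opp (ae_and (hartD hf hcg) (hartZ c hg)).
have a2 := ae_and (hartD k1 k4) (hartZ c k2).
apply: ae_mono2 (ae_and (ae_and e1 e2) e3) (ae_and a1 a2) => x [[-> ->] ->] [[b1 b2] [b3 b4]].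
by rewrite b1 b2 b3 b4; ring.
Qed.

Lemma reg_dx_nrm f : isL2 f -> nrm (reg_dx f) <= nrm f.
Proof.
move=> hf; have [k1 e1] := reg_dxP hf; have hh := hart_L2 hf.
rewrite -(hart_isom k1) -(hart_isom hf) -(nrm_rigid rigid_opp hh).
apply: (nrm_ae_le _ _ _).2; [exact: isL2_mf (hart_L2 k1)|exact: isL2_rigid rigid_opp hh|].
apply: ae_mono e1 => x ->; rewrite normrM normrN ler_piMl//; exact: symb_bnd.
Qed.

(* [sin (d * x) / d] stands in for the weight [x]: its Hartley symbol is a
   difference quotient, which commutes with the symbol up to its Lipschitz
   constant. Likewise [(2 - 2 * cos (d * x)) / d ^+ 2] below stands in for [x ^+ 2]. *)
Lemma reg_dx_sin (d : R) f : isL2 f ->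
  nrm (fun x => sin (d * x) * reg_dx f x) <= nrm (fun x => sin (d * x) * f x) + `|d| * nrm f.
Proof.
move=> hf; have [k1 e1] := reg_dxP hf; have hh := hart_L2 hf.
have ms : measurable_fun setT (fun x : R => sin (d * x)) by mf_tac.
have b (x : R) : `|sin (d * x)| <= 1 by rewrite ler_norml sin_geN1 sin_le1.
have l1 := isL2_bnd ms b k1; have l2 := isL2_bnd ms b hf.
have mb := @mf_symb R.
pose t := hart (fun x => sin (d * x) * f x).
have lt := hart_L2 l2; have lt' := isL2_rigid rigid_opp lt.
(* The main term is [- symb (x - d)] times the reflected transform of [sin (d * x) * f]. What
   remains is half an increment of [symb] over a distance [2 * d], times a translate of [hart f]. *)
have mB : measurable_fun setT (fun x : R => - symb (x - d)) by apply: mfN; apply: (measurableT_comp mb); mf_tac.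
have bB (x : R) : `|- symb (x - d)| <= 1 by rewrite normrN symb_bnd.
have mC : measurable_fun setT (fun x : R => 2^-1 * (symb (x - d) - symb (x + d))).
  by apply: mfM; [mf_tac|apply: mfB; apply: (measurableT_comp mb); mf_tac].
have bC (x : R) : `|2^-1 * (symb (x - d) - symb (x + d))| <= `|d|.
  rewrite normrM ger0_norm ?invr_ge0// ler_pdivrMl//; apply: le_trans (symb_lip _ _) _.
  by rewrite (_ : x - d - (x + d) = - (2 * d)); [rewrite normrN normrM ger0_norm|ring].
have lh := isL2_rigid (rigid_add d) hh.
have p1 := isL2_bnd mB bB lt'; have p2 := isL2_bnd mC bC lh.
rewrite -(hart_isom l1) -(hart_isom l2) -(nrm_rigid rigid_opp lt) -(hart_isom hf) -(nrm_rigid (rigid_add d) hh).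
have B := lerD (nrm_bnd mB bB lt') (nrm_bnd mC bC lh); rewrite mul1r in B; apply: le_trans B.
apply: le_trans (nrmD p1 p2); rewrite le_eqVlt; apply/orP; left; apply/eqP.
apply: nrm_ae; [exact: isL2_mf (hart_L2 l1)|exact: isL2_mf (isL2D p1 p2)|].
have a1 := ae_rigid (rigid_subl d) e1; have a2 := ae_rigid (rigid_addN d) e1.
have a3 := ae_rigid rigid_opp (hart_sin d hf).
apply: ae_mono2 (ae_and a1 a2) (ae_and (hart_sin d k1) a3) => x [h1 h2] [h3 h4].
rewrite h3 h1 h2 h4 -[d - x]opprB -[- x - d]opprD !symbN !opprK [d + x]addrC.
by ring.
Qed.

Lemma isL2_cos (d : R) f : isL2 f -> isL2 (fun x => (2 - 2 * cos (d * x)) * f x).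
Proof.
move=> hf; apply: (@isL2_bnd _ _ _ 4) hf; first by mf_tac.
move=> x; rewrite ler_norml; have := cos_geN1 (d * x); have := cos_le1 (d * x); lra.
Qed.

Lemma hart_cos2 (d : R) f : isL2 f ->
  ae (fun xi => hart (fun x => (2 - 2 * cos (d * x)) * f x) xi = 2 * hart f xi - hart f (xi + d) - hart f (xi - d)).
Proof.
move=> hf.
have mc : measurable_fun setT (fun x : R => cos (d * x)) by mf_tac.
have c (x : R) : `|cos (d * x)| <= 1 by rewrite ler_norml cos_geN1 cos_le1.
have l1 := isL2_bnd mc c hf.
have e0 : (fun x => (2 - 2 * cos (d * x)) * f x) = (fun x => 2 * f x - 2 * (cos (d * x) * f x)).
  by apply/funext => x; ring.
rewrite e0; apply: ae_mono2 (ae_and (hartZ 2 hf) (hartZ 2 l1)) (ae_and (hart_cos d hf) (hartB (isL2Z 2 hf) (isL2Z 2 l1))).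
by move=> x [h1 h2] [h3 ->]; rewrite h1 h2 h3; field.
Qed.

(** A discrete Leibniz rule for the second difference of a product: symbol times second difference,
    second difference of the symbol ([symb_diff2]), and a product of first differences, the last one
    recognized as the transform of [sin (d * x) * f]. *)
Lemma reg_dx_cos (d : R) f : isL2 f ->
  nrm (fun x => (2 - 2 * cos (d * x)) * reg_dx f x) <=
  nrm (fun x => (2 - 2 * cos (d * x)) * f x) + 6 * d ^+ 2 * nrm f + 2 * `|d| * nrm (fun x => sin (d * x) * f x).
Proof.
move=> hf; have [k1 e1] := reg_dxP hf; have hh := hart_L2 hf.
have ms : measurable_fun setT (fun x : R => sin (d * x)) by mf_tac.
have b (x : R) : `|sin (d * x)| <= 1 by rewrite ler_norml sin_geN1 sin_le1.
have l2 := isL2_bnd ms b hf; have l3 := isL2_cos d k1; have l4 := isL2_cos d hf.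
have mb := @mf_symb R.
have mb' (c : R) : measurable_fun setT (fun x : R => symb (x + c)) by apply: (measurableT_comp mb); mf_tac.
have lt := hart_L2 l2; have lc := hart_L2 l4; have lc' := isL2_rigid rigid_opp lc.
have lh := isL2_rigid (rigid_addN d) hh.
have mB : measurable_fun setT (fun x : R => - symb x) by exact: mfN.
have bB (x : R) : `|- symb x| <= 1 by rewrite normrN symb_bnd.
have mC : measurable_fun setT (fun x : R => - (2 * symb x - symb (x + d) - symb (x - d))).
  by have := mb' d => h1; have := mb' (- d) => h2; apply: mfN; apply: mfB => //; apply: mfB => //; mf_tac.
have bC (x : R) : `|- (2 * symb x - symb (x + d) - symb (x - d))| <= 6 * d ^+ 2 by rewrite normrN; exact: symb_diff2.
have mE : measurable_fun setT (fun x : R => - 2 * (symb x - symb (x - d))).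
  by have := mb' (- d) => h2; apply: mfM; [mf_tac|exact: mfB].
have bE (x : R) : `|- 2 * (symb x - symb (x - d))| <= 2 * `|d|.
  have e2 : `|- 2 : R| = 2 by rewrite normrN ger0_norm.
  rewrite normrM e2 ler_wpM2l//; apply: le_trans (symb_lip _ _) _.
  by rewrite subKr.
have p1 := isL2_bnd mB bB lc'; have p2 := isL2_bnd mC bC lh; have p3 := isL2_bnd mE bE lt.
rewrite -(hart_isom l3) -(hart_isom l4) -(nrm_rigid rigid_opp lc) -(hart_isom hf) -(nrm_rigid (rigid_addN d) hh) -(hart_isom l2).
have B := lerD (lerD (nrm_bnd mB bB lc') (nrm_bnd mC bC lh)) (nrm_bnd mE bE lt); rewrite mul1r in B; apply: le_trans B.
apply: le_trans (lerD (nrmD p1 p2) (lexx _)).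
apply: le_trans (nrmD (isL2D p1 p2) p3); rewrite le_eqVlt; apply/orP; left; apply/eqP.
apply: nrm_ae; [exact: isL2_mf (hart_L2 l3)|exact: isL2_mf (isL2D (isL2D p1 p2) p3)|].
have a1 := ae_rigid (rigid_add d) e1; have a2 := ae_rigid (rigid_sub d) e1.
have a3 := ae_rigid rigid_opp (hart_cos2 d hf).
apply: ae_mono2 (ae_and (ae_and a1 a2) e1) (ae_and (ae_and (hart_cos2 d k1) a3) (hart_sin d hf)) => x [[h1 h2] h3] [[h4 h5] h6].
rewrite h4 h1 h2 h3 h5 h6 -[d - x]opprB [- x + d]addrC -[d - x]opprB.
rewrite [- (x + d)]opprD.
by field.
Qed.

Lemma sin_dil n (x : R) : `|n.+1%:R * sin (n.+1%:R^-1 * x)| <= `|x|.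
Proof.
rewrite normrM normr_nat; apply: le_trans (ler_wpM2l _ (sin_le_norm _)) _ => //.
by rewrite normrM normfV normr_nat mulrA divff ?mul1r.
Qed.

Lemma cos_dil n (x : R) : `|n.+1%:R ^+ 2 * (2 - 2 * cos (n.+1%:R^-1 * x))| <= `|x| ^+ 2.
Proof.
rewrite cos_two (_ : n.+1%:R ^+ 2 * _ = (2 * (n.+1%:R * sin (n.+1%:R^-1 * (x / 2)))) ^+ 2); last by rewrite -[_ * x / 2]mulrA; ring.
rewrite normrX ler_pXn2r ?nnegrE// normrM (ger0_norm (ler0n _ 2)).
apply: le_trans (ler_wpM2l _ (sin_dil n _)) _ => //.
by rewrite normrM normfV (ger0_norm (ler0n _ 2)) mulrCA divff ?mulr1.
Qed.

(** For [d = 1 / (n + 1)], the function [(n + 1) * sin (d * x)] is dominated by [|x|] and tends to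
    [x]. Multiplied by [n + 1], the bound of [reg_dx_sin] no longer depends on [n], and Fatou
    applies. *)
Lemma reg_dx_wt1 f : isL2 f -> isL2 (fun x => `|x| * f x) ->
  isL2 (fun x => `|x| * reg_dx f x) /\ nrm (fun x => `|x| * reg_dx f x) <= nrm (fun x => `|x| * f x) + nrm f.
Proof.
move=> hf hw; have hk := reg_dx_L2 hf; have mk := isL2_mf hk; have mf := isL2_mf hf.
pose F n (x : R) := (n.+1%:R * sin (n.+1%:R^-1 * x)) * reg_dx f x.
have ms n : measurable_fun setT (fun x : R => sin (n.+1%:R^-1 * x)) by mf_tac.
have b n (x : R) : `|sin (n.+1%:R^-1 * x)| <= 1 by rewrite ler_norml sin_geN1 sin_le1.
have FE n : F n = (fun x => n.+1%:R * (sin (n.+1%:R^-1 * x) * reg_dx f x)) by apply/funext => x; rewrite /F mulrA.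
have lF n : isL2 (F n) by rewrite FE; apply: isL2Z; exact: isL2_bnd (ms n) (b n) hk.
have nF n : nrm (F n) <= nrm (fun x => `|x| * f x) + nrm f.
  rewrite FE (nrmZ _ (isL2_bnd (ms n) (b n) hk)) normr_nat.
  apply: le_trans (ler_wpM2l (ler0n _ n.+1) (reg_dx_sin _ hf)) _.
  rewrite mulrDr mulrA (ger0_norm _) ?invr_ge0// divff// mul1r lerD2r.
  have nz := nrmZ n.+1%:R (isL2_bnd (ms n) (b n) hf); rewrite normr_nat /= in nz; rewrite -nz.
  apply: nrm_le => //; first by mf_tac.
  by move=> x; rewrite mulrA !normrM normr_id ler_wpM2r// -normrM; exact: sin_dil.
have [||||a c] := @nrm_fatou R F (fun x => x * reg_dx f x) (nrm (fun x => `|x| * f x) + nrm f) lF => //.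
- by rewrite addr_ge0// nrm_ge0.
- by mf_tac.
- by apply: ae_all => x; apply: cvgMl; exact: cvg_nsin.
have mx : measurable_fun setT (fun x : R => `|x| * reg_dx f x) by mf_tac.
have eq x : `| `|x| * reg_dx f x| <= `|x * reg_dx f x| by rewrite !normrM normr_id.
by split; [exact: isL2_le mx eq a|exact: le_trans (nrm_le mx a eq) c].
Qed.

Lemma reg_dx_wt2 f : isL2 f -> isL2 (fun x => `|x| ^+ 2 * f x) ->
  isL2 (fun x => `|x| ^+ 2 * reg_dx f x) /\ nrm (fun x => `|x| ^+ 2 * reg_dx f x) <= 8 * (nrm (fun x => `|x| ^+ 2 * f x) + nrm f).
Proof.
move=> hf hw; have hk := reg_dx_L2 hf; have mk := isL2_mf hk; have mf := isL2_mf hf.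
pose F n (x : R) := (n.+1%:R ^+ 2 * (2 - 2 * cos (n.+1%:R^-1 * x))) * reg_dx f x.
have ms n : measurable_fun setT (fun x : R => sin (n.+1%:R^-1 * x)) by mf_tac.
have b n (x : R) : `|sin (n.+1%:R^-1 * x)| <= 1 by rewrite ler_norml sin_geN1 sin_le1.
have FE n : F n = (fun x => n.+1%:R ^+ 2 * ((2 - 2 * cos (n.+1%:R^-1 * x)) * reg_dx f x)) by apply/funext => x; rewrite /F mulrA.
have lF n : isL2 (F n) by rewrite FE; apply: isL2Z; exact: isL2_cos.
have lw : isL2 (fun x => `|f x| + `| `|x| ^+ 2 * f x|) by apply: isL2D; exact: isL2_norm.
(* The second difference of the symbol contributes [6 * nrm f]. The cross term involves a first
   moment, estimated by [|x| <= 1 + |x| ^+ 2], and brings the coefficient of [nrm f] to 8. *)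
have nF n : nrm (F n) <= 8 * (nrm (fun x => `|x| ^+ 2 * f x) + nrm f).
  rewrite FE (nrmZ _ (isL2_cos _ hk)) ger0_norm ?exprn_ge0//.
  apply: le_trans (ler_wpM2l _ (reg_dx_cos _ hf)) _; first by rewrite exprn_ge0.
  have n0 : 0 < n.+1%:R :> R by [].
  rewrite (ger0_norm _) ?invr_ge0//.
  have b1 : n.+1%:R ^+ 2 * nrm (fun x => (2 - 2 * cos (n.+1%:R^-1 * x)) * f x) <= nrm (fun x => `|x| ^+ 2 * f x).
    rewrite -[n.+1%:R ^+ 2]ger0_norm ?exprn_ge0// -(nrmZ _ (isL2_cos _ hf)).
    apply: nrm_le => //; first by mf_tac.
    by move=> x; rewrite mulrA normrM [X in _ <= X]normrM ler_wpM2r// [X in _ <= X]ger0_norm ?exprn_ge0//; exact: cos_dil.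
  have b2 : n.+1%:R * nrm (fun x => sin (n.+1%:R^-1 * x) * f x) <= nrm f + nrm (fun x => `|x| ^+ 2 * f x).
    have nz := nrmZ n.+1%:R (isL2_bnd (ms n) (b n) hf); rewrite normr_nat /= in nz; rewrite -nz.
    rewrite -(nrm_norm f) -(nrm_norm (fun x => `|x| ^+ 2 * f x)).
    apply: le_trans (nrmD (isL2_norm hf) (isL2_norm hw)).
    apply: nrm_le => //; first by mf_tac.
    move=> x; rewrite mulrA normrM [X in _ <= X]ger0_norm ?addr_ge0// [X in _ <= _ + X]normrM.
    rewrite -[X in _ <= X + _]mul1r -mulrDl ler_wpM2r//; apply: le_trans (sin_dil _ _) _.
    rewrite ger0_norm ?exprn_ge0//; have := sqr_ge0 (`|x| - 1); have := normr_ge0 x; nra.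
  rewrite !mulrDr.
  rewrite (_ : _ * (6 * _ * _) = 6 * nrm f); last by field; rewrite gt_eqF.
  rewrite (_ : _ * (2 * _ * _) = 2 * (n.+1%:R * nrm (fun x => sin (n.+1%:R^-1 * x) * f x))); last by field; rewrite gt_eqF.
  have := nrm_ge0 (fun x => `|x| ^+ 2 * f x); have := nrm_ge0 f.
  move: b1 b2; clear; set p := _ * nrm _; set q := n.+1%:R * nrm _; move: p q => p q; nlra.
have [||||a c] := @nrm_fatou R F (fun x => x ^+ 2 * reg_dx f x) (8 * (nrm (fun x => `|x| ^+ 2 * f x) + nrm f)) lF => //.
- by rewrite mulr_ge0// addr_ge0// nrm_ge0.
- by mf_tac.
- by apply: ae_all => x; apply: cvgMl; exact: cvg_ncos.
have e : (fun x => x ^+ 2 * reg_dx f x) = (fun x => `|x| ^+ 2 * reg_dx f x).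
  by apply/funext => x; rewrite real_normK ?num_real.
by rewrite e in a c.
Qed.

Variables (s : R) (r : nat).
Hypotheses (hs : 2^-1 < s) (hr : r = 1%N \/ r = 2%N).

Lemma reg_dx_X f : isX s r f -> [/\ isX s r (reg_dx f), nS s (reg_dx f) <= nS s f & nW r (reg_dx f) <= 8 * (nW r f + nrm f)].
Proof.
move=> [h1 h2 h3].
have [k1 e1] := reg_dxP h1.
have h2' := isL2_rigid rigid_opp h2.
have le : ae (fun x => `|ws s x * hart (reg_dx f) x| <= `|ws s (- x) * hart f (- x)|).
  apply: ae_mono e1 => x ->; rewrite !normrM wsN ler_wpM2l// normrN ler_piMl//; exact: symb_bnd.
have [a1 a2] := nrm_ae_le (mf_wshart s k1) h2' le.
have [b1 b2] : isL2 (fun x => wt r x * reg_dx f x) /\ nW r (reg_dx f) <= 8 * (nW r f + nrm f).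
  rewrite /nW /wt in h3 *; case: hr h3 => -> h3; last exact: reg_dx_wt2.
  have [c1 c2] := reg_dx_wt1 h1 h3; split=> //; apply: le_trans c2 _.
  by rewrite ler_peMl// ?ler1n// addr_ge0// nrm_ge0.
split; [by split; [exact: k1|exact: a1|exact: b1]| |exact: b2].
by rewrite /nS -(nrm_rigid rigid_opp h2).
Qed.

End regdx.

(** * Conservation of energy *)

Section energy.
Context {R : realType}.
Variables (s : R) (r : nat).
Hypotheses (hs : 2^-1 < s) (hr : r = 1%N \/ r = 2%N).
Local Notation X := (isX s r).
Implicit Types f g h : R -> R.

(** Its square [1 + |x|] cancels the denominator of [symb]: in this weighted pairing [reg_dx] acts
    as d_x. *)
Definition we (x : R) : R := Num.sqrt (1 + `|x|).
Definition nE f := nrm (fun x => we x * hart f x).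

Lemma we_sqr x : we x ^+ 2 = 1 + `|x|. Proof. by rewrite sqr_sqrtr// ltW// symb_den. Qed.
Lemma we_ge0 x : 0 <= we x. Proof. exact: sqrtr_ge0. Qed.
Lemma weN x : we (- x) = we x. Proof. by rewrite /we normrN. Qed.
Lemma mf_we : measurable_fun setT we. Proof. by rewrite /we; mf_tac. Qed.

Lemma pow_le_we (x : R) : (1 + x ^+ 2) `^ 2^-1 <= we x ^+ 2.
Proof.
rewrite we_sqr powR12_sqrt ?(ltW (one_sqr_gt0 x))// -[X in _ <= X](ger0_norm (ltW (symb_den x))) -sqrtr_sqr.
rewrite ler_wsqrtr// -[x ^+ 2]real_normK ?num_real//; have := normr_ge0 x; nra.
Qed.

Lemma we_le x : we x <= 2 * ws s x.
Proof.
have w1 : 1 <= ws s x by apply: ws_ge1; apply: le_trans (ltW hs).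
rewrite -(@ler_pXn2r _ 2) ?nnegrE ?we_ge0 ?mulr_ge0 ?(le_trans ler01 w1)//.
rewrite exprMn ws_sqr we_sqr.
have h1 : (1 + x ^+ 2) `^ 2^-1 <= (1 + x ^+ 2) `^ s by rewrite ler_powR ?one_sqr_ge1// ltW.
apply: le_trans (_ : 2 ^+ 2 * (1 + x ^+ 2) `^ 2^-1 <= _); last by rewrite ler_wpM2l.
rewrite powR12_sqrt ?(ltW (one_sqr_gt0 x))//.
set q := Num.sqrt _; have q0 : 0 <= q := sqrtr_ge0 _.
have q2 : q ^+ 2 = 1 + `|x| ^+ 2 by rewrite sqr_sqrtr ?(ltW (one_sqr_gt0 x))// real_normK ?num_real.
have a0 : 0 <= `|x| by [].
rewrite -(@ler_pXn2r _ 2) ?nnegrE ?addr_ge0 ?mulr_ge0// exprMn q2.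
move: (`|x|) a0 => a a0; nra.
Qed.

Lemma nE_le f : X f -> isL2 (fun x => we x * hart f x) /\ nE f <= 2 * nS s f.
Proof.
move=> hf; have hh := isX_hart hf; have mh := isL2_mf hh; have mw := mf_we.
have m : measurable_fun setT (fun x => we x * hart f x) by mf_tac.
have l2 : isL2 (fun x => 2 * (ws s x * hart f x)) by apply: isL2Z; case: hf.
have le x : `|we x * hart f x| <= `|2 * (ws s x * hart f x)|.
  rewrite mulrA normrM [X in _ <= X]normrM ler_wpM2r// !ger0_norm ?we_ge0 ?we_le//.
  by rewrite mulr_ge0// ltW// ws_gt0.
split; first exact: isL2_le m le l2.
apply: le_trans (nrm_le m l2 le) _; rewrite nrmZ ?ger0_norm//; by case: hf.
Qed.

Lemma isL2_we f : X f -> isL2 (fun x => we x * hart f x). Proof. by move=> /nE_le[]. Qed.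

(** A bound for the sup norm of [f (x + d) - f x] read off the transform. It tends to 0 with [d] by
    dominated convergence, which already makes the cube in [cubic_le] negligible. *)
Definition omega f (d : R) := J (fun y => `|hart f y| * Num.min 2 (`|d| * `|y|)).

Lemma mf_min2 (d : R) : measurable_fun setT (fun y : R => Num.min 2 (`|d| * `|y|)).
Proof. by apply: continuous_measurable_fun; apply: ctsW; apply: cts_min; cts_tac. Qed.

Lemma min2_bnd (a : R) : 0 <= a -> `|Num.min 2 a| <= 2.
Proof. by move=> a0; rewrite ger0_norm; [rewrite ge_min lexx|rewrite le_min a0 ler0n]. Qed.

Lemma omega_itg f (d : R) : X f -> itg (fun y => `|hart f y| * Num.min 2 (`|d| * `|y|)).
Proof.
move=> hf; have [i _] := isX_hart_itg hs hf; have mh := itg_mf i; have mm := mf_min2 d.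
apply: itg_le (itgZ 2 (itg_norm i)); first by mf_tac.
by move=> x; rewrite normrM normr_id mulrC ler_wpM2r// min2_bnd// mulr_ge0.
Qed.

Lemma cas_lip (a b : R) : `|cas a - cas b| <= 2 * Num.min 2 `|a - b|.
Proof.
rewrite minr_pMr// le_min; apply/andP; split.
  have := cas_bnd a; have := cas_bnd b => h1 h2.
  by apply: le_trans (ler_normB _ _) _; lra.
rewrite /cas (_ : _ - _ = (cos a - cos b) + (sin a - sin b)); last by ring.
have := cos_lip a b; have := sin_lip a b => h1 h2.
by apply: le_trans (ler_normD _ _) _; lra.
Qed.

Lemma shift_sup f (d : R) : X f -> ae (fun x => `|f (x + d) - f x| <= omega f d).
Proof.
move=> hf; have [i _] := isX_hart_itg hs hf; have hl := isX_L2 hf.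
have e := hart_inv hl i; have e' := ae_rigid (rigid_add d) e.
apply: ae_mono2 e e' => x -> ->.
have i1 := hart1_itg (x + d) i; have i2 := hart1_itg x i.
have k0 := @kap_gt0 R; have k2 := @kap_le R.
rewrite /hart1 -mulrBr normrM (gtr0_norm k0) -JB//.
have iw := omega_itg d hf.
have O0 : 0 <= omega f d by apply: J_ge0 => y; rewrite mulr_ge0// le_min ler0n mulr_ge0.
apply: le_trans (_ : kap * (2 * omega f d) <= _); last by rewrite mulrA ler_piMl.
rewrite ler_wpM2l ?(ltW k0)//; apply: le_trans (J_norm (itgB i1 i2)) _.
rewrite -JZ//; apply: J_le; [exact: itg_norm (itgB i1 i2)|exact: itgZ|] => y.
rewrite -mulrBr normrM mulrCA ler_wpM2l//; apply: le_trans (cas_lip _ _) _.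
by rewrite -mulrBr addrAC subrr add0r normrM [`|y| * _]mulrC.
Qed.

Lemma cvg_dinv (x : R) : (fun n : nat => `|n.+1%:R^-1| * `|x|) @ \oo --> (0 : R).
Proof.
apply: (@cvg_harm R _ _ `|x|) => n.
by rewrite subr0 normrM !normr_id (ger0_norm _) ?invr_ge0// mulrC.
Qed.

Lemma omega_cvg f : X f -> (fun n : nat => omega f n.+1%:R^-1) @ \oo --> (0 : R).
Proof.
move=> hf; have [i _] := isX_hart_itg hs hf; have mh := itg_mf i.
have [] := @J_dct R (fun n y => `|hart f y| * Num.min 2 (`|n.+1%:R^-1| * `|y|)) (fun=> 0) (fun y => 2 * `|hart f y|).
- by move=> n; have := mf_min2 n.+1%:R^-1 => ?; mf_tac.
- by mf_tac.
- by apply: itgZ; exact: itg_norm.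
- apply: ae_all => y; rewrite -[X in _ --> X](mulr0 `|hart f y|); apply: cvgMr.
  have m0 : Num.min 2 0 = 0 :> R by rewrite min_r.
  rewrite -[X in _ --> X]m0.
  apply: (@cvg_comp _ _ _ (fun n : nat => `|n.+1%:R^-1| * `|y|) (fun t => Num.min (2:R) t) _ _ _ (cvg_dinv y)).
  exact: (@cts_min R (fun=> 2 : R) id (@cts_cst R 2) (@cts_id R) 0).
- by move=> n x; rewrite normrM normr_id mulrC ler_wpM2r// min2_bnd// mulr_ge0.
by rewrite J0.
Qed.

(** On the transform side the increment has coefficients [cos (d * x) - 1] and [sin (d * x)]. They
    are bounded and at most [d * |x|], so their squares are O(d * |x|): the energy, with half a
    derivative, controls them. *)
Lemma shift_nrm f (d : R) : X f -> 0 <= d -> nrm (fun x => f (x + d) - f x) ^+ 2 <= 6 * d * nE f ^+ 2.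
Proof.
have aux1 (a b : R) : 1 - a <= b -> a <= 1 -> -1 <= a -> (a - 1) ^+ 2 <= 2 * b by nra.
have aux2 (a b : R) : - b <= a -> a <= b -> a <= 1 -> -1 <= a -> a ^+ 2 <= b by nra.
have aux3 (e t a b A B : R) : 0 <= e -> 0 <= a -> 0 <= b -> A ^+ 2 <= 2 * (e * t) * a -> B ^+ 2 <= e * t * b ->
    (A - B) ^+ 2 <= 4 * e * ((1 + t) * a) + 2 * e * ((1 + t) * b).
  move=> e0 a0 b0 hA hB; have := sqr_ge0 (A + B); have := mulr_ge0 e0 a0; have := mulr_ge0 e0 b0; nra.
move=> hf d0; have hl := isX_L2 hf; have hh := hart_L2 hl; have hd := isL2_rigid (rigid_add d) hl.
have lw := isL2_we hf; have lw' := isL2_rigid rigid_opp lw.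
have hB := isL2B hd hl.
rewrite -(hart_isom hB) nrm_sqr.
have i1 := isL2_sq lw; have i2 := isL2_sq lw'.
have ic : itg (fun x => 4 * d * (we x * hart f x) ^+ 2 + 2 * d * (we (- x) * hart f (- x)) ^+ 2).
  by apply: itgD; exact: itgZ.
have mh := isL2_mf hh; have mh' := isL2_mf (isL2_rigid rigid_opp hh).
have mBh := isL2_mf (hart_L2 hB).
pose k x := (cos (d * x) - 1) * hart f x - sin (d * x) * hart f (- x).
have mk : measurable_fun setT k by rewrite /k; mf_tac.
have ek : ae (fun x => hart (fun x => f (x + d) - f x) x = k x).
  apply: ae_mono2 (hartB hd hl) (hart_shift d hl) => x -> ->; rewrite /k; ring.
rewrite (J_ae (g := fun x => k x ^+ 2)); [|by mf_tac|by mf_tac|by apply: ae_mono ek => x ->].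
have le x : k x ^+ 2 <= 4 * d * (we x * hart f x) ^+ 2 + 2 * d * (we (- x) * hart f (- x)) ^+ 2.
  rewrite !exprMn !we_sqr normrN /k.
  have y0 : 0 <= d * `|x| by rewrite mulr_ge0.
  have c1 : `|1 - cos (d * x)| <= d * `|x|.
    by have := cos_lip 0 (d * x); rewrite cos0 sub0r normrN normrM (ger0_norm d0).
  have s1 : `|sin (d * x)| <= d * `|x| by have := sin_le_norm (d * x); rewrite normrM (ger0_norm d0).
  have c2 : (cos (d * x) - 1) ^+ 2 <= 2 * (d * `|x|).
    by move: c1; rewrite ler_norml => /andP[_ c1]; apply: aux1; rewrite ?cos_geN1 ?cos_le1.
  have s2 : sin (d * x) ^+ 2 <= d * `|x|.
    by move: s1; rewrite ler_norml => /andP[s1 s1']; apply: aux2; rewrite ?sin_geN1 ?sin_le1.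
  have h2 : 0 <= hart f x ^+ 2 := sqr_ge0 _; have h3 : 0 <= hart f (- x) ^+ 2 := sqr_ge0 _.
  have q1 := ler_wpM2r h2 c2; have q2 := ler_wpM2r h3 s2.
  rewrite -exprMn in q1; rewrite -exprMn in q2.
  exact: aux3 d0 h2 h3 q1 q2.
have ik : itg (fun x => k x ^+ 2).
  by apply: itg_le ic; [mf_tac|move=> x; rewrite ger0_norm ?sqr_ge0].
apply: le_trans (J_le ik ic le) _; rewrite JD; [|exact: itgZ|exact: itgZ].
rewrite !JZ// (J_rigid rigid_opp i1) -nrm_sqr -/(nE f).
by rewrite le_eqVlt; apply/orP; left; apply/eqP; ring.
Qed.

(* With g = f(. + d): 3 int (f g^2 - g f^2) = - int (g - f)^3, because f^3 and g^3
   have the same integral. The cube is o(d), as |g - f| is uniformly small and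
   its square has integral O(d). *)
Lemma sin_cubic f (d : R) : X f ->
  J (fun x => sin (d * x) * (hart f x * hart (fun y => f y ^+ 2) (- x))) =
  6^-1 * J (fun x => (f (x + d) - f x) ^+ 3).
Proof.
move=> hf; have hl := isX_L2 hf.
have [Xp _] := nS_mul hs hr hf hf.
have pE : (fun x => f x * f x) = (fun x => f x ^+ 2) by apply/funext => x; rewrite expr2.
rewrite pE in Xp; set p := (fun y => f y ^+ 2) in Xp *.
have pl := isX_L2 Xp; have ql := hart_L2 pl; have hh := hart_L2 hl.
have p1 := isL2_rigid (rigid_add d) pl; have p2 := isL2_rigid (rigid_add (- d)) pl.
have f1 := isL2_rigid (rigid_add d) hl.
have hd := isL2B p1 p2.
have ql' := isL2_rigid rigid_opp ql.
have mh := isL2_mf hh; have mq' := isL2_mf ql'.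
have i0 : itg (fun x => sin (d * x) * (hart f x * hart p (- x))).
  apply: itg_le (itg_norm (itgM hh ql')); first by mf_tac.
  by move=> x; rewrite normrM ler_piMl// ler_norml sin_geN1 sin_le1.
(* The shifts by [d] and [- d] share their cosine part, so their difference has the pure symbol
   [- 2 * sin (d * x)] applied to the reflected transform. *)
have e1 : ip (hart f) (hart (fun x => p (x + d) - p (x + - d))) =
    - 2 * J (fun x => sin (d * x) * (hart f x * hart p (- x))).
  rewrite -JZ// /ip; apply: J_ae; [by have := isL2_mf (hart_L2 hd) => ?; mf_tac|by mf_tac|].
  apply: ae_mono2 (hartB p1 p2) (ae_and (hart_shift d pl) (hart_shift (- d) pl)) => x -> [-> ->].
  by rewrite mulNr cosN sinN; ring.
rewrite hart_ip// in e1.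
have g1 : itg (fun x => f x * p (x + d)) := itgM hl p1.
have g2 : itg (fun x => f x * p (x + - d)) := itgM hl p2.
have g3 : itg (fun x => f (x + d) * p x) := itgM f1 pl.
have g4 : itg (fun x => f x * p x) := itgM hl pl.
have g5 : itg (fun x => f (x + d) * p (x + d)) := itgM f1 p1.
have e2 : ip f (fun x => p (x + d) - p (x + - d)) = J (fun x => f x * p (x + d)) - J (fun x => f (x + d) * p x).
  rewrite ipB// /ip -(J_rigid (rigid_add d) g2); congr (_ - Rintegral _ _ _); apply/funext => x.
  by rewrite addrK.
have e3 : J (fun x => (f (x + d) - f x) ^+ 3) = - 3 * (J (fun x => f x * p (x + d)) - J (fun x => f (x + d) * p x)).
  rewrite [X in Rintegral _ _ X](_ : _ = (fun x => (f (x + d) * p (x + d) - f x * p x) + (-3 * (f x * p (x + d)) + 3 * (f (x + d) * p x)))); last first.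
    by apply/funext => x; rewrite /p; ring.
  rewrite JD; [|exact: itgB|by apply: itgD; exact: itgZ].
  rewrite JB// JD; [|exact: itgZ|exact: itgZ].
  by rewrite !JZ// (J_rigid (rigid_add d) g4); ring.
by rewrite e3 -e2 e1; field.
Qed.

Lemma cubic_le f (d : R) : X f -> 0 <= d ->
  `|J (fun x => (f (x + d) - f x) ^+ 3)| <= omega f d * (6 * d * nE f ^+ 2).
Proof.
move=> hf d0; have hl := isX_L2 hf.
have hB := isL2B (isL2_rigid (rigid_add d) hl) hl.
set g := (fun x => f (x + d) - f x) in hB.
have mg := isL2_mf hB.
have O0 : 0 <= omega f d by apply: J_ge0 => y; rewrite mulr_ge0// le_min ler0n mulr_ge0.
have [l n] : isL2 (fun x => g x * g x) /\ nrm (fun x => g x * g x) <= nrm (fun x => omega f d * g x).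
  apply: nrm_ae_le; [mf_tac|exact: isL2Z|].
  by apply: ae_mono (shift_sup d hf) => x h; rewrite !normrM ler_wpM2r// (ger0_norm O0).
rewrite nrmZ// (ger0_norm O0) in n.
rewrite [X in Rintegral _ _ X](_ : _ = (fun x => g x * (g x * g x))); last by apply/funext => x; rewrite /g; ring.
apply: le_trans (ip_le hB l) _.
apply: le_trans (ler_wpM2l (nrm_ge0 _) n) _.
rewrite mulrCA ler_wpM2l// -expr2; exact: shift_nrm.
Qed.

Lemma weM_ge f g x : X f -> X g -> `|x * (hart f x * hart g (- x))| <= `|we x * hart f x| * `|we (- x) * hart g (- x)|.
Proof.
move=> hf hg; rewrite !normrM weN mulrACA ler_wpM2r ?mulr_ge0//.
by rewrite -expr2 -normrX we_sqr [X in _ <= X]ger0_norm ?(ltW (symb_den x))// lerDr.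
Qed.

Lemma itg_xi f g : X f -> X g -> itg (fun x => x * (hart f x * hart g (- x))).
Proof.
move=> hf hg; have lf := isL2_norm (isL2_we hf); have lg := isL2_norm (isL2_rigid rigid_opp (isL2_we hg)).
have mf := isL2_mf (isX_hart hf); have mg := isL2_mf (isL2_rigid rigid_opp (isX_hart hg)).
by apply: itg_le (itgM lf lg); [mf_tac|move=> x; exact: weM_ge].
Qed.

(** [x] is the limit of [(n + 1) * sin (x / (n + 1))], with domination by the two energy densities.
    By [sin_cubic] the approximants are [n + 1] times a cubic integral, which is o(1 / (n + 1)) by
    [cubic_le] and [omega_cvg]. *)
Lemma energy_cubic f : X f -> J (fun x => x * (hart f x * hart (fun y => f y ^+ 2) (- x))) = 0.
Proof.
move=> hf.
have [Xp _] := nS_mul hs hr hf hf.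
have pE : (fun x => f x * f x) = (fun x => f x ^+ 2) by apply/funext => x; rewrite expr2.
rewrite pE in Xp; set p := (fun y => f y ^+ 2) in Xp *.
pose F n (x : R) := (n.+1%:R * sin (n.+1%:R^-1 * x)) * (hart f x * hart p (- x)).
have lf := isL2_norm (isL2_we hf); have lg := isL2_norm (isL2_rigid rigid_opp (isL2_we Xp)).
have mf := isL2_mf (isX_hart hf); have mg := isL2_mf (isL2_rigid rigid_opp (isX_hart Xp)).
have [_ c] : itg (fun x => x * (hart f x * hart p (- x))) /\ (J (F n) @[n --> \oo] --> J (fun x => x * (hart f x * hart p (- x)))).
  apply: J_dct (itgM lf lg) _ _.
  - by move=> n; rewrite /F; mf_tac.
  - by mf_tac.
  - by apply: ae_all => x; apply: cvgMl; exact: cvg_nsin.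
  - move=> n x; apply: le_trans (weM_ge x hf Xp); rewrite /F normrM [X in _ <= X]normrM ler_wpM2r//.
    exact: sin_dil.
have c0 : J (F n) @[n --> \oo] --> (0 : R).
  have c1 : (fun n : nat => omega f n.+1%:R^-1 * nE f ^+ 2) @ \oo --> (0 : R).
    by rewrite -[X in _ --> X](mul0r (nE f ^+ 2)); apply: cvgMl; exact: omega_cvg.
  apply/cvgrPdist_le => e e0; have /cvgr0_norm_le/(_ _ e0) := c1; apply: filterS => n hn.
  rewrite sub0r normrN; apply: le_trans hn.
  have n0 : 0 < n.+1%:R :> R by [].
  have i : itg (fun x => sin (n.+1%:R^-1 * x) * (hart f x * hart p (- x))).
    apply: itg_le (itg_norm (itgM (isX_hart hf) (isL2_rigid rigid_opp (isX_hart Xp)))); first by mf_tac.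
    by move=> x; rewrite normrM ler_piMl// ler_norml sin_geN1 sin_le1.
  rewrite [X in Rintegral _ _ X](_ : _ = (fun x => n.+1%:R * (sin (n.+1%:R^-1 * x) * (hart f x * hart p (- x))))); last first.
    by apply/funext => x; rewrite /F -mulrA.
  rewrite JZ// sin_cubic// normrM normr_nat normrM (ger0_norm _) ?invr_ge0//.
  have di : 0 <= n.+1%:R^-1 :> R by rewrite invr_ge0.
  apply: le_trans (_ : n.+1%:R * (6^-1 * (omega f n.+1%:R^-1 * (6 * n.+1%:R^-1 * nE f ^+ 2))) <= _).
    by rewrite ler_wpM2l// ler_wpM2l ?invr_ge0//; exact: cubic_le.
  apply: le_trans (ler_norm _).
  by rewrite le_eqVlt; apply/orP; left; apply/eqP; field; rewrite gt_eqF.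
exact: (cvg_unique (@Rhausdorff R) c c0).
Qed.

Lemma energy_quad f : X f -> J (fun x => x * (hart f x * hart f (- x))) = 0.
Proof.
move=> hf; apply: J_odd; last exact: itg_xi.
by move=> x; rewrite opprK; ring.
Qed.

(** The linear part gives an odd integrand and the quadratic part vanishes by [energy_cubic]. The
    coefficient [c] is arbitrary, so the truncated fields conserve the energy as well. *)
Lemma energy_orth f (c : R) : X f ->
  ip (fun x => we x * hart f x) (fun x => we x * hart (reg_dx (fun y => f y + c * f y ^+ 2)) x) = 0.
Proof.
move=> hf.
have [Xp _] := nS_mul hs hr hf hf.
have pE : (fun x => f x * f x) = (fun x => f x ^+ 2) by apply/funext => x; rewrite expr2.
rewrite pE in Xp; have Xcp := isXZ c Xp; have Xg := isXD hf Xcp.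
have [k1 e1] := reg_dxP (isX_L2 Xg).
have mf := isL2_mf (isX_hart hf); have mw := mf_we; have mk := isL2_mf (hart_L2 k1).
have mf' := isL2_mf (isL2_rigid rigid_opp (isX_hart hf)); have mp' := isL2_mf (isL2_rigid rigid_opp (isX_hart Xp)).
have i1 := itg_xi hf hf; have i2 := itg_xi hf Xp.
have E : ip (fun x => we x * hart f x) (fun x => we x * hart (reg_dx (fun y => f y + c * f y ^+ 2)) x) =
  J (fun x => -1 * (x * (hart f x * hart f (- x))) + - c * (x * (hart f x * hart (fun y => f y ^+ 2) (- x)))).
  apply: J_ae; [mf_tac|mf_tac|].
  have a1 := ae_rigid rigid_opp (hartD (isX_L2 hf) (isX_L2 Xcp)).
  have a2 := ae_rigid rigid_opp (hartZ c (isX_L2 Xp)).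
  apply: ae_mono2 e1 (ae_and a1 a2) => x -> [-> ->].
  rewrite mulrACA -expr2 we_sqr /symb; field.
  by rewrite gt_eqF// symb_den.
by rewrite E (JD (itgZ _ i1) (itgZ _ i2)) (JZ _ i1) (JZ _ i2) energy_quad// energy_cubic// !mulr0 addr0.
Qed.

Definition sg : R := Num.min 1 (2 * s - 1).

Lemma sg_gt0 : 0 < sg.
Proof. by rewrite /sg lt_min ltr01 subr_gt0 -ltr_pdivrMl// mulr1. Qed.

(* Interpolation between H^(1/2) and H^s with exponent depending on [nS f]. *)
Lemma brezis_gallouet f : X f ->
  nA f ^+ 2 <= 20 / sg * (expR 1 * nE f ^+ 2 + 1) * (1 + ln (1 + nS s f)).
Proof.
have aux1 (b l : R) : 1 < b / 2 * l -> 2 < l * b by lra.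
have aux2 (b t l m : R) : 2 * (2 * (1 + m)) - 2 <= (2 * t - 1 - b) * l -> 0 <= m ->
  b / 2 * l + 2^-1 * l <= - (m * 2) + t * l by lra.
move=> hf; have y0 := nS_ge0 s f; set y := nS s f in y0 *.
have l0 : 0 <= ln (1 + y) by rewrite ln_ge0// lerDl.
have g0 := sg_gt0.
(* The constant [10 / b] of [J_le_pow] turns into [20 / sg] times the logarithmic factor, while [b]
   remains at most [sg]. *)
pose b := sg / (2 * (1 + ln (1 + y))).
have D0 : 0 < 2 * (1 + ln (1 + y)) by rewrite mulr_gt0// ltr_wpDr.
have b0 : 0 < b by rewrite divr_gt0.
have b1 : b <= sg by rewrite /b ler_pdivrMr// ler_peMr ?(ltW g0)//; lra.
have b2 : 0 < b <= 1 by rewrite b0 (le_trans b1)// ge_min lexx.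
have gs : sg <= 2 * s - 1 by rewrite ge_min lexx orbT.
have mh := isL2_mf (isX_hart hf).
have lw := isL2_we hf; have lS : isL2 (fun x => ws s x * hart f x) by case: hf.
set k := (fun x : R => expR ((1 + b) / 4 * ln (1 + x ^+ 2)) * hart f x).
have mk : measurable_fun setT k.
  apply: mfM => //; apply: continuous_measurable_fun; exact: cts_pow.
have iB : itg (fun x => expR 1 * (we x * hart f x) ^+ 2 + (1 + y) ^- 2 * (ws s x * hart f x) ^+ 2).
  by apply: itgD; apply: itgZ; exact: isL2_sq.
have y10 : 0 < 1 + y by rewrite ltr_wpDr.
have le x : k x ^+ 2 <= expR 1 * (we x * hart f x) ^+ 2 + (1 + y) ^- 2 * (ws s x * hart f x) ^+ 2.
  rewrite [X in _ <= X](_ : _ = (expR 1 * we x ^+ 2 + (1 + y) ^- 2 * ws s x ^+ 2) * hart f x ^+ 2); last by ring.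
  rewrite /k exprMn ws_sqr ler_wpM2r ?sqr_ge0//.
  have q1 := one_sqr_ge1 x; have q0 := one_sqr_gt0 x; have pw := pow_le_we x.
  rewrite -expRM_natr; set q := 1 + x ^+ 2 in q1 q0 pw *.
  have L0 : 0 <= ln q by rewrite ln_ge0.
  rewrite (_ : (1 + b) / 4 * ln q * 2 = b / 2 * ln q + 2^-1 * ln q); last by field.
  rewrite expRD.
  rewrite /powR gt_eqF// in pw *.
  (* Low frequencies: the excess factor over the energy weight is at most e. High frequencies: the
     spare Sobolev exponent yields the factor [(1 + y) ^- 2], which compensates the size [y] of
     [nS f]. *)
  have [h|h] := leP (b / 2 * ln q) 1.
    apply: ler_wpDr; first by rewrite mulr_ge0 ?expR_ge0// invr_ge0 exprn_ge0// ltW.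
    by apply: ler_pM; rewrite ?expR_ge0// ler_expR.
  apply: ler_wpDl; first by rewrite mulr_ge0 ?expR_ge0 ?sqr_ge0.
  rewrite -{1}[1 + y]lnK ?posrE// -expRM_natr -expRN -!expRD ler_expR.
  have Lb : 2 / b < ln q by rewrite ltr_pdivrMr//; exact: aux1.
  have bE : b * (2 * (1 + ln (1 + y))) = sg by rewrite /b mulfVK// gt_eqF.
  have : (2 * s - 1 - b) * (2 / b) <= (2 * s - 1 - b) * ln q.
    by rewrite ler_wpM2l ?(ltW Lb)// subr_ge0 (le_trans b1).
  have : (2 * s - 1 - b) * (2 / b) >= (sg - b) * (2 / b).
    by rewrite ler_wpM2r ?lerB// divr_ge0// ltW.
  have -> : (sg - b) * (2 / b) = 2 * (2 * (1 + ln (1 + y))) - 2 by rewrite -bE; field; rewrite gt_eqF.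
  by move=> z1 z2; exact: (aux2 _ _ _ _ (le_trans z1 z2) l0).
have ik : itg (fun x => k x ^+ 2).
  by apply: itg_le iB; [mf_tac|move=> x; rewrite ger0_norm ?sqr_ge0].
have nk : nrm k ^+ 2 <= expR 1 * nE f ^+ 2 + 1.
  rewrite nrm_sqr; apply: le_trans (J_le ik iB le) _; rewrite JD ?JZ; try exact: isL2_sq; try by apply: itgZ; exact: isL2_sq.
  rewrite -!nrm_sqr -/(nE f) -/(nS s f) -/y lerD2l mulrC ler_pdivrMr ?exprn_gt0// mul1r.
  by rewrite ler_pXn2r ?nnegrE ?(ltW y10)// lerDr.
have [_ h] := J_le_pow b2 mh (conj mk ik).
apply: le_trans h _; rewrite -/k.
apply: le_trans (ler_wpM2l _ nk) _; first by rewrite divr_ge0// ltW.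
rewrite le_eqVlt; apply/orP; left; apply/eqP; rewrite /b; field.
by rewrite !gt_eqF//; lra.
Qed.

End energy.

(** * The flow *)

Section partitions.
Context {R : realType}.

Lemma le_harm (a b C : R) : (forall n : nat, a <= b + C * n.+1%:R^-1) -> a <= b.
Proof.
move=> h.
have c : (fun n : nat => b + C * n.+1%:R^-1) @ \oo --> b + C * 0.
  by apply: cvgD; [exact: cvg_cst|apply: cvgMr; exact: cvg_harmonic].
rewrite mulr0 addr0 in c.
rewrite -(cvg_lim (@Rhausdorff R) c); apply: limr_ge; first by apply/cvg_ex; exists b.
exact: nearW.
Qed.

(* Summing over a uniform partition makes the quadratic remainders vanish. *)
Lemma partition_growth (f : R -> R) (K C T : R) : 0 <= T ->
  (forall t t', 0 <= t -> t <= t' -> t' <= T -> f t' <= f t + K * (t' - t) + C * (t' - t) ^+ 2) ->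
  f T <= f 0 + K * T.
Proof.
move=> T0 hf; apply: (@le_harm _ _ (C * T ^+ 2)) => n.
have n0 : 0 < n.+1%:R :> R by [].
pose h := T / n.+1%:R; have h0 : 0 <= h by rewrite divr_ge0.
have hT : n.+1%:R * h = T by rewrite /h mulrCA divff ?mulr1// gt_eqF.
have H k : (k <= n.+1)%N -> f (k%:R * h) <= f 0 + K * (k%:R * h) + k%:R * (C * h ^+ 2).
  elim: k => [|k IH] kn; first by rewrite !mul0r mulr0 !addr0.
  have a0 : 0 <= k%:R * h by rewrite mulr_ge0.
  have a1 : k%:R * h <= k.+1%:R * h by rewrite ler_wpM2r// ler_nat.
  have a2 : k.+1%:R * h <= T by rewrite -hT ler_wpM2r// ler_nat.
  apply: le_trans (hf _ _ a0 a1 a2) _.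
  have e : k.+1%:R * h - k%:R * h = h by rewrite -natr1; ring.
  rewrite e; apply: le_trans (lerD (lerD (IH (ltnW kn)) (lexx _)) (lexx _)) _.
  by rewrite -natr1 le_eqVlt; apply/orP; left; apply/eqP; ring.
have := H n.+1 (leqnn _); rewrite hT => q; apply: le_trans q _.
rewrite lerD2l le_eqVlt; apply/orP; left; apply/eqP; rewrite /h; field.
by rewrite gt_eqF.
Qed.

Lemma quad_const (f : R -> R) (C T : R) : 0 <= T ->
  (forall t t', 0 <= t -> t <= t' -> t' <= T -> `|f t' - f t| <= C * (t' - t) ^+ 2) -> f T = f 0.
Proof.
move=> T0 hf; apply/eqP; rewrite eq_le; apply/andP; split.
  have := @partition_growth f 0 C T T0; rewrite mul0r addr0; apply => t t' t0 tt' t'T.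
  have := hf t t' t0 tt' t'T; rewrite ler_norml mul0r addr0 => /andP[_]; lra.
have := @partition_growth (fun t => - f t) 0 C T T0; rewrite mul0r addr0 lerN2; apply => t t' t0 tt' t'T.
have := hf t t' t0 tt' t'T; rewrite ler_norml mul0r addr0 => /andP[]; lra.
Qed.

(** Multiplication by [expR (- (L * t))] removes the linear term and leaves a quadratic remainder,
    to which [partition_growth] applies. *)
Lemma gronwall0 (f : R -> R) (L C T : R) : 0 <= T -> 0 <= L -> 0 <= C -> (forall t, 0 <= f t) -> f 0 = 0 ->
  (forall t t', 0 <= t -> t <= t' -> t' <= T -> f t' <= (1 + L * (t' - t)) * f t + C * (t' - t) ^+ 2) ->
  f T = 0.
Proof.
move=> T0 L0 C0 f0 f00 hf.
have := @partition_growth (fun t => expR (- (L * t)) * f t) 0 C T T0.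
rewrite f00 mulr0 mul0r addr0 => h.
apply/eqP; rewrite eq_le f0 andbT -(pmulr_rle0 _ (expR_gt0 (- (L * T)))); apply: h => t t' t0 tt' t'T.
rewrite mul0r addr0; apply: le_trans (ler_wpM2l (expR_ge0 _) (hf t t' t0 tt' t'T)) _.
rewrite mulrDr; apply: lerD.
  rewrite mulrA ler_wpM2r// (_ : - (L * t') = - (L * t) + - (L * (t' - t))); last by ring.
  rewrite expRD -mulrA ler_piMr ?expR_ge0// expRN mulrC ler_pdivrMr ?expR_gt0// mul1r.
  exact: expR_ge1Dx.
apply: ler_piMl; first by rewrite mulr_ge0// sqr_ge0.
by rewrite -expR0 ler_expR oppr_le0 mulr_ge0// (le_trans t0).
Qed.

Lemma ln1_sub_le (y y' : R) : 0 <= y -> 0 <= y' -> ln (1 + y') - ln (1 + y) <= (y' - y) / (1 + y).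
Proof.
move=> y0 y0'; have p : 0 < 1 + y by rewrite ltr_wpDr.
have p' : 0 < 1 + y' by rewrite ltr_wpDr.
rewrite -ln_div ?posrE// (_ : (1 + y') / (1 + y) = 1 + (y' - y) / (1 + y)); last by field; rewrite gt_eqF.
apply: le_ln1Dx; rewrite ltr_pdivlMr//; lra.
Qed.

(** By concavity of the logarithm, [ln (1 + f)] grows at most linearly; division by [1 + f t], which
    is at least 1, does not enlarge the quadratic remainder. *)
Lemma ln_growth (f : R -> R) (K C T : R) : 0 <= T -> 0 <= C -> (forall t, 0 <= f t) ->
  (forall t t', 0 <= t -> t <= t' -> t' <= T -> f t' <= f t + (t' - t) * (K * (1 + f t)) + C * (t' - t) ^+ 2) ->
  f T <= expR (ln (1 + f 0) + K * T).
Proof.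
move=> T0 C0 f0 hf.
have p t : 0 < 1 + f t by rewrite ltr_wpDr.
apply: (@le_trans _ _ (1 + f T)); first by rewrite lerDr.
rewrite -{1}[1 + f T]lnK ?posrE// ler_expR.
apply: (@partition_growth (fun t => ln (1 + f t)) K C T T0) => t t' t0 tt' t'T.
have h := ln1_sub_le (f0 t) (f0 t'); have q := hf t t' t0 tt' t'T.
rewrite -addrA -lerBlDl; apply: le_trans h _; rewrite ler_pdivrMr//.
have : C * (t' - t) ^+ 2 <= C * (t' - t) ^+ 2 * (1 + f t) by apply: ler_peMr; [rewrite mulr_ge0// sqr_ge0|rewrite lerDl].
rewrite mulrDl; have -> : K * (t' - t) * (1 + f t) = (t' - t) * (K * (1 + f t)) by ring.
lra.
Qed.

(** The same division shows that [ln (1 + f)] satisfies the hypothesis of [ln_growth]. The model is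
    y' = K y ln y, with doubly exponential solutions. *)
Lemma lnln_growth (f : R -> R) (K C T : R) : 0 <= T -> 0 <= C -> (forall t, 0 <= f t) ->
  (forall t t', 0 <= t -> t <= t' -> t' <= T ->
     f t' <= f t + (t' - t) * (K * ((1 + f t) * (1 + ln (1 + f t)))) + C * (t' - t) ^+ 2) ->
  f T <= expR (expR (ln (1 + ln (1 + f 0)) + K * T)).
Proof.
move=> T0 C0 f0 hf.
have p t : 0 < 1 + f t by rewrite ltr_wpDr.
have l0 t : 0 <= ln (1 + f t) by rewrite ln_ge0// lerDl.
apply: (@le_trans _ _ (1 + f T)); first by rewrite lerDr.
rewrite -{1}[1 + f T]lnK ?posrE// ler_expR.
apply: (@ln_growth (fun t => ln (1 + f t)) K C T T0 C0 l0) => t t' t0 tt' t'T.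
have h := ln1_sub_le (f0 t) (f0 t'); have q := hf t t' t0 tt' t'T.
rewrite -addrA -lerBlDl; apply: le_trans h _; rewrite ler_pdivrMr//.
have : C * (t' - t) ^+ 2 <= C * (t' - t) ^+ 2 * (1 + f t) by apply: ler_peMr; [rewrite mulr_ge0// sqr_ge0|rewrite lerDl].
rewrite mulrDl.
have -> : (t' - t) * (K * (1 + ln (1 + f t))) * (1 + f t) = (t' - t) * (K * ((1 + f t) * (1 + ln (1 + f t)))) by ring.
lra.
Qed.

End partitions.

(** * The vector field, its truncation and the global flow *)

Section field.
Context {R : realType}.
Local Opaque nrm ip hart isL2 reg_dx.
Variables (s : R) (r : nat).
Hypotheses (hs : 2^-1 < s) (hr : r = 1%N \/ r = 2%N).
Local Notation X := (isX s r).
Local Notation N := (nX s r).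
Local Notation nS := (nS s).
Local Notation nW := (nW r).
Implicit Types (f g h : R -> R) (u v : R -> R -> R).

(** The equation is the case [c = 1/2]. The coefficient is a parameter because truncating amounts to
    lowering it. *)
Definition field (c : R) f (x : R) : R := -1 * reg_dx (fun y => f y + c * f y ^+ 2) x.

Definition cM : R := 4 `^ (s / 2) * 4.
Lemma cM_ge0 : 0 <= cM. Proof. by rewrite mulr_ge0// powR_ge0. Qed.

Lemma X_sqr f : X f -> X (fun x => f x ^+ 2).
Proof.
by move=> hf; have [] := nS_mul hs hr hf hf; rewrite (_ : (fun x => f x * f x) = (fun x => f x ^+ 2))//; apply/funext => x; rewrite expr2.
Qed.

Lemma X_arg c f : X f -> X (fun y => f y + c * f y ^+ 2).
Proof. by move=> hf; exact: isXD hf (isXZ c (X_sqr hf)). Qed.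

Lemma X_field c f : X f -> X (field c f).
Proof. by move=> hf; apply: isXZ; have [] := reg_dx_X hr (X_arg c hf). Qed.

Lemma sqrE f : (fun x => f x ^+ 2) = (fun x => f x * f x).
Proof. by apply/funext => x; rewrite expr2. Qed.

Lemma field_S c f : X f -> 0 <= c <= 2^-1 -> nS (field c f) <= nS f * (1 + cM * nA f).
Proof.
move=> hf /andP[c0 c1]; have [Xk kS _] := reg_dx_X hr (X_arg c hf).
rewrite /field (nSZ _ Xk) normrN1 mul1r; apply: le_trans kS _.
have X2 := X_sqr hf; apply: le_trans (nSD hf (isXZ c X2)) _; rewrite mulrDr mulr1 lerD2l.
rewrite (nSZ _ X2) (ger0_norm c0) sqrE; have [_ m] := nS_mul hs hr hf hf; rewrite -/cM in m.
have a0 := nS_ge0 s f; have b0 := nA_ge0 f; have m0 := cM_ge0.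
have P : 0 <= cM * (nS f * nA f) by rewrite !mulr_ge0.
apply: le_trans (ler_wpM2l c0 m) _.
rewrite [X in X <= _](_ : _ = c * (2 * (cM * (nS f * nA f)))); last by ring.
rewrite [X in _ <= X](_ : _ = 2^-1 * (2 * (cM * (nS f * nA f)))); last by field.
by rewrite ler_wpM2r// mulr_ge0.
Qed.

Lemma field_W c f : X f -> 0 <= c <= 2^-1 -> nW (field c f) <= 8 * ((1 + nA f) * (nW f + nS f)).
Proof.
move=> hf /andP[c0 c1]; have [Xk _ kW] := reg_dx_X hr (X_arg c hf).
rewrite /field (nWZ _ Xk) normrN1 mul1r; apply: le_trans kW _; rewrite ler_wpM2l//.
have X2 := X_sqr hf; have Xc := isXZ c X2.
have c11 : c <= 1 by lra.
have A0 := nA_ge0 f.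
rewrite mulrDr; apply: lerD.
  apply: le_trans (nWD hf Xc) _; rewrite mulrDl mul1r lerD2l (nWZ _ X2) (ger0_norm c0) sqrE.
  have [_ m] := nW_mul hs hf hf; apply: le_trans (ler_wpM2l c0 m) _.
  by rewrite ler_piMl// mulr_ge0// nW_ge0.
have [l m] := isL2_nA hs hf (isX_L2 hf); rewrite -sqrE in l m.
apply: le_trans (nrmD (isX_L2 hf) (isL2Z c l)) _; rewrite (nrmZ _ l) (ger0_norm c0) mulrDl mul1r.
have nn := nrm_nS hs hf.
apply: lerD => //; apply: le_trans (ler_wpM2l c0 m) _.
apply: le_trans (_ : nA f * nrm f <= _); first by rewrite ler_piMl// mulr_ge0// nrm_ge0.
by rewrite ler_wpM2l.
Qed.

Definition cP : R := (2 * cM + 1) * cA s.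
Lemma cP_ge0 : 0 <= cP.
Proof. by rewrite mulr_ge0 ?cA_ge0// addr_ge0// mulr_ge0// cM_ge0. Qed.

Lemma N_mul f g : X f -> X g -> X (fun x => f x * g x) /\ N (fun x => f x * g x) <= cP * (N f * N g).
Proof.
move=> hf hg; have [h m] := nS_mul hs hr hf hg; split=> //.
have [_ m'] := nW_mul hs hf hg; rewrite -/cM in m.
have af := nA_le hs hf; have ag := nA_le hs hg.
have a0 := cA_ge0 s; have m0 := cM_ge0.
have s1 := nS_ge0 s f; have s2 := nS_ge0 s g; have w2 := nW_ge0 r g.
have n1 := nS_le s r f; have n2 := nS_le s r g; have n3 := nW_le s r g.
have N1 := nX_ge0 s r f; have N2 := nX_ge0 s r g.
have A1 : nA f <= cA s * N f by apply: le_trans af _; rewrite ler_wpM2l.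
have A2 : nA g <= cA s * N g by apply: le_trans ag _; rewrite ler_wpM2l.
have b1 : nS f * nA g <= N f * (cA s * N g) by apply: ler_pM => //; exact: nA_ge0.
have b2 : nA f * nS g <= cA s * N f * N g by apply: ler_pM => //; exact: nA_ge0.
have b3 : nA f * nW g <= cA s * N f * N g by apply: ler_pM => //; exact: nA_ge0.
apply: le_trans (lerD m m') _.
apply: le_trans (lerD (ler_wpM2l m0 (lerD b1 b2)) b3) _.
by rewrite le_eqVlt; apply/orP; left; apply/eqP; rewrite /cP; ring.
Qed.

Lemma N_reg f : X f -> N (reg_dx f) <= 9 * N f.
Proof.
have aux (x y z : R) : z <= x -> 0 <= y -> x + 8 * (y + z) <= 9 * (x + y) by lra.
move=> hf; have [_ a b] := reg_dx_X hr hf; have n := nrm_nS hs hf.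
have w := nW_ge0 r f; apply: le_trans (lerD a b) _; rewrite /nX.
exact: aux.
Qed.

Lemma field_diff c c' f g : X f -> X g ->
  N (fun x => field c f x - field c' g x) <=
  9 * (N (fun x => f x - g x) + N (fun x => c * f x ^+ 2 - c' * g x ^+ 2)).
Proof.
move=> hf hg; have p1 := X_arg c hf; have p2 := X_arg c' hg.
have Xd := isXB hf hg; have Xe := isXB (isXZ c (X_sqr hf)) (isXZ c' (X_sqr hg)).
have e : ae (fun x => field c f x - field c' g x = -1 * reg_dx (fun y => (f y - g y) + (c * f y ^+ 2 - c' * g y ^+ 2)) x).
  apply: ae_mono (reg_dx_lin (-1) (isX_L2 p1) (isX_L2 p2)) => x.
  rewrite (_ : (fun y => _ + _) = (fun y => (f y - g y) + (c * f y ^+ 2 - c' * g y ^+ 2))); last by apply/funext => y; ring.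
  by rewrite /field => ->; ring.
have Xs := isXD Xd Xe; have [Xk _ _] := reg_dx_X hr Xs.
rewrite (nX_ae s r (isX_L2 (isXB (X_field c hf) (X_field c' hg))) (isX_L2 (isXZ (-1) Xk)) e).
rewrite (nXZ _ Xk) normrN1 mul1r; apply: le_trans (N_reg Xs) _.
by rewrite ler_wpM2l//; exact: nXD.
Qed.

Section truncated.
Variable M : R.
Hypothesis M0 : 0 < M.

(* [theta f * f] is the radial projection of [f] on the ball of radius [M]. *)
Definition theta f : R := M / Num.max M (N f).

Lemma tmax_gt0 f : 0 < Num.max M (N f). Proof. by rewrite lt_max M0. Qed.

Lemma theta_bnd f : 0 <= theta f <= 1.
Proof. by rewrite /theta divr_ge0 ?(ltW M0) ?(ltW (tmax_gt0 f))//= ler_pdivrMr ?tmax_gt0// mul1r le_max lexx. Qed.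

Lemma theta_N f : theta f * N f <= M.
Proof.
rewrite /theta mulrAC ler_pdivrMr ?tmax_gt0// ler_wpM2l ?(ltW M0)//.
by rewrite le_max lexx orbT.
Qed.

Lemma theta1 f : N f <= M -> theta f = 1.
Proof. by move=> h; rewrite /theta max_l// divff// gt_eqF. Qed.

(** Write the difference as [theta f * (f - g) + (theta f - theta g) * g]. The second term is
    harmless because [max M (N f)] is 1-Lipschitz in [f] and [N g / max M (N g) <= 1]. *)
Lemma theta_lip f g : X f -> X g -> N (fun x => theta f * f x - theta g * g x) <= 2 * N (fun x => f x - g x).
Proof.
have aux (a b c : R) : a <= c + b -> b <= c + a -> `|Num.max M b - Num.max M a| <= c.
  move=> h1 h2; rewrite ler_norml.
  by case: (leP M a) => ?; case: (leP M b) => ?; apply/andP; split; lra.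
move=> hf hg.
rewrite (_ : (fun x => _) = (fun x => theta f * (f x - g x) + (theta f - theta g) * g x)); last by apply/funext => x; ring.
have Xd := isXB hf hg.
apply: le_trans (nXD (isXZ (theta f) Xd) (isXZ (theta f - theta g) hg)) _.
rewrite (nXZ _ Xd) (nXZ _ hg) mulr2n mulrDl mul1r.
have /andP[t0 t1] := theta_bnd f; have d0 := nX_ge0 s r (fun x => f x - g x).
apply: lerD; first by rewrite (ger0_norm t0) ler_piMl.
have mf := tmax_gt0 f; have mg := tmax_gt0 g.
have e : theta f - theta g = theta f * ((Num.max M (N g) - Num.max M (N f)) / Num.max M (N g)).
  by rewrite /theta; field; rewrite !gt_eqF.
rewrite e normrM (ger0_norm t0) normrM normfV (gtr0_norm mg).
have g0 := nX_ge0 s r g.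
have q : N g / Num.max M (N g) <= 1 by rewrite ler_pdivrMr// mul1r le_max lexx orbT.
have D : `|Num.max M (N g) - Num.max M (N f)| <= N (fun x => f x - g x).
  have h1 := nXD Xd hg; have h2 := nXD (isXZ (-1) Xd) hf.
  rewrite (_ : (fun x => f x - g x + g x) = f) in h1; last by apply/funext => x; ring.
  rewrite (_ : (fun x => -1 * (f x - g x) + f x) = g) in h2; last by apply/funext => x; ring.
  rewrite (nXZ _ Xd) normrN1 mul1r in h2.
  exact: aux.
have Z0 : 0 <= `|Num.max M (N g) - Num.max M (N f)| * (N g / Num.max M (N g)).
  by rewrite mulr_ge0// divr_ge0// ltW.
rewrite [X in X <= _](_ : _ = theta f * (`|Num.max M (N g) - Num.max M (N f)| * (N g / Num.max M (N g)))); last by ring.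
apply: le_trans (ler_piMl Z0 t1) _; apply: le_trans D.
exact: ler_piMr.
Qed.

(** Only the square is evaluated at the projection [theta f * f]. The result is again a [field c]
    with [0 <= c <= 1/2], so the energy identity and the growth bounds apply to it unchanged. *)
Definition tfield f := field (theta f ^+ 2 / 2) f.

Lemma theta_half f : 0 <= theta f ^+ 2 / 2 <= 2^-1.
Proof.
have /andP[t0 t1] := theta_bnd f.
by rewrite divr_ge0 ?sqr_ge0//= ler_piMl ?invr_ge0// exprn_ile1.
Qed.

Lemma tfield_lip f g : X f -> X g ->
  N (fun x => tfield f x - tfield g x) <= 9 * (1 + 2 * cP * M) * N (fun x => f x - g x).
Proof.
move=> hf hg; apply: le_trans (field_diff _ _ hf hg) _; rewrite -mulrA ler_wpM2l// mulrDl mul1r lerD2l.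
have Xf := isXZ (theta f) hf; have Xg := isXZ (theta g) hg.
have Xd := isXB Xf Xg; have Xs := isXD Xf Xg; have [Xp np] := N_mul Xd Xs.
rewrite (_ : (fun x => _) = (fun x => 2^-1 * ((theta f * f x - theta g * g x) * (theta f * f x + theta g * g x)))); last first.
  by apply/funext => x; field.
rewrite (nXZ _ Xp) ger0_norm ?invr_ge0//.
have h1 := theta_lip hf hg.
have h2 : N (fun x => theta f * f x + theta g * g x) <= 2 * M.
  apply: le_trans (nXD Xf Xg) _; rewrite (nXZ _ hf) (nXZ _ hg).
  have /andP[t0 _] := theta_bnd f; have /andP[t0' _] := theta_bnd g.
  rewrite (ger0_norm t0) (ger0_norm t0'); have := theta_N f; have := theta_N g; lra.
have := ler_pM (nX_ge0 s r _) (nX_ge0 s r _) h1 h2 => h3.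
apply: le_trans (ler_wpM2l _ np) _; first by rewrite invr_ge0.
apply: le_trans (ler_wpM2l _ (ler_wpM2l cP_ge0 h3)) _; first by rewrite invr_ge0.
by rewrite le_eqVlt; apply/orP; left; apply/eqP; field.
Qed.

End truncated.

Definition is_flow (Q : (R -> R) -> R -> R) (phi : R -> R) (T : R) u :=
  [/\ u 0 = phi, forall t, 0 <= t <= T -> X (u t) &
   exists2 C : R, 0 <= C & forall t t', 0 <= t <= T -> 0 <= t' <= T ->
     N (fun x => u t' x - u t x) <= C * `|t' - t| /\
     N (fun x => u t' x - u t x - (t' - t) * Q (u t) x) <= C * (t' - t) ^+ 2].

Lemma is_flow_sub Q phi (T T' : R) u : T' <= T -> is_flow Q phi T u -> is_flow Q phi T' u.
Proof.
move=> TT [u0 uX [C C0 hC]].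
have h t : 0 <= t <= T' -> 0 <= t <= T by move=> /andP[-> a]; exact: le_trans a TT.
by split=> // [t /h /uX//|]; exists C => // t t' /h h1 /h h2; exact: hC.
Qed.

Lemma is_flow_eq Q Q' phi (T : R) u : (forall t, 0 <= t <= T -> Q (u t) = Q' (u t)) ->
  is_flow Q phi T u -> is_flow Q' phi T u.
Proof.
move=> e [u0 uX [C C0 hC]]; split=> //; exists C => // t t' h h'.
by rewrite -e//; exact: hC.
Qed.

Lemma tflow_exists (M : R) phi : 0 < M -> X phi -> exists u, forall T : R, 0 <= T -> is_flow (tfield M) phi T u.
Proof.
move=> M0 hphi.
have L0 : 0 <= 9 * (1 + 2 * cP * M).
  by rewrite mulr_ge0// addr_ge0// mulr_ge0 ?(ltW M0)// mulr_ge0// cP_ge0.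
have [u u0 [uX uq]] := @euler_flow R X N (tfield M) _ (fun f g => @isXD _ s r f g) (fun c f => @isXZ _ s r c f)
  (@nX_ge0 R s r) (fun f g => @nXD _ s r f g) (fun c f => @nXZ _ s r c f) (isX_complete hs)
  (fun f hf => X_field _ hf) L0 (tfield_lip M0) phi hphi.
exists u => T T0; split=> //; last exact: uq.
by move=> t /andP[t0 _]; exact: uX.
Qed.

Lemma flow_unique (M : R) phi (T : R) u v : 0 < M -> 0 <= T ->
  is_flow (tfield M) phi T u -> is_flow (tfield M) phi T v -> N (fun x => u T x - v T x) = 0.
Proof.
move=> M0 T0 [u0 uX [C C0 hC]] [v0 vX [C' C0' hC']].
pose L := 9 * (1 + 2 * cP * M).
have L0 : 0 <= L by rewrite mulr_ge0// addr_ge0// mulr_ge0 ?(ltW M0)// mulr_ge0// cP_ge0.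
apply: (@gronwall0 _ (fun t => N (fun x => u t x - v t x)) L (C + C') T T0 L0) => //.
- by rewrite addr_ge0.
- by move=> t; exact: nX_ge0.
- rewrite u0 v0 (_ : (fun x => _) = (fun x => 0 * phi x)); last by apply/funext => x; ring.
  by rewrite nXZ ?normr0 ?mul0r// -u0; apply: uX; rewrite lexx.
move=> t t' t0 tt' t'T; have tI : 0 <= t <= T by rewrite t0 (le_trans tt').
have t'I : 0 <= t' <= T by rewrite t'T (le_trans t0).
have [_ h1] := hC t t' tI t'I; have [_ h2] := hC' t t' tI t'I.
have X1 := uX _ tI; have X2 := vX _ tI; have X3 := uX _ t'I; have X4 := vX _ t'I.
have F1 : X (tfield M (u t)) := X_field _ X1; have F2 : X (tfield M (v t)) := X_field _ X2.
have l := tfield_lip M0 X1 X2; rewrite -/L in l.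
have dt : 0 <= t' - t by rewrite subr_ge0.
rewrite (_ : (fun x => u t' x - v t' x) = (fun x => (u t x - v t x) + ((t' - t) * (tfield M (u t) x - tfield M (v t) x) +
  ((u t' x - u t x - (t' - t) * tfield M (u t) x) + -1 * (v t' x - v t x - (t' - t) * tfield M (v t) x))))); last first.
  by apply/funext => x; ring.
have Y1 := isXB X1 X2; have Y2 := isXB F1 F2.
have Y3 := isXB (isXB X3 X1) (isXZ (t' - t) F1); have Y4 := isXB (isXB X4 X2) (isXZ (t' - t) F2).
have Y4' := isXZ (-1) Y4.
apply: le_trans (nXD Y1 (isXD (isXZ (t' - t) Y2) (isXD Y3 Y4'))) _.
have n1 := nXD (isXZ (t' - t) Y2) (isXD Y3 Y4'); have n2 := nXD Y3 Y4'.
rewrite (nXZ _ Y2) (ger0_norm dt) in n1; rewrite (nXZ _ Y4) normrN1 mul1r in n2.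
have n3 := ler_wpM2l dt l.
apply: le_trans (lerD (lexx _) n1) _.
apply: le_trans (lerD (lexx _) (lerD n3 (le_trans n2 (lerD h1 h2)))) _.
by rewrite le_eqVlt; apply/orP; left; apply/eqP; ring.
Qed.

(** Expand the square of the energy norm around [f]. By [energy_orth] the increment may be replaced,
    in its pairing with [f], by its first-order remainder; along a flow the whole bound is then
    quadratic in time. *)
Lemma energy_step (c d : R) f g : X f -> X g ->
  `|nE g ^+ 2 - nE f ^+ 2| <= 2 * (nE f * nE (fun x => g x - f x - d * field c f x)) + nE (fun x => g x - f x) ^+ 2.
Proof.
have aux (a b x y z p : R) : a = b + 2 * x + z -> x = y -> `|y| <= p -> 0 <= z -> `|a - b| <= 2 * p + z.
  by move=> -> -> /ler_normlP[h1 h2] z0; rewrite ler_norml; apply/andP; split; lra.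
move=> hf hg; have Xd := isXB hg hf; have Xc := X_field c hf; have Xr := isXB Xd (isXZ d Xc).
set rem := (fun x => g x - f x - d * field c f x) in Xr *.
have lf := isL2_we hs hf; have ld := isL2_we hs Xd; have lr := isL2_we hs Xr; have lg := isL2_we hs hg.
have [Xk _ _] := reg_dx_X hr (X_arg c hf); have lk := isL2_we hs Xk.
have e1 : nE g ^+ 2 = nE f ^+ 2 + 2 * ip (fun x => we x * hart f x) (fun x => we x * hart (fun x => g x - f x) x) + nE (fun x => g x - f x) ^+ 2.
  rewrite -nrmD_sqr//; congr (_ ^+ 2); apply: nrm_ae; [exact: isL2_mf lg|exact: isL2_mf (isL2D lf ld)|].
  by apply: ae_mono (hartB (isX_L2 hg) (isX_L2 hf)) => x ->; ring.
have e2 : ip (fun x => we x * hart f x) (fun x => we x * hart (fun x => g x - f x) x) =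
          ip (fun x => we x * hart f x) (fun x => we x * hart rem x).
  have lk' := isL2Z (- d) lk.
  rewrite (ip_ae (isL2_mf lf) (isL2_mf ld) (isL2_mf (isL2D lr lk'))).
    by rewrite ipD// ipZ// (energy_orth hs hr c hf) mulr0 addr0.
  have h1 := hartB (isX_L2 Xd) (isX_L2 (isXZ d Xc)).
  have h2 := hartZ d (isX_L2 Xc); have h3 := hartZ (-1) (isX_L2 Xk).
  apply: ae_mono2 h1 (ae_and h2 h3) => x -> [-> ->]; ring.
apply: aux e1 e2 (ip_le lf lr) (sqr_ge0 _).
Qed.

Section apriori.
Variables (phi : R -> R) (T : R).
Hypotheses (hphi : X phi) (T0 : 0 <= T).

Section bounds.
Variables (M : R) (u : R -> R -> R).
Hypotheses (M0 : 0 < M) (hu : is_flow (tfield M) phi T u).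

Lemma flow_energy t : 0 <= t <= T -> nE (u t) = nE phi.
Proof.
move=> /andP[t0 tT]; have [u0 uX [C C0 hC]] := hu.
have tt : 0 <= t <= T by rewrite t0.
suff e : nE (u t) ^+ 2 = nE (u 0) ^+ 2.
  rewrite u0 in e; have n1 : 0 <= nE (u t) := nrm_ge0 _; have n2 : 0 <= nE phi := nrm_ge0 _.
  by move: (nE (u t)) (nE phi) e n1 n2 => a b e a0 b0; apply/eqP; rewrite -(@eqrXn2 R 2)// e.
(* Bounds the energy norm along the flow, from [nE <= 2 * nS] and the Lipschitz estimate starting at
   [phi]. *)
pose B := 2 * (N phi + C * T).
apply: (@quad_const _ (fun t => nE (u t) ^+ 2) (2 * (B * (2 * C)) + (2 * C) ^+ 2) t t0) => a b a0 ab bt.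
have aI : 0 <= a <= T by rewrite a0 (le_trans ab)// (le_trans bt).
have bI : 0 <= b <= T by rewrite (le_trans a0 ab) (le_trans bt).
have X1 := uX _ aI; have X2 := uX _ bI.
have [h1 h2] := hC a b aI bI.
have Xd := isXB X2 X1; have Xc := X_field (theta M (u a) ^+ 2 / 2) X1; have Xr := isXB Xd (isXZ (b - a) Xc).
apply: le_trans (energy_step (theta M (u a) ^+ 2 / 2) (b - a) X1 X2) _.
have [_ r1] := nE_le hs Xr; have [_ r2] := nE_le hs Xd; have [_ r3] := nE_le hs X1.
have B1 : nE (u a) <= B.
  apply: le_trans r3 _; rewrite ler_wpM2l//; apply: le_trans (nS_le s r _) _.
  have z : 0 <= (0 : R) <= T by apply/andP.
  have [h3 _] := hC 0 a z aI; rewrite subr0 u0 (ger0_norm a0) in h3.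
  have := nXD hphi (isXB X1 hphi); rewrite (_ : (fun x => phi x + _) = u a); last by apply/funext => x; ring.
  move=> h4; apply: le_trans h4 _; rewrite lerD2l; apply: le_trans h3 _.
  by rewrite ler_wpM2l//; case/andP: aI.
have q1 : nE (fun x => u b x - u a x - (b - a) * field (theta M (u a) ^+ 2 / 2) (u a) x) <= 2 * C * (b - a) ^+ 2.
  by apply: le_trans r1 _; rewrite -mulrA ler_wpM2l//; apply: le_trans (nS_le s r _) h2.
have q2 : nE (fun x => u b x - u a x) <= 2 * C * (b - a).
  rewrite ger0_norm ?subr_ge0// in h1.
  by apply: le_trans r2 _; rewrite -mulrA ler_wpM2l//; apply: le_trans (nS_le s r _) h1.
have q3 := ler_pM (nrm_ge0 _) (nrm_ge0 _) B1 q1.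
have q4 : nE (fun x => u b x - u a x) ^+ 2 <= (2 * C * (b - a)) ^+ 2.
  by apply: lerXn2r; rewrite ?nnegrE ?nrm_ge0// (le_trans _ q2)// nrm_ge0.
apply: le_trans (lerD (ler_wpM2l (ler0n _ 2) q3) q4) _.
by rewrite le_eqVlt; apply/orP; left; apply/eqP; ring.
Qed.

(** The added 1 disposes of the square root: [A ^+ 2 <= k * (1 + l)] gives
    [A <= (1 + k) * (1 + l)]. *)
Definition rateA : R := 1 + 20 / sg s * (expR 1 * nE phi ^+ 2 + 1).

Lemma flow_A t : 0 <= t <= T -> nA (u t) <= rateA * (1 + ln (1 + nS (u t))).
Proof.
move=> tI; have [u0 uX _] := hu; have Xt := uX _ tI.
have := brezis_gallouet hs Xt; rewrite (flow_energy tI).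
have l0 : 0 <= ln (1 + nS (u t)) by rewrite ln_ge0// lerDl nS_ge0.
have k0 : 0 <= 20 / sg s * (expR 1 * nE phi ^+ 2 + 1).
  by rewrite mulr_ge0 ?divr_ge0 ?(ltW (sg_gt0 hs))// addr_ge0// mulr_ge0 ?expR_ge0 ?sqr_ge0.
rewrite /rateA; have A0 := nA_ge0 (u t); move: (20 / sg s * _) k0 (ln _) l0 (nA _) A0 => k k0 l l0 A A0 h.
rewrite -(@ler_pXn2r _ 2) ?nnegrE ?mulr_ge0 ?addr_ge0//; apply: le_trans h _.
rewrite exprMn; apply: ler_pM => //; rewrite ?addr_ge0//; nra.
Qed.

Lemma rateA_ge0 : 0 <= rateA.
Proof.
rewrite addr_ge0// mulr_ge0 ?divr_ge0 ?(ltW (sg_gt0 hs))// addr_ge0// mulr_ge0 ?expR_ge0 ?sqr_ge0//.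
Qed.

Lemma flow_step (n : (R -> R) -> R) : (forall f g, X f -> X g -> n (fun x => f x + g x) <= n f + n g) ->
  (forall c f, X f -> n (fun x => c * f x) = `|c| * n f) -> (forall f, n f <= N f) ->
  exists2 C : R, 0 <= C & forall t t', 0 <= t -> t <= t' -> t' <= T ->
  n (u t') <= n (u t) + (t' - t) * n (tfield M (u t)) + C * (t' - t) ^+ 2.
Proof.
move=> nD nZ nN; have [u0 uX [C C0 hC]] := hu; exists C; first exact: C0.
move=> t t' t0 tt' t'T.
have tI : 0 <= t <= T by rewrite t0 (le_trans tt').
have t'I : 0 <= t' <= T by rewrite t'T (le_trans t0).
have [_ h] := hC t t' tI t'I; have X1 := uX _ tI; have X2 := uX _ t'I.
have Xc : X (tfield M (u t)) := X_field _ X1; have Xr := isXB (isXB X2 X1) (isXZ (t' - t) Xc).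
have := nD _ _ (isXD X1 (isXZ (t' - t) Xc)) Xr.
rewrite (_ : (fun x => u t x + _ + _) = u t'); last by apply/funext => x; ring.
move=> h1; apply: le_trans h1 _; apply: lerD; last exact: le_trans (nN _) h.
by apply: le_trans (nD _ _ X1 (isXZ (t' - t) Xc)) _; rewrite nZ// ger0_norm ?subr_ge0.
Qed.

Definition rateS : R := 1 + cM * rateA.

Definition boundS (t : R) : R := expR (expR (ln (1 + ln (1 + nS phi)) + rateS * t)).

Lemma flow_S t : 0 <= t <= T -> nS (u t) <= boundS T.
Proof.
move=> /andP[t0 tT]; have [u0 uX _] := hu.
have [C C0 hC] := flow_step (fun f g => @nSD R s r f g) (fun c f => @nSZ R s r c f) (fun f => nS_le s r f).
have R0 := rateA_ge0; have m0 := cM_ge0.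
apply: le_trans (_ : _ <= boundS t) _; last first.
  by rewrite /boundS !ler_expR lerD2l ler_wpM2l// addr_ge0// mulr_ge0.
rewrite /boundS -u0; apply: (@lnln_growth _ (fun t => nS (u t)) rateS C t t0 C0 _) => [a|a b a0 ab bt].
  exact: nS_ge0.
have aI : 0 <= a <= T by rewrite a0 (le_trans ab)// (le_trans bt).
apply: le_trans (hC a b a0 ab (le_trans bt tT)) _; rewrite lerD2r lerD2l ler_wpM2l ?subr_ge0//.
have Xa := uX _ aI; apply: le_trans (field_S Xa (theta_half M0 (u a))) _.
have S0 := nS_ge0 s (u a); have A := flow_A aI.
have l0 : 0 <= ln (1 + nS (u a)) by rewrite ln_ge0// lerDl.
rewrite [X in _ <= X](_ : _ = (1 + nS (u a)) * (rateS * (1 + ln (1 + nS (u a))))); last by ring.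
apply: ler_pM => //; first by rewrite addr_ge0// mulr_ge0// nA_ge0.
  by rewrite lerDr.
rewrite /rateS mulrDl mul1r lerD//; first by rewrite lerDl.
by rewrite -mulrA ler_wpM2l.
Qed.

Definition rateW : R := 8 * ((1 + cA s * boundS T) * (1 + boundS T)).

Lemma flow_W t : 0 <= t <= T -> nW (u t) <= expR (ln (1 + nW phi) + rateW * T).
Proof.
move=> /andP[t0 tT]; have [u0 uX _] := hu.
have [C C0 hC] := flow_step (fun f g => @nWD R s r f g) (fun c f => @nWZ R s r c f) (fun f => nW_le s r f).
have a0 := cA_ge0 s; have b0 : 0 <= boundS T by rewrite expR_ge0.
have W0 : 0 <= rateW by rewrite mulr_ge0// mulr_ge0// addr_ge0// mulr_ge0.
apply: le_trans (_ : _ <= expR (ln (1 + nW phi) + rateW * t)) _; last first.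
  by rewrite ler_expR lerD2l ler_wpM2l.
rewrite -u0; apply: (@ln_growth _ (fun t => nW (u t)) rateW C t t0 C0 _) => [a|a b a1 ab bt].
  exact: nW_ge0.
have aI : 0 <= a <= T by rewrite a1 (le_trans ab)// (le_trans bt).
apply: le_trans (hC a b a1 ab (le_trans bt tT)) _; rewrite lerD2r lerD2l ler_wpM2l ?subr_ge0//.
have Xa := uX _ aI; apply: le_trans (field_W Xa (theta_half M0 (u a))) _.
have S := flow_S aI; have A := nA_le hs Xa; have w0 := nW_ge0 r (u a).
rewrite /rateW -mulrA ler_wpM2l// -mulrA; apply: ler_pM.
- by rewrite addr_ge0// nA_ge0.
- by rewrite addr_ge0// nS_ge0.
- by rewrite lerD2l; apply: le_trans A _; rewrite ler_wpM2l.
- by rewrite mulrDl mul1r mulrDr mulr1; move: (nW _) (nS _) (boundS T) b0 S w0 => x y z; nra.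
Qed.

End bounds.

(** [B] depends on [phi] and [T] but not on the radius [M], so that [M] can be taken equal to it. *)
Lemma apriori : exists2 B : R, 0 < B & forall (M : R) u, 0 < M -> is_flow (tfield M) phi T u ->
  forall t, 0 <= t <= T -> N (u t) <= B.
Proof.
exists (boundS T + expR (ln (1 + nW phi) + rateW * T)) => [|M u M0 hu t tI]; first by rewrite addr_gt0// expR_gt0.
by apply: lerD; [exact: flow_S M0 hu t tI|exact: flow_W M0 hu t tI].
Qed.

End apriori.

(** On [[0, n + 1]] the truncation radius is the a priori bound itself, so [theta] is 1 along the
    flow. Two such flows also follow the truncated field of the larger radius, hence agree up to
    [N]-null functions by [flow_unique]. *)
Lemma global_flow phi : X phi -> exists u, forall T : R, 0 <= T -> is_flow (field 2^-1) phi T u.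
Proof.
move=> hphi.
have ex (n : nat) : exists v : (R -> R -> R) * R, 0 < v.2 /\ is_flow (field 2^-1) phi n.+1%:R v.1 /\
    forall t, 0 <= t <= n.+1%:R -> N (v.1 t) <= v.2.
  have [B B0 hB] := apriori hphi (ler0n R n.+1).
  have [u hu] := tflow_exists B0 hphi.
  have h := hu n.+1%:R (ler0n _ _); have b := hB B u B0 h.
  exists (u, B); split; [exact: B0|split; last exact: b].
  apply: is_flow_eq h => t tI.
  by rewrite /tfield theta1 ?expr1n ?mul1r//; exact: b.
have [w hw] := choice ex.
have tf (M : R) n : (w n).2 <= M -> is_flow (tfield M) phi n.+1%:R (w n).1.
  move=> le; have [w0 [h b]] := hw n; have M0 := lt_le_trans w0 le.
  apply: is_flow_eq h => t tI.
  by rewrite /tfield theta1 ?expr1n ?mul1r//; exact: le_trans (b _ tI) le.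
have eqv n m t : (n <= m)%N -> 0 <= t <= n.+1%:R -> N (fun x => (w n).1 t x - (w m).1 t x) = 0.
  move=> nm /andP[t0 tn]; pose M := Num.max (w n).2 (w m).2.
  have M0 : 0 < M by rewrite lt_max; have [-> _] := hw n.
  apply: (@flow_unique M phi t) => //; apply: is_flow_sub; try apply: tf; rewrite ?le_max ?lexx ?orbT//.
  by apply: le_trans tn _; rewrite ler_nat.
(* The value at [t] is taken from the flow on [[0, truncn t + 1]]. Up to [T] it differs from the
   single flow [w n] by functions with [N = 0], which the estimates below discard. *)
exists (fun t => (w (Num.truncn t)).1 t) => T T0.
pose n := Num.truncn T.
have hT : T <= n.+1%:R by rewrite ltW// truncnS_gt.
have [w0 [h _]] := hw n; have [u0 uX [C C0 hC]] := is_flow_sub hT h.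
have eqT t : 0 <= t <= T -> N (fun x => (w (Num.truncn t)).1 t x - (w n).1 t x) = 0.
  move=> /andP[t0 tT]; apply: eqv; first exact: le_truncn.
  by rewrite t0 ltW// truncnS_gt.
have XT t : 0 <= t <= T -> X ((w (Num.truncn t)).1 t).
  move=> /andP[t0 tT]; have [_ [[_ + _] _]] := hw (Num.truncn t); apply.
  by rewrite t0 ltW// truncnS_gt.
split; first by rewrite truncn0; have [_ [[]]] := hw 0.
  exact: XT.
exists C; first exact: C0.
move=> t t' tI t'I; have [h1 h2] := hC t t' tI t'I.
have X1 := XT _ tI; have X2 := XT _ t'I; have Y1 := uX _ tI; have Y2 := uX _ t'I.
have Z1 := isXB X1 Y1; have Z2 := isXB X2 Y2; have e1 := eqT _ tI; have e2 := eqT _ t'I.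
set a := (w (Num.truncn t)).1 t in X1 Z1 e1 *; set b := (w (Num.truncn t')).1 t' in X2 Z2 e2 *.
set a' := (w n).1 t in Y1 Z1 e1 h1 h2; set b' := (w n).1 t' in Y2 Z2 e2 h1 h2.
have Z3 := isXD Z2 (isXZ (-1) Z1).
have e3 : N (fun x => (b x - b' x) + -1 * (a x - a' x)) <= 0.
  by apply: le_trans (nXD Z2 (isXZ (-1) Z1)) _; rewrite (nXZ _ Z1) e1 e2 mulr0 addr0.
have W := isXB Y2 Y1.
split.
  rewrite (_ : (fun x => b x - a x) = (fun x => ((b x - b' x) + -1 * (a x - a' x)) + (b' x - a' x))); last by apply/funext => x; ring.
  by apply: le_trans (nXD Z3 W) _; rewrite -[X in _ <= X]add0r; exact: lerD.
(* A radius at which both values are untouched by the truncation: the Lipschitz bound of [tfield]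
   then shows that the fields at [a] and [a'] differ by an [N]-null function. *)
pose M := 1 + N a + N a'.
have M0 : 0 < M by rewrite /M -addrA ltr_wpDr// addr_ge0// nX_ge0.
have [ha ha'] : N a <= M /\ N a' <= M.
  by have := nX_ge0 s r a; have := nX_ge0 s r a'; rewrite /M; move: (N a) (N a') => x y; split; lra.
have l := tfield_lip M0 X1 Y1; rewrite /tfield (theta1 M0 ha) (theta1 M0 ha') expr1n mul1r e1 mulr0 in l.
have Fa := X_field 2^-1 X1; have Fa' := X_field 2^-1 Y1; have FF := isXB Fa Fa'.
have Wr := isXB W (isXZ (t' - t) Fa').
rewrite (_ : (fun x => _) = (fun x => ((b x - b' x) + -1 * (a x - a' x)) +
   (- (t' - t) * (field 2^-1 a x - field 2^-1 a' x) + (b' x - a' x - (t' - t) * field 2^-1 a' x)))); last first.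
  by apply/funext => x; ring.
have F0 : N (fun x => - (t' - t) * (field 2^-1 a x - field 2^-1 a' x)) <= 0.
  by rewrite (nXZ _ FF) mulr_ge0_le0.
apply: le_trans (nXD Z3 (isXD (isXZ (- (t' - t)) FF) Wr)) _.
rewrite -[X in _ <= X]add0r lerD//.
by apply: le_trans (nXD (isXZ (- (t' - t)) FF) Wr) _; rewrite -[X in _ <= X]add0r lerD.
Qed.

End field.

(** * Duhamel's formula and uniqueness *)

Section riemann.
Context {R : realType}.
Implicit Types (F G U : R -> R -> R).

Lemma sum_telescope (a : nat -> R) n : \sum_(k < n) (a k.+1 - a k) = a n - a 0.
Proof.
by elim: n => [|n IH]; rewrite ?big_ord0 ?subrr// big_ord_recr/= IH addrC addrA subrK.
Qed.

Lemma isL2_sum (f : nat -> R -> R) n : (forall k, (k < n)%N -> isL2 (f k)) ->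
  isL2 (fun x => \sum_(k < n) f k x) /\ nrm (fun x => \sum_(k < n) f k x) <= \sum_(k < n) nrm (f k).
Proof.
elim: n => [|n IH] h.
  rewrite (_ : (fun x => _) = (fun=> 0)); last by apply/funext => x; rewrite big_ord0.
  by rewrite big_ord0 nrm0; split=> //; exact: isL2_0.
have [l nl] := IH (fun k kn => h k (ltnW kn)); have hn := h n (ltnSn n).
rewrite (_ : (fun x => _) = (fun x => \sum_(k < n) f k x + f n x)); last first.
  by apply/funext => x; rewrite big_ord_recr.
by split; [exact: isL2D|rewrite big_ord_recr/=; apply: le_trans (nrmD l hn) _; rewrite lerD2r].
Qed.

Section partition.
Variables (t : R) (p : seq R).
Hypothesis hp : itv_partition 0 t p.
Local Notation P := (nth 0 (0 :: p)).

Lemma part_lt k : (k < size p)%N -> P k < P k.+1.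
Proof. by move=> kp; case: hp => /(pathP 0) h _; exact: h. Qed.

Lemma part_last : P (size p) = t. Proof. exact: itv_partition_nth_size hp. Qed.

Lemma part_mono i j : (i <= j)%N -> (j <= size p)%N -> P i <= P j.
Proof.
elim: j => [|j IH]; first by rewrite leqn0 => /eqP ->.
rewrite leq_eqVlt => /orP[/eqP -> //|]; rewrite ltnS => ij jp.
by apply: le_trans (IH ij (ltnW jp)) _; exact: ltW (part_lt jp).
Qed.

Lemma part_in k : (k <= size p)%N -> 0 <= P k <= t.
Proof.
move=> kp; apply/andP; split; first exact: (part_mono (leq0n k) kp).
by rewrite -part_last; exact: part_mono kp (leqnn _).
Qed.

End partition.

Lemma fine_partition (t d : R) : 0 <= t -> 0 < d -> exists2 p, itv_partition 0 t p &
  forall k, (k < size p)%N -> nth 0 (0 :: p) k.+1 - nth 0 (0 :: p) k < d.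
Proof.
rewrite le_eqVlt => /predU1P[<- d0|t0 d0]; first by exists [::] => //; split=> /=.
pose n := Num.truncn (t / d); pose h := t / n.+1%:R.
have n0 : 0 < n.+1%:R :> R by [].
have h0 : 0 < h by rewrite divr_gt0.
have hd : h < d by rewrite ltr_pdivrMr// mulrC -ltr_pdivrMr// truncnS_gt.
pose p := [seq k.+1%:R * h | k <- iota 0 n.+1].
have sp : size p = n.+1 by rewrite size_map size_iota.
have pE k : (k <= n.+1)%N -> nth 0 (0 :: p) k = k%:R * h.
  case: k => [|k] kn; first by rewrite mul0r.
  by rewrite [LHS](nth_map 0%N) ?size_iota// nth_iota.
have step k : (k < n.+1)%N -> nth 0 (0 :: p) k.+1 - nth 0 (0 :: p) k = h.
  by move=> kn; rewrite !pE ?(ltnW kn)// -natr1; ring.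
exists p; last by move=> k; rewrite sp => kn; rewrite step.
split; first by apply/(pathP 0) => i; rewrite sp => kn; rewrite -subr_gt0 (step i kn).
by rewrite (last_nth 0) sp pE// /h mulrCA divff ?mulr1// gt_eqF.
Qed.

Definition isL2_on (t : R) F := forall tau, 0 <= tau <= t -> isL2 (F tau).

Lemma riemann_L2 (t : R) F p c : isL2_on t F -> (forall k, (k < size p)%N -> 0 <= c k <= t) ->
  isL2 (riemann_sum F 0 p c).
Proof.
move=> hF hc; apply: (isL2_sum (f := fun k x => (nth 0 (0 :: p) k.+1 - nth 0 (0 :: p) k) * F (c k) x) _).1.
by move=> k kp; apply: isL2Z; apply: hF; exact: hc.
Qed.

Lemma tags_in (t : R) p (c : nat -> R) : itv_partition 0 t p ->
  (forall k, (k < size p)%N -> nth 0 (0 :: p) k <= c k <= nth 0 (0 :: p) k.+1) ->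
  forall k, (k < size p)%N -> 0 <= c k <= t.
Proof.
move=> hp hc k kp; have /andP[a b] := hc k kp.
have /andP[c1 _] := part_in hp (ltnW kp); have /andP[_ c2] := part_in hp kp.
by rewrite (le_trans c1 a) (le_trans b c2).
Qed.

(** A fundamental theorem of calculus: [U] telescopes over the partition and is expanded around each
    tag. The two remainders on an interval of length l < d add up to at most [C * l ^+ 2], hence to
    [C * d * t] in total. *)
Lemma integral_of_quad F U (t C : R) : 0 <= t -> 0 <= C -> isL2_on t F -> isL2_on t U ->
  (forall a b, 0 <= a <= t -> 0 <= b <= t -> nrm (fun x => U b x - U a x - (b - a) * F a x) <= C * (b - a) ^+ 2) ->
  is_L2_integral F 0 t (fun x => U t x - U 0 x).
Proof.
move=> t0 C0 hF hU hq.
have I0 : 0 <= (0 : R) <= t by apply/andP.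
have It : 0 <= t <= t by rewrite t0 lexx.
have hI : isL2 (fun x => U t x - U 0 x) by apply: isL2B; exact: hU.
split; first exact/L2P.
move=> e e0; have D0 : 0 < C * t + 1 by rewrite ltr_wpDl// mulr_ge0.
(* Makes [C * d * t] smaller than [e]; the added 1 keeps the quotient meaningful and the inequality
   strict when [C * t = 0]. *)
exists (e / (C * t + 1)); first by rewrite divr_gt0.
set d := e / _ => p c hp hc.
have hc1 k : (k < size p)%N -> nth 0 (0 :: p) k <= c k <= nth 0 (0 :: p) k.+1 by move=> /hc[].
have hc2 k : (k < size p)%N -> nth 0 (0 :: p) k.+1 - nth 0 (0 :: p) k < d by move=> /hc[].
have hct := tags_in hp hc1.
have hS := riemann_L2 hF hct.
have hB := isL2B hS hI.
rewrite L2normE// lte_fin.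
pose E k x := (U (nth 0 (0 :: p) k) x - U (c k) x - (nth 0 (0 :: p) k - c k) * F (c k) x) -
  (U (nth 0 (0 :: p) k.+1) x - U (c k) x - (nth 0 (0 :: p) k.+1 - c k) * F (c k) x).
have eE : (riemann_sum F 0 p c \- (fun x => U t x - U 0 x))%R = (fun x => \sum_(k < size p) E k x).
  apply/funext => x; rewrite /= /riemann_sum.
  have := sum_telescope (fun k => U (nth 0 (0 :: p) k) x) (size p).
  rewrite (part_last hp) /= => <-; rewrite -sumrB; apply: eq_bigr => k _; rewrite /E /=; ring.
have qE k : (k < size p)%N -> isL2 (E k) /\ nrm (E k) <= C * d * (nth 0 (0 :: p) k.+1 - nth 0 (0 :: p) k).
  move=> kp; have i1 := part_in hp (ltnW kp); have i2 := part_in hp kp; have i3 := hct k kp.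
  have l1 := isL2B (isL2B (hU _ i1) (hU _ i3)) (isL2Z (nth 0 (0 :: p) k - c k) (hF _ i3)).
  have l2 := isL2B (isL2B (hU _ i2) (hU _ i3)) (isL2Z (nth 0 (0 :: p) k.+1 - c k) (hF _ i3)).
  split; first exact: isL2B.
  apply: le_trans (nrmB l1 l2) _.
  apply: le_trans (lerD (hq _ _ i3 i1) (hq _ _ i3 i2)) _.
  rewrite -mulrDr -mulrA ler_wpM2l//.
  have /andP[c1 c2] := hc1 k kp; have := hc2 k kp; move: (nth _ _ k.+1) (nth _ _ k) (c k) c1 c2 => a b m; nra.
rewrite eE; have [_ n] := isL2_sum (fun k kp => (qE k kp).1).
apply: le_lt_trans n _.
apply: (@le_lt_trans _ _ (\sum_(k < size p) (C * d * (nth 0 (0 :: p) k.+1 - nth 0 (0 :: p) k)))).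
  by apply: ler_sum => k _; have [] := qE k (ltn_ord k).
rewrite -mulr_sumr (sum_telescope (fun k => nth 0 (0 :: p) k)) (part_last hp) subr0.
rewrite (_ : C * d * t = C * t * e / (C * t + 1)); last by rewrite /d; ring.
by rewrite ltr_pdivrMr// mulrC ltr_pM2l// ltrDl.
Qed.

(* Left Riemann sums of [expR (lam * t)] are at most its integral, hence the factor
   [lam^-1] that makes the iteration in [ivp_unique] contract. *)
Lemma integral_diff F G I I' (t lam B : R) : 0 <= t -> 0 < lam -> 0 <= B -> isL2_on t F -> isL2_on t G ->
  is_L2_integral F 0 t I -> is_L2_integral G 0 t I' ->
  (forall a, 0 <= a <= t -> nrm (fun x => F a x - G a x) <= B * expR (lam * a)) ->
  nrm (fun x => I x - I' x) <= B / lam * expR (lam * t).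
Proof.
move=> t0 l0 B0 hF hG [/L2P hI H] [/L2P hI' H'] hd; apply: (@le_eps _ _ _ 2) => e e0.
have [d1 d10 h1] := H e e0; have [d2 d20 h2] := H' e e0.
have d0 : 0 < Num.min d1 d2 by rewrite lt_min d10.
have [p hp fp] := fine_partition t0 d0.
pose c k := nth 0 (0 :: p) k.
have hc k : (k < size p)%N -> nth 0 (0 :: p) k <= c k <= nth 0 (0 :: p) k.+1.
  by move=> kp; rewrite lexx ltW// (part_lt hp kp).
have hct := tags_in hp hc.
have l1 := riemann_L2 hF hct; have l2 := riemann_L2 hG hct.
have n1 : nrm (fun x => riemann_sum F 0 p c x - I x) < e.
  have := h1 p c hp _; rewrite L2normE ?lte_fin; last exact: isL2B.
  apply => k kp; split; first exact: hc.
  by apply: lt_le_trans (fp k kp) _; rewrite ge_min lexx.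
have n2 : nrm (fun x => riemann_sum G 0 p c x - I' x) < e.
  have := h2 p c hp _; rewrite L2normE ?lte_fin; last exact: isL2B.
  apply => k kp; split; first exact: hc.
  by apply: lt_le_trans (fp k kp) _; rewrite ge_min lexx orbT.
have n3 : nrm (fun x => riemann_sum F 0 p c x - riemann_sum G 0 p c x) <= B / lam * expR (lam * t).
  rewrite (_ : (fun x => _) = (fun x => \sum_(k < size p) ((nth 0 (0 :: p) k.+1 - nth 0 (0 :: p) k) * (F (c k) x - G (c k) x)))); last first.
    by apply/funext => x; rewrite /riemann_sum -sumrB; apply: eq_bigr => k _; ring.
  have lk k : (k < size p)%N -> isL2 (fun x => F (c k) x - G (c k) x).
    by move=> kp; apply: isL2B; [apply: hF|apply: hG]; exact: hct.
  have [_ n] := isL2_sum (f := fun k x => (nth 0 (0 :: p) k.+1 - nth 0 (0 :: p) k) * (F (c k) x - G (c k) x)) (fun k kp => isL2Z _ (lk k kp)).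
  apply: le_trans n _.
  apply: (@le_trans _ _ (\sum_(k < size p) (B / lam * expR (lam * nth 0 (0 :: p) k.+1) - B / lam * expR (lam * nth 0 (0 :: p) k)))).
    apply: ler_sum => k _; have kp := ltn_ord k.
    have dk := part_lt hp kp.
    rewrite (nrmZ _ (lk k kp)) gtr0_norm ?subr_gt0//.
    apply: le_trans (ler_wpM2l _ (hd _ (hct k kp))) _; first by rewrite subr_ge0 ltW.
    rewrite /c -mulrBr; set a := nth _ _ k in dk *; set b := nth _ _ k.+1 in dk *.
    rewrite (_ : lam * b = lam * a + lam * (b - a)); last by ring.
    rewrite expRD.
    have := expR_ge1Dx (lam * (b - a)) => ex.
    rewrite [X in _ <= X](_ : _ = B * expR (lam * a) / lam * (expR (lam * (b - a)) - 1)); last by ring.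
    rewrite [X in X <= _](_ : _ = B * expR (lam * a) / lam * (lam * (b - a))); last by field; rewrite gt_eqF.
    apply: ler_wpM2l; last by rewrite lerBrDl.
    by rewrite divr_ge0 ?mulr_ge0 ?expR_ge0// ltW.
  rewrite (sum_telescope (fun k => B / lam * expR (lam * nth 0 (0 :: p) k))) (part_last hp) lerBlDr lerDl.
  by rewrite mulr_ge0 ?divr_ge0 ?expR_ge0// ltW.
have m1 := nrm_tri hI l1 hI'; have m2 := nrm_tri l1 l2 hI'.
rewrite [X in _ <= X + _]nrm_distC in m1.
move: n1 n2 n3 m1 m2; set z := _ * expR _; move: z => z n1 n2 n3 m1 m2.
apply: le_trans m1 _; apply: le_trans (lerD (ltW n1) m2) _.
apply: le_trans (lerD (lexx _) (lerD n3 (ltW n2))) _.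
by rewrite le_eqVlt; apply/orP; left; apply/eqP; ring.
Qed.

End riemann.

(** * The group exp (t A) *)

Section group.
Context {R : realType}.
Implicit Types f g h : R -> R.

(** As [symb] is odd, the pair [(h x, h (- x))] undergoes a plane rotation of angle [a * symb x], up
    to orientation. *)
Definition rot (a : R) h (x : R) : R := cos (a * symb x) * h x + sin (a * symb x) * h (- x).

Lemma exp_tAP (a : R) f : isL2 f -> isL2 (exp_tA a f) /\ ae (fun x => hart (exp_tA a f) x = rot a (hart f) x).
Proof.
move=> hf; have mb := @mf_symb R.
have [] := @multiplierP R (fun x => cos (- (a * symb x))) (fun x => sin (- (a * symb x))) f 1 => //.
- by mf_tac.
- by mf_tac.
- by move=> x; rewrite ler_norml cos_geN1 cos_le1.
- by move=> x; rewrite ler_norml sin_geN1 sin_le1.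
- by move=> x; rewrite symbN mulrN !cosN.
- by move=> x; rewrite symbN mulrN -sinN.
move=> h1 h2; split=> //; apply: ae_mono h2 => x ->.
by rewrite /hm /rot cosN sinN mulNr opprK.
Qed.

Lemma exp_L2 (a : R) f : isL2 f -> isL2 (exp_tA a f). Proof. by move=> hf; have [] := exp_tAP a hf. Qed.

Lemma exp_lin (a c : R) f g : isL2 f -> isL2 g ->
  ae (fun x => exp_tA a (fun y => f y + c * g y) x = exp_tA a f x + c * exp_tA a g x).
Proof.
move=> hf hg; have hcg := isL2Z c hg; have h := isL2D hf hcg.
have [k1 e1] := exp_tAP a hf; have [k2 e2] := exp_tAP a hg; have [k3 e3] := exp_tAP a h.
have k4 := isL2Z c k2.
apply: hart_inj => //; first exact: isL2D.
have a0 := ae_and (hartD hf hcg) (hartZ c hg).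
have a1 := ae_rigid rigid_opp a0.
have a2 := ae_and (hartD k1 k4) (hartZ c k2).
apply: ae_mono2 (ae_and (ae_and e1 e2) e3) (ae_and a0 (ae_and a1 a2)) => x [[h1 h2] ->] [[b1 b2] [[b3 b4] [b5 b6]]].
by rewrite b5 b6 h1 h2 /rot b1 b2 b3 b4; ring.
Qed.

Lemma exp0 f : isL2 f -> ae (fun x => exp_tA 0 f x = f x).
Proof.
move=> hf; have [k e] := exp_tAP 0 hf; apply: hart_inj => //.
by apply: ae_mono e => x ->; rewrite /rot mul0r cos0 sin0 mul1r mul0r addr0.
Qed.

(* Bounds an operator whose Hartley symbol is dominated by a multiple of [|h x| + |h (- x)|]. *)
Lemma hart_dom (K : R) f g : 0 <= K -> isL2 f -> isL2 g ->
  ae (fun x => `|hart g x| <= K * (`|hart f x| + `|hart f (- x)|)) -> nrm g <= 2 * K * nrm f.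
Proof.
move=> K0 hf hg e; have l := isL2_norm (hart_L2 hf); have l' := isL2_rigid rigid_opp l.
have ls := isL2D l l'.
rewrite -(hart_isom hg); apply: le_trans (_ : nrm (fun x => K * (`|hart f x| + `|hart f (- x)|)) <= _).
  apply: (nrm_ae_le _ _ _).2; [exact: isL2_mf (hart_L2 hg)|exact: isL2Z|].
  by apply: ae_mono e => x h; apply: le_trans h _; exact: ler_norm.
rewrite (nrmZ _ ls) (ger0_norm K0) [2 * K]mulrC -mulrA ler_wpM2l//.
apply: le_trans (nrmD l l') _; rewrite (nrm_rigid rigid_opp l) nrm_norm (hart_isom hf).
by rewrite mulr2n mulrDl mul1r.
Qed.

Lemma exp_nrm (a : R) f : isL2 f -> nrm (exp_tA a f) <= 2 * nrm f.
Proof.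
move=> hf; have [k e] := exp_tAP a hf; rewrite -[2]mulr1; apply: hart_dom => //.
apply: ae_mono e => x ->; rewrite mul1r /rot; apply: le_trans (ler_normD _ _) _; rewrite !normrM.
by apply: lerD; rewrite ler_piMl// ler_norml ?cos_geN1 ?cos_le1 ?sin_geN1 ?sin_le1.
Qed.

Lemma cos_sub1 (y : R) : `|cos y - 1| <= y ^+ 2.
Proof.
have h := cos_two y; have s := sin_le_norm (y / 2).
have s2 : sin (y / 2) ^+ 2 <= (y / 2) ^+ 2.
  rewrite -[X in X <= _]real_normK ?num_real// -[X in _ <= X]real_normK ?num_real//.
  exact: lerXn2r.
have c1 := cos_le1 y; rewrite exprMn in h; rewrite ler_norml.
apply/andP; split; nra.
Qed.

Lemma exp_lip (a d : R) f : isL2 f -> nrm (fun x => exp_tA (a - d) f x - exp_tA a f x) <= 2 * `|d| * nrm f.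
Proof.
move=> hf; have [k e] := exp_tAP a hf; have [k' e'] := exp_tAP (a - d) hf.
apply: hart_dom => //; first exact: isL2B.
apply: ae_mono2 (hartB k' k) (ae_and e e') => x -> [-> ->]; rewrite /rot.
rewrite (_ : _ - _ = (cos ((a - d) * symb x) - cos (a * symb x)) * hart f x + (sin ((a - d) * symb x) - sin (a * symb x)) * hart f (- x)); last by ring.
have b : `|(a - d) * symb x - a * symb x| <= `|d|.
  rewrite (_ : _ - _ = - (d * symb x)); last by ring.
  by rewrite normrN normrM ler_piMr// symb_bnd.
apply: le_trans (ler_normD _ _) _; rewrite !normrM mulrDr; apply: lerD; rewrite ler_wpM2r//.
  exact: le_trans (cos_lip _ _) b.
exact: le_trans (sin_lip _ _) b.
Qed.

(** The first-order expansion in time of the group generated by [A = - reg_dx]. On the transform it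
    reduces to [cos y - 1] and [sin y - y], both bounded by [y ^+ 2], at [y = d * symb x] with
    [|symb x| <= 1]. *)
Lemma exp_quad (a d : R) f : isL2 f ->
  nrm (fun x => exp_tA (a - d) f x - exp_tA a f x - d * exp_tA a (reg_dx f) x) <= 4 * d ^+ 2 * nrm f.
Proof.
move=> hf; have [k e] := exp_tAP a hf; have [k' e'] := exp_tAP (a - d) hf.
have [r er] := reg_dxP hf; have [kr ekr] := exp_tAP a r.
have -> : 4 * d ^+ 2 = 2 * (2 * d ^+ 2) by ring.
apply: hart_dom => //; first by rewrite mulr_ge0// sqr_ge0.
  by apply: isL2B; [exact: isL2B|exact: isL2Z].
have a1 := hartB (isL2B k' k) (isL2Z d kr); have a2 := hartB k' k; have a3 := hartZ d kr.
have er' := ae_rigid rigid_opp er.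
apply: ae_mono2 (ae_and a1 (ae_and a2 a3)) (ae_and (ae_and e e') (ae_and ekr (ae_and er er'))) => x [-> [-> ->]] [[-> ->] [-> ]].
rewrite /rot => -[-> ->]; rewrite symbN !opprK.
set h := hart f x; set h' := hart f (- x); set b := symb x.
set y := d * b; set z := a * b.
have -> : (a - d) * b = z - y by rewrite /z /y; ring.
have yd : y ^+ 2 <= d ^+ 2.
  have := symb_bnd x; rewrite -/b => b1; rewrite /y exprMn ler_piMr ?sqr_ge0//.
  by rewrite -real_normK ?num_real// exprn_ile1.
have c1 := cos_sub1 y; have s1 := sin_sub_id y.
have sN : -1 <= sin z <= 1 by rewrite sin_geN1 sin_le1.
have cN : -1 <= cos z <= 1 by rewrite cos_geN1 cos_le1.
rewrite (_ : _ - _ = (cos z * (cos y - 1) + sin z * (sin y - y)) * h + (sin z * (cos y - 1) - cos z * (sin y - y)) * h'); last first.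
  by rewrite cosB sinB /y; ring.
have P (p q : R) : `|p| <= 1 -> `|q| <= 1 -> `|p * (cos y - 1) + q * (sin y - y)| <= 2 * d ^+ 2.
  move=> p1 q1; apply: le_trans (ler_normD _ _) _; rewrite !normrM.
  have := ler_piMl (normr_ge0 (cos y - 1)) p1; have := ler_piMl (normr_ge0 (sin y - y)) q1; lra.
apply: le_trans (ler_normD _ _) _; rewrite [X in _ <= X]mulrDr normrM [X in _ + X <= _]normrM.
apply: lerD; rewrite ler_wpM2r//; first by apply: P; rewrite ler_norml.
by rewrite -mulNr; apply: P; rewrite ?normrN ler_norml.
Qed.

End group.

(** * Existence and uniqueness for the initial value problem *)

Section well_posedness.
Context {R : realType}.
Variables (s : R) (r : nat).
Hypotheses (hs : 2^-1 < s) (hr : r = 1%N \/ r = 2%N).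
Local Notation X := (isX s r).
Local Notation N := (nX s r).
Local Opaque nrm ip hart isL2 reg_dx exp_tA.
Implicit Types (f g phi : R -> R) (u v : R -> R -> R).

Lemma wsobolevP f : wsobolev s r f <-> X f.
Proof.
split=> [[/L2P h1 h2 /L2P h3]|[h1 h2 h3]].
  by split; [exact: h1|exact: (weighted_fourier_fin (mf_ws s) (wsN s) h1 h2)|exact: h3].
split; [exact/L2P| |exact/L2P].
have := weighted_fourier_norm (mf_ws s) (wsN s) h1 h2; rewrite /Hs_norm /ws => ->.
exact: ltry.
Qed.

Definition wn f : R := Num.sqrt ((kap^-1 * nS s f) ^+ 2 + nW r f ^+ 2).

Lemma wsobolev_normE f : X f -> wsobolev_norm s r f = (wn f)%:E.
Proof.
move=> [h1 h2 h3].
have e : Hs_norm s f = (kap^-1 * nS s f)%:E by exact: (weighted_fourier_norm (mf_ws s) (wsN s) h1 h2).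
have k0 : 0 <= kap^-1 :> R by rewrite invr_ge0 ltW// kap_gt0.
rewrite /wsobolev_norm e (L2normE h3) !poweR_EFin /=.
rewrite !powR_mulrn ?mulr_ge0 ?nS_ge0 ?nrm_ge0// powR12_sqrt//.
by rewrite addr_ge0// sqr_ge0.
Qed.

Lemma wn_bounds f : N f <= 2 * wn f /\ wn f <= (1 + kap^-1) * N f.
Proof.
have k0 := @kap_gt0 R; have k2 := @kap_le R.
have k1 : 1 <= kap^-1 :> R by rewrite invf_ge1//; lra.
have a0 := nS_ge0 s f; have b0 := nW_ge0 r f; rewrite /wn /nX.
move: (kap^-1) k1 (nS s f) a0 (nW r f) b0 => k k1 a a0 b b0.
have q : 0 <= (k * a) ^+ 2 + b ^+ 2 by rewrite addr_ge0// sqr_ge0.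
have k0' : 0 <= k by rewrite (le_trans ler01).
have ka : a <= k * a by rewrite ler_peMl.
have ka0 := le_trans a0 ka.
split.
  have h1 : k * a <= Num.sqrt ((k * a) ^+ 2 + b ^+ 2).
    by rewrite -{1}[k * a](ger0_norm ka0) -sqrtr_sqr ler_wsqrtr// lerDl sqr_ge0.
  have h2 : b <= Num.sqrt ((k * a) ^+ 2 + b ^+ 2).
    by rewrite -{1}[b](ger0_norm b0) -sqrtr_sqr ler_wsqrtr// lerDr sqr_ge0.
  by rewrite mulr2n mulrDl mul1r; apply: lerD => //; exact: le_trans h1.
have p0 : 0 <= (1 + k) * (a + b) by rewrite mulr_ge0// addr_ge0.
rewrite -[X in _ <= X](ger0_norm p0) -sqrtr_sqr ler_wsqrtr//.
have P1 := mulr_ge0 ka0 b0; have P2 := mulr_ge0 k0' b0.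
have h : k * a + b <= (1 + k) * (a + b) by rewrite mulrDl mul1r mulrDr; lra.
apply: le_trans (_ : (k * a + b) ^+ 2 <= _); first by nra.
by apply: lerXn2r; rewrite ?nnegrE// addr_ge0.
Qed.

(** Stated for a general filter finer than [nbhs t], to cover both the one-sided neighbourhoods of
    continuity and the punctured ones of the time derivative. *)
Lemma cvg0_lip (F : R -> \bar R) (G : set_system R) (A : set R) (t C : R) : Filter G ->
  (forall P : set R, nbhs t P -> G P) -> G A ->
  (forall t', A t' -> `|t' - t| <= 1 -> (0 <= F t' <= (C * `|t' - t|)%:E)%E) ->
  F @ G --> 0%E.
Proof.
move=> FG Gt GA h; apply: (@squeeze_cvge _ _ _ _ (fun=> 0%E) F (fun t' => (C * `|t' - t|)%:E) _ 0%E).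
- have : nbhs t (fun x => `|x - t| <= 1).
    by apply: filterS (nbhsx_ballx t 1 ltr01) => x; rewrite /ball/= distrC => /ltW.
  by move/Gt => G1; apply: filterS2 G1 GA => x h1 Ax; exact: h.
- exact: cvg_cst.
- apply/fine_cvgP; split; first exact: nearW.
  have c : (fun t' => C * `|t' - t|) @ nbhs t --> C * `|t - t|.
    have /ctsW c : cts (fun t' : R => C * `|t' - t|) by cts_tac.
    exact: (c t).
  rewrite subrr normr0 mulr0 in c.
  by move=> P hP; apply: Gt; exact: c.
Qed.

Lemma field_le f : X f -> N (field 2^-1 f) <= 9 * (N f + 2^-1 * (cP s * (N f * N f))).
Proof.
move=> hf; have Xa := X_arg hs hr 2^-1 hf; have [Xk _ _] := reg_dx_X hr Xa.
rewrite /field (nXZ _ Xk) normrN1 mul1r; apply: le_trans (N_reg hs hr Xa) _; rewrite ler_wpM2l//.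
have X2 := X_sqr hs hr hf; apply: le_trans (nXD hf (isXZ 2^-1 X2)) _; rewrite lerD2l (nXZ _ X2) ger0_norm ?invr_ge0//.
by rewrite ler_wpM2l ?invr_ge0// sqrE; have [] := N_mul hs hr hf hf.
Qed.

Lemma nrm_N f : X f -> nrm f <= N f.
Proof. by move=> hf; apply: le_trans (nrm_nS hs hf) (nS_le _ _ _). Qed.

Section existence.
Variables (phi : R -> R) (u : R -> R -> R).
Hypothesis flow : forall T : R, 0 <= T -> is_flow s r (field 2^-1) phi T u.

Let uX t : 0 <= t -> X (u t).
Proof. by move=> t0; have [_ h _] := flow t0; apply: h; rewrite t0 lexx. Qed.

Let u0 : u 0 = phi. Proof. by have [h _ _] := flow (lexx 0). Qed.

Let fX t : 0 <= t -> X (field 2^-1 (u t)).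
Proof. by move=> t0; apply: X_field => //; exact: uX. Qed.

Lemma flow_local t : 0 <= t -> exists2 C : R, 0 <= C & forall t', 0 <= t' -> `|t' - t| <= 1 ->
  N (fun x => u t' x - u t x) <= C * `|t' - t| /\
  N (fun x => u t' x - u t x - (t' - t) * field 2^-1 (u t) x) <= C * (t' - t) ^+ 2.
Proof.
move=> t0; have T0 : 0 <= t + 1 by rewrite addr_ge0.
have [_ _ [C C0 hC]] := flow T0; exists C; first exact: C0.
move=> t' t'0; rewrite ler_norml => /andP[_ h]; apply: hC; apply/andP; split=> //; lra.
Qed.

Lemma flow_curve : continuous_curve (wsobolev s r) (wsobolev_norm s r) u.
Proof.
move=> t t0; split; first by apply/wsobolevP; exact: uX.
have [C C0 hC] := flow_local t0.
apply: (@cvg0_lip _ _ [set t' | 0 <= t'] t ((1 + kap^-1) * C)) => [P hP||t' /= t'0 h].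
- by change (nbhs t (fun x => 0 <= x -> P x)); apply: filterS hP.
- by change (nbhs t (fun x => 0 <= x -> 0 <= x)); exact: filterE.
have Xd := isXB (uX t'0) (uX t0); rewrite wsobolev_normE// !lee_fin sqrtr_ge0/=.
have [_ b] := wn_bounds (fun x => u t' x - u t x).
apply: le_trans b _; rewrite -mulrA ler_wpM2l//; last by have [] := hC t' t'0 h.
by rewrite addr_ge0// invr_ge0 ltW// kap_gt0.
Qed.

Lemma flow_derivative : time_derivative u (fun t => field 2^-1 (u t)).
Proof.
move=> t t0; have [C C0 hC] := flow_local t0.
apply: (@cvg0_lip _ _ [set t' | 0 <= t' /\ t' != t] t C) => [P hP||t' /= [t'0 t't] h].
- by change (nbhs t (fun x => x != t -> 0 <= x -> P x)); apply: filterS hP.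
- by change (nbhs t (fun x => x != t -> 0 <= x -> 0 <= x /\ x != t)); exact: filterE.
have d0 : t' - t != 0 by rewrite subr_eq0.
have Xd := isXB (isXB (uX t'0) (uX t0)) (isXZ (t' - t) (fX t0)).
rewrite (_ : (fun x => _) = (fun x => (t' - t)^-1 * (u t' x - u t x - (t' - t) * field 2^-1 (u t) x))); last first.
  by apply/funext => x; field.
rewrite L2normE; last exact: isL2Z (isX_L2 Xd).
rewrite !lee_fin nrm_ge0/= (nrmZ _ (isX_L2 Xd)) normfV ler_pdivrMl ?normr_gt0//.
apply: le_trans (nrm_N Xd) _; have [_ q] := hC t' t'0 h; apply: le_trans q _.
by rewrite -[(t' - t) ^+ 2]real_normK ?num_real// expr2 mulrCA.
Qed.

Lemma flow_derivative_curve : continuous_curve L2 L2norm (fun t => field 2^-1 (u t)).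
Proof.
move=> t t0; split; first by apply/L2P; exact: isX_L2 (fX t0).
have [C C0 hC] := flow_local t0.
pose K := N (u t); have K0 : 0 <= K := nX_ge0 s r (u t).
have P0 := cP_ge0 s.
apply: (@cvg0_lip _ _ [set t' | 0 <= t'] t (9 * (C + 2^-1 * (cP s * (C * (2 * K + C)))))) => [P hP||t' /= t'0 h].
- by change (nbhs t (fun x => 0 <= x -> P x)); apply: filterS hP.
- by change (nbhs t (fun x => 0 <= x -> 0 <= x)); exact: filterE.
have Xd := isXB (fX t'0) (fX t0).
rewrite L2normE; last exact: isX_L2 Xd.
rewrite !lee_fin nrm_ge0/=; apply: le_trans (nrm_N Xd) _.
have Xu := uX t0; have Xu' := uX t'0; have Xw := isXB Xu' Xu; have Xs := isXD Xw (isXZ 2 Xu).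
apply: le_trans (field_diff hs hr _ _ Xu' Xu) _; rewrite -mulrA ler_wpM2l//.
have [q _] := hC t' t'0 h; rewrite mulrDl; apply: lerD; first exact: q.
have [Xp np] := N_mul hs hr Xw Xs.
rewrite (_ : (fun x => _) = (fun x => 2^-1 * ((u t' x - u t x) * ((u t' x - u t x) + 2 * u t x)))); last first.
  by apply/funext => x; ring.
rewrite (nXZ _ Xp) ger0_norm ?invr_ge0// -mulrA ler_wpM2l ?invr_ge0//; apply: le_trans np _.
have q2 : N (fun x => u t' x - u t x + 2 * u t x) <= 2 * K + C.
  apply: le_trans (nXD Xw (isXZ 2 Xu)) _; rewrite (nXZ _ Xu) ger0_norm// addrC lerD2l.
  by apply: le_trans q _; rewrite ler_piMr.
rewrite [X in _ <= X](_ : _ = cP s * ((C * `|t' - t|) * (2 * K + C))); last by ring.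
by rewrite ler_wpM2l//; apply: ler_pM => //; exact: nX_ge0.
Qed.

Let F (t tau : R) := exp_tA (t - tau) (reg_dx (fun x => u tau x ^+ 2)).

Let regX tau : 0 <= tau -> X (reg_dx (fun x => u tau x ^+ 2)).
Proof. by move=> h; have [] := reg_dx_X hr (X_sqr hs hr (uX h)). Qed.

(** The definition of [field 2^-1], transported by the group. In [duhamel_quad] it cancels the
    linear part of the field against the time derivative of the group and leaves the quadratic
    integrand. *)
Lemma field_cancel (a tau : R) : 0 <= tau -> ae (fun x => exp_tA a (reg_dx (u tau)) x +
  exp_tA a (field 2^-1 (u tau)) x + 2^-1 * exp_tA a (reg_dx (fun x => u tau x ^+ 2)) x = 0).
Proof.
move=> h; have Xu := uX h; have lu := isX_L2 Xu; have X2 := X_sqr hs hr Xu; have l2 := isX_L2 X2.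
have k1 := reg_dx_L2 lu; have k2 := reg_dx_L2 l2; have lf := isX_L2 (fX h).
have ka := isL2D k1 (isL2Z 2^-1 k2); have kz := isL2D ka (isL2Z 1 lf).
have z0 : ae (fun x => reg_dx (u tau) x + 2^-1 * reg_dx (fun x => u tau x ^+ 2) x + 1 * field 2^-1 (u tau) x = 0).
  by apply: ae_mono (reg_dx_lin 2^-1 lu l2) => x e; rewrite /field e; ring.
have n0 : nrm (fun x => reg_dx (u tau) x + 2^-1 * reg_dx (fun x => u tau x ^+ 2) x + 1 * field 2^-1 (u tau) x) = 0.
  by rewrite -(@nrm0 R); apply: nrm_ae z0; [exact: isL2_mf kz|exact: isL2_mf (@isL2_0 R)].
have e0 := nrm_eq0 (exp_L2 a kz) _.
have {}e0 : ae (fun x => exp_tA a (fun x => reg_dx (u tau) x + 2^-1 * reg_dx (fun x => u tau x ^+ 2) x + 1 * field 2^-1 (u tau) x) x = 0).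
  by apply: e0; apply/eqP; rewrite eq_le nrm_ge0 andbT -(mulr0 2) -n0; exact: exp_nrm.
apply: ae_mono2 (ae_and (exp_lin a 1 ka lf) (exp_lin a 2^-1 k1 k2)) e0 => x [h1 h2] e3.
by rewrite h1 h2 mul1r addrAC in e3.
Qed.

(** The product rule: [-2 * exp_tA (t - tau) (u tau)] is an antiderivative in [tau] of the Duhamel
    integrand. The factor -2 inverts the coefficient [- 1/2] in front of the integral. *)
Lemma duhamel_quad t : 0 <= t -> exists2 C : R, 0 <= C & forall a b, 0 <= a <= t -> 0 <= b <= t ->
  nrm (fun x => -2 * exp_tA (t - b) (u b) x - -2 * exp_tA (t - a) (u a) x - (b - a) * F t a x) <= C * (b - a) ^+ 2.
Proof.
move=> t0; have [_ _ [C C0 hC]] := flow t0.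
pose K := N phi + C * t.
have K0 : 0 <= K by rewrite addr_ge0 ?nX_ge0// mulr_ge0.
pose K2 := 9 * (K + 2^-1 * (cP s * (K * K))).
have P0 := cP_ge0 s.
have K20 : 0 <= K2 by rewrite mulr_ge0// addr_ge0// mulr_ge0 ?invr_ge0// mulr_ge0// mulr_ge0.
have NK a : 0 <= a <= t -> N (u a) <= K.
  move=> aI; have z : 0 <= (0 : R) <= t by apply/andP.
  have [h _] := hC 0 a z aI; have Xa := uX (proj1 (andP aI)); have Xp := uX (lexx 0).
  have := nXD Xp (isXB Xa Xp); rewrite (_ : (fun x => u 0 x + _) = u a); last by apply/funext => x; ring.
  move=> h2; apply: le_trans h2 _; rewrite {1}u0 lerD2l; apply: le_trans h _; rewrite ler_wpM2l// subr0.
  by case/andP: aI => a0 at'; rewrite ger0_norm.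
exists (2 * (4 * K + 2 * K2 + 2 * C)); first by rewrite mulr_ge0// !addr_ge0// mulr_ge0.
move=> a b aI bI; have a0 := proj1 (andP aI); have b0 := proj1 (andP bI).
have [_ rem] := hC a b aI bI.
have Xa := uX a0; have Xb := uX b0; have Xf := fX a0; have Xk := regX a0.
have Xr := isXB (isXB Xb Xa) (isXZ (b - a) Xf).
set q := field 2^-1 (u a) in rem Xf Xr; set rm := (fun x => _) in rem Xr.
have la := isX_L2 Xa; have lq := isX_L2 Xf; have lr := isX_L2 Xr.
have nK := le_trans (nrm_N Xa) (NK a aI).
have nq : nrm q <= K2.
  apply: le_trans (nrm_N Xf) _; apply: le_trans (field_le Xa) _; rewrite ler_wpM2l//.
  have := NK a aI => NKa; rewrite lerD// ler_wpM2l ?invr_ge0// ler_wpM2l//.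
  by apply: ler_pM => //; exact: nX_ge0.
have nr := le_trans (nrm_N Xr) rem.
set sg := t - a; set d := b - a.
have sd : t - b = sg - d by rewrite /sg /d; ring.
(* Three quadratic errors: [e1] from expanding the group on [u a], [d * e2] from moving the field by
   the group over a time [d], and [e3] from the remainder of the flow. *)
pose e1 x := exp_tA (sg - d) (u a) x - exp_tA sg (u a) x - d * exp_tA sg (reg_dx (u a)) x.
pose e2 x := exp_tA (sg - d) q x - exp_tA sg q x.
pose e3 x := exp_tA (sg - d) rm x.
have l1 : isL2 e1.
  by apply: isL2B; [apply: isL2B; exact: exp_L2|apply: isL2Z; apply: exp_L2; exact: reg_dx_L2].
have l2 : isL2 e2 by apply: isL2B; exact: exp_L2.
have l3 : isL2 e3 by exact: exp_L2.
have n1 : nrm e1 <= 4 * d ^+ 2 * K.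
  by apply: le_trans (exp_quad _ _ la) _; rewrite ler_wpM2l// mulr_ge0// sqr_ge0.
have n2 : nrm e2 <= 2 * `|d| * K2 by apply: le_trans (exp_lip _ _ lq) _; rewrite ler_wpM2l// mulr_ge0.
have n3 : nrm e3 <= 2 * (C * d ^+ 2) by apply: le_trans (exp_nrm _ lr) _; rewrite ler_wpM2l.
have lq2 := isL2D la (isL2Z d lq).
have ub : u b = (fun x => (u a x + d * q x) + 1 * rm x) by apply/funext => x; rewrite /rm /d /q; ring.
have eq1 : ae (fun x => -2 * exp_tA (t - b) (u b) x - -2 * exp_tA (t - a) (u a) x - d * F t a x =
   -2 * ((e1 x + d * e2 x) + e3 x)).
  rewrite sd {1}ub.
  apply: ae_mono2 (ae_and (exp_lin (sg - d) 1 lq2 lr) (exp_lin (sg - d) d la lq)) (field_cancel sg a0) => x [-> ->] c.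
  rewrite /e1 /e2 /e3 /F -/sg -/q in c *.
  set A := exp_tA sg (reg_dx (fun x => u a x ^+ 2)) x in c *; set B := exp_tA sg (reg_dx (u a)) x in c *; set D := exp_tA sg q x in c *.
  have -> : B = - D - 2^-1 * A by rewrite -[LHS]subr0 -c; ring.
  by field.
have lb := isX_L2 Xb; have lF : isL2 (F t a) by apply: exp_L2; exact: isX_L2 Xk.
have l4 := isL2D (isL2D l1 (isL2Z d l2)) l3.
have lhs : isL2 (fun x => -2 * exp_tA (t - b) (u b) x - -2 * exp_tA (t - a) (u a) x - d * F t a x).
  by apply: isL2B; [apply: isL2B; apply: isL2Z; exact: exp_L2|exact: isL2Z].
rewrite (nrm_ae (isL2_mf lhs) (isL2_mf (isL2Z (-2) l4)) eq1) (nrmZ _ l4) normrN ger0_norm// -mulrA ler_wpM2l//.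
apply: le_trans (nrmD (isL2D l1 (isL2Z d l2)) l3) _.
apply: le_trans (lerD (nrmD l1 (isL2Z d l2)) n3) _; rewrite (nrmZ _ l2).
apply: le_trans (lerD (lerD n1 (ler_wpM2l (normr_ge0 d) n2)) (lexx _)) _.
have dd : `|d| * (2 * `|d| * K2) = 2 * d ^+ 2 * K2.
  by rewrite -[d ^+ 2]real_normK ?num_real//; ring.
by rewrite dd le_eqVlt; apply/orP; left; apply/eqP; ring.
Qed.

Lemma flow_solves : solves_ivp phi u.
Proof.
move=> t t0; have [C C0 hC] := duhamel_quad t0.
have lu tau : 0 <= tau -> isL2 (fun x => -2 * exp_tA (t - tau) (u tau) x).
  by move=> h; apply: isL2Z; apply: exp_L2; exact: isX_L2 (uX h).
exists (fun x => -2 * exp_tA (t - t) (u t) x - -2 * exp_tA (t - 0) (u 0) x).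
  apply: (@integral_of_quad R (F t) (fun tau x => -2 * exp_tA (t - tau) (u tau) x) t C t0 C0) => //.
    by move=> tau /andP[h _]; apply: exp_L2; exact: isX_L2 (regX h).
  by move=> tau /andP[h _]; exact: lu.
apply/ae_eqP; rewrite subrr subr0 u0.
by apply: ae_mono (exp0 (isX_L2 (uX t0))) => x ->; field.
Qed.

End existence.

(** Uniqueness concerns arbitrary continuous curves, whose only bound on [[0, T]] comes from
    compactness. *)
Lemma curve_bound v (T : R) : 0 <= T -> continuous_curve (wsobolev s r) (wsobolev_norm s r) v ->
  exists2 K : R, 0 <= K & forall t, 0 <= t <= T -> N (v t) <= K.
Proof.
move=> T0 hv.
have vX t : 0 <= t -> X (v t) by move=> t0; apply/wsobolevP; have [] := hv t t0.
have cg : {within `[0, T], continuous (fun t => N (v t))}.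
  apply/subspace_continuousP => t /=; rewrite in_itv/= => /andP[t0 tT].
  have [_ /fine_cvgP[_ c]] := hv t t0.
  apply/cvgrPdist_le => e e0; have e2 : 0 < e / 2 by rewrite divr_gt0.
  have /cvgr0_norm_le/(_ _ e2) := c.
  move=> hn; have {}hn : nbhs t (fun y => 0 <= y -> `|fine (wsobolev_norm s r (v y \- v t))| <= e / 2) := hn.
  change (nbhs t (fun y => `[0, T]%classic y -> `|N (v t) - N (v y)| <= e)).
  apply: filterS hn => y hy; rewrite /= in_itv/= => /andP[y0 yT].
  have := hy y0; have Xd := isXB (vX y y0) (vX t t0); rewrite /= wsobolev_normE//=.
  rewrite ger0_norm ?sqrtr_ge0// ler_pdivlMr// mulrC => h.
  have [b _] := wn_bounds (fun x => v y x - v t x).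
  have {}h := le_trans b h.
  have h1 := nXD Xd (vX t t0); have h2 := nXD (isXZ (-1) Xd) (vX y y0).
  rewrite (_ : (fun x => _ + _) = v y) in h1; last by apply/funext => x; ring.
  rewrite (_ : (fun x => _ + _) = v t) in h2; last by apply/funext => x; ring.
  rewrite (nXZ _ Xd) normrN1 mul1r in h2.
  move: (N (v y)) (N (v t)) h h1 h2; set z := N _; move: z => z p q h h1 h2.
  by rewrite ler_norml; apply/andP; split; lra.
have [c _ hc] := EVT_max T0 cg.
exists (N (v c)); first exact: nX_ge0.
by move=> t tI; apply: hc; rewrite in_itv.
Qed.

(** Under the weight [expR (- ((L + 1) * t))] the integral equation halves any bound for the L^2
    distance of two solutions. Iterating from the crude bound [Ku + Kv] drives the distance to 0. *)
Lemma ivp_unique phi u v (T : R) : 0 <= T -> isL2 phi ->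
  continuous_curve (wsobolev s r) (wsobolev_norm s r) u -> continuous_curve (wsobolev s r) (wsobolev_norm s r) v ->
  solves_ivp phi u -> solves_ivp phi v -> v T = u T %[ae leb R].
Proof.
move=> T0 hphi cu cv su sv.
have uX t : 0 <= t -> X (u t) by move=> t0; apply/wsobolevP; have [] := cu t t0.
have vX t : 0 <= t -> X (v t) by move=> t0; apply/wsobolevP; have [] := cv t t0.
have [Ku Ku0 bu] := curve_bound T0 cu; have [Kv Kv0 bv] := curve_bound T0 cv.
(* The Lipschitz constant of the integrand in L^2: 2 from [exp_nrm], and the sup norm of [u + v], at
   most [cA s * (Ku + Kv)], from factoring the difference of squares. *)
pose L := 2 * (cA s * (Ku + Kv)).
have L0 : 0 <= L by rewrite mulr_ge0// mulr_ge0 ?cA_ge0// addr_ge0.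
have lam0 : 0 < L + 1 by rewrite ltr_wpDl.
pose w t := nrm (fun x => v t x - u t x).
have regX f : X f -> isL2 (reg_dx (fun x => f x ^+ 2)).
  by move=> hf; apply: reg_dx_L2; exact: isX_L2 (X_sqr hs hr hf).
have step (B : R) : 0 <= B -> (forall t, 0 <= t <= T -> w t <= B * expR ((L + 1) * t)) ->
    forall t, 0 <= t <= T -> w t <= B / 2 * expR ((L + 1) * t).
  move=> B0 hB t /andP[t0 tT].
  have [I hI /ae_eqP eu] := su t t0; have [I' hI' /ae_eqP ev] := sv t t0.
  have lI : isL2 I by case: hI => /L2P. have lI' : isL2 I' by case: hI' => /L2P.
  have wE : w t = 2^-1 * nrm (fun x => I' x - I x).
    have lII := isL2B lI' lI.
    rewrite /w -[X in X * _]ger0_norm ?invr_ge0// -normrN -nrmZ//; apply: nrm_ae.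
    - exact: isL2_mf (isL2B (isX_L2 (vX t t0)) (isX_L2 (uX t t0))).
    - exact: isL2_mf (isL2Z _ lII).
    - by apply: ae_mono2 eu ev => x -> ->; ring.
  rewrite wE mulrAC [X in _ <= X]mulrC ler_wpM2l ?invr_ge0//.
  have hd a : 0 <= a <= t -> nrm (fun x => exp_tA (t - a) (reg_dx (fun x => v a x ^+ 2)) x -
      exp_tA (t - a) (reg_dx (fun x => u a x ^+ 2)) x) <= L * B * expR ((L + 1) * a).
    move=> /andP[a0 at']; have aT : 0 <= a <= T by rewrite a0 (le_trans at').
    have Xu := uX a a0; have Xv := vX a a0; have Xs := isXD Xv Xu; have Xd := isXB Xv Xu.
    have k1 := regX _ Xu; have k2 := regX _ Xv.
    have p1 := isX_L2 (X_sqr hs hr Xu); have p2 := isX_L2 (X_sqr hs hr Xv).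
    have [l n] := isL2_nA hs Xs (isX_L2 Xd).
    have el := exp_lin (t - a) (-1) k2 k1; have rl := reg_dx_lin (-1) p2 p1.
    have m1 := exp_L2 (t - a) k1; have m2 := exp_L2 (t - a) k2.
    have kd := isL2D k2 (isL2Z (-1) k1).
    have pE : (fun y => v a y ^+ 2 + -1 * u a y ^+ 2) = (fun x => (v a x + u a x) * (v a x - u a x)).
      by apply/funext => x; ring.
    rewrite (nrm_ae (isL2_mf (isL2B m2 m1)) (isL2_mf (exp_L2 (t - a) kd))); last first.
      by apply: ae_mono el => x ->; rewrite mulN1r.
    apply: le_trans (exp_nrm _ kd) _.
    rewrite pE in rl; have kp := reg_dx_L2 l.
    rewrite -(nrm_ae (isL2_mf kp) (isL2_mf kd) rl).
    rewrite /L -!mulrA ler_wpM2l//; apply: le_trans (reg_dx_nrm l) _; apply: le_trans n _.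
    rewrite mulrA; apply: ler_pM; [exact: nA_ge0|exact: nrm_ge0| |exact: hB a aT].
    apply: le_trans (nA_le hs Xs) _; rewrite ler_wpM2l ?cA_ge0//.
    apply: le_trans (nS_le s r _) _; apply: le_trans (nXD Xv Xu) _.
    by rewrite addrC; apply: lerD; [exact: bu|exact: bv].
  have onF (g : R -> R -> R) : (forall a, 0 <= a -> X (g a)) -> isL2_on t (fun tau => exp_tA (t - tau) (reg_dx (fun x => g tau x ^+ 2))).
    by move=> hg tau /andP[h _]; apply: exp_L2; apply: regX; exact: hg.
  have LB : 0 <= L * B by rewrite mulr_ge0.
  apply: le_trans (integral_diff t0 lam0 LB (onF v vX) (onF u uX) hI' hI hd) _.
  rewrite ler_wpM2r ?expR_ge0// ler_pdivrMr// mulrC ler_wpM2l//.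
  by rewrite lerDl.
have it (n : nat) t : 0 <= t <= T -> w t <= (Ku + Kv) * 2^-1 ^+ n * expR ((L + 1) * t).
  elim: n t => [|n IH] t tI.
    have t0 := proj1 (andP tI); rewrite expr0 mulr1.
    apply: le_trans (nrm_N (isXB (vX t t0) (uX t t0))) _.
    have := nXD (vX t t0) (isXZ (-1) (uX t t0)); rewrite (nXZ _ (uX t t0)) normrN1 mul1r.
    rewrite (_ : (fun x => _) = (fun x => v t x - u t x)); last by apply/funext => x; ring.
    move=> h; apply: le_trans h _; apply: le_trans (lerD (bv t tI) (bu t tI)) _; rewrite addrC.
    apply: ler_peMr; first by rewrite addr_ge0.
    by rewrite -[X in X <= _]expR0 ler_expR mulr_ge0// ltW.
  rewrite exprSr mulrA; apply: step => //.
  by rewrite mulr_ge0 ?addr_ge0// exprn_ge0.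
have TI : 0 <= T <= T by rewrite T0 lexx.
apply/ae_eqP; apply: nrm_eq0_eq; [exact: isX_L2 (vX T T0)|exact: isX_L2 (uX T T0)|].
apply/eqP; rewrite eq_le nrm_ge0 andbT.
apply: (@le_geom R _ _ ((Ku + Kv) * expR ((L + 1) * T))) => n; rewrite add0r mulrAC; exact: it.
Qed.

End well_posedness.

Theorem theorem1p1 (R : realType) (s : R) (r : nat) (phi : R -> R)
    (hs : 2^-1 < s) (hr : r = 1%N \/ r = 2%N) (hphi : wsobolev s r phi) :
  let is_solution (u : R -> R -> R) :=
    [/\ continuous_curve (wsobolev s r) (wsobolev_norm s r) u,
        solves_ivp phi u &
        exists2 u' : R -> R -> R,
          time_derivative u u' & continuous_curve L2 L2norm u'] in
  exists2 u : R -> R -> R, is_solution u &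
    forall v : R -> R -> R, is_solution v ->
      forall t : R, 0 <= t -> v t = u t %[ae @lebesgue_measure R].
Proof.
move=> is_solution; have Xphi : isX s r phi by apply/wsobolevP.
have [u hu] := global_flow hs hr Xphi.
have su : solves_ivp phi u by apply: flow_solves hu.
have cu : continuous_curve (wsobolev s r) (wsobolev_norm s r) u by apply: flow_curve hu.
exists u; first split=> //.
  exists (fun t => field 2^-1 (u t)); first by apply: flow_derivative hu.
  by apply: flow_derivative_curve hu.
move=> v [cv sv _] t t0; exact: (ivp_unique hs hr t0 (isX_L2 Xphi) cu cv su sv).
Qed.
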